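(* Let $q$ be a power of a prime, $G=\mathrm{GL}_{4,\mathbb{F}_q}$ with $\mu(x)=\mathrm{diag}(xI_3,I_1)$, $T$, $B$ as in the context, and let $S$ be a $k$-scheme with a morphism $\zeta\colon S\to G\text{-}\mathtt{Zip}^\mu$ satisfying conditions (a), (b), (c) of the context. Then $\langle C_S\rangle=\langle C_{\mathrm{zip}}\rangle$.
   Context: Notation: $k=\overline{\mathbb{F}}_q$, $\sigma$ the $q$-power Frobenius. For a connected reductive group $G$ over $\mathbb{F}_q$ and a cocharacter $\mu\colon\mathbb{G}_{m,k}\to G_k$: let $P=P_-(\mu)$ (resp. $P_+(\mu)$) be the parabolic subgroup of $G_k$ consisting of $g$ such that $t\mapsto\mu(t)^{-1}g\mu(t)$ (resp. $t\mapsto\mu(t)g\mu(t)^{-1}$) extends to a morphism $\mathbb{A}^1_k\to G_k$; $L$ the centralizer of $\mu$; $Q=(P_+(\mu))^{(q)}$, $M=L^{(q)}$, $\varphi\colon L\to M$ the $q$-Frobenius. The zip group is $E=\{(x,y)\in P\times Q:\varphi(\bar x)=\bar y\}$ ($\bar x$, $\bar y$ the Levi components), acting on $G_k$ by $(x,y)\cdot g=xgy^{-1}$; $G\text{-}\mathtt{Zip}^\mu:=[E\backslash G_k]$. Fix a Borel pair $(B,T)$ over $\mathbb{F}_q$ with $B\subset P$; positive roots are those with root groups in the opposite Borel $B^+$; $I$ the simple roots of $L$, $W$ the Weyl group, $w_0$ its longest element, $w_{0,I}$ the longest element of $W_I$, $z=\sigma(w_{0,I})w_0$. For $\lambda\in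 X^*(T)$, $V_I(\lambda)=\mathrm{Ind}_B^P(\lambda)=\{f\colon P\to\mathbb{A}^1: f(xb)=\lambda(b)^{-1}f(x)\}$ and $\mathcal{V}_I(\lambda)$ its associated vector bundle on $G\text{-}\mathtt{Zip}^\mu$. The zip flag stack is $[E'\backslash G_k]$, $E'=E\cap(B\times G_k)$, and $\mathcal{F}_w=[E'\backslash BwBz^{-1}]$ for $w\in W$. Condition on $(S,\zeta)$: (a) $\zeta$ smooth; (b) $\zeta$ surjective on each connected component of $S$; (c) for each $w\in W$ of length 1, $\overline{\mathrm{Flag}(S)}_w$ is pseudo-complete (global regular functions are locally constant), where $\mathrm{Flag}(S)=S\times_{G\text{-}\mathtt{Zip}^\mu}[E'\backslash G_k]$ and $\mathrm{Flag}(S)_w$ is the preimage of $\mathcal{F}_w$. $\mathcal{V}_I(\lambda)$ on $S$ is the pullback. $C_{\mathrm{zip}}=\{\lambda: H^0(G\text{-}\mathtt{Zip}^\mu,\mathcal{V}_I(\lambda))\neq0\}$, $C_S=\{\lambda: H^0(S,\mathcal{V}_I(\lambda))\neq0\}$, $\langle C\rangle=\{\lambda:\exists N\ge1, N\lambda\in C\}$. Specifics: $T$ is the diagonal torus, $B$ the lower-triangular Borel of $\mathrm{GL}_4$, $X^*(T)=\mathbb{Z}^4$ via $\mathrm{diag}(x_1,\dots,x_4)\mapsto\prod x_i^{a_i}$. *)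

(* Defs.v *)
From HB Require Import structures.
From mathcomp Require Import all_boot all_order all_fingroup all_algebra.
From mathcomp Require Import all_classical.
From mathcomp Require Import topology.

Set Implicit Arguments.
Unset Strict Implicit.
Unset Printing Implicit Defensive.

Import GRing.Theory.
Local Open Scope classical_set_scope.
Local Open Scope ring_scope.

Record opens (X : topologicalType) :=
  Opens { oset :> set X; oset_open : open oset }.

Definition topen (X : topologicalType) : opens X := Opens (@openT X).

Lemma open_pre (X Y : topologicalType) (f : X -> Y) (fc : continuous f)
  (V : opens Y) : open (f @^-1` V).
Proof. by move/continuousP: fc; apply; exact: oset_open. Qed.

Definition preim (X Y : topologicalType) (f : X -> Y) (fc : continuous f)
  (V : opens Y) : opens X := Opens (open_pre fc V).

(* Possibly trivial rings are needed for sections over the empty set. *)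
Record kringed (k : fieldType) := KRinged {
  pts :> topologicalType;
  sect : opens pts -> comPzRingType;
  kcst : forall U : opens pts, {rmorphism k -> sect U};
  rstr : forall U V : opens pts, V `<=` U -> {rmorphism sect U -> sect V};
  res_id : forall (U : opens pts) (UU : U `<=` U) (s : sect U), rstr UU s = s;
  res_res : forall (U V W : opens pts) (VU : V `<=` U) (WV : W `<=` V)
    (WU : W `<=` U) (s : sect U), rstr WV (rstr VU s) = rstr WU s;
  res_cst : forall (U V : opens pts) (VU : V `<=` U) (c : k),
    rstr VU (kcst U c) = kcst V c;
  sect_glue : forall (U : opens pts) (I : Type) (V : I -> opens pts)
    (VU : forall i, V i `<=` U), U `<=` \bigcup_i V i ->
    forall s : forall i, sect (V i),
    (forall i j (W : opens pts) (Wi : W `<=` V i) (Wj : W `<=` V j),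
        rstr Wi (s i) = rstr Wj (s j)) ->
    exists! t : sect U, forall i, rstr (VU i) t = s i
}.

(* [x] lies in [U] and the germ of [f] at [x] is a unit of the stalk. *)
Definition unit_at (k : fieldType) (X : kringed k) (U : opens X)
    (f : sect U) (x : X) : Prop :=
  exists (V : opens X) (VU : V `<=` U), oset V x /\ exists g, rstr VU f * g = 1.

(* For [x] in [U]: no stalk is trivial, and non-units are stable under sum. *)
Definition locally_ringed (k : fieldType) (X : kringed k) : Prop :=
  forall (U : opens X) (x : X), oset U x ->
    ~ unit_at (0 : sect U) x /\
    forall f g : sect U, unit_at (f + g) x -> unit_at f x \/ unit_at g x.

Definition prime_ideal (A : comPzRingType) (J : set A) : Prop :=
  [/\ J 0, forall a b, J a -> J b -> J (a + b), forall a b, J b -> J (a * b),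
      ~ J 1 & forall a b, J (a * b) -> J a \/ J b].

(* [U] is isomorphic to Spec of [sect U] through the canonical map sending x
   to the prime of functions vanishing at x: this map is bijective, the sets
   D(f) form a basis of [U], and sections over D(f) are the localization at
   [f] of the sections over [U]. *)
Definition affine_open (k : fieldType) (X : kringed k) (U : opens X) : Prop :=
  [/\ forall J : set (sect U), prime_ideal J ->
        exists! x : X, oset U x /\ forall f, J f <-> ~ unit_at f x,
      forall (x : X) (V : opens X), oset U x -> oset V x ->
        exists f : sect U, unit_at f x /\ unit_at f `<=` V
    & forall (f : sect U) (D : opens X) (DU : D `<=` U),
        D = unit_at f :> set X ->
        [/\ exists g, rstr DU f * g = 1,
            forall s : sect D, exists n a, rstr DU f ^+ n * s = rstr DU a
          & forall a : sect U, rstr DU a = 0 -> exists n, f ^+ n * a = 0]].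

Record kscheme (k : fieldType) := KScheme {
  kringed_of :> kringed k;
  kscheme_local : locally_ringed kringed_of;
  kscheme_affine : forall x : kringed_of,
    exists U : opens kringed_of, oset U x /\ affine_open U
}.

(* [pull V U] is the composite of O_Y(V) -> O_X(f^-1 V) with restriction to
   [U]. *)
Record schhom (k : fieldType) (X Y : kscheme k) := Hom {
  hfun :> X -> Y;
  hcont : continuous hfun;
  pull : forall (V : opens Y) (U : opens X), U `<=` hfun @^-1` V ->
    {rmorphism sect V -> sect U};
  pull_res : forall (V V' : opens Y) (U U' : opens X)
    (UV : U `<=` hfun @^-1` V) (U'V' : U' `<=` hfun @^-1` V')
    (VV : V' `<=` V) (UU : U' `<=` U) (s : sect V),
    rstr UU (pull UV s) = pull U'V' (rstr VV s);
  pull_cst : forall (V : opens Y) (U : opens X) (UV : U `<=` hfun @^-1` V)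
    (c : k), pull UV (kcst V c) = kcst U c;
  pull_local : forall (V : opens Y) (U : opens X) (UV : U `<=` hfun @^-1` V)
    (s : sect V) (x : X), unit_at (pull UV s) x -> unit_at s (hfun x)
}.

Section Composition.
Variables (k : fieldType) (X Y Z : kscheme k) (g : schhom Y Z) (f : schhom X Y).

Lemma comp_cont : continuous (g \o f).
Proof. by move=> x; apply: continuous_comp; apply: hcont. Qed.

Definition comp_pull (V : opens Z) (U : opens X)
    (UV : U `<=` (g \o f) @^-1` V) : {rmorphism sect V -> sect U} :=
  @pull k X Y f (preim (@hcont _ _ _ g) V) U UV \o
  @pull k Y Z g V (preim (@hcont _ _ _ g) V) (fun y gy => gy).

Lemma comp_pull_res (V V' : opens Z) (U U' : opens X)
    (UV : U `<=` (g \o f) @^-1` V) (U'V' : U' `<=` (g \o f) @^-1` V')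
    (VV : V' `<=` V) (UU : U' `<=` U) (s : sect V) :
  rstr UU (comp_pull UV s) = comp_pull U'V' (rstr VV s).
Proof.
rewrite /comp_pull /=.
have W : preim (@hcont _ _ _ g) V' `<=` preim (@hcont _ _ _ g) V.
  by move=> y /=; apply: VV.
rewrite (pull_res (V' := preim (@hcont _ _ _ g) V') _ U'V' W).
by congr (pull _ _); apply: pull_res.
Qed.

Lemma comp_pull_cst (V : opens Z) (U : opens X)
    (UV : U `<=` (g \o f) @^-1` V) (c : k) :
  comp_pull UV (kcst V c) = kcst U c.
Proof. by rewrite /comp_pull /= !pull_cst. Qed.

Lemma comp_pull_local (V : opens Z) (U : opens X)
    (UV : U `<=` (g \o f) @^-1` V) (s : sect V) (x : X) :
  unit_at (comp_pull UV s) x -> unit_at s ((g \o f) x).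
Proof. by rewrite /comp_pull /= => /pull_local/pull_local. Qed.

Definition schcomp : schhom X Z :=
  Hom comp_cont comp_pull_res comp_pull_cst comp_pull_local.

End Composition.

Definition Gam (k : fieldType) (X : kscheme k) : comPzRingType :=
  sect (topen X).

Definition gpull (k : fieldType) (X Y : kscheme k) (f : schhom X Y) :
    {rmorphism Gam Y -> Gam X} :=
  @pull k X Y f (topen Y) (topen X) (fun _ _ => I).

Definition infinitesimal_lifting (A B : comPzRingType)
    (phi : {rmorphism A -> B}) (uniq_lift : Prop) : Prop :=
  forall (C C0 : comPzRingType) (p : {rmorphism C -> C0}),
    (forall c0, exists c, p c = c0) ->
    (forall a b, p a = 0 -> p b = 0 -> a * b = 0) ->
  forall (alpha : {rmorphism A -> C}) (beta : {rmorphism B -> C0}),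
    p \o alpha =1 beta \o phi ->
    let lift (gam : {rmorphism B -> C}) :=
      gam \o phi =1 alpha /\ p \o gam =1 beta in
    (exists gam, lift gam) /\
    (uniq_lift -> forall gam gam', lift gam -> lift gam' -> gam =1 gam').

(* Polynomials in n variables as formal sums of monomials. *)
Definition mvpoly (A : Type) (n : nat) := seq (A * {ffun 'I_n -> nat}).

Definition mveval (A C : comPzRingType) (alpha : A -> C) (n : nat)
    (c : 'I_n -> C) (P : mvpoly A n) : C :=
  \sum_(m <- P) alpha m.1 * \prod_i c i ^+ m.2 i.

(* [B] has the universal property of A[x_1, ..., x_n] / (r). *)
Definition finitely_presented (A B : comPzRingType)
    (phi : {rmorphism A -> B}) : Prop :=
  exists (n : nat) (b : 'I_n -> B) (r : seq (mvpoly A n)),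
    (forall P, P \in r -> mveval phi b P = 0) /\
    forall (C : comPzRingType) (alpha : {rmorphism A -> C}) (c : 'I_n -> C),
      (forall P, P \in r -> mveval alpha c P = 0) ->
      let ext (gam : {rmorphism B -> C}) :=
        gam \o phi =1 alpha /\ forall i, gam (b i) = c i in
      (exists gam, ext gam) /\
      forall gam gam', ext gam -> ext gam' -> gam =1 gam'.

Definition locally_on_affines (k : fieldType) (X Y : kscheme k) (f : schhom X Y)
    (Q : forall A B : comPzRingType, {rmorphism A -> B} -> Prop) : Prop :=
  forall x : X, exists (U : opens X) (V : opens Y) (UV : U `<=` f @^-1` V),
    [/\ oset U x, affine_open U, affine_open V & Q _ _ (pull UV)].

Definition smooth (k : fieldType) (X Y : kscheme k) (f : schhom X Y) : Prop :=
  locally_on_affines f (fun A B phi =>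
    finitely_presented phi /\ infinitesimal_lifting phi False).

Definition etale (k : fieldType) (X Y : kscheme k) (f : schhom X Y) : Prop :=
  locally_on_affines f (fun A B phi =>
    finitely_presented phi /\ infinitesimal_lifting phi True).

(* A family of sections on open sets [U i] covering [Z], agreeing at all
   points of [Z], is a global section of O_Y / I_Z, where I_Z consists of the
   functions vanishing at all points of [Z]; this quotient is the structure
   sheaf of the reduced closed subscheme [Z].  As k is algebraically closed and
   the schemes at hand are locally of finite type, locally constant means
   locally equal to an element of k. *)
Definition pseudo_complete (k : fieldType) (Y : kscheme k) (Z : set Y) : Prop :=
  forall (I : Type) (U : I -> opens Y) (s : forall i, sect (U i)),
    Z `<=` \bigcup_i U i ->
    (forall i j (W : opens Y) (Wi : W `<=` U i) (Wj : W `<=` U j) (y : Y),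
        Z y -> oset W y -> ~ unit_at (rstr Wi (s i) - rstr Wj (s j)) y) ->
  forall z, Z z -> exists i (V : opens Y) (VU : V `<=` U i) (c : k),
    oset V z /\
    forall y, Z y -> oset V y -> ~ unit_at (rstr VU (s i) - kcst V c) y.

Record GL (R : comPzRingType) := MkGL {
  glm :> 'M[R]_4;
  gli : 'M[R]_4;
  glmK : glm *m gli = 1%:M;
  gliK : gli *m glm = 1%:M
}.

Section GroupLaw.
Variable R : comPzRingType.

Definition gl1 : GL R := MkGL (mulmx1 1%:M) (mulmx1 1%:M).

Definition glV (x : GL R) : GL R := MkGL (gliK x) (glmK x).

Lemma glMK (x y : GL R) : (x *m y) *m (gli y *m gli x) = 1%:M.
Proof. by rewrite mulmxA -(mulmxA (glm x)) glmK mulmx1 glmK. Qed.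

Lemma glKM (x y : GL R) : (gli y *m gli x) *m (x *m y) = 1%:M.
Proof. by rewrite mulmxA -(mulmxA (gli y)) gliK mulmx1 gliK. Qed.

Definition glM (x y : GL R) : GL R := MkGL (glMK x y) (glKM x y).

Lemma gl_permK (s : 'S_4) : perm_mx s *m perm_mx s^-1 = 1%:M :> 'M[R]_4.
Proof. by rewrite -perm_mxM mulgV perm_mx1. Qed.

Lemma gl_permVK (s : 'S_4) : perm_mx s^-1 *m perm_mx s = 1%:M :> 'M[R]_4.
Proof. by rewrite -perm_mxM mulVg perm_mx1. Qed.

Definition gl_perm (s : 'S_4) : GL R := MkGL (gl_permK s) (gl_permVK s).

End GroupLaw.

Section BaseChange.
Variables (R R' : comPzRingType) (f : {rmorphism R -> R'}).

Lemma gl_mapK (x : GL R) : map_mx f x *m map_mx f (gli x) = 1%:M.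
Proof. by rewrite -map_mxM glmK map_mx1. Qed.

Lemma gl_mapVK (x : GL R) : map_mx f (gli x) *m map_mx f x = 1%:M.
Proof. by rewrite -map_mxM gliK map_mx1. Qed.

Definition glmap (x : GL R) : GL R' := MkGL (gl_mapK x) (gl_mapVK x).

End BaseChange.

(* Exponents of mu(t) = diag(t, t, t, 1). *)
Definition mu (i : 'I_4) : nat := (i < 3)%N.

(* The (i, j) entry of mu(t)^-1 x mu(t) is t^(mu j - mu i) x_ij, so t may be
   specialized to 0 if and only if x_ij = 0 whenever the exponent is
   negative. *)
Definition in_Pminus (R : comPzRingType) (x : GL R) : Prop :=
  forall i j, (mu j < mu i)%N -> x i j = 0.

Definition in_Pplus (R : comPzRingType) (x : GL R) : Prop :=
  forall i j, (mu i < mu j)%N -> x i j = 0.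

(* [is_trig_mx] means lower triangular. *)
Definition in_B (R : comPzRingType) (x : GL R) : Prop := is_trig_mx x.

(* The component in the centralizer of mu of an element of P_-(mu) or
   P_+(mu). *)
Definition levi (R : comPzRingType) (x : 'M[R]_4) : 'M[R]_4 :=
  \matrix_(i, j) if mu i == mu j then x i j else 0.

(* The character prod_i b_ii^(lam i) of B; the diagonal of b^-1 is the inverse
   of that of b. *)
Definition gl_char (R : comPzRingType) (lam : 'rV[int]_4) (b : GL R) : R :=
  \prod_i match lam 0 i with
          | Posz n => b i i ^+ n
          | Negz n => gli b i i ^+ n.+1
          end.

(* The Weyl group is 'S_4, via permutation matrices. *)
Definition simple_refl (i : 'I_3) : 'S_4 :=
  tperm (widen_ord (leqnSn 3) i) (lift ord0 i).

Definition word (s : seq 'I_3) : 'S_4 := (\prod_(i <- s) simple_refl i)%g.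

Definition has_length (w : 'S_4) (n : nat) : Prop :=
  (exists s, size s = n /\ word s = w) /\
  forall s, word s = w -> (n <= size s)%N.

Definition w0 : 'S_4 := perm (@rev_ord_inj 4).

(* I consists of the first two simple roots. *)
Definition w0I : 'S_4 := tperm (inord 0) (inord 2).

(* Frobenius acts trivially on the Weyl group, since T is split. *)
Definition zW : 'S_4 := (w0I * w0)%g.

Definition GL2 (R : comPzRingType) : Type := (GL R * GL R)%type.

(* mu is defined over the prime field, so that Q = P_+(mu). *)
Definition zipE (q : nat) (R : comPzRingType) (e : GL2 R) : Prop :=
  [/\ in_Pminus e.1, in_Pplus e.2
    & map_mx (fun a : R => a ^+ q) (levi e.1) = levi e.2].

Definition zipE' (q : nat) (R : comPzRingType) (e : GL2 R) : Prop :=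
  zipE q e /\ in_B e.1.

Definition GL2_1 (R : comPzRingType) : GL2 R := (gl1 R, gl1 R).

Definition GL2_M (R : comPzRingType) (e e' : GL2 R) : GL2 R :=
  (glM e.1 e'.1, glM e.2 e'.2).

Definition GL2_map (R R' : comPzRingType) (f : {rmorphism R -> R'})
  (e : GL2 R) : GL2 R' := (glmap f e.1, glmap f e.2).

(* Group schemes and their actions are given on T-points, [T] a k-scheme; [act]
   is only relevant on the subgroup [H] of GL_4 * GL_4. *)
Definition action_on (k : fieldType) (X : kscheme k) : Type :=
  forall T : kscheme k, GL2 (Gam T) -> schhom T X -> schhom T X.

Definition is_action (k : fieldType)
    (H : forall R : comPzRingType, GL2 R -> Prop) (X : kscheme k)
    (act : action_on X) : Prop :=
  [/\ forall T (x : schhom T X), act T (GL2_1 _) x = x,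
      forall T e e' (x : schhom T X), H _ e -> H _ e' ->
        act T (GL2_M e e') x = act T e (act T e' x)
    & forall T T' (u : schhom T' T) e (x : schhom T X), H _ e ->
        act T' (GL2_map (gpull u) e) (schcomp x u) = schcomp (act T e x) u].

(* [H] is simply transitive on the fibres of [pi], and [pi] has sections locally
   for the étale topology. *)
Definition is_torsor (k : fieldType)
    (H : forall R : comPzRingType, GL2 R -> Prop) (X S : kscheme k)
    (pi : schhom X S) (act : action_on X) : Prop :=
  [/\ is_action H act,
      forall T e (x : schhom T X), H _ e ->
        schcomp pi (act T e x) = schcomp pi x,
      forall T (x x' : schhom T X), schcomp pi x = schcomp pi x' ->
        exists! e : GL2 (Gam T), H _ e /\ act T e x = x'
    & exists (U : kscheme k) (u : schhom U S) (s : schhom U X),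
        [/\ etale u, forall y, exists x, u x = y & schcomp pi s = u]].

(* The k-scheme GL_4, with its universal matrix. *)
Record GLscheme (k : fieldType) := MkGLscheme {
  glsch :> kscheme k;
  gluniv : GL (Gam glsch);
  gluniv_univ : forall (T : kscheme k) (x : GL (Gam T)),
    exists! t : schhom T glsch, glmap (gpull t) gluniv = x
}.

Definition mat (k : fieldType) (G : GLscheme k) (T : kscheme k)
  (t : schhom T G) : GL (Gam T) := glmap (gpull t) (gluniv G).

Definition zip_act (R : comPzRingType) (e : GL2 R) (g : GL R) : GL R :=
  glM (glM e.1 g) (glV e.2).

(* A morphism from [S] to the quotient stack [E \ G]: an E-torsor over [S] with
   an equivariant map to [G]; the torsor is the fibre product of [S] and [G]
   over the stack. *)
Record zip_mor (k : fieldType) (q : nat) (G : GLscheme k) (S : kscheme k) :=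
  MkZipMor {
    ztot : kscheme k;
    zproj : schhom ztot S;
    zact : action_on ztot;
    ztorsor : is_torsor (zipE q) zproj zact;
    zloc : schhom ztot G;
    zequiv : forall T e (x : schhom T ztot), zipE q e ->
      mat (schcomp zloc (zact e x)) = zip_act e (mat (schcomp zloc x))
  }.

(* Properties of the morphism to the stack are tested after base change along
   the smooth atlas [G] of the stack. *)
Definition zeta_smooth (k : fieldType) (q : nat) (G : GLscheme k)
    (S : kscheme k) (zeta : zip_mor q G S) : Prop :=
  smooth (zloc zeta).

Definition zeta_surj_on_components (k : fieldType) (q : nat) (G : GLscheme k)
    (S : kscheme k) (zeta : zip_mor q G S) : Prop :=
  forall (s : S) (g : G), exists x : ztot zeta,
    connected_component setT s (zproj zeta x) /\ zloc zeta x = g.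

(* Flag(S), the pullback to [S] of the stack [E' \ G], is the quotient by E'
   of the torsor. *)
Record flag_space (k : fieldType) (q : nat) (G : GLscheme k) (S : kscheme k)
    (zeta : zip_mor q G S) := MkFlagSpace {
  fsch :> kscheme k;
  fproj : schhom (ztot zeta) fsch;
  ftorsor : is_torsor (zipE' q) fproj (@zact _ _ _ _ zeta)
}.

(* The image of (b, b') |-> b w b' z^-1, a set of points of [G]. *)
Definition bruhat (k : fieldType) (G : GLscheme k) (w : 'S_4) : set G :=
  [set g | exists (T : kscheme k) (t : schhom T G) (tau : T)
       (b b' : GL (Gam T)),
     [/\ t tau = g, in_B b, in_B b' &
         mat t = glM (glM (glM b (gl_perm _ w)) b') (glV (gl_perm _ zW))]].

Definition flag_stratum (k : fieldType) (q : nat) (G : GLscheme k)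
    (S : kscheme k) (zeta : zip_mor q G S) (F : flag_space zeta) (w : 'S_4) :
    set F :=
  fproj F @` (zloc zeta @^-1` bruhat (G := G) w).
Arguments flag_stratum {k q G S zeta} F w _.

(* Functions on P after base change to [T]: maps r |-> f(r) for r in P(T1) and
   [T1] a [T]-scheme.  Values outside P are irrelevant. *)
Definition fun_on (k : fieldType) (T : kscheme k) : Type :=
  forall T1 : kscheme k, schhom T1 T -> GL (Gam T1) -> Gam T1.

(* The [T]-points of V_I(lam) = Ind_B^P(lam), viewed as an affine space: these
   are V_I(lam) tensored with the functions on [T], that is, since induction
   commutes with flat base change, the regular functions on P over [T]
   satisfying f(r b) = lam(b)^-1 f(r).  By Yoneda, a regular function is a
   natural map on points. *)
Definition in_VI (k : fieldType) (lam : 'rV[int]_4) (T : kscheme k)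
    (f : fun_on T) : Prop :=
  (forall T1 T2 (v : schhom T1 T) (u : schhom T2 T1) r, in_Pminus r ->
     f T2 (schcomp v u) (glmap (gpull u) r) = gpull u (f T1 v r)) /\
  (forall T1 (v : schhom T1 T) r b, in_Pminus r -> in_B b ->
     f T1 v (glM r b) = gl_char (- lam) b * f T1 v r).

(* (p f)(r) = f(p^-1 r) *)
Definition VI_act (k : fieldType) (T : kscheme k) (p : GL (Gam T))
    (f : fun_on T) : fun_on T :=
  fun T1 v r => f T1 v (glM (glV (glmap (gpull v) p)) r).

(* For a functor [X] of k-schemes with base change maps [bc] and an action of
   E: the vector bundle [E \ (X * V_I(lam))] on [E \ X], where E acts on
   V_I(lam) through its first projection to P, has a nonzero global section,
   i.e. there is a nonzero E-equivariant morphism from [X] to V_I(lam). *)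
Definition has_section (k : fieldType) (q : nat) (X : kscheme k -> Type)
    (bc : forall T T' : kscheme k, schhom T' T -> X T -> X T')
    (act : forall T : kscheme k, GL2 (Gam T) -> X T -> X T)
    (lam : 'rV[int]_4) : Prop :=
  exists s : forall T : kscheme k, X T -> fun_on T,
    [/\ forall T x, in_VI lam (s T x),
        forall T T' (u : schhom T' T) x T1 (v : schhom T1 T') r, in_Pminus r ->
          s T' (bc _ _ u x) T1 v r = s T x T1 (schcomp u v) r,
        forall T e x T1 (v : schhom T1 T) r, zipE q e -> in_Pminus r ->
          s T (act T e x) T1 v r = VI_act e.1 (s T x) v r
      & exists T x T1 (v : schhom T1 T) r, in_Pminus r /\ s T x T1 v r <> 0].

Definition C_zip (k : fieldType) (q : nat) : set 'rV[int]_4 :=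
  [set lam | @has_section k q (fun T => GL (Gam T))
     (fun T T' u => glmap (gpull u)) (fun T => @zip_act (Gam T)) lam].

Definition C_S (k : fieldType) (q : nat) (G : GLscheme k) (S : kscheme k)
    (zeta : zip_mor q G S) : set 'rV[int]_4 :=
  [set lam | @has_section k q (fun T => schhom T (ztot zeta))
     (fun T T' u x => schcomp x u) (@zact _ _ _ _ zeta) lam].

Definition saturation (C : set 'rV[int]_4) : set 'rV[int]_4 :=
  [set lam | exists N : nat, (0 < N)%N /\ C (lam *+ N)].

(* Main.v *)
(** A section of V_I(lam) over S is a function f on the E-torsor X over S such that
    f (e x) = lam(e_1) f x for e in E'; write h for the matrix of the point of G under
    x, its columns being permuted by z.  With (l0, l1, l2, l3) = lam, both saturated
    cones consist of the lam having a positive multiple for which some integer m >= 0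
    satisfies m <= l0 - l1, q m <= l1 - l2 and
      q^2 (l0 - m) + q l1 + (l2 + q m) <= (1 + q + q^2) l3.

    For a nonzero f, let m be its order along the divisor h_03 = 0.  Dividing f
    successively by powers of the entries of h above the diagonal and restricting to
    their zeros gives leading coefficients on a chain of strata.  On a stratum where
    only the entry h_(i,i+1) is left, a power of the leading coefficient, divided by a
    power of h_(i,i+1) and by units, is invariant under E', hence descends to
    Flag(S) and is locally constant there by pseudo-completeness; this bounds the order
    along h_(i,i+1).  The orders obtained along the different chains are monotone, and
    the bounds together give the third inequality.  The first two compare, on a
    one-parameter unipotent subgroup u, the order of f (u(t) x) at t = 0 with its degree
    in t, which is at most l0 - l1 (resp. l1 - l2) because f comes from a section of
    V_I(lam).

    Conversely, monomials in h_03, two partial Hasse invariants, the determinant of the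
    upper left 3 x 3 block of g and det g give sections on the stack of zips; their
    pullbacks to S are nonzero since X -> G is smooth and surjective. *)
From HB Require Import structures.
Require Import Defs.
From mathcomp Require Import all_boot all_order all_fingroup all_algebra.
From mathcomp Require Import all_classical.
From mathcomp Require Import topology.
From mathcomp Require Import ring zify.
From mathcomp Require mpoly.
Import -(notations) mpoly.
Set Implicit Arguments.
Unset Strict Implicit.
Unset Printing Implicit Defensive.
Import GRing.Theory.
Local Open Scope classical_set_scope.
Local Open Scope ring_scope.

(** Nothing makes X irreducible, so an order of vanishing along an entry of h is a local notion:
    near a point of a stratum, a list of entries with exponents is [good] or [bad] according to the
    existence of a leading coefficient. Both conditions are open and together they exhaust the
    stratum; E' being connected, neither can be left along an orbit. The orders used are the least
    ones at closed points of the smallest stratum, which condition (b) makes accessible from a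
    component where f is nonzero. Leading coefficients are unique because germs of strata are
    domains: X is smooth over GL_4, so the entries of h can be deformed at will and every stratum is
    formally smooth over k. Flatness, openness of smooth maps and descent from X to Flag(S) rest on
    one argument: a Newton substitution maps the relations of a smooth algebra into the square of
    the ideal they generate, and Krull's theorem applies to its iterates. The exponent q^3 - 1 used
    on the curves comes from the permutation s_i z^-1 that represents the curve: a 3-cycle with one
    fixed point. *)

Definition nzof (D : comPzRingType) (H : (1 : D) != 0) : comNzRingType :=
  HB.pack D (GRing.PzSemiRing_isNonZero.Build D H).

(** * Ideals, localizations and quotient rings *)

Record ideal (R : comPzRingType) := Ideal {
  iset :> R -> Prop;
  ideal0 : iset 0;
  idealD : forall a b, iset a -> iset b -> iset (a + b);
  idealM : forall a b, iset b -> iset (a * b)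
}.

Section IdealTheory.
Variables (R : comPzRingType) (J : ideal R).

Lemma idealMr a b : J a -> J (a * b).
Proof. by rewrite mulrC; exact: idealM. Qed.

Lemma idealN a : J a -> J (- a).
Proof. by move=> Ja; rewrite -mulN1r; apply: idealM. Qed.

Lemma idealB a b : J a -> J b -> J (a - b).
Proof. by move=> Ja Jb; apply: idealD => //; apply: idealN. Qed.

Lemma idealBDr a b : J (a - b) -> J b -> J a.
Proof. by move=> Jab Jb; rewrite -(subrK b a); apply: idealD. Qed.

Lemma ideal_sum (I : Type) (r : seq I) (P : pred I) (F : I -> R) :
  (forall i, P i -> J (F i)) -> J (\sum_(i <- r | P i) F i).
Proof. by move=> JF; apply: big_ind => //; [exact: ideal0|exact: idealD]. Qed.

End IdealTheory.

Record locdata (R : comPzRingType) := LocData {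
  lden :> R -> Prop;
  lnul : ideal R;
  lden1 : lden 1;
  ldenM : forall a b, lden a -> lden b -> lden (a * b)
}.

(* Fractions a/s with s in the multiplicative set [lden], a/s being identified
   with b/t when u(at - bs) lies in the ideal [lnul] for some u in [lden]: the
   localization of R/[lnul]. *)
Section Fractions.
Variables (R : comPzRingType) (L : locdata R).

Definition feq (p q : R * R) : Prop :=
  exists u, L u /\ lnul L (u * (p.1 * q.2 - q.1 * p.2)).

Lemma feq_refl p : feq p p.
Proof. by exists 1; split; [exact: lden1|rewrite subrr mulr0; exact: ideal0]. Qed.

Lemma feq_sym p q : feq p q -> feq q p.
Proof.
move=> [u [Lu Iu]]; exists u; split=> //.
by rewrite -opprB mulrN; apply: idealN.
Qed.

Lemma feq_trans q p r : L q.2 -> feq p q -> feq q r -> feq p r.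
Proof.
move=> Lq [u [Lu Iu]] [v [Lv Iv]]; exists (u * v * q.2); split.
  by do 2?apply: ldenM.
have -> : u * v * q.2 * (p.1 * r.2 - r.1 * p.2) =
  v * r.2 * (u * (p.1 * q.2 - q.1 * p.2)) +
  u * p.2 * (v * (q.1 * r.2 - r.1 * q.2)) by ring.
by apply: idealD; apply: idealM.
Qed.

(** A fraction is its whole equivalence class, as a set of pairs, so that equality of fractions is
    plain equality. *)
Definition frac : Type := {c : set (R * R) | exists p, L p.2 /\ c = feq p}.

HB.instance Definition _ := gen_eqMixin frac.
HB.instance Definition _ := gen_choiceMixin frac.

Definition mkfrac (a s : R) (Ls : L s) : frac :=
  exist _ (feq (a, s)) (ex_intro _ (a, s) (conj Ls erefl)).

Lemma mkfracP a s (Ls : L s) b t (Lt : L t) :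
  mkfrac a Ls = mkfrac b Lt <-> feq (a, s) (b, t).
Proof.
split=> [[E]|E].
  by have := feq_refl (b, t); rewrite -[feq (b, t)]E.
apply: eq_exist; apply/funext => r; apply/propext; split.
  by apply: (@feq_trans (a, s)) => //; apply: feq_sym.
exact: (@feq_trans (b, t)).
Qed.

Definition frep (c : frac) : {p : R * R | L p.2} :=
  let: exist p Hp := cid (svalP c) in exist _ p (proj1 Hp).

Lemma frepK c : mkfrac (sval (frep c)).1 (s := (sval (frep c)).2) (svalP (frep c)) = c.
Proof.
rewrite /frep; case: (cid _) => -[a s] /= [La E]; case: c E => c Hc /= E.
by apply: eq_exist; rewrite E.
Qed.

Lemma fracP (c : frac) : exists a s (Ls : L s), c = mkfrac a Ls.
Proof. by rewrite -(frepK c); do 3?eexists. Qed.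

Definition frac2 (f : R -> R -> R -> R -> R) (c d : frac) : frac :=
  mkfrac (f (sval (frep c)).1 (sval (frep c)).2
                 (sval (frep d)).1 (sval (frep d)).2)
         (s := (sval (frep c)).2 * (sval (frep d)).2) (ldenM (svalP (frep c)) (svalP (frep d))).

Definition fcompat (f : R -> R -> R -> R -> R) :=
  forall a s b t a' s' b' t', L s -> L t -> L s' -> L t' ->
    feq (a, s) (a', s') -> feq (b, t) (b', t') ->
    feq (f a s b t, s * t) (f a' s' b' t', s' * t').

Lemma frac2E f a s (Ls : L s) b t (Lt : L t) : fcompat f ->
  frac2 f (mkfrac a Ls) (mkfrac b Lt) =
  mkfrac (f a s b t) (ldenM Ls Lt).
Proof.
move=> fc; apply/mkfracP; apply: fc => //; try exact: (svalP (frep _)).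
  have := frepK (mkfrac a Ls); move: (frep _) => [[a' s'] /= La'].
  by move/mkfracP.
have := frepK (mkfrac (b) Lt); move: (frep _) => [[a' s'] /= La'].
by move/mkfracP.
Qed.

Definition fadd := frac2 (fun a s b t => a * t + b * s).
Definition fmul := frac2 (fun a _ b _ => a * b).
Definition fopp (c : frac) : frac :=
  mkfrac (- (sval (frep c)).1) (s := (sval (frep c)).2) (svalP (frep c)).

Lemma faddE a s (Ls : L s) b t (Lt : L t) :
  fadd (mkfrac a Ls) (mkfrac b Lt) =
  mkfrac (a * t + b * s) (ldenM Ls Lt).
Proof.
apply: frac2E => {Ls Lt}{}a {}s {}b {}t a' s' b' t' Ms Mt Ms' Mt' [u [Lu /= Iu]] [v [Lv /= Iv]].
exists (u * v); split => /=; first exact: ldenM.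
have -> : u * v * ((a * t + b * s) * (s' * t') - (a' * t' + b' * s') * (s * t)) =
  v * t * t' * (u * (a * s' - a' * s)) + u * s * s' * (v * (b * t' - b' * t)).
  ring.
by apply: idealD; apply: idealM.
Qed.

Lemma fmulE a s (Ls : L s) b t (Lt : L t) :
  fmul (mkfrac a Ls) (mkfrac b Lt) =
  mkfrac (a * b) (ldenM Ls Lt).
Proof.
apply: frac2E => {Ls Lt}{}a {}s {}b {}t a' s' b' t' Ms Mt Ms' Mt' [u [Lu /= Iu]] [v [Lv /= Iv]].
exists (u * v); split => /=; first exact: ldenM.
have -> : u * v * (a * b * (s' * t') - a' * b' * (s * t)) =
  v * b * t' * (u * (a * s' - a' * s)) + u * a' * s * (v * (b * t' - b' * t)).
  ring.
by apply: idealD; apply: idealM.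
Qed.

Lemma foppE a s (Ls : L s) :
  fopp (mkfrac a Ls) = mkfrac (- a) Ls.
Proof.
apply/mkfracP.
have := frepK (mkfrac a Ls); move: (frep _) => [[a' s'] /= La'].
move/mkfracP => -[u [Lu /= Iu]]; exists u; split=> //=.
by rewrite !mulNr -opprD mulrN; apply: idealN.
Qed.

Definition fcst (a : R) : frac := mkfrac a (lden1 L).

Local Ltac fracs :=
  do ?[let c := fresh "c" in move=> c;
       let a := fresh "a" in let s := fresh "s" in let Ls := fresh "Ls" in
       have [a [s [Ls ->]]] := fracP c];
  rewrite ?(faddE, fmulE, foppE); apply/mkfracP; exists 1; split;
  [exact: lden1|rewrite /=].

Local Ltac zeroI := match goal with |- iset _ ?x =>
  (have -> : x = 0 by ring); exact: ideal0 end.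

Lemma faddA : associative fadd. Proof. by fracs; zeroI. Qed.
Lemma faddC : commutative fadd. Proof. by fracs; zeroI. Qed.
Lemma fadd0 : left_id (fcst 0) fadd. Proof. by fracs; zeroI. Qed.
Lemma faddN : left_inverse (fcst 0) fopp fadd. Proof. by fracs; zeroI. Qed.
Lemma fmulA : associative fmul. Proof. by fracs; zeroI. Qed.
Lemma fmulC : commutative fmul. Proof. by fracs; zeroI. Qed.
Lemma fmul1 : left_id (fcst 1) fmul. Proof. by fracs; zeroI. Qed.
Lemma fmulDl : left_distributive fmul fadd. Proof. by fracs; zeroI. Qed.

HB.instance Definition _ := GRing.isZmodule.Build frac faddA faddC fadd0 faddN.
HB.instance Definition _ :=
  GRing.Zmodule_isComPzRing.Build frac fmulA fmulC fmul1 fmulDl.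

Fact fcst_is_zmod_morphism : zmod_morphism fcst.
Proof.
move=> a b; symmetry; rewrite [LHS]/GRing.add /= [X in fadd _ X]/GRing.opp /=.
by rewrite /fcst foppE; fracs; zeroI.
Qed.

Fact fcst_is_monoid_morphism : monoid_morphism fcst.
Proof. by split=> // a b; symmetry; rewrite [LHS]/GRing.mul /=; fracs; zeroI. Qed.

HB.instance Definition _ :=
  GRing.isZmodMorphism.Build R frac fcst fcst_is_zmod_morphism.
HB.instance Definition _ :=
  GRing.isMonoidMorphism.Build R frac fcst fcst_is_monoid_morphism.

Lemma fcst_eq0 a : fcst a = 0 <-> exists u, L u /\ lnul L (u * a).
Proof.
split=> [/mkfracP[u [Lu /=]]|[u [Lu Iu]]].
  by rewrite mulr1 mul0r subr0; exists u.
by apply/mkfracP; exists u; rewrite /= mulr1 mul0r subr0.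
Qed.

Lemma fcst_eq a b : fcst a = fcst b <-> exists u, L u /\ lnul L (u * (a - b)).
Proof.
rewrite -fcst_eq0 (_ : fcst (a - b) = fcst a - fcst b); last exact: rmorphB.
split=> [->|/eqP]; first by rewrite subrr.
by rewrite subr_eq0 => /eqP.
Qed.

Lemma fcst_unit s : L s -> exists v, fcst s * v = 1.
Proof.
move=> Ls; exists (mkfrac 1 Ls); rewrite [LHS]/GRing.mul /= fmulE.
by apply/mkfracP; exists 1; split; [exact: lden1|rewrite /=; zeroI].
Qed.

Lemma frac_surj (c : frac) : exists a s, L s /\ fcst s * c = fcst a.
Proof.
have [a [s [Ls ->]]] := fracP c; exists a, s; split=> //.
rewrite [LHS]/GRing.mul /= fmulE.
by apply/mkfracP; exists 1; split; [exact: lden1|rewrite /=; zeroI].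
Qed.

End Fractions.

Section FracLift.
Variables (R : comPzRingType) (L : locdata R) (S : comPzRingType).
Variable f : {rmorphism R -> S}.
Hypothesis fden : forall s, L s -> exists v, f s * v = 1.
Hypothesis fnul : forall a, lnul L a -> f a = 0.

(** The element v is f a / f s. Quantifying over all representations of c makes [flift] independent
    of the chosen one. *)
Lemma flift_key (c : frac L) :
  exists v, forall a s, L s -> fcst L s * c = fcst L a -> f s * v = f a.
Proof.
have [a [s [Ls E]]] := frac_surj c; have [w fw] := fden Ls.
exists (f a * w) => b t Lt Eb.
have : fcst L (t * a) = fcst L (s * b).
  by rewrite !rmorphM /= -E -Eb mulrCA.
move/fcst_eq => -[u [Lu /fnul]]; have [x fx] := fden Lu.
rewrite rmorphM => /(congr1 (fun y => x * y)).
rewrite mulr0 mulrA (mulrC x) fx mul1r rmorphB => /eqP; rewrite subr_eq0 => /eqP.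
rewrite !rmorphM mulrA => ->.
by rewrite mulrAC fw mul1r.
Qed.

Definition flift (c : frac L) : S := sval (cid (flift_key c)).

Lemma fliftE c a s : L s -> fcst L s * c = fcst L a -> f s * flift c = f a.
Proof. by rewrite /flift; case: (cid _) => v /= Hv; apply: Hv. Qed.

Lemma flift_cst a : flift (fcst L a) = f a.
Proof.
by rewrite -[LHS]mul1r -(rmorph1 f); apply: fliftE; rewrite ?rmorph1 ?mul1r //;
  exact: lden1.
Qed.

Lemma flift_uniq c v a s : L s -> fcst L s * c = fcst L a -> f s * v = f a ->
  v = flift c.
Proof.
move=> Ls /(fliftE Ls) E Ev; have [w fw] := fden Ls.
by rewrite -[v]mul1r -fw mulrAC Ev -E mulrAC fw mul1r.
Qed.

Fact flift_is_zmod_morphism : zmod_morphism flift.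
Proof.
move=> c d; have [a [s [Ls Ec]]] := frac_surj c.
have [b [t [Lt Ed]]] := frac_surj d.
symmetry; apply: (@flift_uniq _ _ (t * a - s * b) (s * t)); first exact: ldenM.
  rewrite rmorphM rmorphB !rmorphM /= -Ec -Ed; ring.
rewrite rmorphM rmorphB !rmorphM /= -(fliftE Ls Ec) -(fliftE Lt Ed); ring.
Qed.

Fact flift_is_monoid_morphism : monoid_morphism flift.
Proof.
split=> [|c d]; first by rewrite -(rmorph1 (fcst L)) flift_cst rmorph1.
have [a [s [Ls Ec]]] := frac_surj c; have [b [t [Lt Ed]]] := frac_surj d.
symmetry; apply: (@flift_uniq _ _ (a * b) (s * t)); first exact: ldenM.
  rewrite !rmorphM /= -Ec -Ed; ring.
rewrite !rmorphM /= -(fliftE Ls Ec) -(fliftE Lt Ed); ring.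
Qed.

HB.instance Definition _ :=
  GRing.isZmodMorphism.Build (frac L) S flift flift_is_zmod_morphism.
HB.instance Definition _ :=
  GRing.isMonoidMorphism.Build (frac L) S flift flift_is_monoid_morphism.

Lemma fliftP : exists g : {rmorphism frac L -> S}, forall a, g (fcst L a) = f a.
Proof. by exists (flift : {rmorphism _ -> _}); exact: flift_cst. Qed.

End FracLift.

Section Quotient.
Variables (R : comPzRingType) (J : ideal R).

(** The quotient by J is the localization at the multiplicative set {1}; it thus inherits the ring
    structure and the lifting property of [frac]. *)
Definition quo_data : locdata R :=
  @LocData R [set 1] J erefl (fun a b (ea : a = 1) (eb : b = 1) =>
    etrans (congr2 _ ea eb) (mulr1 1)).

Definition quo : comPzRingType := frac quo_data.

Definition toquo : {rmorphism R -> quo} := fcst quo_data.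

Lemma toquo_eq0 a : toquo a = 0 <-> J a.
Proof.
split=> [/fcst_eq0[u [/= -> ]]|Ja]; first by rewrite mul1r.
by apply/fcst_eq0; exists 1; rewrite mul1r.
Qed.

Lemma toquo_kill a : J a -> toquo a = 0. Proof. by move/toquo_eq0. Qed.

Lemma toquo_mem a : toquo a = 0 -> J a. Proof. by move/toquo_eq0. Qed.

Lemma toquo_eq a b : toquo a = toquo b <-> J (a - b).
Proof.
rewrite -toquo_eq0 rmorphB; split=> [->|/eqP]; first by rewrite subrr.
by rewrite subr_eq0 => /eqP.
Qed.

Lemma toquo_surj c : exists a, toquo a = c.
Proof.
by have [a [s [/= -> E]]] := frac_surj c; exists a; rewrite -E rmorph1 mul1r.
Qed.

Lemma quo_lift (S : comPzRingType) (f : {rmorphism R -> S}) :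
  (forall a, J a -> f a = 0) ->
  exists g : {rmorphism quo -> S}, forall a, g (toquo a) = f a.
Proof.
move=> fJ; apply: (@fliftP _ quo_data _ f) => // s /= ->.
by exists 1; rewrite rmorph1 mulr1.
Qed.

End Quotient.
Global Opaque toquo.

(** With J J inside J2 and J2 inside J, the kernel of R/J2 -> R/J squares to zero: this is the test
    situation of infinitesimal lifting. *)
Lemma quo_proj (R : comPzRingType) (J J2 : ideal R) :
  (forall x, J2 x -> J x) -> (forall x y, J x -> J y -> J2 (x * y)) ->
  exists pr : {rmorphism quo J2 -> quo J},
    [/\ forall x, pr (toquo J2 x) = toquo J x, forall c, exists c', pr c' = c
      & forall a b, pr a = 0 -> pr b = 0 -> a * b = 0].
Proof.
move=> J2J JJ2.
have [|pr Hpr] := @quo_lift _ J2 _ (toquo J); first by move=> x /J2J; exact: toquo_kill.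
exists pr; split=> // [c|a b].
  by have [x <-] := toquo_surj c; exists (toquo J2 x).
have [x <-] := toquo_surj a; have [y <-] := toquo_surj b; rewrite !Hpr.
move=> /toquo_mem Jx /toquo_mem Jy; rewrite -rmorphM; apply: toquo_kill.
exact: JJ2.
Qed.

(** * Prime ideals and generated ideals *)

Section Primes.
Variable R : comPzRingType.

Lemma prime_exists (J : ideal R) (M : set R) :
  M 1 -> (forall a b, M a -> M b -> M (a * b)) -> (forall a, J a -> ~ M a) ->
  exists P : set R, [/\ prime_ideal P, iset J `<=` P & forall a, P a -> ~ M a].
Proof.
move=> M1 MM JM.
pose good (A : set R) := (forall a b, A a -> A b -> A (a + b)) /\
  (forall a b, A b -> A (a * b)).
pose P := [set A : set R | A = set0 \/ [/\ good A, iset J `<=` A & forall a, A a -> ~ M a]].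
have [F FP Ftot|A [AP Amax]] := @Zorn_bigcup R P.
  have [[A0 [FA0 A0n]]|F0] := pselect (exists A, F A /\ A !=set0); last first.
    left; apply/seteqP; split=> // x [A FA Ax].
    by case: F0; exists A; split=> //; exists x.
  have nz A : F A -> A !=set0 -> [/\ good A, iset J `<=` A & forall a, A a -> ~ M a].
    by move=> /FP[->|//] [].
  right; split.
  - split=> [a b [A FA Aa] [B FB Bb]|a b [A FA Ab]].
      have [/(_ _ Aa) Ba|/(_ _ Bb) Ab] := Ftot _ _ FA FB.
        have [[BD _] _ _] : [/\ good B, iset J `<=` B & forall a, B a -> ~ M a].
          by apply: nz => //; exists b.
        by exists B => //; apply: BD.
      have [[AD _] _ _] : [/\ good A, iset J `<=` A & forall a, A a -> ~ M a].
        by apply: nz => //; exists a.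
      by exists A => //; apply: AD.
    have [[_ AM] _ _] : [/\ good A, iset J `<=` A & forall a, A a -> ~ M a].
      by apply: nz => //; exists b.
    by exists A => //; apply: AM.
  - by have [_ JA _] := nz _ FA0 A0n; move=> x /JA Ax; exists A0.
  - move=> a [A FA Aa].
    have [_ _ AM'] : [/\ good A, iset J `<=` A & forall a, A a -> ~ M a].
      by apply: nz => //; exists a.
    exact: AM'.
have {AP} [[AD AM] JA AM'] : [/\ good A, iset J `<=` A & forall a, A a -> ~ M a].
  case: AP => // A0; exfalso; apply: (Amax (iset J)).
    rewrite A0; split=> // /(_ 0); apply; exact: ideal0.
  right; split=> //; split; [exact: idealD|exact: idealM].
have A0 : A 0 by apply: JA; exact: ideal0.
(* Maximality: A together with an element outside it generates an ideal that meets M. *)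
have ext c : ~ A c -> exists m a r, M m /\ A a /\ m = a + r * c.
  move=> nAc; apply: contrapT => H.
  pose B := [set x | exists a r, A a /\ x = a + r * c].
  have AB : A `<=` B by move=> x Ax; exists x, 0; rewrite mul0r addr0.
  apply: (Amax B).
    split=> // /(_ c) BA; apply/nAc/BA; exists 0, 1.
    by rewrite mul1r add0r.
  right; split.
  - split=> [x y [a [r [Aa ->]]] [b [s [Ab ->]]]|x y [b [s [Ab ->]]]].
      by exists (a + b), (r + s); split; [exact: AD|ring].
    by exists (x * b), (x * s); split; [exact: AM|ring].
  - by move=> x /JA /AB.
  - by move=> x [a [r [Aa E]]] Mx; apply: H; exists x, a, r.
exists A; split=> //; split=> //; first by move/AM'; apply.
move=> a b Aab; have [Aa|nAa] := pselect (A a); first by left.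
have [Ab|nAb] := pselect (A b); first by right.
have [m [x [r [Mm [Ax Em]]]]] := ext _ nAa.
have [m' [y [s [Mm' [Ay Em']]]]] := ext _ nAb.
exfalso; apply: (AM' (m * m')); last exact: MM.
rewrite Em Em' (_ : _ * _ = (y + s * b) * x + r * a * y + r * s * (a * b)); last ring.
by apply: (AD); [apply: (AD)|]; apply: (AM).
Qed.

Definition idp (P : set R) (HP : prime_ideal P) : ideal R :=
  let: And5 h0 hD hM _ _ := HP in Ideal h0 hD hM.

Lemma idpE P HP a : idp (P := P) HP a = P a.
Proof. by case: HP. Qed.

Definition ideal_zero : ideal R.
Proof.
exists [set 0] => // [a b -> ->|a b ->]; by rewrite /= ?addr0 ?mulr0.
Defined.

Lemma primeX (P : set R) a n : prime_ideal P -> P (a ^+ n) -> P a.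
Proof.
move=> [_ _ _ P1 Pm]; elim: n => [|n IH]; first by rewrite expr0.
by rewrite exprS => /Pm[].
Qed.

Lemma nilp_prime (J : ideal R) a :
  (forall P, prime_ideal P -> iset J `<=` P -> P a) -> exists n, J (a ^+ n).
Proof.
move=> H; apply: contrapT => Hn.
have [|b c [m ->] [n ->]|x Jx [n E]|P [pP JP PM]] :=
  @prime_exists J [set x | exists n, x = a ^+ n].
- by exists 0%N; rewrite expr0.
- by exists (m + n)%N; rewrite exprD.
- by apply: Hn; exists n; rewrite -E.
- by apply: (PM a); [exact: H|exists 1%N; rewrite expr1].
Qed.

End Primes.

Lemma prime_preim (R S : comPzRingType) (f : {rmorphism R -> S}) (P : set S) :
  prime_ideal P -> prime_ideal (f @^-1` P).
Proof.
move=> [P0 PD PM P1 Pm]; split=> [|a b|a b||a b] /=.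
- by rewrite rmorph0.
- by rewrite rmorphD; exact: PD.
- by rewrite rmorphM; exact: PM.
- by rewrite rmorph1.
- by rewrite rmorphM; exact: Pm.
Qed.

Section Span.
Variables (R : comPzRingType) (G : set R).

Definition span_set : set R := [set x | exists l : seq (R * R),
  (forall p, p \in l -> G p.2) /\ x = \sum_(p <- l) p.1 * p.2].

Definition span : ideal R.
Proof.
exists span_set.
- by exists [::]; rewrite big_nil.
- move=> a b [l [lG ->]] [m [mG ->]]; exists (l ++ m); rewrite big_cat; split=> //.
  by move=> p; rewrite mem_cat => /orP[/lG|/mG].
- move=> a b [l [lG ->]]; exists [seq (a * p.1, p.2) | p <- l]; split.
    by move=> p /mapP[q /lG Gq ->].
  by rewrite big_map mulr_sumr; apply: eq_bigr => p _; rewrite mulrA.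
Defined.

Lemma spanP x : span x <-> exists l : seq (R * R),
  (forall p, p \in l -> G p.2) /\ x = \sum_(p <- l) p.1 * p.2.
Proof. by []. Qed.

Lemma span_mem x : G x -> span x.
Proof.
move=> Gx; exists [:: (1, x)]; rewrite big_seq1 mul1r; split=> // p.
by rewrite inE => /eqP->.
Qed.

Lemma span_min (J : ideal R) : G `<=` iset J -> iset span `<=` iset J.
Proof.
move=> GJ x [l [lG ->]]; rewrite big_seq; apply: ideal_sum => p /lG/GJ.
exact: idealM.
Qed.

End Span.

Global Opaque span.

Definition span_seq (R : comPzRingType) (l : seq R) : ideal R :=
  span [set x | x \in l].

Lemma span_seqP (R : comPzRingType) (l : seq R) x :
  span_seq l x <-> exists c : nat -> R, x = \sum_(i < size l) c i * l`_i.
Proof.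
split=> [/spanP[m [ml ->]]|[c ->]]; last first.
  by apply: ideal_sum => i _; apply/idealM/span_mem; exact: mem_nth.
elim: m ml => [|p m IH] ml.
  by exists (fun=> 0); rewrite big_nil big1 // => i _; rewrite mul0r.
have [|c Ec] := IH; first by move=> q qm; apply: ml; rewrite inE qm orbT.
have pl : p.2 \in l by apply: ml; rewrite inE eqxx.
exists (fun i => c i + (if i == index p.2 l then p.1 else 0)).
rewrite big_cons Ec addrC.
transitivity (\sum_(i < size l) c i * l`_i +
    \sum_(i < size l) (if i == index p.2 l :> nat then p.1 else 0) * l`_i).
  congr (_ + _); have il : (index p.2 l < size l)%N by rewrite index_mem.
  rewrite (bigD1 (Ordinal il)) //= eqxx nth_index // big1 ?addr0 // => i.
  by rewrite -val_eqE /= => /negbTE->; rewrite mul0r.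
by rewrite -big_split; apply: eq_bigr => i _; rewrite mulrDl.
Qed.

(** * The prime spectrum and its structure sheaf *)

Definition primes (D : comPzRingType) : Type := {P : set D | prime_ideal P}.

HB.instance Definition _ D := gen_eqMixin (primes D).
HB.instance Definition _ D := gen_choiceMixin (primes D).

Section Zariski.
Variable D : comPzRingType.
Implicit Types P Q : primes D.

Definition zopen (U : set (primes D)) : Prop :=
  forall P, U P -> exists f, ~ sval P f /\ forall Q, ~ sval Q f -> U Q.

Lemma prime1 P : ~ sval P 1. Proof. by case: (svalP P). Qed.

Lemma primeM P a b : ~ sval P a -> ~ sval P b -> ~ sval P (a * b).
Proof. by move=> na nb; case: (svalP P) => _ _ _ _ /[apply] -[]. Qed.

Lemma primeMl P a b : ~ sval P (a * b) -> ~ sval P a.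
Proof. by move=> nab Pa; apply: nab; rewrite mulrC; case: (svalP P) => _ _ + _ _; apply. Qed.

Lemma primeMr P a b : ~ sval P (a * b) -> ~ sval P b.
Proof. by rewrite mulrC; exact: primeMl. Qed.

Lemma zopenT : zopen setT.
Proof. by move=> P _; exists 1; split=> //; exact: prime1. Qed.

Lemma zopenI : setI_closed zopen.
Proof.
move=> U V oU oV P [/oU[f [Pf fU]] /oV[g [Pg gV]]]; exists (f * g).
by split=> [|Q Qfg]; [exact: primeM|split; [apply/fU/(primeMl Qfg)|apply/gV/(primeMr Qfg)]].
Qed.

Lemma zopen_bigU (I : Type) (F : I -> set (primes D)) :
  (forall i, zopen (F i)) -> zopen (\bigcup_i F i).
Proof.
move=> oF P [i _ /(oF i)[f [Pf fF]]]; exists f; split=> // Q /fF FQ.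
by exists i.
Qed.

HB.instance Definition _ :=
  isOpenTopological.Build (primes D) zopenT zopenI zopen_bigU.

Lemma zopenE (U : set (primes D)) : open U = zopen U. Proof. by []. Qed.

Definition zbasic (f : D) : opens (primes D).
Proof. by exists [set P | ~ sval P f]; rewrite zopenE => P Pf; exists f. Defined.

Definition prime_data P : locdata D.
Proof.
refine (@LocData D (fun a => ~ sval P a) (ideal_zero D) _ _).
  exact: prime1.
exact: primeM.
Defined.

Definition ploc P : comPzRingType := frac (prime_data P).
Definition toploc P : {rmorphism D -> ploc P} := fcst (prime_data P).

Lemma toploc_eq0 P a : toploc P a = 0 <-> exists u, ~ sval P u /\ u * a = 0.
Proof. exact: fcst_eq0. Qed.

Lemma toploc_cancel P f (x y : ploc P) : ~ sval P f ->
  toploc P f * x = toploc P f * y -> x = y.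
Proof.
move=> Pf E; have [v fv] := @fcst_unit _ (prime_data P) f Pf.
by rewrite -[x]mul1r -[y]mul1r -fv !(mulrAC _ v) E.
Qed.

Lemma toploc_unit P a : (exists v, toploc P a * v = 1) -> ~ sval P a.
Proof.
move=> [v av] Pa; have [b [t [Pt E]]] := @frac_surj _ (prime_data P) v.
have : toploc P (a * b - t) = 0.
  by rewrite rmorphB rmorphM /= -E mulrCA av mulr1 subrr.
move=> /toploc_eq0[u [Pu]]; rewrite mulrBr => /eqP; rewrite subr_eq0 => /eqP Eu.
apply: (primeM Pu Pt); rewrite -Eu mulrCA mulrC.
by case: (svalP P) => _ _ + _ _; apply.
Qed.

Section Sections.
Variable U : opens (primes D).

Definition pin : Type := {P | oset U P}.

(** Sections are families of germs that are locally fractions a/f; the condition is written f s = a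
    to avoid inverses. *)
Definition regular (s : forall P : pin, ploc (sval P)) : Prop :=
  forall P : pin, exists f a, ~ sval (sval P) f /\
    forall Q : pin, ~ sval (sval Q) f -> toploc _ f * s Q = toploc _ a.

Definition ssect : Type := {s | regular s}.

HB.instance Definition _ := gen_eqMixin ssect.
HB.instance Definition _ := gen_choiceMixin ssect.

Lemma ssect_eq (s t : ssect) : (forall P : pin, sval s P = sval t P) -> s = t.
Proof.
by case: s t => [s ?] [t ?] /= E; apply: eq_exist; apply: functional_extensionality_dep.
Qed.

Lemma reg_cst a : regular (fun P : pin => toploc (sval P) a).
Proof. by move=> P; exists 1, a; split=> [|Q _]; [exact: prime1|rewrite rmorph1 mul1r]. Qed.

Lemma reg_add (s t : ssect) : regular (fun P : pin => sval s P + sval t P).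
Proof.
move=> P; have [f [a [Pf fs]]] := svalP s P; have [g [b [Pg gt]]] := svalP t P.
exists (f * g), (g * a + f * b); split=> [|Q Qfg]; first exact: primeM.
rewrite rmorphD !rmorphM /= -(fs _ (primeMl Qfg)) -(gt _ (primeMr Qfg)); ring.
Qed.

Lemma reg_opp (s : ssect) : regular (fun P : pin => - sval s P).
Proof.
move=> P; have [f [a [Pf fs]]] := svalP s P; exists f, (- a); split=> // Q Qf.
by rewrite mulrN fs // rmorphN.
Qed.

Lemma reg_mul (s t : ssect) : regular (fun P : pin => sval s P * sval t P).
Proof.
move=> P; have [f [a [Pf fs]]] := svalP s P; have [g [b [Pg gt]]] := svalP t P.
exists (f * g), (a * b); split=> [|Q Qfg]; first exact: primeM.
rewrite !rmorphM /= -(fs _ (primeMl Qfg)) -(gt _ (primeMr Qfg)); ring.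
Qed.

Definition scst a : ssect := exist _ _ (reg_cst a).
Definition sadd s t : ssect := exist _ _ (reg_add s t).
Definition sopp s : ssect := exist _ _ (reg_opp s).
Definition smul s t : ssect := exist _ _ (reg_mul s t).

Lemma saddA : associative sadd. Proof. by move=> *; apply: ssect_eq => P /=; rewrite addrA. Qed.
Lemma saddC : commutative sadd. Proof. by move=> *; apply: ssect_eq => P /=; rewrite addrC. Qed.
Lemma sadd0 : left_id (scst 0) sadd.
Proof. by move=> *; apply: ssect_eq => P /=; rewrite rmorph0 add0r. Qed.
Lemma saddN : left_inverse (scst 0) sopp sadd.
Proof. by move=> *; apply: ssect_eq => P /=; rewrite addNr rmorph0. Qed.
Lemma smulA : associative smul. Proof. by move=> *; apply: ssect_eq => P /=; rewrite mulrA. Qed.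
Lemma smulC : commutative smul. Proof. by move=> *; apply: ssect_eq => P /=; rewrite mulrC. Qed.
Lemma smul1 : left_id (scst 1) smul.
Proof. by move=> *; apply: ssect_eq => P /=; rewrite rmorph1 mul1r. Qed.
Lemma smulDl : left_distributive smul sadd.
Proof. by move=> *; apply: ssect_eq => P /=; rewrite mulrDl. Qed.

HB.instance Definition _ := GRing.isZmodule.Build ssect saddA saddC sadd0 saddN.
HB.instance Definition _ :=
  GRing.Zmodule_isComPzRing.Build ssect smulA smulC smul1 smulDl.

Fact scst_is_zmod_morphism : zmod_morphism scst.
Proof. by move=> a b; apply: ssect_eq => P /=; rewrite rmorphB. Qed.
Fact scst_is_monoid_morphism : monoid_morphism scst.
Proof. by split=> [|a b]; apply: ssect_eq => P //=; rewrite rmorphM. Qed.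
HB.instance Definition _ :=
  GRing.isZmodMorphism.Build D ssect scst scst_is_zmod_morphism.
HB.instance Definition _ :=
  GRing.isMonoidMorphism.Build D ssect scst scst_is_monoid_morphism.

End Sections.

Section Restriction.
Variables (U V : opens (primes D)) (VU : V `<=` U).

Definition pincl (P : pin V) : pin U := exist _ (sval P) (VU (svalP P)).

Lemma reg_restr (s : ssect U) : regular (fun P : pin V => sval s (pincl P)).
Proof.
move=> P; have [f [a [Pf fs]]] := svalP s (pincl P).
by exists f, a; split=> // Q Qf; exact: (fs (pincl Q)).
Qed.

Definition srestr (s : ssect U) : ssect V := exist _ _ (reg_restr s).

Fact srestr_is_zmod_morphism : zmod_morphism srestr.
Proof. by move=> a b; apply: ssect_eq. Qed.
Fact srestr_is_monoid_morphism : monoid_morphism srestr.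
Proof. by split=> [|a b]; apply: ssect_eq. Qed.
HB.instance Definition _ := GRing.isZmodMorphism.Build (ssect U) (ssect V) srestr
  srestr_is_zmod_morphism.
HB.instance Definition _ := GRing.isMonoidMorphism.Build (ssect U) (ssect V) srestr
  srestr_is_monoid_morphism.

End Restriction.

Lemma sres_id (U : opens (primes D)) (UU : U `<=` U) (s : ssect U) : srestr UU s = s.
Proof. by apply: ssect_eq => -[P UP] /=; congr (sval s (exist _ _ _)). Qed.

Lemma sres_res (U V W : opens (primes D)) (VU : V `<=` U) (WV : W `<=` V)
  (WU : W `<=` U) (s : ssect U) : srestr WV (srestr VU s) = srestr WU s.
Proof. by apply: ssect_eq => -[P WP] /=; congr (sval s (exist _ _ _)). Qed.

Definition interO (X : topologicalType) (U V : opens X) : opens X :=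
  Opens (openI (@oset_open _ U) (@oset_open _ V)).

Lemma ssect_glue (U : opens (primes D)) (I : Type) (V : I -> opens (primes D))
    (VU : forall i, V i `<=` U) : U `<=` \bigcup_i V i ->
    forall s : forall i, ssect (V i),
    (forall i j (W : opens (primes D)) (Wi : W `<=` V i) (Wj : W `<=` V j),
        srestr Wi (s i) = srestr Wj (s j)) ->
    exists! t : ssect U, forall i, srestr (VU i) t = s i.
Proof.
move=> cov s E.
have Ept i j P (Pi : oset (V i) P) (Pj : oset (V j) P) :
    sval (s i) (exist _ P Pi) = sval (s j) (exist _ P Pj).
  have Wi : interO (V i) (V j) `<=` V i by move=> Q [].
  have Wj : interO (V i) (V j) `<=` V j by move=> Q [].
  have Wij := E i j _ Wi Wj.
  have := congr1 (fun t : ssect (interO (V i) (V j)) => sval t (exist _ P (conj Pi Pj))) Wij.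
  by rewrite /= /pincl /= (Prop_irrelevance (Wi _ _) Pi) (Prop_irrelevance (Wj _ _) Pj).
have /choice[i0 Hi0] : forall P : pin U, exists i, oset (V i) (sval P).
  by move=> [P UP]; have [i _ ViP] := cov _ UP; exists i.
pose t (P : pin U) : ploc (sval P) := sval (s (i0 P)) (exist _ (sval P) (Hi0 P)).
have tr : regular t.
  move=> P; have [f [a [Pf fs]]] := svalP (s (i0 P)) (exist _ (sval P) (Hi0 P)).
  have /= := @oset_open _ (V (i0 P)); rewrite zopenE => /(_ _ (Hi0 P))[g [Pg gV]].
  exists (g * f), (g * a); split=> [|Q Qgf]; first exact: primeM.
  rewrite !rmorphM /= -mulrA; congr (_ * _).
  have VQ := gV _ (primeMl Qgf).
  by rewrite /t (Ept _ (i0 P) _ _ VQ); apply: (fs (exist _ (sval Q) VQ)) => /=; exact: primeMr Qgf.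
exists (exist _ t tr); split=> [i|t' Ht'].
  by apply: ssect_eq => -[P ViP] /=; rewrite /t /=; apply: Ept.
apply: ssect_eq => -[P UP]; rewrite /= /t -Ht' /=.
by congr (sval t' (exist _ _ _)); exact: Prop_irrelevance.
Qed.

End Zariski.

Section SpecScheme.
Variables (k : fieldType) (D : comPzRingType) (kap : {rmorphism k -> D}).

Definition spec_ringed : kringed k.
Proof.
refine (@KRinged k (primes D) (@ssect D)
  (fun U => (scst U : {rmorphism _ -> _}) \o kap)
  (fun U V VU => (srestr VU : {rmorphism _ -> _})) _ _ _ _).
- exact: sres_id.
- exact: sres_res.
- by move=> U V VU c; apply: ssect_eq.
- exact: ssect_glue.
Defined.

(** Near P the section is the fraction a/f, whose inverse f/a is regular on D(fa). *)
Lemma spec_unit (U : opens (primes D)) (s : ssect U) (P : primes D) (UP : oset U P) f a :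
  ~ sval P f ->
  (forall Q : pin U, ~ sval (sval Q) f -> toploc _ f * sval s Q = toploc _ a) ->
  @unit_at k spec_ringed U s P <-> ~ sval P a.
Proof.
move=> Pf fs; split=> [[V [VU [VP [g sg]]]]|Pa].
  apply: toploc_unit; have [v fv] := @fcst_unit _ (prime_data P) f Pf.
  exists (sval g (exist _ P VP) * v).
  have := congr1 (fun t : ssect V => sval t (exist _ P VP)) sg => /= E.
  rewrite -(fs (exist _ P UP)) //= -[X in _ = X](mulr1 1) -{1}fv.
  have -> : sval s (exist _ P UP) = sval s (pincl VU (exist _ P VP)).
    by congr (sval s (exist _ _ _)); exact: Prop_irrelevance.
  rewrite -[in RHS](rmorph1 (toploc P)) -[X in _ = _ * X]E /=; ring.
pose V := interO U (zbasic (f * a)).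
have VU : V `<=` U by move=> Q [].
have inv (Q : pin V) : exists v, toploc (sval Q) a * v = 1.
  by apply: fcst_unit; case: Q => Q [] /= _ /primeMr.
pose g (Q : pin V) : ploc (sval Q) := toploc (sval Q) f * sval (cid (inv Q)).
have ag Q : toploc (sval Q) a * g Q = toploc (sval Q) f.
  by rewrite /g mulrCA; case: (cid _) => v /= ->; rewrite mulr1.
have gr : regular g.
  by move=> Q; exists a, f; split=> [|R _]; [case: Q => Q [] /= _ /primeMr|exact: ag].
exists V, VU; split; first by split=> //; apply: primeM.
exists (exist _ g gr); apply: ssect_eq => Q /=.
have Qf : ~ sval (sval Q) f by case: Q => Q [] /= _ /primeMl.
apply: (toploc_cancel Qf); rewrite mulrA (fs (pincl VU Q)) //= ag rmorph1 mulr1 //.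
Qed.

Lemma spec_local : locally_ringed spec_ringed.
Proof.
move=> U P UP; split=> [|s t].
  rewrite (@spec_unit U 0 P UP 1 0) ?rmorph0; first last.
  - by move=> Q _; rewrite /= rmorph0 mulr0.
  - exact: prime1.
  by case: (svalP P) => P0 _ _ _ _; apply.
have [f [a [Pf fs]]] := svalP s (exist _ P UP).
have [g [b [Pg gt]]] := svalP t (exist _ P UP).
rewrite (spec_unit UP Pf fs) (spec_unit UP Pg gt).
rewrite (@spec_unit U (s + t) P UP (f * g) (g * a + f * b)); first last.
- move=> Q Qfg; rewrite rmorphD !rmorphM /= -(fs _ (primeMl Qfg)) -(gt _ (primeMr Qfg)); ring.
- exact: primeM.
move=> Pab; apply: contrapT => H; apply: Pab.
case: (svalP P) => _ PD PM _ _.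
by apply: PD; apply: PM; apply: contrapT => n; apply: H; [left|right].
Qed.

End SpecScheme.

(* Quasi-compactness of D(f). *)
Lemma basic_section (D : comPzRingType) (U : opens (primes D)) (f : D) (s : ssect U) :
  (forall P, oset U P <-> ~ sval P f) ->
  exists n a, forall P : pin U, toploc (sval P) (f ^+ n) * sval s P = toploc _ a.
Proof.
move=> Uf.
(* The admissible denominators: s is a single fraction on D(g). No prime of D(f) contains all of
   them, so a power of f is a combination of finitely many. *)
pose G := [set g | exists a, (forall P, ~ sval P g -> oset U P) /\
  forall Q : pin U, ~ sval (sval Q) g -> toploc _ g * sval s Q = toploc _ a].
have [n /spanP[l [lG El]]] : exists n, span G (f ^+ n).
  apply: nilp_prime => P pP GP; apply: contrapT => nPf.
  have UP : oset U (exist _ P pP) by apply/Uf.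
  have [g [a [Pg gs]]] := svalP s (exist _ _ UP).
  apply: (primeM (P := exist _ P pP) nPf Pg); apply/GP/span_mem; exists (f * a); split=> [Q|Q Qf].
    by move=> /primeMl /Uf.
  by rewrite !rmorphM /= -mulrA gs //; exact: primeMr Qf.
have /choice[a Ha] : forall p : D * D, exists a, p \in l -> (forall P, ~ sval P p.2 -> oset U P) /\
  forall Q : pin U, ~ sval (sval Q) p.2 -> toploc _ p.2 * sval s Q = toploc _ a.
  by move=> p; have [/lG[a Ha]|] := boolP (p \in l); [exists a|exists 0].
(* Two local fractions have the same germs on the intersection of their domains, hence agree up to a
   power of the product of the denominators; N serves for all pairs of the list. *)
have [N HN] : exists N, forall p q, p \in l -> q \in l ->
    (p.2 * q.2) ^+ N * (a p * q.2 - a q * p.2) = 0.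
  have cpt p q : exists N, p \in l -> q \in l ->
      (p.2 * q.2) ^+ N * (a p * q.2 - a q * p.2) = 0.
    have [pl|] := boolP (p \in l); last by exists 0%N.
    have [ql|] := boolP (q \in l); last by exists 0%N.
    pose A := [set c | c * (a p * q.2 - a q * p.2) = 0].
    have IA : exists J : ideal D, iset J = A.
      unshelve eexists; first (exists A).
      - by rewrite /A /= mul0r.
      - by move=> x y; rewrite /A /= mulrDl => -> ->; rewrite addr0.
      - by move=> x y; rewrite /A /= -mulrA => ->; rewrite mulr0.
      by [].
    case: IA => J JA.
    have [|N] := @nilp_prime D J (p.2 * q.2); last by rewrite JA; exists N.
    rewrite JA => P pP AP; apply: contrapT => nP.
    have nP' : ~ sval (exist _ P pP : primes D) (p.2 * q.2) by [].
    have [pU ps] := Ha _ pl; have [qU qs] := Ha _ ql.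
    have UP := pU _ (primeMl nP').
    have := ps (exist _ _ UP) (primeMl nP'); have := qs (exist _ _ UP) (primeMr nP').
    move=> /= Eq Ep.
    have : toploc (exist _ P pP) (a p * q.2 - a q * p.2) = 0.
      rewrite rmorphB !rmorphM /= -Ep -Eq; ring.
    by move=> /toploc_eq0[u [nu u0]]; apply: nu; apply: AP.
  have /choice[Nf HNf] : forall pq : (D * D) * (D * D), exists N, pq.1 \in l -> pq.2 \in l ->
      (pq.1.2 * pq.2.2) ^+ N * (a pq.1 * pq.2.2 - a pq.2 * pq.1.2) = 0.
    by move=> [p q]; exact: cpt.
  exists (\max_(pq <- [seq (p, q) | p <- l, q <- l]) Nf pq) => p q pl ql.
  have pql : (p, q) \in [seq (p, q) | p <- l, q <- l] by apply/allpairsP; exists (p, q).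
  have : (Nf (p, q) <= \max_(pq <- [seq (p, q) | p <- l, q <- l]) Nf pq)%N.
    by apply: (leq_bigmax_seq (F := Nf)).
  move=> /subnK <-; rewrite exprD -mulrA.
  by rewrite (HNf (p, q)) // mulr0.
(* The powers g^(N+1) still generate a power of f, and after multiplication by g^N the numerators
   match exactly, so the coefficients of this combination glue the fractions. *)
have [n' ] : exists n', span_seq [seq p.2 ^+ N.+1 | p <- l] (f ^+ n').
  apply: nilp_prime => P pP GP; apply: (@primeX _ P _ n) => //; rewrite El.
  rewrite -(idpE pP) big_seq; apply: ideal_sum => p pl; apply: idealM; rewrite idpE.
  apply: (@primeX _ P _ N.+1) => //; apply/GP/span_mem.
  by apply/mapP; exists p.
move=> /span_seqP[c Ec]; exists n'.
exists (\sum_(i < size l) c i * ((nth 0 l i).2 ^+ N * a (nth 0 l i))) => P.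
have [q ql nq] : exists2 q, q \in l & ~ sval (sval P) q.2.
  apply: contrapT => H; have /Uf := svalP P; apply; apply: (@primeX _ _ _ n); first exact: svalP.
  rewrite El -(idpE (svalP (sval P))) big_seq; apply: ideal_sum => p pl; apply: idealM.
  by rewrite idpE; apply: contrapT => np; apply: H; exists p.
have nqN : ~ sval (sval P) (q.2 ^+ N.+1) by move/primeX => H; apply/nq/H/svalP.
have [_ /(_ P nq) qs] := Ha _ ql.
have key : toploc (sval P) (q.2 ^+ N.+1) * sval s P = toploc _ (q.2 ^+ N * a q).
  by rewrite exprSr !rmorphM -mulrA qs.
apply: (toploc_cancel nqN); rewrite mulrCA key -!rmorphM; congr (toploc _ _).
rewrite Ec size_map mulr_suml mulr_sumr; apply: eq_bigr => i _.
have il : nth 0 l i \in l by exact: mem_nth.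
rewrite (nth_map 0) //; set p := nth 0 l i in il *.
have := HN p q il ql; rewrite mulrBr => /eqP; rewrite subr_eq0 => /eqP E.
transitivity (c i * ((p.2 * q.2) ^+ N * (a q * p.2))).
  by rewrite exprMn exprSr; ring.
by rewrite -E exprMn exprSr; ring.
Qed.

(** * Units, basic opens and affine opens of a scheme *)

Section SchemeLemmas.
Variables (k : fieldType) (X : kscheme k).
Implicit Types (U V W : opens X).

Lemma unit_in U (f : sect U) x : unit_at f x -> oset U x.
Proof. by move=> [V [VU [Vx _]]]; exact: VU. Qed.

Lemma unit_res U V (VU : V `<=` U) (f : sect U) x : oset V x ->
  unit_at (rstr VU f) x <-> unit_at f x.
Proof.
move=> Vx; split=> [[O [OV [Ox [g fg]]]]|[O [OU [Ox [g fg]]]]].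
  have OU : O `<=` U by move=> y /OV/VU.
  by exists O, OU; split=> //; exists g; rewrite -fg res_res.
have OO : interO V O `<=` O by move=> y [].
have OV : interO V O `<=` V by move=> y [].
exists (interO V O), OV; split=> //; exists (rstr OO g).
by rewrite (res_res VU OV (fun y h => OU _ (OO _ h))) -(res_res OU OO) -rmorphM fg rmorph1.
Qed.

Lemma unit_open U (f : sect U) : open (unit_at f).
Proof.
suff -> : unit_at f = \bigcup_(V in [set V : opens X |
    exists VU : V `<=` U, exists g, rstr VU f * g = 1]) V.
  by apply: bigcup_open => V _; exact: oset_open.
apply/seteqP; split=> [x [V [VU [Vx H]]]|x [V [VU H] Vx]]; first by exists V => //; exists VU.
by exists V, VU.
Qed.

Definition dop U (f : sect U) : opens X := Opens (unit_open f).

Lemma dop_sub U (f : sect U) : dop f `<=` U.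
Proof. by move=> x; exact: unit_in. Qed.

Lemma unit_at1 U x : oset U x -> unit_at (1 : sect U) x.
Proof.
move=> Ux; exists U, (fun _ h => h); split=> //; exists 1.
by rewrite mulr1 rmorph1.
Qed.

Lemma unit_atM U (f g : sect U) x : unit_at (f * g) x <-> unit_at f x /\ unit_at g x.
Proof.
split=> [[V [VU [Vx [h fgh]]]]|[[V [VU [Vx [h fh]]]] [V' [VU' [Vx' [h' fh']]]]]].
  split; exists V, VU; split=> //.
    by exists (rstr VU g * h); rewrite mulrA -rmorphM.
  by exists (rstr VU f * h); rewrite mulrA -rmorphM (mulrC g).
have OV : interO V V' `<=` V by move=> y [].
have OV' : interO V V' `<=` V' by move=> y [].
have OU : interO V V' `<=` U by move=> y [/VU].
exists (interO V V'), OU; split=> //; exists (rstr OV h * rstr OV' h').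
rewrite rmorphM -mulrACA -(res_res VU OV) -(res_res VU' OV' OU g) -!rmorphM.
by rewrite fh fh' !rmorph1 mulr1.
Qed.

Lemma unit_atX U (f : sect U) n x : unit_at f x -> unit_at (f ^+ n) x.
Proof.
move=> fx; elim: n => [|n IH]; first by rewrite expr0; exact/unit_at1/(unit_in fx).
by rewrite exprS; apply/unit_atM.
Qed.

Lemma nonunit0 U x : ~ unit_at (0 : sect U) x.
Proof. by move=> H; have [] := kscheme_local (unit_in H). Qed.

Lemma nonunit_prime U x : oset U x -> prime_ideal [set f : sect U | ~ unit_at f x].
Proof.
move=> Ux; split=> [|f g nf ng fg|f g ng /unit_atM[]//|H|f g nfg].
- exact: nonunit0.
- by have [_ /(_ _ _ fg)[]] := kscheme_local Ux.
- exact/H/unit_at1.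
- by apply: contrapT => H; apply: nfg; apply/unit_atM; split; apply: contrapT => h; apply: H; [left|right].
Qed.

(** Both sections glue the same family, namely the common restrictions to all the opens on which
    they agree. *)
Lemma sect_eq U (s t : sect U) : (forall x, oset U x -> exists V (VU : V `<=` U),
  oset V x /\ rstr VU s = rstr VU t) -> s = t.
Proof.
move=> H.
pose I := {V : opens X | exists VU : V `<=` U, rstr VU s = rstr VU t}.
have VU (i : I) : sval i `<=` U by case: (svalP i).
have E (i : I) : rstr (VU i) s = rstr (VU i) t.
  by case: (svalP i) => VU' E; rewrite (Prop_irrelevance (VU i) VU').
have cov : U `<=` \bigcup_(i : I) sval i.
  move=> x /H[V [VU' [Vx EV]]].
  by exists (exist _ V (ex_intro _ VU' EV) : I).
have [|r [_ ru]] := @sect_glue _ _ U I (fun i => sval i) VU cov (fun i => rstr (VU i) s).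
  move=> i j W Wi Wj.
  by rewrite (res_res (VU i) Wi (fun y h => VU i _ (Wi _ h))) (res_res (VU j) Wj (fun y h => VU i _ (Wi _ h))).
by rewrite -(ru s) // -(ru t).
Qed.

Lemma sect_eq0 U (s : sect U) : (forall x, oset U x -> exists V (VU : V `<=` U),
  oset V x /\ rstr VU s = 0) -> s = 0.
Proof.
move=> H; apply: sect_eq => x /H[V [VU [Vx E]]]; exists V, VU; split=> //.
by rewrite E rmorph0.
Qed.

Section Affine.
Variables (U : opens X) (aU : affine_open U).

Lemma aff_frac (f : sect U) (D : opens X) (DU : D `<=` U) : D = unit_at f :> set X ->
  [/\ exists g, rstr DU f * g = 1,
      forall s : sect D, exists n a, rstr DU f ^+ n * s = rstr DU a
    & forall a : sect U, rstr DU a = 0 -> exists n, f ^+ n * a = 0].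
Proof. by case: aU => _ _ /(_ f D DU) H; exact: H. Qed.

Lemma aff_inv (f : sect U) : (forall x, oset U x -> unit_at f x) -> exists g, f * g = 1.
Proof.
move=> H; have [|[g fg] _ _] := @aff_frac f U (fun _ h => h); last first.
  by exists g; rewrite -fg res_id.
by apply/seteqP; split=> [x /H|x /unit_in].
Qed.

Lemma aff_basic x V : oset U x -> oset V x ->
  exists f : sect U, unit_at f x /\ unit_at f `<=` V.
Proof. by case: aU => _ + _; apply. Qed.

Lemma aff_point (J : set (sect U)) : prime_ideal J ->
  exists! x : X, oset U x /\ forall f, J f <-> ~ unit_at f x.
Proof. by case: aU => + _ _; apply. Qed.

Lemma aff_eq x y : oset U x -> oset U y ->
  (forall f : sect U, unit_at f x <-> unit_at f y) -> x = y.
Proof.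
move=> Ux Uy E; have [z [_ zu]] := aff_point (nonunit_prime Ux).
by rewrite -(zu x) // -(zu y) //; split=> // f /=; rewrite E.
Qed.

(** A section s over D(f) satisfies f^n s = a with a defined on U, so D(s) is the basic open D(fa)
    of U; the axioms for U then transfer by clearing powers of f. *)
Lemma basic_affine (f : sect U) : affine_open (dop f).
Proof.
have DU : dop f `<=` U := @dop_sub U f.
have [[g fg] Df Dn] := @aff_frac f _ DU erefl.
have Dunit x : oset (dop f) x -> forall s n (a : sect U), rstr DU f ^+ n * s = rstr DU a ->
    (unit_at s x <-> unit_at a x).
  move=> Dx s n a E; rewrite -(unit_res DU) // -E; split=> [sx|/unit_atM[]//].
  by apply/unit_atM; split=> //; apply: unit_atX; apply/unit_res.
have fgX n : rstr DU f ^+ n * g ^+ n = 1 by rewrite -exprMn fg expr1n.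
split.
- move=> J pJ; have pJ' := prime_preim (rstr DU) pJ.
  have [x [[Ux Jx] xu]] := aff_point pJ'.
  have nJf n : ~ J (rstr DU f ^+ n).
    case: pJ => _ _ JM J1 _ Jf; apply: J1; rewrite -(fgX n) mulrC; exact: JM.
  have Dx : oset (dop f) x.
    by apply: contrapT => /Jx H; apply: (nJf 1%N); rewrite expr1.
  have Jeq (s : sect (dop f)) : forall n a, rstr DU f ^+ n * s = rstr DU a ->
      (J s <-> J (rstr DU a)).
    move=> n a <-; case: pJ => _ _ JM _ Jm; split=> [Js|/Jm[/nJf|]//]; exact: JM.
  exists x; split=> [|y [Dy Jy]].
    split=> // s; have [n [a E]] := Df s.
    by rewrite (Jeq _ _ _ E) (Dunit _ Dx _ _ _ E); exact: (Jx a).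
  apply: xu; split; first exact: (DU).
  by move=> a /=; rewrite Jy unit_res.
- move=> x V Dx Vx; have [h [hx hV]] := aff_basic (unit_in Dx) Vx.
  exists (rstr DU h); split=> [|y hy]; first exact/unit_res.
  by apply: hV; apply/(unit_res DU) => //; exact: unit_in hy.
move=> s E ED Es; have EU : E `<=` U := fun y h => DU _ (ED _ h).
have [n [a sa]] := Df s.
have Efa : E = unit_at (f * a) :> set X.
  rewrite Es; apply/seteqP; split=> y.
    move=> sy; have Dy := unit_in sy; apply/unit_atM; split=> //.
    exact/(Dunit _ Dy _ _ _ sa).
  by move/unit_atM => [Dy ay]; apply/(Dunit _ Dy _ _ _ sa).
have [[v fav] fas fa0] := @aff_frac _ _ EU Efa.
have rfa : rstr EU (f * a) = rstr ED (rstr DU f ^+ n.+1) * rstr ED s.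
  by rewrite -rmorphM exprS -mulrA sa -rmorphM (res_res DU ED EU).
have gE m : rstr ED (rstr DU f ^+ m) * rstr ED (g ^+ m) = 1.
  by rewrite -rmorphM fgX rmorph1.
split.
- by exists (rstr ED (rstr DU f ^+ n.+1) * v); rewrite mulrA (mulrC (rstr ED s)) -rfa.
- move=> t; have [m [b tb]] := fas t; exists m, (g ^+ (n.+1 * m) * rstr DU b).
  rewrite rmorphM (res_res DU ED EU) -tb rfa exprMn -(rmorphXn _ m (rstr DU f ^+ _)) /=.
  by rewrite -exprM -mulrA mulrA (mulrC (rstr ED (g ^+ _))) gE mul1r.
move=> c c0; have [l [c' cc']] := Df c.
have : rstr EU c' = 0 by rewrite -(res_res DU ED EU) -cc' rmorphM c0 mulr0.
move=> /fa0[m /(congr1 (rstr DU))]; rewrite rmorph0 rmorphM rmorphXn /= rmorphM => E0.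
exists m; rewrite -[LHS]mul1r -(fgX (l + n.+1 * m)%N).
have -> : rstr DU f ^+ (l + n.+1 * m) * g ^+ (l + n.+1 * m) * (s ^+ m * c) =
  g ^+ (l + n.+1 * m) * ((rstr DU f ^+ n.+1 * s) ^+ m * (rstr DU f ^+ l * c)).
  have -> : rstr DU f ^+ (l + n.+1 * m) = rstr DU f ^+ l * (rstr DU f ^+ n.+1) ^+ m.
    by rewrite exprD exprM.
  rewrite [(_ * s) ^+ m]exprMn; move: (_ ^+ m) (s ^+ m) (g ^+ _) (_ ^+ l) => x1 x2 x3 x4; ring.
by rewrite exprS -mulrA sa cc' E0 mulr0.
Qed.

End Affine.

Lemma aff_nbhd x V : oset V x -> exists U, [/\ oset U x, affine_open U & U `<=` V].
Proof.
move=> Vx; have [U [Ux aU]] := kscheme_affine x.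
have [f [fx fV]] := aff_basic aU Ux Vx.
by exists (dop f); split=> //; exact: basic_affine.
Qed.

End SchemeLemmas.

Lemma rmorph_ext (A B : comPzRingType) (f g : {rmorphism A -> B}) : f =1 g -> f = g.
Proof.
move=> E; have : (f : A -> B) = g by apply/funext.
case: f g E => f [[m1] [m2]] [g [[n1] [n2]]] /= _ E; subst g.
by rewrite (Prop_irrelevance m1 n1) (Prop_irrelevance m2 n2).
Qed.

Lemma schhom_ext (k : fieldType) (X Y : kscheme k) (f g : schhom X Y) :
  (forall x, f x = g x) ->
  (forall (V : opens Y) (U : opens X) (UV : U `<=` f @^-1` V) (UV' : U `<=` g @^-1` V) s,
    pull UV s = pull UV' s) -> f = g.
Proof.
case: f g => [f fc pf pr pc pl] [g gc pg qr qc ql] /= /funext E; subst g => H.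
rewrite (Prop_irrelevance gc fc).
have E : pf = pg.
  do 2!apply: functional_extensionality_dep => ?; apply: functional_extensionality_dep => UV.
  exact: (rmorph_ext (H _ _ UV UV)).
by subst pg; rewrite (Prop_irrelevance pr qr) (Prop_irrelevance pc qc) (Prop_irrelevance pl ql).
Qed.

Lemma pull_unit (k : fieldType) (X Y : kscheme k) (f : schhom X Y) (V : opens Y)
    (U : opens X) (UV : U `<=` f @^-1` V) (s : sect V) x : oset U x ->
  unit_at (pull UV s) x <-> unit_at s (f x).
Proof.
move=> Ux; split; first exact: pull_local.
move=> [O [OV [Ox [g sg]]]].
pose U' := interO U (Defs.preim (@hcont _ _ _ f) O).
have UU : U' `<=` U by move=> y [].
have UO : U' `<=` f @^-1` O by move=> y [].
exists U', UU; split=> //; exists (pull UO g).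
by rewrite (pull_res UV UO OV UU) -rmorphM sg rmorph1.
Qed.

Definition sub_topen (X : topologicalType) (W : opens X) : W `<=` topen X :=
  fun _ _ => I.

Definition resT (k : fieldType) (X : kscheme k) (W : opens X) : {rmorphism Gam X -> sect W} :=
  rstr (@sub_topen X W).

(** * Affine schemes and the morphisms out of them *)

Section Spec.
Variables (k : fieldType) (D : comPzRingType) (kap : {rmorphism k -> D}).

Notation S := (spec_ringed kap).

Definition toG : {rmorphism D -> ssect (topen (primes D))} := scst (topen (primes D)).

(** The annihilator of a - b is contained in no prime, so it contains 1. *)
Lemma toG_inj a b : toG a = toG b -> a = b.
Proof.
move=> /eqP; rewrite -subr_eq0 -rmorphB => /eqP E; apply/eqP; rewrite -subr_eq0.
set c := a - b in E *.
have H : forall (P : primes D), exists u, ~ sval P u /\ u * c = 0.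
  move=> P; apply/toploc_eq0.
  have := congr1 (fun t : ssect (topen (primes D)) => sval t (exist _ P I)) E.
  by rewrite /= rmorph0.
pose A := [set u | u * c = 0].
have IA : exists J : ideal D, iset J = A.
  unshelve eexists; first (exists A).
  - by rewrite /A /= mul0r.
  - by move=> x y; rewrite /A /= mulrDl => -> ->; rewrite addr0.
  - by move=> x y; rewrite /A /= -mulrA => ->; rewrite mulr0.
  by [].
case: IA => J JA; have [|n] := @nilp_prime D J 1.
  rewrite JA => P pP AP; have [u [nu u0]] := H (exist _ P pP).
  by case: nu; apply: AP.
by rewrite JA /A /= expr1n mul1r => ->.
Qed.

Lemma toG_surj s : exists a, toG a = s.
Proof.
have [|n [a H]] := @basic_section D (topen (primes D)) 1 s.
  by move=> P; split=> // _; exact: prime1.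
exists a; apply: ssect_eq => P /=; rewrite -H expr1n rmorph1 mul1r //.
Qed.

Definition fromG (s : ssect (topen (primes D))) : D := sval (cid (toG_surj s)).

Lemma fromGK s : toG (fromG s) = s.
Proof. by rewrite /fromG; case: (cid _). Qed.

Lemma toGK a : fromG (toG a) = a.
Proof. by apply: toG_inj; rewrite fromGK. Qed.

Fact fromG_is_zmod_morphism : zmod_morphism fromG.
Proof. by move=> s t; apply: toG_inj; rewrite rmorphB !fromGK. Qed.
Fact fromG_is_monoid_morphism : monoid_morphism fromG.
Proof. by split=> [|s t]; apply: toG_inj; rewrite ?rmorph1 ?rmorphM !fromGK. Qed.
HB.instance Definition _ :=
  GRing.isZmodMorphism.Build _ _ fromG fromG_is_zmod_morphism.
HB.instance Definition _ :=
  GRing.isMonoidMorphism.Build _ _ fromG fromG_is_monoid_morphism.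

Lemma unit_toG (U : opens (primes D)) (a : D) (P : primes D) : oset U P ->
  @unit_at k S U (scst U a) P <-> ~ sval P a.
Proof.
move=> UP; apply: (@spec_unit k D kap U _ P UP 1 a); first exact: prime1.
by move=> Q _; rewrite rmorph1 mul1r.
Qed.

Lemma spec_affine : @affine_open k S (topen S).
Proof.
have unitT (s : ssect (topen (primes D))) P : @unit_at k S _ s P <-> ~ sval P (fromG s).
  by rewrite -{1}(fromGK s); exact: unit_toG.
split.
- move=> J pJ; have pP := prime_preim toG pJ.
  exists (exist _ _ pP); split=> [|P [_ JP]].
    split=> // s; rewrite unitT /= fromGK.
    by split=> [Js|/contrapT//]; exact.
  case: P JP => P HP JP; apply: eq_exist; apply/funext => a; apply/propext.
  rewrite /= JP unit_toG //=.
  by split=> [/contrapT//|Pa]; exact.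
- move=> P V _ VP; have /= := @oset_open _ V; rewrite zopenE => /(_ _ VP)[f [Pf fV]].
  exists (toG f); split=> [|Q]; first exact/unit_toG.
  by move/unitT; rewrite toGK; exact: fV.
move=> s E ET Es; have Ef P : oset E P <-> ~ sval P (fromG s).
  by have -> : oset E P = @unit_at k S _ s P by rewrite Es; [].
rewrite -(fromGK s) in Es *; move: (fromG s) Es Ef => {s}f Es Ef.
split.
- have inv (Q : pin E) : exists v, toploc (sval Q) f * v = 1.
    by apply: fcst_unit; apply/Ef; exact: svalP Q.
  have gr : regular (fun Q : pin E => sval (cid (inv Q))).
    move=> Q; exists f, 1; split=> [|R _]; first exact/Ef/(svalP Q).
    by rewrite rmorph1; case: (cid _).
  exists (exist _ _ gr); apply: ssect_eq => Q /=; rewrite rmorph1.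
  by case: (cid _).
- move=> t; have [n [a H]] := basic_section t Ef.
  have Er : @rstr k S _ _ ET (toG f) = scst E f by apply: ssect_eq.
  by exists n, (toG a); rewrite Er -rmorphXn; apply: ssect_eq => Q; exact: H.
move=> c; rewrite -(fromGK c); move: (fromG c) => {}c c0.
pose A := [set u | u * c = 0].
have IA : exists J : ideal D, iset J = A.
  unshelve eexists; first (exists A).
  - by rewrite /A /= mul0r.
  - by move=> x y; rewrite /A /= mulrDl => -> ->; rewrite addr0.
  - by move=> x y; rewrite /A /= -mulrA => ->; rewrite mulr0.
  by [].
case: IA => J JA; have [|n] := @nilp_prime D J f.
  rewrite JA => P pP AP; apply: contrapT => nP.
  have EP : oset E (exist _ P pP : primes D) by apply/Ef.
  have := congr1 (fun t : ssect E => sval t (exist _ _ EP)) c0.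
  rewrite /= rmorph0 => /toploc_eq0[u [nu uc]].
  by apply: nu; apply: AP.
by rewrite JA => fc; exists n; rewrite -rmorphXn -rmorphM fc rmorph0.
Qed.

Definition Spec : kscheme k.
Proof.
exists S; first exact: spec_local.
by move=> x; exists (topen S); split=> //; exact: spec_affine.
Defined.

End Spec.

Section SpecMor.
Variables (k : fieldType) (D : comPzRingType) (kap : {rmorphism k -> D}).
Variables (X : kscheme k) (W : opens X) (aW : affine_open W).
Variable beta : {rmorphism sect W -> D}.
Hypothesis beta_k : forall c, beta (kcst W c) = kap c.

Lemma smfun_key (P : primes D) :
  exists x, oset W x /\ forall f : sect W, sval P (beta f) <-> ~ unit_at f x.
Proof.
have [x [Hx _]] := aff_point aW (prime_preim beta (svalP P)).
by exists x.
Qed.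

Definition smfun P : X := sval (cid (smfun_key P)).

Lemma smfun_in P : oset W (smfun P).
Proof. by rewrite /smfun; case: (cid _) => x []. Qed.

Lemma smfunE P f : unit_at f (smfun P) <-> ~ sval P (beta f).
Proof.
rewrite /smfun; case: (cid _) => x /= [_ ->].
by split=> [? /(_ _)|/contrapT//]; apply.
Qed.

Lemma smfun_nbhd P V : oset V (smfun P) ->
  exists h : sect W, ~ sval P (beta h) /\ dop h `<=` V.
Proof.
by move=> Vx; have [h [hx hV]] := aff_basic aW (smfun_in P) Vx; exists h; split=> //; apply/smfunE.
Qed.

Lemma smfun_cont : continuous (smfun : Spec kap -> X).
Proof.
apply/continuousP => V oV; rewrite zopenE => P /= VP.
have [h [Ph hV]] := @smfun_nbhd P (Opens oV) VP.
exists (beta h); split=> // Q Qh /=; apply: hV => /=; exact/smfunE.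
Qed.

(* [s] is the fraction a/g on the neighbourhood [O] of the image of [P]. *)
Definition triple V (s : sect V) P (g a : sect W) (O : opens X) : Prop :=
  exists (OV : O `<=` V) (OW : O `<=` W),
    [/\ oset O (smfun P), unit_at g (smfun P) & rstr OW g * rstr OV s = rstr OW a].

(** Both fractions represent s on a basic open of W around the image of P, hence agree up to a power
    of its equation, which is a unit in the local ring at P. *)
Lemma triple_uniq V (s : sect V) P g a O g' a' O' :
  triple s P g a O -> triple s P g' a' O' ->
  toploc P (beta (g' * a)) = toploc P (beta (g * a')).
Proof.
move=> [OV [OW [Ox gx E]]] [OV' [OW' [Ox' gx' E']]].
have [h [Ph hO]] := @smfun_nbhd P (interO O O') (conj Ox Ox').
have hOl : dop h `<=` O by move=> y /hO[].
have hOr : dop h `<=` O' by move=> y /hO[].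
have hW := @dop_sub k X W h.
have [_ _ /(_ (g' * a - g * a'))[|n /(congr1 beta)]] := @aff_frac k X W aW h _ hW erefl.
  rewrite rmorphB !rmorphM -(res_res OW hOl hW a) -E -(res_res OW' hOr hW a') -E'.
  rewrite !rmorphM (res_res OW hOl hW) (res_res OW' hOr hW).
  by rewrite (res_res OV hOl (fun y i => OV _ (hOl _ i))) (res_res OV' hOr (fun y i => OV _ (hOl _ i))) mulrCA subrr.
rewrite rmorph0 rmorphM rmorphXn rmorphB => E0.
apply/eqP; rewrite -subr_eq0 -rmorphB; apply/eqP/toploc_eq0.
exists (beta h ^+ n); split=> // H; apply: Ph; apply: primeX H; exact: svalP.
Qed.

Lemma triple_exists V (s : sect V) P : oset V (smfun P) -> exists g a O, triple s P g a O.
Proof.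
move=> Vx; have [h [Ph hV]] := smfun_nbhd Vx.
have hW := @dop_sub k X W h.
have [_ /(_ (rstr hV s))[n [a E]] _] := @aff_frac k X W aW h _ hW erefl.
exists (h ^+ n), a, (dop h), hV, hW; rewrite rmorphXn; split=> //; first exact/smfunE.
exact/unit_atX/smfunE.
Qed.

Lemma smval_key V (s : sect V) P : oset V (smfun P) -> exists v : ploc P,
  forall g a O, triple s P g a O -> toploc P (beta g) * v = toploc P (beta a).
Proof.
move=> Vx; have [g [a [O T]]] := triple_exists s Vx.
have Pg : ~ sval P (beta g) by apply/smfunE; case: T => ? [? []].
have [w gw] := @fcst_unit _ (prime_data P) _ Pg.
exists (toploc P (beta a) * w) => g' a' O' T'.
have := triple_uniq T T'; rewrite !rmorphM => E.
by rewrite mulrA E mulrAC gw mul1r.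
Qed.

Section Pull.
Variables (V : opens X) (U : opens (Spec kap)) (UV : U `<=` smfun @^-1` V).

Definition smval (s : sect V) (P : pin U) : ploc (sval P) :=
  sval (cid (smval_key s (UV (svalP P)))).

Lemma smvalE (s : sect V) P g a O : triple s (sval P) g a O ->
  toploc _ (beta g) * smval s P = toploc _ (beta a).
Proof. by rewrite /smval; case: (cid _) => v /= H; exact: H. Qed.

Lemma triple_near (s : sect V) P g a O : triple s P g a O -> exists h, ~ sval P (beta (g * h)) /\
  forall Q, ~ sval Q (beta (g * h)) -> triple s Q g a O.
Proof.
move=> [OV [OW [Ox gx E]]]; have [h [Ph hO]] := smfun_nbhd Ox.
exists h; rewrite rmorphM; split; first by apply: primeM => //; apply/smfunE.
move=> Q nQ; exists OV, OW; split=> //.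
  apply: hO; apply/smfunE; exact: primeMr nQ.
apply/smfunE; exact: primeMl nQ.
Qed.

Lemma smval_reg s : regular (smval s).
Proof.
move=> P; have [g [a [O T]]] := triple_exists s (UV (svalP P)).
have [h [Ph hT]] := triple_near T.
exists (beta (g * h)), (beta (a * h)); split=> // Q /hT/smvalE E.
by rewrite !rmorphM /= mulrAC E.
Qed.

Definition smpull (s : sect V) : ssect U := exist _ _ (smval_reg s).

Lemma smval_uniq (s : sect V) (P : pin U) v g a O : triple s (sval P) g a O ->
  toploc _ (beta g) * v = toploc _ (beta a) -> v = smval s P.
Proof.
move=> T E; apply: (@toploc_cancel _ _ (beta g)); last by rewrite E (smvalE T).
by apply/smfunE; case: T => ? [? []].
Qed.

Lemma triple_inter (s : sect V) P g a O (s' : sect V) g' a' O' : triple s P g a O -> triple s' P g' a' O' ->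
  triple (s - s') P (g * g') (g' * a - g * a') (interO O O') /\
  triple (s * s') P (g * g') (a * a') (interO O O').
Proof.
move=> [OV [OW [Ox gx E]]] [OV' [OW' [Ox' gx' E']]].
have Il : interO O O' `<=` O by move=> y [].
have Ir : interO O O' `<=` O' by move=> y [].
pose IV : interO O O' `<=` V := fun y i => OV _ (Il _ i).
pose IW : interO O O' `<=` W := fun y i => OW _ (Il _ i).
have F : rstr IW g * rstr IV s = rstr IW a.
  by rewrite -(res_res OW Il) -(res_res OV Il) -rmorphM E (res_res OW Il IW).
have F' : rstr IW g' * rstr IV s' = rstr IW a'.
  by rewrite -(res_res OW' Ir) -(res_res OV' Ir) -rmorphM E' (res_res OW' Ir IW).
have gg : unit_at (g * g') (smfun P) by apply/unit_atM.
split; exists IV, IW; split=> //.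
  rewrite !rmorphB !rmorphM -F -F'; ring.
rewrite !rmorphM -F -F'; ring.
Qed.

Fact smpull_is_zmod_morphism : zmod_morphism smpull.
Proof.
move=> s t; apply: ssect_eq => P /=; symmetry.
have [g [a [O T]]] := triple_exists s (UV (svalP P)).
have [g' [a' [O' T']]] := triple_exists t (UV (svalP P)).
have [T'' _] := triple_inter T T'; apply: (smval_uniq T'').
rewrite rmorphB !rmorphM rmorphB !rmorphM /= -(smvalE T) -(smvalE T'); ring.
Qed.

Fact smpull_is_monoid_morphism : monoid_morphism smpull.
Proof.
split=> [|s t]; apply: ssect_eq => P /=; symmetry.
  have Vx := UV (svalP P).
  have IV : interO V W `<=` V by move=> y [].
  have IW : interO V W `<=` W by move=> y [].
  apply: (@smval_uniq _ _ _ 1 1 (interO V W)).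
    exists IV, IW; rewrite !rmorph1 mulr1; split=> //; first by split=> //; exact: smfun_in.
    exact/unit_at1/smfun_in.
  by rewrite !rmorph1 mulr1.
have [g [a [O T]]] := triple_exists s (UV (svalP P)).
have [g' [a' [O' T']]] := triple_exists t (UV (svalP P)).
have [_ T''] := triple_inter T T'; apply: (smval_uniq T'').
rewrite !rmorphM /= -(smvalE T) -(smvalE T'); ring.
Qed.

HB.instance Definition _ :=
  GRing.isZmodMorphism.Build (sect V) (ssect U) smpull smpull_is_zmod_morphism.
HB.instance Definition _ :=
  GRing.isMonoidMorphism.Build (sect V) (ssect U) smpull smpull_is_monoid_morphism.

End Pull.

(** The morphism into the affine open W attached to a ring map [beta]. Sections over arbitrary opens
    are pulled back through their local fractions ([triple]). *)
Definition specmor : schhom (Spec kap) X.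
Proof.
refine (@Defs.Hom k (Spec kap) X smfun smfun_cont
  (fun V U UV => (@smpull V U UV : {rmorphism sect V -> ssect U})) _ _ _).
- move=> V V' U U' UV U'V' VV UU s; apply: ssect_eq => P /=.
  have [g [a [O T]]] := triple_exists (rstr VV s) (U'V' _ (svalP P)).
  apply: (smval_uniq U'V' (P := P) (v := smval UV s (pincl UU P)) T).
  apply: (@smvalE _ _ UV _ (pincl UU P) g a O).
  case: T => [OV' [OW [Ox gx E]]]; exists (fun y i => VV _ (OV' _ i)), OW; split=> //.
  by rewrite -(res_res VV OV').
- move=> V U UV c; apply: ssect_eq => P /=; symmetry.
  have IV : interO V W `<=` V by move=> y [].
  have IW : interO V W `<=` W by move=> y [].
  apply: (@smval_uniq _ _ _ _ _ _ 1 (kcst W c) (interO V W)).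
    exists IV, IW; rewrite rmorph1 mul1r !res_cst; split=> //.
      by split; [exact: (UV _ (svalP P))|exact: smfun_in].
    exact/unit_at1/smfun_in.
  by rewrite !rmorph1 mul1r beta_k.
move=> V U UV s P H; have UP := unit_in H.
have [g [a [O T]]] := triple_exists s (UV _ UP).
have [h [Ph hT]] := triple_near T.
move: H; rewrite (@spec_unit k D kap U (smpull UV s) P UP _ (beta (a * h)) Ph); last first.
  by move=> Q /hT/(smvalE UV (P := Q)) E; rewrite !rmorphM /= mulrAC E.
rewrite rmorphM => /primeMl/smfunE ax.
case: T => OV [OW [Ox gx E]]; apply/(unit_res OV) => //.
have : unit_at (rstr OW g * rstr OV s) (smfun P) by rewrite E; apply/unit_res.
by case/unit_atM.
Defined.

Lemma specmor_in P : oset W (specmor P). Proof. exact: smfun_in. Qed.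

Lemma specmor_unit P f : unit_at f (specmor P) <-> ~ sval P (beta f).
Proof. exact: smfunE. Qed.

Lemma specmor_pull (U : opens (Spec kap)) (UW : U `<=` specmor @^-1` W) s : pull UW s = scst U (beta s) :> ssect U.
Proof.
apply: ssect_eq => P; symmetry.
apply: (@smval_uniq _ _ _ _ _ _ 1 s W); last by rewrite rmorph1 rmorph1 mul1r.
exists (fun _ h => h), (fun _ h => h); rewrite rmorph1 mul1r; split=> //; first exact: smfun_in.
exact/unit_at1/smfun_in.
Qed.

Lemma specmor_gpull (f : Gam X) : gpull specmor f = toG D (beta (resT W f)).
Proof.
have TW : topen (Spec kap) `<=` specmor @^-1` W by move=> P _; exact: specmor_in.
rewrite -[LHS](res_id (fun _ h => h)).
transitivity (pull TW (resT W f)); last exact: specmor_pull.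
exact: pull_res.
Qed.

End SpecMor.

Section Uniqueness.
Variables (k : fieldType) (T X : kscheme k) (W : opens X) (aW : affine_open W).
Variables (x y : schhom T X).
Hypotheses (xW : topen T `<=` x @^-1` W) (yW : topen T `<=` y @^-1` W).
Hypothesis xy : forall s, pull xW s = pull yW s.

Lemma mor_uniq : x = y.
Proof.
have E t : x t = y t.
  apply: (aff_eq aW); [exact: (xW (t := t))|exact: (yW (t := t))|] => f.
  by rewrite -(pull_unit xW) // xy (pull_unit yW).
apply: schhom_ext => // V U UV UV' s.
apply: sect_eq => t Ut.
have [h [hx hV']] := aff_basic aW (xW (t := t) I) (UV _ Ut).
have hV : dop h `<=` V := hV'.
have hW := @dop_sub k X W h.
have [_ /(_ (rstr hV s))[n [a Ea]] _] := @aff_frac k X W aW h _ hW erefl.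
pose O := interO U (Defs.preim (@hcont _ _ _ x) (dop h)).
have OU : O `<=` U by move=> z [].
have Ox : O `<=` x @^-1` dop h by move=> z [].
have Oy : O `<=` y @^-1` dop h by move=> z [_]; rewrite /= E.
exists O, OU; split; first by split.
rewrite (pull_res UV Ox hV OU) (pull_res UV' Oy hV OU).
have OT : O `<=` topen T by [].
have P (c : sect W) : pull Ox (rstr hW c) = pull Oy (rstr hW c).
  by rewrite -(pull_res xW Ox hW OT) -(pull_res yW Oy hW OT) xy.
have [[v hv] _ _] := @aff_frac k X W aW h _ hW erefl.
have := congr1 (pull Ox) Ea; have := congr1 (pull Oy) Ea.
rewrite !rmorphM !rmorphXn /= -!P => <- /(congr1 (fun z => pull Ox v ^+ n * z)).
rewrite !mulrA -!exprMn -!rmorphM (mulrC v) hv rmorph1 expr1n !mul1r.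
exact.
Qed.

End Uniqueness.

(** * Polynomial rings in several variables *)

Section Mpoly.
Variables (n : nat) (R : comNzRingType).

Definition mp : comNzRingType := mpoly.mpoly n R.

Definition mpc : {rmorphism R -> mp} := @mpoly.mpolyC n R.

Definition mpv (i : 'I_n) : mp := mpoly.mpolyX R (mpoly.mnm1 i).

Lemma mp_ind (P : mp -> Prop) :
  (forall c, P (mpc c)) -> (forall i, P (mpv i)) ->
  (forall p q, P p -> P q -> P (p + q)) -> (forall p q, P p -> P q -> P (p * q)) ->
  forall p, P p.
Proof.
move=> PC PV PD PM.
have PX m : P (mpoly.mpolyX R m).
  rewrite mpoly.mpolyXE_id; apply: big_ind => [||i _].
  - by rewrite -(rmorph1 mpc); exact: PC.
  - exact: PM.
  elim: (m i) => [|j IH]; first by rewrite expr0 -(rmorph1 mpc); exact: PC.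
  by rewrite exprS; apply: PM; [exact: PV|].
elim/mpoly.mpolyind => [|c m p _ _ Pp]; first by rewrite -(rmorph0 mpc); exact: PC.
by apply: (PD) => //; rewrite -mpoly.mul_mpolyC; apply: PM; [exact: PC|exact: PX].
Qed.

Section Eval.
Variables (S : comNzRingType) (f : {rmorphism R -> S}) (h : 'I_n -> S).

Definition mev : {rmorphism mp -> S} := mpoly.mmap f h.

Lemma mevC c : mev (mpc c) = f c. Proof. exact: mpoly.mmapC. Qed.

Lemma mevV i : mev (mpv i) = h i.
Proof. by rewrite /mev /= mpoly.mmapX mpoly.mmap1U. Qed.

End Eval.

Lemma mp_hom_eq (S : comPzRingType) (f g : {rmorphism mp -> S}) :
  (forall c, f (mpc c) = g (mpc c)) -> (forall i, f (mpv i) = g (mpv i)) -> f =1 g.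
Proof.
move=> C V; elim/mp_ind => // p q Ep Eq; first by rewrite !rmorphD Ep Eq.
by rewrite !rmorphM Ep Eq.
Qed.

End Mpoly.

Lemma mp0_surj (R : comNzRingType) p : exists c, mpc 0 R c = p.
Proof.
elim/mp_ind: p => [c|[]//|p q [c <-] [d <-]|p q [c <-] [d <-]]; first by exists c.
  by exists (c + d); rewrite rmorphD.
by exists (c * d); rewrite rmorphM.
Qed.

Section MpStep.
Variables (n : nat) (R : comNzRingType).

Definition mpw : {rmorphism mp n R -> mp n.+1 R} :=
  mev (mpc n.+1 R) (fun i => mpv R (widen_ord (leqnSn n) i)).

Definition mpstep : {rmorphism {poly (mp n R)} -> mp n.+1 R} :=
  horner_morph (f := mpw) (u := mpv R ord_max) (fun p => mulrC _ _).

Lemma mpstep_cst p : mpstep p%:P = mpw p.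
Proof. by rewrite /mpstep /= horner_morphC. Qed.

Lemma mpstep_surj p : exists q, mpstep q = p.
Proof.
elim/mp_ind: p => [c|i|p q [c <-] [d <-]|p q [c <-] [d <-]].
- by exists (mpc n R c)%:P; rewrite mpstep_cst /mpw mevC.
- case: (unliftP ord_max i) => [j ->|->]; last by exists 'X; rewrite /mpstep /= horner_morphX.
  exists (mpv R j)%:P; rewrite mpstep_cst /mpw mevV; congr (mpv R _).
  by apply: val_inj; rewrite /= /bump leqNgt ltn_ord.
- by exists (c + d); rewrite rmorphD.
- by exists (c * d); rewrite rmorphM.
Qed.

End MpStep.

(** Since [mp n.+1 R] is a quotient of the polynomial ring in one variable over [mp n R], it
    suffices to adjoin one variable and to pass to quotients. The Noetherian property, Chevalley's
    theorem and the Nullstellensatz are all obtained in this way. *)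
Lemma mp_closed (R : comNzRingType)
    (PP : forall S : comNzRingType, {rmorphism R -> S} -> Prop) :
  PP R idfun ->
  (forall (S : comNzRingType) (f : {rmorphism R -> S}), PP S f ->
     PP {poly S} ((polyC : {rmorphism S -> {poly S}}) \o f)) ->
  (forall (S S' : comNzRingType) (f : {rmorphism R -> S}) (g : {rmorphism S -> S'}),
     (forall y, exists x, g x = y) -> PP S f -> PP S' (g \o f)) ->
  forall n, PP (mp n R) (mpc n R).
Proof.
move=> P0 PS PQ; elim=> [|n IH].
  have := PQ _ _ _ (mpc 0 R) (@mp0_surj R) P0; congr (PP _ _).
  exact: rmorph_ext.
have := PQ _ _ _ (mpstep n R) (@mpstep_surj n R) (PS _ _ IH); congr (PP _ _).
by apply: rmorph_ext => c /=; rewrite mpstep_cst /mpw mevC.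
Qed.

(** * Noetherian rings and Krull's intersection theorem *)

Lemma nat_min (P : nat -> Prop) : (exists n, P n) -> exists n, P n /\ forall m, P m -> (n <= m)%N.
Proof.
move=> [n Pn]; have ex : exists n, `[< P n >] by exists n; apply/asboolP.
by exists (ex_minn ex); case: ex_minnP => m /asboolP Pm Hm; split=> // j /asboolP/Hm.
Qed.

(** The chain condition for sequences in the free modules R^s, not just in R: the vector form is
    what Hilbert's argument propagates and what [krull] applies to tuples of coefficients. *)
Definition noeth (R : comNzRingType) : Prop := forall s (v : nat -> 'rV[R]_s),
  exists N (c : nat -> R), v N = \sum_(i < N) c i *: v i.

Lemma noeth_surj (R S : comNzRingType) (g : {rmorphism R -> S}) :
  (forall y, exists x, g x = y) -> noeth R -> noeth S.
Proof.
move=> /choice[h gh] nR s v.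
have [N [c E]] := nR s (fun i => map_mx h (v i)).
exists N, (g \o c); have hK w : map_mx g (map_mx h w) = w :> 'rV_s.
  by apply/rowP => j; rewrite !mxE gh.
rewrite -[LHS]hK E map_mx_sum; apply: eq_bigr => i _.
by rewrite map_mxZ hK.
Qed.

(** Otherwise the span of the first N vectors would gain rank at every step and exceed the dimension
    s. *)
Lemma noeth_field (k : fieldType) : noeth k.
Proof.
move=> s v; pose W N := (\sum_(i < N) <<v i>>)%MS.
have [N sub] : exists N, (v N <= W N)%MS.
  apply: contrapT => H; have rk N : (N <= \rank (W N))%N.
    elim: N => // N IH; apply: leq_ltn_trans IH _.
    rewrite /W big_ord_recr /= -/(W N); apply: rank_ltmx; apply/andP; split.
      exact: addsmxSl.
    apply/negP => Hs; apply: H; exists N; apply: submx_trans Hs.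
    by apply: submx_trans (addsmxSr _ _); rewrite genmxE.
  by have := leq_trans (rk s.+1) (rank_leq_col _); rewrite ltnn.
exists N; have /sub_sumsmxP[u E] := sub.
have H (i : 'I_N) : exists c, u i *m <<v i>>%MS = c *: v i.
  by apply/sub_rVP; apply: submx_trans (submxMl _ _) _; rewrite genmxE.
have /choice[c Hc] : forall i : nat, exists c, forall h : (i < N)%N,
    u (Ordinal h) *m <<v i>>%MS = c *: v i.
  move=> i; have [h|h] := pselect (i < N)%N; last by exists 0.
  have [c Hc] := H (Ordinal h); exists c => h'; rewrite -Hc.
  by congr (u _ *m _); apply: val_inj.
exists c; rewrite E; apply: eq_bigr => -[i h] _; exact: Hc.
Qed.

Section HilbertBasis.
Variables (R : comNzRingType) (nR : noeth R) (s : nat).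
Implicit Types w : 'rV[{poly R}]_s.

Definition vsize w := (\max_j size (w 0%R j))%N.

Lemma vsizeP w j : (size (w 0%R j) <= vsize w)%N.
Proof. exact: (leq_bigmax (F := fun j => size (w 0%R j))). Qed.

Definition spanl (l : seq 'rV[{poly R}]_s) w :=
  exists c : nat -> {poly R}, w = \sum_(i < size l) c i *: nth 0 l i.

(** Hilbert's basis argument in R[X]^s: successive vectors of least size outside the span of the
    previous ones. A relation between their top coefficient vectors would produce a smaller vector
    outside the span. *)
Lemma hilbert_aux (Sp : set 'rV[{poly R}]_s) :
  (forall w w', Sp w -> Sp w' -> Sp (w + w')) -> (forall c w, Sp w -> Sp (c *: w)) ->
  exists l, (forall w, w \in l -> Sp w) /\ forall w, Sp w -> spanl l w.
Proof.
move=> SD SZ; apply: contrapT => H.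
have step l : exists w, (forall w, w \in l -> Sp w) -> [/\ Sp w, ~ spanl l w &
    forall w', Sp w' -> ~ spanl l w' -> (vsize w <= vsize w')%N].
  have [lS|lS] := pselect (forall w, w \in l -> Sp w); last by exists 0.
  have [w [Sw nw]] : exists w, Sp w /\ ~ spanl l w.
    apply: contrapT => H'; apply: H; exists l; split=> // w Sw.
    by apply: contrapT => nw; apply: H'; exists w.
  have [|m [[w' [Sw' nw' Ew']] mm]] :=
    @nat_min (fun m => exists w, [/\ Sp w, ~ spanl l w & vsize w = m]).
    by exists (vsize w), w.
  by exists w' => _; split=> // w2 S2 n2; rewrite Ew'; apply: mm; exists w2.
have [next Hn] := choice step.
pose L := fix L n := if n is m.+1 then rcons (L m) (next (L m)) else [::].
pose f n := next (L n).
have LE n : L n = mkseq f n by elim: n => //= n IH; rewrite mkseqS -IH.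
have LS n : forall w, w \in L n -> Sp w.
  elim: n => //= n IH w; rewrite mem_rcons inE => /orP[/eqP->|/IH//].
  by case: (Hn _ IH).
have fS n : Sp (f n) by case: (Hn _ (LS n)).
have fn n : ~ spanl (L n) (f n) by case: (Hn _ (LS n)).
have fmin n w : Sp w -> ~ spanl (L n) w -> (vsize (f n) <= vsize w)%N.
  by case: (Hn _ (LS n)) => _ _; apply.
have spE n w : spanl (L n) w <-> exists c, w = \sum_(i < n) c (nat_of_ord i) *: f i.
  rewrite /spanl LE size_mkseq; split=> -[c ->]; exists c; apply: eq_bigr => i _;
  by rewrite nth_mkseq.
have mono i N : (i < N)%N -> (vsize (f i) <= vsize (f N))%N.
  move=> iN; apply: fmin => //; move=> /spE[c Ec]; apply: (fn N); apply/spE.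
  exists (fun j => if (j < i)%N then c j else 0).
  rewrite Ec (big_ord_widen_cond N (fun=> true) (fun j => c j *: f j)) ?(ltnW iN) //.
  rewrite big_mkcond /=; apply: eq_bigr => j _.
  by case: ifP => _; rewrite ?scale0r.
pose d n := (vsize (f n)).-1.
have fpos n : (0 < vsize (f n))%N.
  rewrite lt0n; apply/eqP => E; apply: (fn n).
  exists (fun=> 0); rewrite big1 => [|i _]; last by rewrite scale0r.
  apply/rowP => j; rewrite mxE; apply/eqP; rewrite -size_poly_eq0 -leqn0.
  by have := vsizeP (f n) j; rewrite E.
(* The relation between the coefficients in the degrees [d n] lets w cancel the top coefficients of
   [f N]. *)
have [N [c Ec]] := nR (fun n => \row_j (f n 0 j)`_(d n)).
pose w := f N - \sum_(i < N) (c i *: 'X^(d N - d i)) *: f i.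
have Sw : Sp w.
  rewrite /w; apply: (SD) => //; rewrite -scaleN1r; apply: (SZ).
  elim/big_ind: _ => [||i _]; [|exact: SD|exact: SZ].
  by rewrite -(scale0r (f 0%N)); apply: (SZ).
have nw : ~ spanl (L N) w.
  move=> /spE[e Ee]; apply: (fn N); apply/spE.
  exists (fun i => e i + (c i *: 'X^(d N - d i))).
  under eq_bigr do rewrite scalerDl.
  by rewrite big_split /= -Ee /w subrK.
have := fmin N w Sw nw; apply/negP; rewrite -ltnNge.
have dN : vsize (f N) = (d N).+1 by rewrite /d prednK.
rewrite dN ltnS; apply/bigmax_leqP => j _; apply/leq_sizeP => i di.
have nthE m (e : nat) : (d m <= e)%N -> (f m 0 j)`_e = if e == d m then (f m 0 j)`_(d m) else 0.
  move=> me; case: eqP => [->//|ne]; apply: nth_default.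
  apply: (leq_trans (vsizeP _ _)); rewrite -[vsize _]prednK // -/(d m).
  by rewrite ltn_neqAle me andbT eq_sym; apply/eqP.
move/rowP: (Ec) => /(_ j) Ej; rewrite !mxE summxE in Ej.
have Ew : w 0 j = f N 0 j - \sum_(m < N) c m *: ('X^(d N - d m) * f m 0 j).
  rewrite !mxE summxE; congr (_ - _); apply: eq_bigr => m _.
  by rewrite mxE -scalerAl.
suff E0 : (w 0%R j)`_i = 0 by exact: E0.
rewrite Ew coefB coef_sum nthE //.
rewrite (eq_bigr (fun m : 'I_N => c m * (if i == d N then (f m 0 j)`_(d m) else 0))); last first.
  move=> m _; rewrite coefZ coefXnM ltnNge (leq_trans (leq_subr _ _) di) /=.
  have dm : (d m <= d N)%N by rewrite /d -!subn1; apply/leq_sub2r/mono.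
  have dE : (i - (d N - d m) == d m)%N = (i == d N).
    by rewrite -(eqn_add2r (d N - d m)) subnK ?(leq_trans (leq_subr _ _) di) // subnKC.
  by rewrite nthE ?dE // -(leq_add2r (d N - d m)) subnK ?(leq_trans (leq_subr _ _) di) // subnKC.
case: eqP => [_|_]; last by rewrite big1 ?subr0 // => m _; rewrite mulr0.
rewrite Ej; apply/eqP; rewrite subr_eq0; apply/eqP; apply: eq_bigr => m _.
by rewrite !mxE.
Qed.

End HilbertBasis.

Lemma noeth_poly (R : comNzRingType) : noeth R -> noeth {poly R}.
Proof.
move=> nR s v.
pose Sp := [set w | exists N (c : nat -> {poly R}), w = \sum_(i < N) c i *: v i].
have widen N M (c : nat -> {poly R}) : (N <= M)%N -> \sum_(i < N) c i *: v i =
    \sum_(i < M) (if (i < N)%N then c i else 0) *: v i.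
  move=> NM; rewrite (big_ord_widen_cond M (fun=> true) (fun j => c j *: v j)) //.
  by rewrite big_mkcond /=; apply: eq_bigr => j _; case: ifP => _; rewrite ?scale0r.
have SD w w' : Sp w -> Sp w' -> Sp (w + w').
  move=> [N [c ->]] [M [e ->]]; exists (maxn N M).
  exists (fun i => (if (i < N)%N then c i else 0) + (if (i < M)%N then e i else 0)).
  rewrite (widen _ _ c (leq_maxl N M)) (widen _ _ e (leq_maxr N M)) -big_split /=.
  by apply: eq_bigr => i _; rewrite scalerDl.
have SZ c w : Sp w -> Sp (c *: w).
  move=> [N [e ->]]; exists N, (fun i => c * e i).
  by rewrite scaler_sumr; apply: eq_bigr => i _; rewrite scalerA.
have [l [lS Sl]] := hilbert_aux nR SD SZ.
have [N HN] : exists N, forall w, w \in l -> exists c : nat -> {poly R}, w = \sum_(i < N) c i *: v i.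
  elim: l lS {Sl} => [|w l IH] lS; first by exists 0%N.
  have [|N HN] := IH; first by move=> w' w'l; apply: lS; rewrite inE w'l orbT.
  have [|M [c Ec]] := lS w; first by rewrite inE eqxx.
  exists (maxn N M) => w'; rewrite inE => /orP[/eqP->|/HN[e ->]].
    by exists (fun i => if (i < M)%N then c i else 0); rewrite Ec; apply/widen/leq_maxr.
  by exists (fun i => if (i < N)%N then e i else 0); apply/widen/leq_maxl.
exists N; have [|c Ec] := Sl (v N).
  exists N.+1, (fun i => if i == N then 1 else 0).
  rewrite big_ord_recr /= eqxx scale1r big1 ?add0r // => i _.
  by rewrite (ltn_eqF (ltn_ord i)) scale0r.
have /choice[e He] : forall i, exists e : nat -> {poly R}, (i < size l)%N ->
    nth 0 l i = \sum_(j < N) e j *: v j.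
  move=> i; case: (ltnP i (size l)) => [il|]; last by exists (fun=> 0).
  by have [e Ee] := HN _ (mem_nth 0 il); exists e.
exists (fun j => \sum_(i < size l) c i * e i j); rewrite Ec.
transitivity (\sum_(i < size l) \sum_(j < N) (c i * e i j) *: v j).
  apply: eq_bigr => i _; rewrite He // scaler_sumr.
  by apply: eq_bigr => j _; rewrite scalerA.
by rewrite exchange_big; apply: eq_bigr => j _; rewrite scaler_suml.
Qed.

Lemma noeth_mp (k : fieldType) n : noeth (mp n k).
Proof.
apply: (@mp_closed k (fun S _ => noeth S)).
- exact: noeth_field.
- by move=> S f; exact: noeth_poly.
- by move=> S S' f g gs; exact: noeth_surj gs.
Qed.

(* [ipow G n] is the n-th power of the ideal generated by [G]. *)
Inductive ipow (R : comPzRingType) (G : set R) : nat -> R -> Prop :=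
| ip_cst c : ipow G 0 c
| ip_0 n : ipow G n 0
| ip_D n x y : ipow G n x -> ipow G n y -> ipow G n (x + y)
| ip_M n c x : ipow G n x -> ipow G n (c * x)
| ip_S n x y : G y -> ipow G n x -> ipow G n.+1 (y * x).

Section Ipow.
Variables (R : comPzRingType) (G : set R).

Lemma ipow_le n x : ipow G n.+1 x -> ipow G n x.
Proof.
move=> H; have : forall m, n.+1 = m.+1 -> ipow G m x; last by apply.
elim: H => {x n}[c|n|n x y _ Hx _ Hy|n c x _ Hx|n x y Gy Hx _] m // E.
- exact: ip_0.
- by apply: ip_D; [exact: Hx|exact: Hy].
- by apply: ip_M; exact: Hx.
- by case: E => <-; exact: ip_M.
Qed.

Lemma ipow_leq m n x : (m <= n)%N -> ipow G n x -> ipow G m x.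
Proof.
move=> /subnK <-; elim: (n - m)%N => //= i IH H; exact/IH/ipow_le.
Qed.

Lemma ipow_mul m n x y : ipow G m x -> ipow G n y -> ipow G (m + n) (x * y).
Proof.
move=> Hx Hy; elim: Hx => {x m}[c|m|m x x' _ Hx _ Hx'|m c x _ Hx|m x z Gz _ Hx].
- exact: ip_M.
- by rewrite mul0r; exact: ip_0.
- by rewrite mulrDl; exact: ip_D.
- by rewrite -mulrA; exact: ip_M.
- by rewrite -mulrA addSn; exact: ip_S.
Qed.

Lemma ipow_sum n (I : Type) (r : seq I) (F : I -> R) :
  (forall i, ipow G n (F i)) -> ipow G n (\sum_(i <- r) F i).
Proof. by move=> H; apply: big_ind => //; [exact: ip_0|exact: ip_D]. Qed.

Lemma ipow1 x : G x -> ipow G 1 x.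
Proof. by move=> Gx; rewrite -(mulr1 x); apply: ip_S => //; exact: ip_cst. Qed.

End Ipow.

Section Krull.
Variables (k : fieldType) (n d s : nat) (a : 'I_d -> mp n k).
Variables (Lam : comPzRingType) (rho : {rmorphism mp n k -> Lam}) (lam : 'I_s -> Lam).
Variables (K : set Lam).
Hypothesis K0 : K 0.
Hypothesis KD : forall x y, K x -> K y -> K (x + y).
Hypothesis KM : forall p x, K x -> K (rho p * x).
Variable x : Lam.
Hypothesis Kx : forall N, exists c : 'I_s -> mp n k,
  (forall j, ipow (range a) N (c j)) /\ K (x - \sum_j rho (c j) * lam j).

(* The Rees algebra is the image of [rees]. *)
Let rees : {rmorphism mp (n + d) k -> {poly (mp n k)}} :=
  mev ((polyC : {rmorphism _ -> _}) \o mpc n k)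
    (fun i => match fintype.split i with inl i => (mpv k i)%:P | inr j => a j *: 'X end).

Lemma rees_cst p : exists P, rees P = p%:P.
Proof.
elim/mp_ind: p => [c|i|p q [P EP] [Q EQ]|p q [P EP] [Q EQ]].
- by exists (mpc _ _ c); rewrite /rees mevC.
- by exists (mpv k (lshift d i)); rewrite /rees mevV (unsplitK (inl i)).
- by exists (P + Q); rewrite !rmorphD EP EQ.
- by exists (P * Q); rewrite !rmorphM EP EQ.
Qed.

Lemma rees_ipow N c : ipow (range a) N c -> exists P, rees P = c *: 'X^N.
Proof.
elim=> {N c}[c|N|N p q _ [P EP] _ [Q EQ]|N c p _ [P EP]|N p q [j _ <-] _ [P EP]].
- by have [P EP] := rees_cst c; exists P; rewrite EP expr0 alg_polyC.
- by exists 0; rewrite rmorph0 scale0r.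
- by exists (P + Q); rewrite rmorphD EP EQ scalerDl.
- have [C EC] := rees_cst c; exists (C * P).
  by rewrite rmorphM EC EP mul_polyC scalerA.
exists (mpv k (rshift n j) * P); rewrite rmorphM EP /rees mevV (unsplitK (inr j)).
by rewrite -scalerAl -scalerAr scalerA exprS.
Qed.

Lemma rees_coef P m : (0 < m)%N -> span (range a) (rees P)`_m.
Proof.
elim/mp_ind: P m => [c|i|P Q IP IQ|P Q IP IQ] m m0.
- by rewrite /rees mevC /= coefC gtn_eqF //=; exact: ideal0.
- rewrite /rees mevV; case: (fintype.split i) => j.
    by rewrite coefC gtn_eqF //=; exact: ideal0.
  by rewrite coefZ; apply/idealMr/span_mem; exists j.
- by rewrite rmorphD coefD; apply: idealD; [exact: IP|exact: IQ].
rewrite rmorphM coefM; apply: ideal_sum => i _.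
case: (posnP i) => [->|i0]; last exact/idealMr/IP.
by apply/idealM/IQ; rewrite subn0.
Qed.

Lemma krull : exists i, span (range a) i /\ K ((1 - rho i) * x).
Proof.
have [c Hc] := choice Kx.
have /choice[P HP] : forall Nj : nat * 'I_s, exists P, rees P = c Nj.1 Nj.2 *: 'X^(Nj.1).
  by move=> [N j]; apply: rees_ipow; case: (Hc N).
have [N [q Eq]] := noeth_mp (fun N => \row_j P (N, j)).
pose e (i : 'I_N) := (rees (q i))`_(N - i).
have Ec j : c N j = \sum_(i < N) e i * c i j.
  have := congr1 (fun p : {poly mp n k} => p`_N) (HP (N, j)); rewrite /= coefZ coefXn eqxx mulr1 => <-.
  have /rowP/(_ j) := Eq; rewrite mxE summxE => ->.
  rewrite rmorph_sum coef_sum; apply: eq_bigr => i _.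
  rewrite !mxE rmorphM (HP (nat_of_ord i, j)) /= -scalerAr coefZ coefMXn.
  by rewrite ltnNge ltnW //= mulrC.
exists (\sum_i e i); split.
  by apply: ideal_sum => i _; apply: rees_coef; rewrite subn_gt0.
have -> : (1 - rho (\sum_i e i)) * x = x - \sum_j rho (c N j) * lam j -
    \sum_(i < N) rho (e i) * (x - \sum_j rho (c i j) * lam j).
  have -> : \sum_j rho (c N j) * lam j = \sum_(i < N) rho (e i) * \sum_j rho (c i j) * lam j.
    under [RHS]eq_bigr do rewrite mulr_sumr; rewrite exchange_big; apply: eq_bigr => j _.
    rewrite Ec rmorph_sum mulr_suml; apply: eq_bigr => i _; by rewrite rmorphM mulrA.
  under [X in _ = _ - X]eq_bigr do rewrite mulrBr.
  by rewrite sumrB -mulr_suml -rmorph_sum /=; ring.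
apply: KD; first by case: (Hc N).
rewrite -mulN1r mulr_sumr; apply: big_ind => // i _.
rewrite mulrA -(rmorphN1 rho) -rmorphM; apply: KM; by case: (Hc i).
Qed.

End Krull.

(** * Residue fields, Chevalley's theorem and the Nullstellensatz *)

Section ResidueField.
Variables (R : comPzRingType) (P : primes R).

(** Inverting the complement of P modulo P gives the fraction field of R/P. *)
Definition resd : locdata R :=
  @LocData R (fun a => ~ sval P a) (idp (svalP P)) (@prime1 R P) (@primeM R P).

Definition resf : Type := frac resd.

HB.instance Definition _ := GRing.ComPzRing.copy resf (frac resd).

Fact resf_nz : (1 : resf) != 0.
Proof.
apply/eqP => /(@fcst_eq0 _ resd)[u [nu]]; rewrite idpE mulr1 => Pu; exact: nu.
Qed.

HB.instance Definition _ := GRing.PzSemiRing_isNonZero.Build resf resf_nz.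

Lemma resf_unit (x : resf) : x != 0 -> exists y, y * x = 1.
Proof.
have [a [s [Ls E]]] := @frac_surj _ resd x => x0.
have [v sv] := fcst_unit Ls.
have na : ~ sval P a.
  move=> Pa; move/eqP: x0; apply.
  have : fcst resd a = 0 by apply/fcst_eq0; exists 1; rewrite mul1r idpE; split=> //; exact: lden1.
  rewrite -E => /(congr1 (fun y => v * y)); rewrite mulr0 mulrA (mulrC v) sv mul1r.
  exact.
have [w aw] := fcst_unit (L := resd) na.
exists (w * fcst resd s); change ((w * fcst resd s) * (x : frac resd) = 1).
by rewrite -mulrA E mulrC aw.
Qed.

Definition resf_inv (x : resf) : resf :=
  if pselect (x != 0) is left h then sval (cid (resf_unit h)) else 0.

Fact resf_mulV (x : resf) : x != 0 -> resf_inv x * x = 1.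
Proof. by rewrite /resf_inv; case: pselect => // h _; case: (cid _). Qed.

Fact resf_inv0 : resf_inv 0 = 0.
Proof. by rewrite /resf_inv; case: pselect => // h; case/eqP: (h). Qed.

HB.instance Definition _ := GRing.ComNzRing_isField.Build resf resf_mulV resf_inv0.

Definition tores : {rmorphism R -> resf} := fcst resd.

Lemma tores_eq0 a : tores a = 0 <-> sval P a.
Proof.
split=> [/(@fcst_eq0 _ resd)[u [nu]]|Pa].
  rewrite idpE => Pua; case: (svalP P) => _ _ _ _ /(_ _ _ Pua)[]//.
by apply/(@fcst_eq0 _ resd); exists 1; rewrite mul1r idpE; split=> //; exact: lden1.
Qed.

End ResidueField.
Global Opaque tores.

Lemma mk_ideal (R : comPzRingType) (S : set R) :
  S 0 -> (forall a b, S a -> S b -> S (a + b)) -> (forall a b, S b -> S (a * b)) ->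
  exists J : ideal R, forall x, J x <-> S x.
Proof. by move=> S0 SD SM; exists (Ideal S0 SD SM). Qed.

Section PolyPrimes.
Variables (A : comNzRingType).
Implicit Types (G H : {poly A}) (p : primes A).

Lemma map_res0 p G : map_poly (tores p) G = 0 <-> forall i, sval p G`_i.
Proof.
split=> [E i|H]; first by apply/tores_eq0; rewrite -coef_map E coef0.
by apply/polyP => i; rewrite coef_map coef0; apply/tores_eq0.
Qed.

Lemma prime_extend p : prime_ideal [set G : {poly A} | map_poly (tores p) G = 0].
Proof.
split=> [|a b|a b||a b] /=.
- by rewrite rmorph0.
- by rewrite rmorphD /= => -> ->; rewrite addr0.
- by rewrite rmorphM /= => ->; rewrite mulr0.
- by rewrite rmorph1 => /eqP; rewrite oner_eq0.
- by rewrite rmorphM => /eqP; rewrite mulf_eq0 => /orP[]/eqP; [left|right].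
Qed.

(** Among the elements of J that are nonzero modulo p, one of least degree after reduction is
    truncated at that degree: the removed terms vanish modulo p, so they belong to J. *)
Lemma min_poly p (J : ideal {poly A}) :
  (forall G, map_poly (tores p) G = 0 -> J G) ->
  (exists G, J G /\ map_poly (tores p) G <> 0) ->
  exists G, [/\ J G, ~ sval p (lead_coef G), G != 0 &
    forall H, J H -> map_poly (tores p) H <> 0 -> (size G <= size (map_poly (tores p) H))%N].
Proof.
move=> pJ [G0 [JG0 nG0]].
have [|m [[G [JG nG Em]] mm]] := @nat_min (fun m => exists G,
  [/\ J G, map_poly (tores p) G <> 0 & size (map_poly (tores p) G) = m]).
  by exists (size (map_poly (tores p) G0)), G0.
pose T := take_poly m G.
have ET : map_poly (tores p) T = map_poly (tores p) G.
  apply/polyP => i; rewrite !coef_map coef_take_poly; case: ltnP => // mi.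
  have E0 : tores p G`_i = 0 by rewrite -coef_map; apply: nth_default; rewrite Em.
  by rewrite raddf0; apply/esym; exact: E0.
have JT : J T.
  apply: (idealBDr (b := G)) => //; apply: pJ.
  by rewrite rmorphB /= ET subrr.
have sT : size T = m.
  apply/eqP; rewrite eqn_leq size_take_poly /= -Em -ET; exact: size_poly.
have m0 : (0 < m)%N by rewrite -Em size_poly_gt0; apply/eqP.
exists T; split=> //.
- move/tores_eq0; rewrite lead_coefE sT -coef_map ET -Em => /eqP.
  by rewrite -lead_coefE lead_coef_eq0 => /eqP.
- by rewrite -size_poly_gt0 sT.
- by move=> H JH nH; rewrite sT; apply: mm; exists H.
Qed.

Lemma pseudo_div G H : H != 0 -> exists e Q R,
  (lead_coef H ^+ e)%:P * G = Q * H + R /\ (size R < size H)%N.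
Proof.
move=> H0; exists (Pdiv.Ring.rscalp G H), (Pdiv.Ring.rdivp G H), (Pdiv.Ring.rmodp G H).
split; last by rewrite Pdiv.Ring.ltn_rmodp.
by rewrite mul_polyC Pdiv.ComRing.rdivp_eq.
Qed.

Lemma res_lead p G : ~ sval p (lead_coef G) -> size (map_poly (tores p) G) = size G.
Proof.
move=> H; apply/eqP; rewrite eqn_leq size_poly leqNgt; apply/negP => lt.
apply: H; apply/tores_eq0; rewrite lead_coefE -coef_map; apply: nth_default.
by rewrite -ltnS prednK // (leq_ltn_trans _ lt).
Qed.

(* Chevalley's theorem for A -> A[X]: a is the product of the leading
   coefficient of a minimal relation and of a nonzero constant in q + (v). *)
Lemma chevalley_poly (q : primes {poly A}) v : ~ sval q v ->
  exists a, ~ sval q a%:P /\ forall n : primes A,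
    (forall c, sval q c%:P -> sval n c) -> ~ sval n a ->
    exists q' : primes {poly A}, [/\ sval q `<=` sval q',
      forall c, sval q' c%:P <-> sval n c & ~ sval q' v].
Proof.
move=> nv; pose p : primes A := exist _ _ (prime_preim (polyC : {rmorphism _ -> _}) (svalP q)).
have pE c : sval p c <-> sval q c%:P by [].
pose J := idp (svalP q); have JE G : J G = sval q G by exact: idpE.
have pJ G : map_poly (tores p) G = 0 -> J G.
  move/map_res0 => H; rewrite -[G]coefK poly_def; apply: ideal_sum => i _.
  by rewrite -mul_polyC; apply: idealMr; rewrite JE; exact: H.
have ncst c : ~ sval p c -> ~ J c%:P by rewrite JE.
(* If q contains nothing beyond the extension of its contraction p, a coefficient of v outside p
   serves as a. *)
have [ex|nex] := pselect (exists G, J G /\ map_poly (tores p) G <> 0); last first.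
  have [i ni] : exists i, ~ sval p v`_i.
    apply: contrapT => H; apply: nv; rewrite -JE; apply/pJ/map_res0 => i.
    by apply: contrapT => ni; apply: H; exists i.
  exists v`_i; split=> // n pn na; exists (exist _ _ (prime_extend n)); split=> /=.
  - move=> G qG; apply/map_res0 => j; apply: pn.
    have [E|E] := pselect (map_poly (tores p) G = 0); first by move/map_res0: E => /(_ j).
    by case: nex; exists G; rewrite JE.
  - move=> c; split=> [/map_res0/(_ 0%N)|nc]; first by rewrite coefC.
    by apply/map_res0 => j; rewrite coefC; case: ifP => // _; rewrite -(idpE (svalP n)); exact: ideal0.
  - by move/map_res0/(_ i).
have [G [JG lG G0 minG]] := min_poly pJ ex.
have sG : (1 < size G)%N.
  rewrite ltnNge; apply/negP => /size1_polyC E; apply: (ncst (lead_coef G)) => //.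
  by rewrite E lead_coefC -E.
have [|||Jv JvE] := @mk_ideal _ [set H | exists Y Z, J Y /\ H = Y + Z * v].
- by exists 0, 0; rewrite mul0r addr0; split=> //; exact: ideal0.
- move=> a b [Y [Z [JY ->]]] [Y' [Z' [JY' ->]]]; exists (Y + Y'), (Z + Z').
    by split; [exact: idealD|ring].
- move=> a b [Y [Z [JY ->]]]; exists (a * Y), (a * Z).
    by split; [exact: idealM|ring].
have JJv H : J H -> Jv H by move=> JH; apply/JvE; exists H, 0; rewrite mul0r addr0.
have Jvv : Jv v by apply/JvE; exists 0, 1; rewrite mul1r add0r; split=> //; exact: ideal0.
have [||H [JH lH H0 minH]] := @min_poly p Jv.
- by move=> H /pJ/JJv.
- exists G; split; first exact: JJv.
  by move=> E; apply: lG; rewrite lead_coefE; move/map_res0: E.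
have small (I : ideal {poly A}) (T R : {poly A}) :
    (forall H, I H -> map_poly (tores p) H <> 0 -> (size T <= size (map_poly (tores p) H))%N) ->
    I R -> (size R < size T)%N -> map_poly (tores p) R = 0.
  move=> mT IR lt; apply: contrapT => nz; have := mT _ IR nz; apply/negP.
  by rewrite -ltnNge (leq_ltn_trans _ lt) // size_poly.
have nX (n : primes A) e c : ~ sval n c -> ~ sval n (c ^+ e) by move=> nc nce; apply: nc; apply: (@primeX _ (sval n) _ e) => //; exact: svalP n.
(* H is not in q, since dividing v by H would then put v in q. If H had positive degree, dividing G
   by H would give a quotient in q of smaller degree than G and nonzero modulo p. *)
have sH : size H = 1%N.
  apply/eqP; rewrite eqn_leq size_poly_gt0 H0 andbT leqNgt; apply/negP => gtH.
  have JH' : ~ J H.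
    have [e [Q [R [E sR]]]] := pseudo_div v H0 => JH'.
    have JR : J R.
      apply: pJ; apply: (small Jv H) => //.
      have -> : R = (lead_coef H ^+ e)%:P * v - Q * H by rewrite E; ring.
      by apply: idealB; [exact: idealM|exact/JJv/idealM].
    have : J ((lead_coef H ^+ e)%:P * v) by rewrite E; apply: idealD => //; exact: idealM.
    by rewrite JE; case: (svalP q) => _ _ _ _ /[apply] -[] //; exact: (nX p e _ lH).
  have [e [Q [R [E sR]]]] := pseudo_div G H0.
  have R0 : map_poly (tores p) R = 0.
    apply: (small Jv H) => //; have -> : R = (lead_coef H ^+ e)%:P * G - Q * H by rewrite E; ring.
    by apply: idealB; [exact/JJv/idealM|exact: idealM].
  have JQH : J (Q * H).
    have -> : Q * H = (lead_coef H ^+ e)%:P * G - R by rewrite E; ring.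
    by apply: idealB; [exact: idealM|exact: pJ].
  have JQ : J Q by move: JQH JH'; rewrite !JE; case: (svalP q) => _ _ _ _ /[apply] -[].
  have := congr1 (map_poly (tores p)) E; rewrite rmorphD !rmorphM /= R0 addr0 /= map_polyC /= => E'.
  have ce : tores p (lead_coef H ^+ e) != 0 by apply/eqP => /tores_eq0; exact: (nX p e _ lH).
  have sE : size G = (size (map_poly (tores p) Q) + size H).-1.
    rewrite -(res_lead lG) -(res_lead lH) -size_proper_mul ?mulf_neq0 ?lead_coef_eq0 //; first last.
    - by rewrite -size_poly_gt0 res_lead // size_poly_gt0.
    - apply/eqP => Q0; move/eqP: E'; rewrite Q0 mul0r mulf_eq0 polyC_eq0 (negPf ce) /=.
      by rewrite -size_poly_eq0 res_lead // size_poly_eq0 (negPf G0).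
    by rewrite -E' mul_polyC size_scale.
  have nQ : map_poly (tores p) Q <> 0.
    move=> Q0; move/eqP: E'; rewrite Q0 mul0r mulf_eq0 polyC_eq0 (negPf ce) /=.
    by rewrite -size_poly_eq0 res_lead // size_poly_eq0 (negPf G0).
  have := minG _ JQ nQ; rewrite sE; move: gtH.
  case: (size H) => [|[|h]] // _; rewrite addnS /= addnS ltnNge leq_addr //.
set c0 := lead_coef H in lH; have HE : H = c0%:P by rewrite [LHS](size1_polyC (eq_leq sH)) /c0 lead_coefE sH.
set c := lead_coef G in lG; exists (c * c0); split.
  by rewrite -pE; case: (svalP p) => _ _ _ _ pm /pm[].
move=> n pn ncc; have nc := primeMl ncc; have nc0 := primeMr ncc.
have [|||Jn JnE] := @mk_ideal _ [set H | exists Y Z, [/\ J Y, map_poly (tores n) Z = 0 & H = Y + Z]].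
- by exists 0, 0; rewrite addr0 rmorph0; split=> //; exact: ideal0.
- move=> a b [Y [Z [JY nZ ->]]] [Y' [Z' [JY' nZ' ->]]]; exists (Y + Y'), (Z + Z').
    by split; [exact: idealD|rewrite rmorphD /= nZ nZ' addr0|ring].
- move=> a b [Y [Z [JY nZ ->]]]; exists (a * Y), (a * Z).
    by split; [exact: idealM|rewrite rmorphM /= nZ mulr0|ring].
(* A prime containing q and the extension of n, and meeting A in n only. It exists because division
   by G, whose leading coefficient is outside n, shows that the constants in q + n A[X] lie in n. *)
have [|_ _ [s ns <-] [t nt <-]|_ /JnE[Y [Z [JY nZ ->]]] [s ns Es]|Q [pQ JQ' nQ]] :=
  @prime_exists _ Jn [set s%:P | s in [set s | ~ sval n s]].
- by exists 1 => //; exact: prime1.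
- by exists (s * t); [exact: primeM|rewrite polyCM].
- have [e [Q [R [E sR]]]] := pseudo_div Y G0.
  have R0 : map_poly (tores p) R = 0.
    apply: (small J G) => //; have -> : R = (lead_coef G ^+ e)%:P * Y - Q * G by rewrite E; ring.
    by apply: idealB; exact: idealM.
  have R0' : map_poly (tores n) R = 0.
    by apply/map_res0 => i; apply: pn; move/map_res0: R0; apply.
  have := congr1 (map_poly (tores n)) E; rewrite rmorphD !rmorphM /= R0' addr0 /= map_polyC /=.
  have -> : map_poly (tores n) Y = (tores n s)%:P.
    by have := congr1 (map_poly (tores n)) Es; rewrite rmorphD /= nZ addr0 /= map_polyC.
  rewrite -polyCM -rmorphM => E'.
  have : tores n (c ^+ e * s) != 0 by apply/eqP => /tores_eq0; apply: primeM => //; exact: nX.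
  rewrite -(polyC_eq0 (tores n _)) E' mulf_eq0 negb_or => /andP[Q0 GG0].
  have := size_polyC (tores n (c ^+ e * s)); rewrite E' size_mul // (res_lead nc).
  move: Q0; rewrite -size_poly_gt0; case: (size _) => // j _ /=.
  by case: (size G) sG => [|[|g]] // _; rewrite !addnS /=; case: (_ != 0).
- have JQ Y Z : J Y -> map_poly (tores n) Z = 0 -> Q (Y + Z).
    by move=> JY nZ; apply: JQ'; apply/JnE; exists Y, Z.
  exists (exist _ Q pQ); split=> /=.
  + by move=> Y qY; rewrite -(addr0 Y); apply: JQ; rewrite ?JE ?rmorph0.
  + move=> a; split=> [Qa|na].
      by apply: contrapT => na; apply: (nQ _ Qa); exists a.
    rewrite -(add0r a%:P); apply: JQ; first exact: ideal0.
    rewrite map_polyC /=.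
    by apply/eqP; rewrite polyC_eq0; apply/eqP/tores_eq0.
  + move=> Qv; apply: (nQ H); last by exists c0.
    case/JvE: JH => Y [Z [JY ->]]; case: pQ => _ QD QM _ _; apply: QD; last exact: QM.
    by rewrite -(addr0 Y); apply: JQ; rewrite ?rmorph0.
Qed.

End PolyPrimes.

(** Chevalley's theorem, for the closed set defined by q minus the zeros of v: its image contains a
    neighbourhood of the contraction of q in the closure of that point. *)
Definition chev (A R : comNzRingType) (f : {rmorphism A -> R}) : Prop :=
  forall (q : primes R) v, ~ sval q v -> exists a, ~ sval q (f a) /\
    forall n : primes A, (forall c, sval q (f c) -> sval n c) -> ~ sval n a ->
    exists q' : primes R, [/\ sval q `<=` sval q',
      forall c, sval q' (f c) <-> sval n c & ~ sval q' v].

Lemma prime_image (R S : comPzRingType) (g : {rmorphism R -> S}) (q : set R) :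
  (forall y, exists x, g x = y) -> prime_ideal q -> (forall x, g x = 0 -> q x) ->
  exists Q : primes S, forall x, sval Q (g x) <-> q x.
Proof.
move=> gs [q0 qD qM q1 qm] gq.
have E x y : g x = g y -> q x -> q y.
  move=> Exy qx; rewrite -(subrK x y); apply: qD => //; apply: gq.
  by rewrite rmorphB Exy subrr.
have pQ : prime_ideal (g @` q).
  split=> [|_ _ [x qx <-] [y qy <-]|a _ [y qy <-]|[x qx]|a b [x qx]].
  - by exists 0; rewrite ?rmorph0.
  - by exists (x + y); [exact: qD|rewrite rmorphD].
  - by have [x <-] := gs a; exists (x * y); [exact: qM|rewrite rmorphM].
  - by rewrite -(rmorph1 g) => /E /(_ qx).
  - have [x' <-] := gs a; have [y' <-] := gs b; rewrite -rmorphM => /E /(_ qx)/qm.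
    by case=> h; [left; exists x'|right; exists y'].
exists (exist _ _ pQ) => x /=; split=> [[y qy /E]|qx]; first exact.
by exists x.
Qed.

Lemma chev_mp (A : comNzRingType) n : chev (mpc n A).
Proof.
apply: (@mp_closed A (fun S f => chev f)).
- by move=> q v nv; exists v; split=> // n' qn nv'; exists n'.
- move=> S f Cf q v nv; have [b [nb Hb]] := chevalley_poly nv.
  pose qS : primes S := exist _ _ (prime_preim (polyC : {rmorphism _ -> _}) (svalP q)).
  have [a [na Ha]] := Cf qS b nb; exists a; split=> // n' qn nn.
  have [q1 [q1s q1n q1b]] := Ha n' qn nn.
  have [q2 [q2s q2n q2v]] := Hb q1 q1s q1b.
  by exists q2; split=> // c; rewrite -q1n -q2n.
- move=> S S' f g gs Cf q v nv; have [w Ew] := gs v.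
  pose qS : primes S := exist _ _ (prime_preim g (svalP q)).
  have [|a [na Ha]] := Cf qS w; first by rewrite /= Ew.
  exists a; split=> // n' qn nn; have [q1 [q1s q1n q1w]] := Ha n' qn nn.
  have [|Q HQ] := prime_image gs (svalP q1).
    by move=> x E; apply: q1s; rewrite /= E -(idpE (svalP q)); exact: ideal0.
  exists Q; split=> [y|c|].
  + by have [x <-] := gs y => qx; apply/HQ/q1s.
  + by rewrite -q1n; exact: HQ.
  + by rewrite -Ew HQ.
Qed.

(** The Nullstellensatz in the form used to pass from points to k-points: where v does not vanish
    identically, it is nonzero at some k-point. *)
Definition nullst (k : fieldType) (R : comNzRingType) (f : {rmorphism k -> R}) : Prop :=
  forall (q : primes R) v, ~ sval q v -> exists xi : {rmorphism R -> k},
    [/\ forall c, xi (f c) = c, forall x, sval q x -> xi x = 0 & xi v != 0].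

Lemma ker_prime (k : fieldType) (R : comPzRingType) (xi : {rmorphism R -> k}) :
  prime_ideal [set x | xi x = 0].
Proof.
split=> [|a b|a b||a b] /=.
- by rewrite rmorph0.
- by rewrite rmorphD => -> ->; rewrite addr0.
- by rewrite rmorphM => ->; rewrite mulr0.
- by rewrite rmorph1 => /eqP; rewrite oner_eq0.
- by rewrite rmorphM => /eqP; rewrite mulf_eq0 => /orP[]/eqP; [left|right].
Qed.

(** An element of least degree in a nonzero q has a root z, and q then consists of the polynomials
    vanishing at z. If q is zero, any point where v does not vanish is suitable. *)
Lemma closed_point (k : closedFieldType) (q : primes {poly k}) v : ~ sval q v ->
  exists z : k, (forall P, sval q P -> P.[z] = 0) /\ v.[z] != 0.
Proof.
move=> nv; have J := svalP q.
have [[P [qP P0]]|H] := pselect (exists P, sval q P /\ P != 0); last first.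
  have /closed_nonrootP[z nz] : v != 0.
    by apply/eqP => v0; apply: nv; rewrite v0 -(idpE J); exact: ideal0.
  exists z; split=> // P qP; apply/eqP; rewrite -/(root P z).
  have -> : P = 0 by apply/eqP; apply: contrapT => P0; apply: H; exists P; split=> //; exact/negP.
  exact: root0.
have [|m [[T [qT T0 Em]] mm]] := @nat_min (fun m => exists T, [/\ sval q T, T != 0 & size T = m]).
  by exists (size P), P.
have cst (c : k) : sval q c%:P -> c = 0.
  move=> qc; apply/eqP/negP => c0; apply: (@prime1 _ q); rewrite -(idpE J).
  rewrite -polyC1 -(mulVf (introN idP c0)) polyCM; apply: idealM; by rewrite idpE.
have /closed_rootP[z /factor_theorem[S ES]] : size T != 1%N.
  apply/eqP => /eqP/size_poly1P[c c0 ET]; move/eqP: c0; apply; apply: cst.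
  by rewrite -ET.
have qz : sval q ('X - z%:P).
  case: J => _ _ _ _ qm; move: qT; rewrite ES => /qm[] // qS.
  have S0 : S != 0 by apply: contraNneq T0 => S0; rewrite ES S0 mul0r.
  have /mm : exists T, [/\ sval q T, T != 0 & size T = size S] by exists S.
  by rewrite -Em ES size_Mmonic ?monicXsubC // size_XsubC addn2 /= ltnn.
have qE Q : sval q Q <-> Q.[z] = 0.
  have /factor_theorem[S' ES'] : root (Q - Q.[z]%:P) z by rewrite /root hornerD hornerN hornerC subrr.
  have qd : sval q (Q - Q.[z]%:P).
    by rewrite ES' -(idpE J); apply: idealM; rewrite idpE.
  split=> [qQ|Q0]; last by move: qd; rewrite Q0 subr0.
  apply: cst; rewrite -[_%:P](subKr Q) -(idpE J); apply: idealB; by rewrite idpE.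
exists z; split=> [Q /qE//|]; apply/eqP => /qE; exact: nv.
Qed.

(** When a variable is added, [chevalley_poly] yields a function b on the base to be kept nonzero;
    over a k-point with b nonzero the fibre is a prime of k[X] not containing v, and [closed_point]
    applies. *)
Lemma nullst_mp (k : closedFieldType) n : nullst (mpc n k).
Proof.
apply: (@mp_closed k (fun S f => nullst f)).
- move=> q v nv; exists idfun; split=> // [x qx|].
    apply/eqP/negP => /negP x0; apply: (@prime1 _ q); rewrite -(idpE (svalP q)).
    by rewrite -(mulVf x0); apply: idealM; rewrite idpE.
  by apply/eqP => v0; apply: nv; rewrite /= in v0; rewrite v0 -(idpE (svalP q)); exact: ideal0.
- move=> S f Nf q v nv; have [b [nb Hb]] := chevalley_poly nv.
  pose qS : primes S := exist _ _ (prime_preim (polyC : {rmorphism _ -> _}) (svalP q)).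
  have [xi [xif xiq xib]] := Nf qS b nb.
  pose ker : primes S := exist _ _ (ker_prime xi).
  have [//||q' [qq' q'n q'v]] := Hb ker; first exact/eqP.
  have gs (P : {poly k}) : exists Q, map_poly xi Q = P.
    by exists (map_poly f P); apply/polyP => i; rewrite !coef_map /= xif.
  have [|Q HQ] := prime_image gs (svalP q').
    move=> P /polyP P0; rewrite -[P]coefK poly_def -(idpE (svalP q')).
    apply: ideal_sum => i _; rewrite -mul_polyC; apply: idealMr; rewrite idpE.
    by apply/q'n => /=; rewrite -coef_map P0 coef0.
  have [|z [Qz vz]] := @closed_point k Q (map_poly xi v); first by rewrite HQ.
  pose ev : {rmorphism {poly S} -> k} := horner_eval z \o (map_poly xi : {rmorphism _ -> _}).
  exists ev; split=> //.
  + by move=> c; rewrite /ev /= map_polyC /= /horner_eval hornerC xif.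
  + by move=> x qx; apply: Qz; apply/HQ/qq'.
- move=> S S' f g gs Nf q v nv; have [w Ew] := gs v.
  pose qS : primes S := exist _ _ (prime_preim g (svalP q)).
  have [|xi [xif xiq xiw]] := Nf qS w; first by rewrite /= Ew.
  have kerg x : g x = 0 -> xi x = 0.
    by move=> E; apply: xiq; rewrite /= E -(idpE (svalP q)); exact: ideal0.
  have /choice[h gh] := gs.
  have hB x : xi (h (g x)) = xi x.
    by apply/eqP; rewrite -subr_eq0 -rmorphB; apply/eqP/kerg; rewrite rmorphB gh subrr.
  have zm : zmod_morphism (xi \o h).
    move=> x y; have [x' <-] := gs x; have [y' <-] := gs y.
    by rewrite /= -rmorphB !hB rmorphB.
  have mm : monoid_morphism (xi \o h).
    split; first by rewrite /= -(rmorph1 g) hB rmorph1.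
    move=> x y; have [x' <-] := gs x; have [y' <-] := gs y.
    by rewrite /= -rmorphM !hB rmorphM.
  pose H1 := GRing.isZmodMorphism.Build _ _ (xi \o h) zm.
  pose H2 := GRing.isMonoidMorphism.Build _ _ (xi \o h) mm.
  pose xi' : {rmorphism S' -> k} := HB.pack (xi \o h) H1 H2.
  exists xi'; split=> [c|x qx|] /=; first by rewrite hB xif.
    by apply: xiq; rewrite /= gh.
  by rewrite -Ew hB.
Qed.

(** * Smooth algebras: flatness, fibres, openness and localization *)

Section MpCoef.
Variables (n : nat) (A L : comNzRingType) (iota : {rmorphism A -> L}).

Definition mpcf (m : mpoly.multinom n) (p : mp n A) : A := mpoly.mcoeff m p.

Definition mpX (m : mpoly.multinom n) : mp n A := mpoly.mpolyX A m.

Lemma mpcfD m p q : mpcf m (p + q) = mpcf m p + mpcf m q.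
Proof. exact: mpoly.mcoeffD. Qed.

Lemma mpcf0 m : mpcf m 0 = 0.
Proof. exact: mpoly.mcoeff0. Qed.

Lemma mpcf_cst m c p : mpcf m (mpc n A c * p) = c * mpcf m p.
Proof. exact: mpoly.mcoeffCM. Qed.

Lemma mpE p : p = \sum_(m <- mpoly.msupp p) mpc n A (mpcf m p) * mpX m.
Proof.
rewrite [LHS]mpoly.mpolyE; apply: eq_bigr => m _.
by rewrite -mpoly.mul_mpolyC.
Qed.

Definition mpmap : {rmorphism mp n A -> mp n L} := mpoly.map_mpoly iota.

Lemma mpmapC c : mpmap (mpc n A c) = mpc n L (iota c).
Proof. by rewrite /mpmap /= mpoly.map_mpolyC. Qed.

Lemma mpmapX m : mpmap (mpX m) = mpoly.mpolyX L m.
Proof. exact: mpoly.map_mpolyX. Qed.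

Lemma mpmap_cf m p : mpoly.mcoeff m (mpmap p : mp n L) = iota (mpcf m p).
Proof. exact: mpoly.mcoeff_map_mpoly. Qed.

End MpCoef.
Global Opaque mpc mpmap mev.

Section Image.
Variables (k A : comNzRingType) (kap : {rmorphism k -> A}) (n : nat) (G : seq A).

(** Its image is the polynomial ring over the k-subalgebra of A generated by G. Finitely many
    elements of A[z] thus come from a Noetherian ring over k. *)
Definition gens_ev : {rmorphism mp (size G + n) k -> mp n A} :=
  mev (mpc n A \o kap)
    (fun i => match fintype.split i with inl j => mpc n A G`_j | inr j => mpv A j end).

Lemma gens_evC c : gens_ev (mpc _ _ c) = mpc n A (kap c).
Proof. by rewrite /gens_ev mevC. Qed.

Lemma gens_evV i : gens_ev (mpv k i) =
  match fintype.split i with inl j => mpc n A G`_j | inr j => mpv A j end.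
Proof. by rewrite /gens_ev mevV. Qed.

Definition genby (q : mp n A) := exists P, gens_ev P = q.

Lemma genbyD p q : genby p -> genby q -> genby (p + q).
Proof. by move=> [P <-] [Q <-]; exists (P + Q); rewrite rmorphD. Qed.

Lemma genbyM p q : genby p -> genby q -> genby (p * q).
Proof. by move=> [P <-] [Q <-]; exists (P * Q); rewrite rmorphM. Qed.

Lemma genby_cst c : genby (mpc n A (kap c)).
Proof. by exists (mpc _ _ c); rewrite /gens_ev mevC. Qed.

Lemma genby_gen a : a \in G -> genby (mpc n A a).
Proof.
move=> aG; have iG : (index a G < size G)%N by rewrite index_mem.
exists (mpv k (lshift n (Ordinal iG))).
by rewrite /gens_ev mevV (unsplitK (inl _)) /= nth_index.
Qed.

Lemma genby_var i : genby (mpv A i).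
Proof. by exists (mpv k (rshift (size G) i)); rewrite /gens_ev mevV (unsplitK (inr _)). Qed.

Lemma genby1 : genby 1.
Proof. by exists 1; rewrite rmorph1. Qed.

Lemma genby_X m : genby (mpX A m).
Proof.
rewrite /mpX mpoly.mpolyXE_id; apply: big_ind => [||i _]; [exact: genby1|exact: genbyM|].
by elim: (m i) => [|j IH]; rewrite ?expr0 ?exprS; [exact: genby1|apply: genbyM => //; exact: genby_var].
Qed.

Lemma genby_coef q : (forall m, m \in mpoly.msupp q -> mpcf m q \in G) -> genby q.
Proof.
move=> H; rewrite [q]mpE big_seq; apply: big_ind => [||m mq].
- by exists 0; rewrite rmorph0.
- exact: genbyD.
- by apply: genbyM; [exact/genby_gen/H|exact: genby_X].
Qed.

End Image.
Global Opaque gens_ev.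

Lemma genby_list (k A : comNzRingType) (kap : {rmorphism k -> A}) n (Q : seq (mp n A)) :
  exists G, forall q, q \in Q -> genby kap G q.
Proof.
exists (flatten [seq [seq mpcf m q | m <- mpoly.msupp q] | q <- Q]) => q qQ.
apply: genby_coef => m mq; apply/flatten_mapP; exists q => //.
by apply/mapP; exists m.
Qed.

Fixpoint rm_iter (R : comPzRingType) (f : {rmorphism R -> R}) N : {rmorphism R -> R} :=
  if N is M.+1 then rm_iter f M \o f else idfun.

(* If A[z]/(r) is smooth over A, then an element m of an A-module L/N which dies
   in the base change to A[z]/(r) is killed by a polynomial congruent to 1
   modulo (r): by iterating the Newton substitution, m is divisible by all
   powers of (r), and Krull's theorem applies. *)
Section Flat.
Variables (k : fieldType) (A : comNzRingType) (kap : {rmorphism k -> A}).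
Variables (n : nat) (r : seq (mp n A)) (th : {rmorphism mp n A -> mp n A}).
Hypothesis thC : forall c, th (mpc n A c) = mpc n A c.

Definition sqgen : set (mp n A) := [set z | exists x y, [/\ x \in r, y \in r & z = x * y]].

Hypothesis thr : forall p, p \in r -> span sqgen (th p).
Variables (L : comNzRingType) (iota : {rmorphism A -> L}) (N : set L).
Hypothesis N0 : N 0.
Hypothesis ND : forall x y, N x -> N y -> N (x + y).
Hypothesis NM : forall a x, N x -> N (iota a * x).

Let K : set (mp n L) := [set q | forall m, N (mpcf m q)].
Let im := mpmap n iota.

Let K0 : K 0. Proof. by move=> m; rewrite mpcf0. Qed.
Let KD x y : K x -> K y -> K (x + y).
Proof. by move=> Kx Ky m; rewrite mpcfD; apply: ND. Qed.

Let KM p x : K x -> K (im p * x).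
Proof.
move=> Kx m; rewrite /mpcf mpoly.mcoeffM; apply: big_ind => // -[m1 m2] /= _.
by rewrite mpmap_cf; apply: NM; exact: Kx.
Qed.

Let thL : {rmorphism mp n L -> mp n L} := mev (mpc n L) (fun i => im (th (mpv A i))).

Let thL_im p : thL (im p) = im (th p).
Proof.
apply: (@mp_hom_eq _ _ _ (thL \o im) (im \o th)) => [c|i] /=.
  by rewrite thC /im mpmapC /thL mevC.
by rewrite /im mpmapX /thL mevV.
Qed.

Let thL_K q : K q -> K (thL q).
Proof.
move=> Kq; rewrite [q]mpE rmorph_sum; apply: big_ind => // m _.
rewrite rmorphM -[mpX L m]/(mpoly.mpolyX L m) -(mpmapX iota) thL_im /thL mevC => m'.
rewrite mpcf_cst mulrC /mpcf mpmap_cf; apply: NM; exact: Kq.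
Qed.

Lemma flat m nu : K nu -> span_seq (map im r) (mpc n L m - nu) ->
  exists p, span_seq r (1 - p) /\ forall a, N (iota (mpcf a p) * m).
Proof.
move=> Knu /spanP[l0 [l0r El0]].
have [l [lr El]] : exists l : seq (L * (mp n A * mp n A)),
    (forall w, w \in l -> w.2.2 \in r) /\
    mpc n L m - nu = \sum_(w <- l) mpc n L w.1 * im (w.2.1 * w.2.2).
  rewrite El0; elim: l0 l0r {El0} => [|p l0 IH] l0r; first by exists [::]; rewrite !big_nil.
  have [|l [lr El]] := IH; first by move=> q ql; apply: l0r; rewrite inE ql orbT.
  have /mapP[x xr Ex] : p.2 \in map im r by apply: l0r; rewrite inE eqxx.
  exists ([seq (mpcf a p.1, (mpX A a, x)) | a <- mpoly.msupp p.1] ++ l); split.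
    by move=> w; rewrite mem_cat => /orP[/mapP[a _ ->]//|/lr].
  rewrite big_cons big_cat /= El; congr (_ + _); rewrite big_map Ex {1}[p.1]mpE mulr_suml.
  by apply: eq_bigr => a _; rewrite rmorphM mulrA /im mpmapX.
have /choice[Lp HLp] : forall p, exists Lp : seq (mp n A * mp n A), p \in r ->
    (forall u, u \in Lp -> sqgen u.2) /\ th p = \sum_(u <- Lp) u.1 * u.2.
  move=> p; have [/thr/spanP[Lp HLp]|_] := boolP (p \in r); first by exists Lp.
  by exists [::].
(* All the polynomials involved are defined over one finitely generated subalgebra, where Krull's
   theorem is available. *)
have [G HG] := genby_list kap (r ++ [seq th (mpv A i) | i <- enum 'I_n] ++
  flatten [seq [seq u.1 | u <- Lp p] | p <- r] ++ [seq w.2.1 | w <- l]).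
have Gr p : p \in r -> genby kap G p by move=> pr; apply: HG; rewrite mem_cat pr.
have Gth i : genby kap G (th (mpv A i)).
  apply: HG; rewrite !mem_cat; apply/or4P/Or42/mapP; exists i => //; exact: mem_enum.
have Gl w : w \in l -> genby kap G w.2.1.
  by move=> wl; apply: HG; rewrite !mem_cat; apply/or4P/Or44/mapP; exists w.
have GLp p u : p \in r -> u \in Lp p -> genby kap G u.1.
  move=> pr uL; apply: HG; rewrite !mem_cat; apply/or4P/Or43/flatten_mapP.
  by exists p => //; apply/mapP; exists u.
have Gt q : genby kap G q -> genby kap G (th q).
  move=> [P <-]; elim/mp_ind: P => [c|i|P Q IP IQ|P Q IP IQ].
  - by rewrite gens_evC /= thC; exact: genby_cst.
  - rewrite gens_evV; case: fintype.split => j; last exact: Gth.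
    by rewrite thC; apply: genby_gen; exact: mem_nth.
  - by rewrite !rmorphD; apply: genbyD.
  - by rewrite !rmorphM; apply: genbyM.
have GtN M q : genby kap G q -> genby kap G (rm_iter th M q).
  by elim: M q => //= M IH q /Gt/IH.
pose rho := gens_ev kap n G.
have /choice[rt Hrt] : forall i : 'I_(size r), exists P, rho P = r`_i.
  by move=> i; apply: Gr; exact: mem_nth.
(* Each application of [th] squares the ideal of relations; the exponent M + 1 instead of 2^M is
   enough. *)
have rN M x : x \in r -> exists c, ipow (range rt) M.+1 c /\ rho c = rm_iter th M x.
  elim: M x => [|M IH] x xr /=.
    have ix : (index x r < size r)%N by rewrite index_mem.
    exists (rt (Ordinal ix)); rewrite Hrt /= nth_index //; split=> //.
    by apply: ipow1; exists (Ordinal ix).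
  have [Lsq ->] := HLp x xr; rewrite rmorph_sum.
  have Lg u : u \in Lp x -> genby kap G u.1 by exact: GLp.
  elim: (Lp x) Lsq Lg => [|u L' IHL] Lsq Lg.
    by exists 0; rewrite big_nil rmorph0; split=> //; exact: ip_0.
  have [||c [ic Ec]] := IHL.
  - by move=> u' u'L; apply: Lsq; rewrite inE u'L orbT.
  - by move=> u' u'L; apply: Lg; rewrite inE u'L orbT.
  have [x1 [y1 [x1r y1r Eu]]] : sqgen u.2 by apply: Lsq; rewrite inE eqxx.
  have [cx [icx Ecx]] := IH _ x1r; have [cy [icy Ecy]] := IH _ y1r.
  have [P EP] : genby kap G (rm_iter th M u.1) by apply/GtN/Lg; rewrite inE eqxx.
  exists (P * (cx * cy) + c); split.
    apply: ip_D => //; apply: ip_M; apply: (@ipow_leq _ _ _ (M.+1 + M.+1)).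
      by rewrite addSn ltnS leq_addl.
    exact: ipow_mul.
  by rewrite rmorphD !rmorphM big_cons Ec Ecx Ecy -/rho EP rmorphM Eu rmorphM.
have [||||i [/= si Ki]] := @krull k _ _ (size l) rt (mp n L) (im \o rho)
    (fun j => mpc n L (nth (0, (0, 0)) l j).1) K _ _ _ (mpc n L m) _; rewrite //.
- by move=> p x; exact: KM.
- move=> M; have /choice[c Hc] : forall j : 'I_(size l), exists c, ipow (range rt) M c /\
      rho c = rm_iter th M ((nth (0, (0, 0)) l j).2.1 * (nth (0, (0, 0)) l j).2.2).
    move=> j; set w := nth _ _ _; have wl : w \in l by exact: mem_nth.
    have [P EP] := GtN M _ (Gl _ wl); have [c [ic Ec]] := rN M _ (lr _ wl).
    exists (P * c); split; first by apply/ip_M/ipow_le.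
    by rewrite !rmorphM Ec -EP.
  exists c; split=> [j|]; first by case: (Hc j).
  have thN q : K q -> K (rm_iter thL M q).
    elim: (M) q => //= M' IH q Kq; exact/IH/thL_K.
  have thNC c' : rm_iter thL M (mpc n L c') = mpc n L c'.
    by elim: (M) => //= M' IH; rewrite /thL mevC.
  have thNim q : rm_iter thL M (im q) = im (rm_iter th M q).
    by elim: (M) q => //= M' IH q; rewrite thL_im IH.
  have := thN _ Knu; congr (K _).
  have -> : nu = mpc n L m - \sum_(w <- l) mpc n L w.1 * im (w.2.1 * w.2.2).
    by rewrite -El; ring.
  rewrite rmorphB rmorph_sum; congr (_ - _); first exact: thNC.
  rewrite (big_nth (0, (0, 0))) big_mkord; apply: eq_bigr => j _.
  rewrite [RHS]mulrC [LHS]rmorphM; congr (_ * _); first exact: thNC.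
  by apply: etrans (thNim _) _; rewrite /=; case: (Hc j) => _ ->.
exists (1 - rho i); split.
  have -> : 1 - (1 - rho i) = rho i by ring.
  move: si => /spanP[l' [l'r ->]]; rewrite rmorph_sum big_seq; apply: ideal_sum => u /l'r[j _ Ej].
  by rewrite rmorphM; apply/idealM/span_mem; rewrite -Ej Hrt /=; exact: mem_nth.
move=> a; have := Ki a; rewrite -(rmorph1 im) -rmorphB mulrC mpcf_cst.
by rewrite /mpcf mpmap_cf mulrC.
Qed.

End Flat.

Section Presentation.
Variables (A B : comNzRingType) (phi : {rmorphism A -> B}).

Lemma mveval_hom n (C C' : comPzRingType) (f : {rmorphism C -> C'}) (al : A -> C)
    (c : 'I_n -> C) (P : mvpoly A n) :
  f (mveval al c P) = mveval (f \o al) (f \o c) P.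
Proof.
rewrite /mveval rmorph_sum; apply: eq_bigr => m _; rewrite rmorphM rmorph_prod.
by congr (_ * _); apply: eq_bigr => i _; rewrite rmorphXn.
Qed.

Lemma mveval_ext n (C : comPzRingType) (al al' : A -> C) (c c' : 'I_n -> C) (P : mvpoly A n) :
  al =1 al' -> c =1 c' -> mveval al c P = mveval al' c' P.
Proof.
move=> E E'; apply: eq_bigr => m _; rewrite E; congr (_ * _).
by apply: eq_bigr => i _; rewrite E'.
Qed.

Lemma fp_newton u : finitely_presented phi -> infinitesimal_lifting phi u ->
  exists n (r : seq (mp n A)) (beta : {rmorphism mp n A -> B})
    (th : {rmorphism mp n A -> mp n A}),
  [/\ forall c, beta (mpc n A c) = phi c, forall b, exists p, beta p = b,
      forall p, beta p = 0 <-> span_seq r p, forall c, th (mpc n A c) = mpc n A c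
    & (forall p, p \in r -> span (sqgen r) (th p)) /\ forall p, span_seq r (th p - p)].
Proof.
move=> [n [b [r0 [r0b univ]]]] lift.
pose tp P := mveval (mpc n A) (fun i => mpv A i) P.
pose r := [seq tp P | P <- r0].
have [J JE] : exists J, J = span_seq r by exists (span_seq r).
pose beta := mev phi b.
have betaP P : beta (tp P) = mveval phi b P.
  rewrite /tp mveval_hom; apply: mveval_ext => [c|i] /=; first by rewrite /beta mevC.
  by rewrite /beta mevV.
have [|[gam [gamC gamV]] _] := univ (quo J) (toquo J \o mpc n A) (fun i => toquo J (mpv A i)).
  move=> P Pr; transitivity (toquo J (tp P)); first by rewrite /tp mveval_hom.
  by apply: toquo_kill; rewrite JE; apply/span_mem/mapP; exists P.
have gb p : gam (beta p) = toquo J p.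
  apply: (@mp_hom_eq _ _ _ (gam \o beta) (toquo J)) => [c|i] /=.
    by rewrite /beta mevC; exact: gamC.
  by rewrite /beta mevV gamV.
have bJ p : J p -> beta p = 0.
  rewrite JE => /spanP[l [lr ->]]; rewrite rmorph_sum big_seq big1 // => w /lr/mapP[P Pr E].
  by rewrite rmorphM E betaP r0b ?mulr0.
have [bb Hbb] := quo_lift bJ.
have [_ uniq] := univ B phi b r0b.
have bbK x : bb (gam x) = x.
  apply: (uniq (bb \o gam) idfun) => //; split=> [c|i] /=.
  - by have /= -> := gamC c; rewrite Hbb /beta mevC.
  - by rewrite gamV Hbb /beta mevV.
have [J2 J2E] : exists J2, J2 = span (sqgen r) by exists (span (sqgen r)).
have J2J x : J2 x -> J x.
  rewrite J2E JE; apply: span_min => _ [y [z [yr zr ->]]].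
  exact/idealM/span_mem.
have JJ2 x y : J x -> J y -> J2 (x * y).
  rewrite J2E JE => /spanP[l [lr ->]] /spanP[l' [lr' ->]]; rewrite big_distrlr /= big_seq.
  apply: ideal_sum => w wl; rewrite big_seq; apply: ideal_sum => w' wl'.
  rewrite mulrACA; apply/idealM/span_mem; exists w.2, w'.2; split=> //.
    exact: lr.
  exact: lr'.
have [pr [Hpr prs pr0]] := quo_proj J2J JJ2.
have [|[g [gC gp]] _] := lift (quo J2) (quo J) pr prs pr0 (toquo J2 \o mpc n A) gam.
  by move=> c /=; rewrite Hpr -gb /beta mevC.
have /choice[de Hde] : forall i, exists d, toquo J2 d = g (b i).
  by move=> i; exact: toquo_surj.
exists n, r, beta, (mev (mpc n A) de).
have thE p : toquo J2 (mev (mpc n A) de p) = g (beta p).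
  apply: (@mp_hom_eq _ _ _ (toquo J2 \o mev (mpc n A) de) (g \o beta)) => [c|i] /=.
    by rewrite /beta !mevC; exact/esym/gC.
  by rewrite /beta !mevV Hde.
split.
- by move=> c; rewrite /beta mevC.
- move=> x; have [p Ep] := toquo_surj (gam x); exists p.
  by rewrite -[RHS]bbK -Ep Hbb.
- move=> p; rewrite -JE; split=> [bp|/bJ//]; apply: toquo_mem.
  exact: etrans (esym (gb p)) (etrans (congr1 gam bp) (rmorph0 gam)).
- by move=> c; rewrite mevC.
- split=> p; last first.
    rewrite -JE; apply/toquo_eq.
    exact: etrans (esym (Hpr _)) (etrans (congr1 pr (thE p)) (etrans (gp _) (gb p))).
  move=> pr'; rewrite -J2E; apply: toquo_mem.
  have Jp : J p by rewrite JE; exact: span_mem.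
  exact: etrans (thE p) (etrans (congr1 g (bJ _ Jp)) (rmorph0 g)).
Qed.

End Presentation.

Section Fibre.
Variables (k : fieldType) (A : comNzRingType) (kap : {rmorphism k -> A}).
Variables (n : nat) (r : seq (mp n A)) (th : {rmorphism mp n A -> mp n A}).
Hypothesis thC : forall c, th (mpc n A c) = mpc n A c.
Hypothesis thr : forall p, p \in r -> span (sqgen r) (th p).
Variables (L : comNzRingType) (iota : {rmorphism A -> L}) (x : primes L).
Hypothesis nonempty : forall p, span_seq r (1 - p) -> ~ (forall a, sval x (iota (mpcf a p))).

(** If no such prime existed, some s outside x would be a combination of the relations plus a
    polynomial with coefficients in x. By [flat], a polynomial congruent to 1 modulo the relations
    would have all its coefficients in x, against [nonempty]. *)
Lemma fibre_point : exists d : primes (mp n L),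
  (forall p, p \in r -> sval d (mpmap n iota p)) /\ forall s, sval d (mpc n L s) <-> sval x s.
Proof.
pose red := mpmap n (tores x).
have redE q : red q = 0 <-> forall a, sval x (mpcf a q).
  split=> [E a|H]; first by apply/tores_eq0; rewrite -mpmap_cf -/red E mpoly.mcoeff0.
  by apply/mpoly.mpolyP => a; rewrite mpmap_cf mpoly.mcoeff0; apply/tores_eq0.
have [|||J JE] := @mk_ideal _ [set q : mp n L | exists u v,
    [/\ red u = 0, span_seq (map (mpmap n iota) r) v & q = u + v]].
- by exists 0, 0; rewrite rmorph0 addr0; split=> //; exact: ideal0.
- move=> a b [u [v [ru sv ->]]] [u' [v' [ru' sv' ->]]]; exists (u + u'), (v + v').
  by split; [rewrite rmorphD /= ru ru' addr0|exact: idealD|rewrite addrACA].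
- move=> a b [u [v [ru sv ->]]]; exists (a * u), (a * v).
  by split; [rewrite rmorphM /= ru mulr0|exact: idealM|rewrite mulrDr].
have [|_ _ [s ns <-] [t nt <-]|q /JE[u [v [ru sv ->]]] [s ns Es]|Q [pQ JQ nQ]] :=
  @prime_exists _ J [set mpc n L s | s in [set s | ~ sval x s]].
- by exists 1; [exact: prime1|rewrite rmorph1].
- by exists (s * t); [exact: primeM|rewrite rmorphM].
- have x0 : sval x 0 by rewrite -(idpE (svalP x)); exact: ideal0.
  have xD a b : sval x a -> sval x b -> sval x (a + b).
    by rewrite -!(idpE (svalP x)); exact: idealD.
  have xM a b : sval x b -> sval x (iota a * b).
    by rewrite -!(idpE (svalP x)); exact: idealM.
  have sv' : span_seq (map (mpmap n iota) r) (mpc n L s - u) by rewrite Es addrC addKr.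
  have [p [p1 px]] := flat kap thC thr x0 xD xM (proj1 (redE u) ru) sv'.
  apply: (nonempty p1) => a.
  have := px a; case: (svalP x) => _ _ _ _ xm /xm[]//.
exists (exist _ Q pQ); split=> [p pr|s] /=.
  apply: JQ; apply/JE; exists 0, (mpmap n iota p); rewrite rmorph0 add0r; split=> //.
  by apply/span_mem/mapP; exists p.
split=> [Qs|xs]; first by apply: contrapT => ns; apply: (nQ _ Qs); exists s.
apply: JQ; apply/JE; exists (mpc n L s), 0; rewrite addr0; split=> //; last exact: ideal0.
apply/redE => a; rewrite -[mpc n L s]mulr1 mpcf_cst -(idpE (svalP x)) mulrC.
by apply: idealM; rewrite idpE.
Qed.

End Fibre.

Lemma noeth_max (A : comNzRingType) (P : ideal A -> Prop) : noeth A -> (exists J, P J) ->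
  exists J, P J /\ forall J' : ideal A, (forall x, J x -> J' x) -> P J' -> forall x, J' x -> J x.
Proof.
move=> nA [J0 PJ0]; apply: contrapT => H.
have step (J : {J | P J}) : exists J' : {J | P J}, (forall x, sval J x -> sval J' x) /\
    exists x, sval J' x /\ ~ sval J x.
  apply: contrapT => H'; apply: H; exists (sval J); split; first exact: svalP J.
  move=> J' JJ' PJ' x J'x; apply: contrapT => nx; apply: H'.
  by exists (exist _ J' PJ'); split=> //; exists x.
have /choice[nx Hnx] := step.
pose s := fix s N : {J | P J} := if N is M.+1 then nx (s M) else exist _ J0 PJ0.
have mono M N : (M <= N)%N -> forall x, sval (s M) x -> sval (s N) x.
  elim: N => [|N IH]; first by rewrite leqn0 => /eqP->.
  rewrite leq_eqVlt => /orP[/eqP->//|]; rewrite ltnS => /IH HN x /HN.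
  by case: (Hnx (s N)) => /= + _; apply.
have /choice[v Hv] : forall N, exists x, sval (s N.+1) x /\ ~ sval (s N) x.
  by move=> N; case: (Hnx (s N)).
have [N [c Ec]] := nA 1%N (fun i => \row_(j < 1) v i).
have [_] := Hv N; apply; have /rowP/(_ ord0) := Ec; rewrite mxE summxE => ->.
apply: ideal_sum => i _; rewrite !mxE; apply: idealM; apply: (mono i.+1) => //.
by case: (Hv i).
Qed.

Section Openness.
Variables (k : fieldType) (A : comNzRingType) (kap : {rmorphism k -> A}).
Variables (n : nat) (r : seq (mp n A)) (th : {rmorphism mp n A -> mp n A}).
Hypothesis thC : forall c, th (mpc n A c) = mpc n A c.
Hypothesis thr : forall p, p \in r -> span (sqgen r) (th p).

(** Membership of x in the image of the spectrum of A[z]/(r). *)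
Definition over (x : primes A) : Prop := exists y : primes (mp n A),
  (forall p, p \in r -> sval y p) /\ forall c, sval y (mpc n A c) <-> sval x c.

Lemma span_prime (R : comPzRingType) (l : seq R) (y : primes R) :
  (forall p, p \in l -> sval y p) -> forall q, span_seq l q -> sval y q.
Proof.
move=> ly q /spanP[m [ml ->]]; rewrite -(idpE (svalP y)) big_seq.
by apply: ideal_sum => w /ml wl; apply: idealM; rewrite idpE; exact: ly.
Qed.

Lemma coef_prime (m : nat) (R : comNzRingType) (y : primes (mp m R)) p :
  (forall a, sval y (mpc m R (mpcf a p))) -> sval y p.
Proof.
move=> H; rewrite [p]mpE -(idpE (svalP y)); apply: ideal_sum => a _.
by apply: idealMr; rewrite idpE.
Qed.

Lemma prime_split1 (R : comPzRingType) (y : primes R) p : sval y p -> ~ sval y (1 - p).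
Proof.
move=> yp y1; apply: (@prime1 _ y); rewrite -(subrK p 1).
by case: (svalP y) => _ + _ _ _; apply.
Qed.

(** Noetherian induction on closed sets V(b). A maximal counterexample b is prime, as neighbourhoods
    for b + (c) and b + (c') combine. At its generic point, [fibre_point] and Chevalley's theorem
    give a dense open set of V(b); the complement V(b + (a)) is covered by maximality. *)
Lemma open_noeth (y : primes (mp n A)) : noeth A -> (forall p, p \in r -> sval y p) ->
  exists j, ~ sval y (mpc n A j) /\ forall x, ~ sval x j -> over x.
Proof.
move=> nA ry.
pose good (b : ideal A) := exists j, ~ sval y (mpc n A j) /\
  forall x, (forall c, b c -> sval x c) -> ~ sval x j -> over x.
suff [j [nj Hj]] : good (ideal_zero A).
  exists j; split=> // x; apply: Hj => c ->.
  by rewrite -(idpE (svalP x)); exact: ideal0.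
apply: contrapT => H0.
have [|b [nb bmax]] := @noeth_max A (fun b => ~ good b) nA; first by exists (ideal_zero A).
have addel c : ~ b c -> exists j, ~ sval y (mpc n A j) /\
    forall x, (forall c, b c -> sval x c) -> sval x c -> ~ sval x j -> over x.
  move=> nbc; have [|||b' b'E] := @mk_ideal _ [set x | exists u v, b u /\ x = u + v * c].
  - by exists 0, 0; rewrite mul0r addr0; split=> //; exact: ideal0.
  - move=> a a' [u [v [bu ->]]] [u' [v' [bu' ->]]]; exists (u + u'), (v + v').
    by split; [exact: idealD|ring].
  - move=> a a' [u [v [bu ->]]]; exists (a * u), (a * v).
    by split; [exact: idealM|ring].
  have [[j [nj Hj]]|ng] := pselect (good b'); last first.
    case: nbc; apply: (bmax b') => //.
      by move=> u bu; apply/b'E; exists u, 0; rewrite mul0r addr0.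
    by apply/b'E; exists 0, 1; rewrite mul1r add0r; split=> //; exact: ideal0.
  exists j; split=> // x bx xc; apply: Hj => a /b'E[u [v [bu ->]]].
  rewrite -(idpE (svalP x)); apply: idealD; first by rewrite idpE; exact: bx.
  by apply: idealM; rewrite idpE.
have b1 : ~ b 1.
  move=> b1; apply: nb; exists 1; rewrite rmorph1; split; first exact: prime1.
  by move=> x bx; case: (@prime1 _ x); exact: bx.
have pb : prime_ideal (iset b).
  split=> //; [exact: ideal0|exact: idealD|exact: idealM|] => c c' bcc.
  apply: contrapT => /not_orP[/addel[j [nj Hj]] /addel[j' [nj' Hj']]].
  apply: nb; exists (j * j'); rewrite rmorphM; split; first exact: primeM.
  move=> x bx nx; have := bx _ bcc; case: (svalP x) => _ _ _ _ /[apply] -[xc|xc].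
    by apply: Hj => //; exact: primeMl nx.
  by apply: Hj' => //; exact: primeMr nx.
have by_ c : b c -> sval y (mpc n A c).
  move=> bc; apply: contrapT => nc; apply: nb; exists c; split=> // x bx []; exact: bx.
have [|q [rq qb]] := @fibre_point k A kap n r th thC thr A idfun (exist _ _ pb).
  move=> p p1 /= pa; apply: (@prime_split1 _ y p); last exact: (span_prime ry).
  by apply: coef_prime => a; apply/by_/pa.
have [a [na Ha]] := @chev_mp A n q 1 (@prime1 _ q).
have [|j [nj Hj]] := addel a; first by move=> ba; apply: na; apply/qb.
apply: nb; exists j; split=> // x bx nx; have [xa|nxa] := pselect (sval x a).
  exact: Hj.
have [|//|y' [qy' y'x _]] := Ha x.
  by move=> c /qb; exact: bx.
exists y'; split=> // p pr; apply: qy'.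
have := rq p pr; congr (sval q _).
by apply/mpoly.mpolyP => m; rewrite mpmap_cf.
Qed.

End Openness.

Lemma rmorph_nz (R : comPzRingType) (S : comNzRingType) (f : {rmorphism R -> S}) : (1 : R) != 0.
Proof.
by apply/eqP => /(congr1 f)/eqP; rewrite rmorph1 rmorph0 oner_eq0.
Qed.

Section OpennessGeneral.
Variables (k : fieldType) (A : comNzRingType) (kap : {rmorphism k -> A}).
Variables (n : nat) (r : seq (mp n A)) (th : {rmorphism mp n A -> mp n A}).
Hypothesis thC : forall c, th (mpc n A c) = mpc n A c.
Hypothesis thr : forall p, p \in r -> span (sqgen r) (th p).

(* Everything is defined over a finitely generated subalgebra. *)
Lemma fg_model : exists (A0 : comNzRingType) (kap0 : {rmorphism k -> A0})
    (iota : {rmorphism A0 -> A}) (r0 : seq (mp n A0)) (th0 : {rmorphism mp n A0 -> mp n A0}),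
  [/\ noeth A0, r = map (mpmap n iota) r0, forall c, th0 (mpc n A0 c) = mpc n A0 c
    & forall p, p \in r0 -> span (sqgen r0) (th0 p)].
Proof.
have /choice[Lp HLp] : forall p, exists Lp : seq (mp n A * mp n A), p \in r ->
    (forall u, u \in Lp -> sqgen r u.2) /\ th p = \sum_(u <- Lp) u.1 * u.2.
  move=> p; have [/thr/spanP[Lp HLp]|_] := boolP (p \in r); first by exists Lp.
  by exists [::].
pose Q := r ++ [seq th (mpv A i) | i <- enum 'I_n] ++
  flatten [seq [seq u.1 | u <- Lp p] | p <- r].
pose G := flatten [seq [seq mpcf m q | m <- mpoly.msupp q] | q <- Q].
pose rho : {rmorphism mp (size G) k -> A} := mev kap (fun i => G`_i).
have [|||J JE] := @mk_ideal _ [set P | rho P = 0].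
- by rewrite /= rmorph0.
- by move=> a b /=; rewrite rmorphD /= => -> ->; rewrite addr0.
- by move=> a b /=; rewrite rmorphM /= => ->; rewrite mulr0.
have [io Hio] : exists io : {rmorphism quo J -> A}, forall P, io (toquo J P) = rho P.
  by apply: quo_lift => P /JE.
have nz : (1 : quo J) != 0.
  exact: rmorph_nz io.
pose A0 := nzof nz; pose iota : {rmorphism A0 -> A} := io.
have iinj (x : A0) : iota x = 0 -> x = 0.
  by have [P <-] := toquo_surj x; rewrite /iota Hio => /JE/toquo_kill.
have imG a : a \in G -> exists x : A0, iota x = a.
  move=> aG; have iG : (index a G < size G)%N by rewrite index_mem.
  exists (toquo J (mpv k (Ordinal iG))).
  by rewrite /iota Hio /rho mevV /= nth_index.
pose im := mpmap n iota.
have iminj (x : mp n A0) : im x = 0 -> x = 0.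
  move=> E; apply/mpoly.mpolyP => m; rewrite mpoly.mcoeff0; apply: iinj.
  by rewrite -mpmap_cf -/im E mpoly.mcoeff0.
have imQ q : q \in Q -> exists x, im x = q.
  move=> qQ; rewrite [q]mpE big_seq; apply: (big_ind (fun q => exists x, im x = q)) => [|_ _ [x <-] [y <-]|m mq].
  - by exists 0; rewrite rmorph0.
  - by exists (x + y); rewrite rmorphD.
  - have [|x Ex] := imG (mpcf m q).
      by apply/flatten_mapP; exists q => //; apply/mapP; exists m.
    by exists (mpc n A0 x * mpX A0 m); rewrite rmorphM /= /im mpmapC Ex mpmapX.
have /choice[de Hde] : forall i, exists d, im d = th (mpv A i).
  move=> i; apply: imQ; rewrite !mem_cat; apply/orP; right; apply/orP; left.
  by apply/mapP; exists i => //; exact: mem_enum.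
have /choice[lf Hlf] : forall q, exists x, q \in Q -> im x = q.
  by move=> q; have [/imQ[x Ex]|_] := boolP (q \in Q); [exists x|exists 0].
have rQ p : p \in r -> p \in Q by move=> pr; rewrite mem_cat pr.
pose r0 := map lf r; pose th0 : {rmorphism mp n A0 -> mp n A0} := mev (mpc n A0) de.
have th0C c : th0 (mpc n A0 c) = mpc n A0 c by rewrite /th0 mevC.
have imth p : im (th0 p) = th (im p).
  apply: (@mp_hom_eq _ _ _ (im \o th0) (th \o im)) => [c|i] /=.
    by rewrite th0C /im mpmapC thC.
  by rewrite /th0 mevV Hde /im mpmapX.
exists A0, (toquo J \o mpc _ k), iota, r0, th0; split=> //.
- apply: (@noeth_surj _ A0 (toquo J)); last exact: noeth_mp.
  by move=> x; exact: toquo_surj.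
- rewrite /r0 -map_comp -[LHS]map_id; apply/eq_in_map => p pr /=.
  by rewrite -/im Hlf //; exact: rQ.
- move=> _ /mapP[p pr ->]; have [Lsq Eth] := HLp p pr.
  have [x [sx Ex]] : exists x, span (sqgen r0) x /\ im x = \sum_(u <- Lp p) u.1 * u.2.
    have LQ u : u \in Lp p -> u.1 \in Q.
      move=> uL; rewrite !mem_cat; apply/orP; right; apply/orP; right; apply/flatten_mapP.
      by exists p => //; apply/mapP; exists u.
    elim: (Lp p) Lsq LQ => [|u L' IH] Lsq LQ.
      by exists 0; rewrite big_nil rmorph0; split=> //; exact: ideal0.
    have [||x [sx Ex]] := IH.
    - by move=> v vL; apply: Lsq; rewrite inE vL orbT.
    - by move=> v vL; apply: LQ; rewrite inE vL orbT.
    have [y [z [yr zr Eu]]] : sqgen r u.2 by apply: Lsq; rewrite inE eqxx.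
    exists (lf u.1 * (lf y * lf z) + x); split.
      apply: idealD => //; apply/idealM/span_mem; exists (lf y), (lf z).
      by split=> //; apply: map_f.
    rewrite big_cons rmorphD !rmorphM /= -/im Ex Eu !Hlf //; try exact: rQ.
    by apply: LQ; rewrite inE eqxx.
  suff -> : th0 (lf p) = x by [].
  apply/eqP; rewrite -subr_eq0; apply/eqP/iminj.
  by rewrite rmorphB /= -/im imth Hlf ?Eth ?Ex ?subrr //; exact: rQ.
Qed.

(** Openness holds over the Noetherian model of [fg_model]; a point in the fibre of the model makes
    that fibre nonempty, and [fibre_point] then produces one over A. *)
Lemma smooth_open (y : primes (mp n A)) : (forall p, p \in r -> sval y p) ->
  exists j, ~ sval y (mpc n A j) /\ forall x, ~ sval x j -> over r x.
Proof.
move=> ry; have [A0 [kap0 [iota [r0 [th0 [nA0 Er th0C th0r]]]]]] := fg_model.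
pose im := mpmap n iota.
pose y0 : primes (mp n A0) := exist _ _ (prime_preim im (svalP y)).
have [|j [nj Hj]] := @open_noeth k A0 kap0 n r0 th0 th0C th0r y0 nA0.
  by move=> p pr /=; apply: ry; rewrite Er; exact: map_f.
exists (iota j); split; first by rewrite -(mpmapC n iota).
move=> x nx; pose x0 : primes A0 := exist _ _ (prime_preim iota (svalP x)).
have [y' [y'r y'x]] := Hj x0 nx.
have [|d [dr dx]] := @fibre_point k A0 kap0 n r0 th0 th0C th0r A iota x.
  move=> p p1 px; apply: (@prime_split1 _ y' p); last exact: (span_prime y'r).
  by apply: coef_prime => a; apply/y'x; exact: px.
by exists d; split=> // p; rewrite Er => /mapP[q qr ->]; exact: dr.
Qed.

End OpennessGeneral.

Lemma surj_factor (R S T : comPzRingType) (b : {rmorphism R -> S}) (g : {rmorphism R -> T}) :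
  (forall y, exists x, b x = y) -> (forall x, b x = 0 -> g x = 0) ->
  exists h : {rmorphism S -> T}, forall x, h (b x) = g x.
Proof.
move=> /choice[sec secK] bg.
have E x : g (sec (b x)) = g x.
  by apply/eqP; rewrite -subr_eq0 -rmorphB; apply/eqP/bg; rewrite rmorphB secK subrr.
have zm : zmod_morphism (g \o sec).
  move=> x y; rewrite /= -rmorphB -[in LHS](secK x) -[in LHS](secK y) -rmorphB E.
  by rewrite rmorphB.
have mm : monoid_morphism (g \o sec).
  split; first by rewrite /= -(rmorph1 b) E rmorph1.
  move=> x y; rewrite /= -rmorphM -[in LHS](secK x) -[in LHS](secK y) -rmorphM E.
  by rewrite rmorphM.
pose H1 := GRing.isZmodMorphism.Build _ _ (g \o sec) zm.
pose H2 := GRing.isMonoidMorphism.Build _ _ (g \o sec) mm.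
by exists (HB.pack (g \o sec) H1 H2 : {rmorphism S -> T}) => x; exact: E.
Qed.

(** What is kept of smoothness on a chart: a presentation of B as A[z]/(r), and a substitution
    congruent to the identity modulo (r) which sends the relations into the square of (r). *)
Definition smooth_data (A B : comNzRingType) (phi : {rmorphism A -> B}) : Prop :=
  exists n (r : seq (mp n A)) (beta : {rmorphism mp n A -> B})
    (th : {rmorphism mp n A -> mp n A}),
  [/\ forall c, beta (mpc n A c) = phi c, forall b, exists p, beta p = b,
      forall p, beta p = 0 <-> span_seq r p, forall c, th (mpc n A c) = mpc n A c
    & (forall p, p \in r -> span (sqgen r) (th p)) /\ forall p, span_seq r (th p - p)].

Lemma span_sq (n : nat) (A : comNzRingType) (r : seq (mp n A)) x y :
  span_seq r x -> span_seq r y -> span (sqgen r) (x * y).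
Proof.
move=> /spanP[l [lr ->]] /spanP[l' [lr' ->]]; rewrite big_distrlr /= big_seq.
apply: ideal_sum => w wl; rewrite big_seq; apply: ideal_sum => w' wl'.
rewrite mulrACA; apply/idealM/span_mem; exists w.2, w'.2.
by split; [exact: lr|exact: lr'|].
Qed.

Lemma mpwC n (A : comNzRingType) c : mpw n A (mpc n A c) = mpc n.+1 A c.
Proof. by rewrite /mpw mevC. Qed.

Lemma mpwV n (A : comNzRingType) i :
  mpw n A (mpv A i) = mpv A (widen_ord (leqnSn n) i).
Proof. by rewrite /mpw mevV. Qed.

Global Opaque mpw.

Section SmoothLocalization.
Variables (A B B' : comNzRingType) (phi : {rmorphism A -> B}) (psi : {rmorphism B -> B'}).
Variables (g : B) (gi : B').
Hypothesis gK : psi g * gi = 1.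
Hypothesis psi_surj : forall s, exists m a, psi g ^+ m * s = psi a.
Hypothesis psi_ker : forall a, psi a = 0 -> exists m, g ^+ m * a = 0.

Definition ext_ev (n : nat) (S : comNzRingType) (f : {rmorphism A -> S})
    (h : 'I_n -> S) (t : S) : {rmorphism mp n.+1 A -> S} :=
  mev f (fun i => if unlift ord_max i is Some j then h j else t).

Lemma ext_evC n S f h t c : @ext_ev n S f h t (mpc n.+1 A c) = f c.
Proof. exact: mevC. Qed.

Lemma ext_ev_last n S f h t : @ext_ev n S f h t (mpv A ord_max) = t.
Proof. by rewrite /ext_ev mevV unlift_none. Qed.

Lemma ext_ev_widen n S f h t i :
  @ext_ev n S f h t (mpv A (widen_ord (leqnSn n) i)) = h i.
Proof.
rewrite /ext_ev mevV (_ : widen_ord _ _ = lift ord_max i) ?liftK //.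
by apply: val_inj; rewrite /= /bump leqNgt ltn_ord.
Qed.

(** The inverse of g is adjoined as a variable w with the relation g w = 1, for which the Newton
    step is w (2 - g w), with g already moved by [th]. *)
Lemma smooth_localize : smooth_data phi -> smooth_data (psi \o phi).
Proof.
move=> [n [r [beta [th [bC bs bk thC [thr thd]]]]]].
have [gh Egh] := bs g.
pose W := mpw n A.
have [w Ew] : exists w, w = mpv A (@ord_max n) by exists (mpv A ord_max).
pose e := W gh * w - 1.
pose r' := e :: map W r.
have re : span_seq r' e by apply: span_mem; rewrite /= inE eqxx.
have rW p : span_seq r p -> span_seq r' (W p).
  move=> /spanP[l [lr ->]]; rewrite rmorph_sum big_seq; apply: ideal_sum => u /lr ur.
  rewrite rmorphM; apply/idealM/span_mem; rewrite /= inE; apply/orP; right.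
  by apply: map_f.
pose be' := ext_ev (psi \o phi) (fun i => psi (beta (mpv A i))) gi.
have be'W p : be' (W p) = psi (beta p).
  apply: (@mp_hom_eq _ _ _ (be' \o W) (psi \o beta)) => [c|i] /=.
    by rewrite /W mpwC ext_evC bC.
  by rewrite /W mpwV ext_ev_widen.
have be'w : be' w = gi by rewrite Ew; exact: ext_ev_last.
have be'r p : span_seq r' p -> be' p = 0.
  move=> /spanP[l [lr ->]]; rewrite rmorph_sum big_seq big1 // => u /lr /=.
  rewrite inE rmorphM => /orP[/eqP->|/mapP[q qr ->]].
    by rewrite rmorphB rmorphM be'W Egh be'w gK rmorph1 subrr mulr0.
  by rewrite be'W (proj2 (bk q)) ?rmorph0 ?mulr0 //; exact: span_mem.
(* Modulo the relations, a power of g clears the variable w from any polynomial. *)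
have red p : exists N q, span_seq r' (W gh ^+ N * p - W q).
  elim/mp_ind: p => [c|i|p q [N [p' Hp]] [M [q' Hq]]|p q [N [p' Hp]] [M [q' Hq]]].
  - by exists 0%N, (mpc n A c); rewrite /W mpwC expr0 mul1r subrr; exact: ideal0.
  - case: (unliftP ord_max i) => [j ->|->].
      exists 0%N, (mpv A j); rewrite /W mpwV expr0 mul1r.
      rewrite (_ : widen_ord _ _ = lift ord_max j) ?subrr; first exact: ideal0.
      by apply: val_inj; rewrite /= /bump leqNgt ltn_ord.
    by exists 1%N, 1; rewrite expr1 rmorph1 -Ew.
  - exists (N + M)%N, (gh ^+ M * p' + gh ^+ N * q').
    have -> : W gh ^+ (N + M) * (p + q) - W (gh ^+ M * p' + gh ^+ N * q') =
      W gh ^+ M * (W gh ^+ N * p - W p') + W gh ^+ N * (W gh ^+ M * q - W q').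
      rewrite rmorphD !rmorphM !rmorphXn exprD /=.
      by move: (W gh ^+ M) (W gh ^+ N) (W p') (W q') => a b c d; ring.
    by apply: idealD; apply: idealM.
  - exists (N + M)%N, (p' * q').
    have -> : W gh ^+ (N + M) * (p * q) - W (p' * q') =
      W gh ^+ M * q * (W gh ^+ N * p - W p') + W p' * (W gh ^+ M * q - W q').
      rewrite rmorphM exprD /=.
      by move: (W gh ^+ M) (W gh ^+ N) (W p') (W q') => a b c d; ring.
    by apply: idealD; apply: idealM.
pose th' : {rmorphism mp n.+1 A -> mp n.+1 A} :=
  ext_ev (mpc n.+1 A) (fun i => W (th (mpv A i))) (w * (2%:R - W (th gh) * w)).
have th'C c : th' (mpc n.+1 A c) = mpc n.+1 A c by exact: ext_evC.
have th'W p : th' (W p) = W (th p).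
  apply: (@mp_hom_eq _ _ _ (th' \o W) (W \o th)) => [c|i] /=.
    by rewrite /W !mpwC th'C thC mpwC.
  by rewrite /W mpwV ext_ev_widen.
have th'w : th' w = w * (2%:R - W (th gh) * w) by rewrite [in LHS]Ew; exact: ext_ev_last.
have He : span_seq r' (W (th gh) * w - 1).
  have -> : W (th gh) * w - 1 = e + w * W (th gh - gh).
    rewrite rmorphB /e; move: (W (th gh)) (W gh) => a b; ring.
  by apply: idealD => //; apply/idealM/rW/thd.
have hd p : span_seq r' (th' p - p).
  elim/mp_ind: p => [c|i|p q Hp Hq|p q Hp Hq].
  - by rewrite th'C subrr; exact: ideal0.
  - case: (unliftP ord_max i) => [j ->|->].
      have -> : mpv A (lift ord_max j) = W (mpv A j).
        rewrite /W mpwV; congr (mpv A _).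
        by apply: val_inj; rewrite /= /bump leqNgt ltn_ord.
      by rewrite th'W -rmorphB; exact/rW/thd.
    rewrite -Ew th'w.
    have -> : w * (2%:R - W (th gh) * w) - w = - w * (W (th gh) * w - 1).
      move: (W (th gh)) => a; ring.
    exact: idealM.
  - have -> : th' (p + q) - (p + q) = (th' p - p) + (th' q - q).
      rewrite rmorphD; move: (th' p) (th' q) => a b; ring.
    exact: idealD.
  - have -> : th' (p * q) - p * q = th' q * (th' p - p) + p * (th' q - q).
      rewrite rmorphM; move: (th' p) (th' q) => a b; ring.
    by apply: idealD; apply: idealM.
have ew N : span_seq r' (1 - (W gh * w) ^+ N).
  elim: N => [|N IH]; first by rewrite expr0 subrr; exact: ideal0.
  have -> : 1 - (W gh * w) ^+ N.+1 = (1 - (W gh * w) ^+ N) - (W gh * w) ^+ N * e.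
    rewrite exprSr /e; move: ((W gh * w) ^+ N) (W gh) => a b; ring.
  by apply: idealB => //; apply: idealM.
exists n.+1, r', be', th'; split=> //.
- by move=> c; rewrite ext_evC.
- move=> s; have [m [a Ea]] := psi_surj s; have [p Ep] := bs a.
  exists (w ^+ m * W p); rewrite rmorphM rmorphXn be'w be'W Ep -Ea mulrA -exprMn.
  by rewrite (mulrC gi) gK expr1n mul1r.
- move=> p; split=> [p0|]; last exact: be'r.
  have [N [q Hq]] := red p.
  have : psi (beta q) = 0.
    rewrite -be'W; have := be'r _ Hq.
    by rewrite rmorphB rmorphM /= p0 mulr0 sub0r => /eqP; rewrite oppr_eq0 => /eqP.
  move=> /psi_ker[M gM]; have : span_seq r (gh ^+ M * q).
    by apply/bk; rewrite rmorphM rmorphXn Egh.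
  move=> /rW HM.
  have : span_seq r' (W gh ^+ (M + N) * p).
    have -> : W gh ^+ (M + N) * p = W gh ^+ M * (W gh ^+ N * p - W q) + W (gh ^+ M * q).
      rewrite rmorphM rmorphXn exprD /=.
      by move: (W gh ^+ M) (W gh ^+ N) (W q) => a b c; ring.
    by apply: idealD => //; apply: idealM.
  move=> HP; have -> : p = w ^+ (M + N) * (W gh ^+ (M + N) * p) +
      (1 - (W gh * w) ^+ (M + N)) * p.
    by rewrite exprMn; move: (W gh ^+ _) (w ^+ _) => a b; ring.
  by apply: idealD; [exact: idealM|exact: idealMr].
- split=> // p; rewrite inE => /orP[/eqP->|/mapP[q qr ->]].
    have -> : th' e = - ((W (th gh) * w - 1) * (W (th gh) * w - 1)).
      rewrite /e rmorphB rmorphM rmorph1 th'W th'w; move: (W (th gh)) => a; ring.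
    by apply: idealN; apply: span_sq.
  rewrite th'W; have /spanP[l [lr ->]] := thr q qr.
  rewrite rmorph_sum big_seq; apply: ideal_sum => u /lr[x [y [xr yr ->]]].
  rewrite !rmorphM; apply/idealM/span_mem; exists (W x), (W y).
  by split=> //; rewrite inE map_f ?orbT.
Qed.

End SmoothLocalization.

Definition smooth_pz (A B : comPzRingType) (phi : {rmorphism A -> B}) : Prop :=
  exists (hA : (1 : A) != 0) (hB : (1 : B) != 0),
    @smooth_data (nzof hA) (nzof hB) phi.

Lemma open_nb (X : topologicalType) (S : set X) :
  (forall x, S x -> exists V : opens X, oset V x /\ V `<=` S) -> open S.
Proof.
move=> H; have -> : S = \bigcup_(V in [set V : opens X | V `<=` S]) V.
  by apply/seteqP; split=> [x /H[V [Vx VS]]|x [V VS /VS]//]; exists V.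
by apply: bigcup_open => V _; exact: oset_open.
Qed.

(** * Smooth morphisms of schemes and torsors *)

Section PointPrimes.
Variables (k : fieldType) (X : kscheme k).

Lemma sect_nz (U : opens X) x : oset U x -> (1 : sect U) != 0.
Proof.
move=> Ux; apply/eqP => E; apply: (@nonunit0 k X U x); rewrite -E.
exact: unit_at1.
Qed.

Definition ptprime (U : opens X) x (Ux : oset U x) : primes (sect U) :=
  exist _ _ (nonunit_prime Ux).

Lemma ptprimeE (U : opens X) x (Ux : oset U x) f : sval (ptprime Ux) f <-> ~ unit_at f x.
Proof. by []. Qed.

Lemma prime_pt (U : opens X) (aU : affine_open U) (P : primes (sect U)) :
  exists x, oset U x /\ forall f, sval P f <-> ~ unit_at f x.
Proof. by have [x [Hx _]] := aff_point aU (svalP P); exists x. Qed.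

End PointPrimes.

Lemma pull_restr (k : fieldType) (X Y : kscheme k) (f : schhom X Y) (V V' : opens Y)
    (U : opens X) (UV : U `<=` f @^-1` V) (UV' : U `<=` f @^-1` V') (VV : V' `<=` V) s :
  pull UV' (rstr VV s) = pull UV s.
Proof. by rewrite -(pull_res UV UV' VV (fun _ h => h)) res_id. Qed.

Lemma rstr_pull (k : fieldType) (X Y : kscheme k) (f : schhom X Y) (V : opens Y)
    (U U' : opens X) (UV : U `<=` f @^-1` V) (UV' : U' `<=` f @^-1` V) (UU : U' `<=` U) s :
  rstr UU (pull UV s) = pull UV' s.
Proof. by rewrite (pull_res UV UV' (fun _ h => h) UU) res_id. Qed.

Lemma comp_pull_via (k : fieldType) (X Y Z : kscheme k) (g : schhom Y Z) (f : schhom X Y)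
    (V : opens Z) (V1 : opens Y) (U : opens X) (UV : U `<=` schcomp g f @^-1` V)
    (V1V : V1 `<=` g @^-1` V) (U1 : U `<=` f @^-1` V1) s :
  pull UV s = pull U1 (pull V1V s).
Proof.
have V1p : V1 `<=` Defs.preim (@hcont _ _ _ g) V by move=> y /V1V.
pose pV : Defs.preim (@hcont _ _ _ g) V `<=` g @^-1` V := fun y gy => gy.
have UVp : U `<=` f @^-1` Defs.preim (@hcont _ _ _ g) V := UV.
rewrite -(rstr_pull pV V1V V1p) (pull_restr UVp).
by rewrite /= (Prop_irrelevance UVp UV).
Qed.

Lemma schcompA (k : fieldType) (X Y Z T : kscheme k) (h : schhom Z T) (g : schhom Y Z)
  (f : schhom X Y) : schcomp h (schcomp g f) = schcomp (schcomp h g) f.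
Proof.
apply: schhom_ext => // V U UV UV' s.
pose O := Defs.preim (@hcont _ _ _ h) V; pose O' := Defs.preim (@hcont _ _ _ g) O.
have a1 : O `<=` h @^-1` V by [].
have a2 : O' `<=` g @^-1` O by [].
have a3 : U `<=` f @^-1` O' by move=> x /UV.
have a4 : U `<=` schcomp g f @^-1` O by move=> x /UV.
have a5 : O' `<=` schcomp h g @^-1` V by [].
rewrite (comp_pull_via UV a1 a4) (comp_pull_via a4 a2 a3).
by rewrite (comp_pull_via UV' a5 a3) (comp_pull_via a5 a1 a2).
Qed.

Lemma prime_quo (R : comPzRingType) (P : primes R) :
  exists (D : comPzRingType) (t : {rmorphism R -> D}) (z : primes D),
    [/\ forall q, t q = 0 <-> sval P q, forall c, exists q, t q = c
      & forall c, sval z c <-> c = 0].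
Proof.
pose t := toquo (idp (svalP P)).
have tE q : t q = 0 <-> sval P q by rewrite toquo_eq0 idpE.
have p0 : prime_ideal [set q : quo (idp (svalP P)) | q = 0].
  split=> [|a b|a b||a b] /=.
  - by [].
  - by move=> -> ->; rewrite addr0.
  - by move=> ->; rewrite mulr0.
  - by rewrite -(rmorph1 t) => /tE; exact: prime1.
  - have [a' <-] := toquo_surj a; have [b' <-] := toquo_surj b.
    rewrite -rmorphM => /tE; have [_ _ _ _ Pm] := svalP P.
    by case/Pm => /tE ->; [left|right].
exists (quo (idp (svalP P))), t, (exist _ _ p0); split=> // c.
by have [q <-] := toquo_surj c; exists q.
Qed.

Section SmoothMaps.
Variables (k : fieldType) (U F : kscheme k) (f : schhom U F) (unr : Prop).
Hypothesis sf : locally_on_affines f (fun A B phi =>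
  finitely_presented phi /\ infinitesimal_lifting phi unr).

(** Smoothness provides a single affine neighbourhood of x; localization at a function shrinks it
    into O and keeps the smooth presentation. *)
Lemma smooth_chart x (O : opens U) : oset O x ->
  exists (U1 : opens U) (V : opens F) (UV : U1 `<=` f @^-1` V),
    [/\ oset U1 x, affine_open U1, affine_open V, U1 `<=` O & smooth_pz (pull UV)].
Proof.
move=> Ox; have [U0 [V [UV [U0x aU0 aV [fp lift]]]]] := sf x.
have [g [gx gO]] := aff_basic aU0 U0x Ox.
have dU := @dop_sub k U U0 g.
have UV1 : dop g `<=` f @^-1` V by move=> y /dU/UV.
exists (dop g), V, UV1; split=> //; first exact: basic_affine.
have hA := sect_nz (UV _ U0x); have h0 := sect_nz U0x.
have hB : (1 : sect (dop g)) != 0 by apply: (@sect_nz k U _ x).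
exists hA, hB.
have [[gi ggi] gs gk] := @aff_frac k U U0 aU0 g _ dU erefl.
have sd : @smooth_data (nzof hA) (nzof h0) (pull UV) by exact: (@fp_newton (nzof hA) (nzof h0) (pull UV) unr fp lift).
have := @smooth_localize (nzof hA) (nzof h0) (nzof hB) (pull UV) (rstr dU) g gi ggi gs gk sd.
congr (smooth_data _); apply: rmorph_ext => c /=.
by rewrite (pull_res UV UV1 (fun _ h => h) dU) res_id.
Qed.

(** By [smooth_open], every point near f y has a prime of the presentation above it; pushed forward
    to the coordinate ring of the affine chart, this prime is a point of O. *)
Lemma smooth_map_open (O : opens U) : open (f @` O).
Proof.
apply: open_nb => _ [y Oy <-].
have [U1 [V [UV [U1y aU1 aV U1O [hA [hB [n [r [beta [th [bC bs bk thC [thr _]]]]]]]]]]]] :=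
  smooth_chart Oy.
pose A := nzof hA; pose B := nzof hB.
pose yB : primes B := ptprime U1y.
pose yA : primes (mp n A) := exist _ _ (prime_preim beta (svalP yB)).
have [|j [nj Hj]] := @smooth_open k A (kcst V) n r th thC thr yA.
  move=> p pr; rewrite /= (proj2 (bk p)); last exact: span_mem.
  by move=> H; exact: nonunit0 H.
exists (dop (j : sect V)); split.
  apply/(pull_unit UV) => //.
  by apply: contrapT => nu; apply: nj; rewrite /= bC.
move=> z jz; have Vz := unit_in jz.
have [|y' [y'r y'z]] := Hj (ptprime Vz); first by move/ptprimeE.
have [|Q HQ] := @prime_image _ _ beta (sval y') bs (svalP y').
  by move=> p /bk; exact: span_prime.
have [y1 [U1y1 Hy1]] := prime_pt aU1 Q.
exists y1; first exact: U1O.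
apply: (aff_eq aV) => //; first exact: (UV).
move=> c; rewrite -(pull_unit UV) //.
have E : sval Q (pull UV c) <-> ~ unit_at c z.
  by rewrite -(bC c) HQ y'z.
have := Hy1 (pull UV c); rewrite E => -[h1 h2].
by split=> h; apply: contrapT => n'; [exact: h1 n' h|exact: h2 n' h].
Qed.

(* A point of X and a point of U over the same point of F come from a point of
   the fibre product; the second one may be moved inside its fibre. *)
Lemma smooth_co (X : kscheme k) (p : schhom X F) x u1 (W : opens X) (O : opens U) :
  p x = f u1 -> oset W x -> oset O u1 ->
  exists (D : comPzRingType) (kap : {rmorphism k -> D}) (t1 : schhom (Spec kap) X)
    (t2 : schhom (Spec kap) U) (tau : Spec kap),
  [/\ schcomp p t1 = schcomp f t2, t1 tau = x, forall t, oset W (t1 t)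
    & forall t, oset O (t2 t)].
Proof.
move=> pxu Wx Ou.
have [U1 [V [UV [U1u aU1 aV U1O [hA [hB [n [r [beta [th [bC bs bk thC [thr _]]]]]]]]]]]] :=
  smooth_chart Ou.
have Vx : oset V (p x) by rewrite pxu; exact: (UV).
pose WV := interO W (Defs.preim (@hcont _ _ _ p) V).
have [W1 [W1x aW1 W1W]] := @aff_nbhd k X x WV (conj Wx Vx).
have WV1 : W1 `<=` p @^-1` V by move=> z /W1W[].
have hL := sect_nz W1x.
pose A := nzof hA; pose B := nzof hB; pose L := nzof hL.
pose xL : primes L := ptprime W1x.
pose yB : primes B := ptprime U1u.
pose yA : primes (mp n A) := exist _ _ (prime_preim beta (svalP yB)).
pose iota : {rmorphism A -> L} := pull WV1.
have xy c : sval xL (iota c) <-> sval yB (pull UV c).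
  change (~ unit_at (pull WV1 c) x <-> ~ unit_at (pull UV c) u1).
  by rewrite (pull_unit WV1) // (pull_unit UV) // pxu.
have rY p' : p' \in r -> sval yA p'.
  move=> pr; rewrite /= (proj2 (bk p')); last exact: span_mem.
  by move=> H; exact: nonunit0 H.
(* A prime of L[z] above x that contains the relations; the point u1 shows that the fibre is
   nonempty. *)
have [|d [dr dx]] := @fibre_point k A (kcst V) n r th thC thr L iota xL.
  move=> q q1 qx; apply: (@prime_split1 _ yA q); last exact: (span_prime rY).
  apply: coef_prime => a; have := qx a; rewrite xy.
  by rewrite [sval yA _]/= bC.
have [D [td [z0 [dE tds z0E]]]] := prime_quo d.
pose tL : {rmorphism L -> D} := td \o mpc n L.
have [tB HtB] : exists h : {rmorphism B -> D}, forall q, h (beta q) = (td \o mpmap n iota) q.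
  apply: (@surj_factor _ _ _ beta (td \o mpmap n iota) bs) => q /bk qr.
  exact/dE/(span_prime (y := exist _ _ (prime_preim (mpmap n iota) (svalP d))) dr qr).
pose kap : {rmorphism k -> D} := tL \o kcst W1.
have tBk c : tB (kcst U1 c) = kap c.
  rewrite -(pull_cst UV) -bC HtB /= mpmapC; congr (td (mpc n L _)).
  exact: pull_cst.
pose t1 := @specmor k D kap X W1 aW1 tL (fun c => erefl).
pose t2 := @specmor k D kap U U1 aU1 tB tBk.
have t1W t : oset W1 (t1 t) by exact: specmor_in.
have t2U t : oset U1 (t2 t) by exact: specmor_in.
exists D, kap, t1, t2, z0; split.
- have T1 : topen (Spec kap) `<=` schcomp p t1 @^-1` V by move=> t _; exact/WV1/t1W.
  have T2 : topen (Spec kap) `<=` schcomp f t2 @^-1` V by move=> t _; exact/UV/t2U.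
  apply: (mor_uniq aV (xW := T1) (yW := T2)) => c.
  have T1' : topen (Spec kap) `<=` t1 @^-1` W1 by move=> t _; exact: t1W.
  have T2' : topen (Spec kap) `<=` t2 @^-1` U1 by move=> t _; exact: t2U.
  rewrite (comp_pull_via T1 WV1 T1') (comp_pull_via T2 UV T2').
  rewrite [LHS]specmor_pull [RHS]specmor_pull -bC HtB /= mpmapC.
  by congr (scst _ (td (mpc n L _))).
- apply: (aff_eq aW1) => // q; rewrite specmor_unit /=.
  rewrite z0E dE dx.
  by split=> [/contrapT//|h]; exact.
- by move=> t; have [] := W1W _ (t1W t).
- by move=> t; exact/U1O/t2U.
Qed.

End SmoothMaps.

Section TorsorOpen.
Variables (k : fieldType) (H : forall R : comPzRingType, GL2 R -> Prop).
Variables (X S : kscheme k) (pi : schhom X S) (act : action_on X).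
Hypothesis tor : is_torsor H pi act.

Definition invariant (Om : set X) : Prop :=
  forall (D : comPzRingType) (kap : {rmorphism k -> D}) (x : schhom (Spec kap) X) e tau,
    H e -> Om (x tau) <-> Om (act e x tau).

Lemma torsor_surj z : exists x, pi x = z.
Proof.
case: tor => _ _ _ [U [u [s [_ us su]]]]; have [y <-] := us z.
by exists (s y); rewrite -su.
Qed.

(** Along an étale local section s, the image of Om is the image under u of the open preimage of Om
    by s. A point of X and a point of the section above the same point of S are joined by
    [smooth_co] and then differ by the group. *)
Lemma torsor_open (Om : opens X) : invariant Om ->
  open (pi @` Om) /\ forall x, (pi @` Om) (pi x) -> oset Om x.
Proof.
move=> inv; case: tor => _ _ tr [U [u [s [eu us su]]]].
pose sOm := Defs.preim (@hcont _ _ _ s) Om.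
have co x u1 (O : opens U) : pi x = u u1 -> oset O u1 ->
    exists u2, [/\ oset O u2, u u2 = pi x & oset Om x <-> oset Om (s u2)].
  move=> E Ou.
  have [D [kap [t1 [t2 [tau [Et t1x _ t2O]]]]]] := @smooth_co k U S u True eu X pi x u1 (topen X) O E I Ou.
  have Ep : schcomp pi (schcomp s t2) = schcomp pi t1 by rewrite schcompA su.
  have [e [[He Ee] _]] := tr _ _ _ Ep.
  exists (t2 tau); split=> //.
    by rewrite -t1x; have := congr1 (fun m : schhom _ S => m tau) Et.
  by rewrite (inv _ _ (schcomp s t2) e tau He) Ee t1x.
have V1 x : (u @` sOm) (pi x) -> oset Om x.
  by move=> [u1 Ou1 /esym E]; have [u2 [Ou2 _ ->]] := co _ _ _ E Ou1.
have EV : pi @` Om = u @` sOm.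
  apply/seteqP; split=> [_ [x Omx <-]|_ [u1 Ou1 <-]].
    have [u0 /esym E] := us (pi x).
    by have [u2 [_ Eu HO]] := co _ _ (topen U) E I; exists u2 => //; apply/HO.
  exists (s u1) => //; by rewrite -su.
by rewrite EV; split; [exact: smooth_map_open eu sOm|exact: V1].
Qed.

End TorsorOpen.

Lemma prime_eq (R : comPzRingType) (P Q : primes R) :
  (forall c, sval P c <-> sval Q c) -> P = Q.
Proof.
case: P Q => [P pP] [Q pQ] /= E; apply: eq_exist.
by apply/funext => c; apply/propext.
Qed.

(** * Affine test points, matrices and lifting charts *)

Section RingOf.
Variables (k : fieldType) (D : comPzRingType) (kap : {rmorphism k -> D}).
Variables (X : kscheme k).

Definition lands (x : schhom (Spec kap) X) (W : opens X) : Prop :=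
  topen (Spec kap) `<=` x @^-1` W.

Lemma landsP (x : schhom (Spec kap) X) W : (forall t, oset W (x t)) -> lands x W.
Proof. by move=> H t _; exact: H. Qed.

Definition ringof (x : schhom (Spec kap) X) W (xW : lands x W) : {rmorphism sect W -> D} :=
  @fromG D \o pull xW.

Lemma ringofE x W (xW : lands x W) s : toG D (ringof xW s) = pull xW s.
Proof. exact: fromGK. Qed.

Lemma ringof_cst x W (xW : lands x W) c : ringof xW (kcst W c) = kap c.
Proof. by rewrite /ringof /= pull_cst; exact: (toGK (kap c)). Qed.

Lemma ringof_unit x W (xW : lands x W) s t : unit_at s (x t) <-> ~ sval t (ringof xW s).
Proof. by rewrite -(pull_unit xW) // -ringofE; exact: unit_toG. Qed.

Lemma ringof_res x W W' (xW : lands x W) (xW' : lands x W') (WW : W' `<=` W) s :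
  ringof xW' (rstr WW s) = ringof xW s.
Proof. by apply: toG_inj; rewrite !ringofE; exact: (pull_restr xW xW' WW s). Qed.

Lemma ringof_gpull x W (xW : lands x W) f : gpull x f = toG D (ringof xW (resT W f)).
Proof.
pose xT : topen (Spec kap) `<=` x @^-1` topen X := fun _ _ => I.
by rewrite ringofE; symmetry; exact: (pull_restr xT xW (@sub_topen X W) f).
Qed.

Lemma ringof_specmor W (aW : affine_open W) beta bk (xW : lands (@specmor k D kap X W aW beta bk) W) s :
  ringof xW s = beta s.
Proof. by apply: toG_inj; rewrite ringofE specmor_pull. Qed.

Lemma specmor_lands W (aW : affine_open W) beta bk : lands (@specmor k D kap X W aW beta bk) W.
Proof. by apply: landsP => t; exact: specmor_in. Qed.

Lemma lands_uniq W (aW : affine_open W) x y (xW : lands x W) (yW : lands y W) :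
  (forall s, ringof xW s = ringof yW s) -> x = y.
Proof.
by move=> E; apply: (mor_uniq aW (xW := xW) (yW := yW)) => s; rewrite -!ringofE E.
Qed.

End RingOf.

Section SpecMap.
Variables (k : fieldType) (C D : comPzRingType).
Variables (kc : {rmorphism k -> C}) (kd : {rmorphism k -> D}) (f : {rmorphism C -> D}).
Hypothesis fk : forall c, f (kc c) = kd c.

Lemma specmap_key c : (f \o @fromG C) (kcst (topen (Spec kc)) c) = kd c.
Proof. by rewrite /= -fk; congr (f _); exact: (toGK (kc c)). Qed.

Definition specmap : schhom (Spec kd) (Spec kc) :=
  @specmor k D kd (Spec kc) (topen (Spec kc)) (spec_affine kc) (f \o @fromG C) specmap_key.

Lemma specmap_pt (Q : Spec kd) c : sval (specmap Q : Spec kc) c <-> sval Q (f c).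
Proof.
have := @specmor_unit k D kd (Spec kc) (topen (Spec kc)) (spec_affine kc) _ specmap_key Q (toG C c).
rewrite /= toGK -/specmap => H.
have := @unit_toG k C kc (topen _) c (specmap Q) I; rewrite [scst _ c]/(toG C c) H.
by move=> E; split=> h; apply: contrapT => n; [case: (proj1 E n)|case: (proj2 E n)].
Qed.

Lemma specmap_gpull c : gpull specmap (toG C c) = toG D (f c).
Proof.
by rewrite specmor_gpull /resT /= sres_id toGK.
Qed.

Variable X : kscheme k.

Lemma lands_comp (x : schhom (Spec kc) X) W : lands x W -> lands (schcomp x specmap) W.
Proof. by move=> xW t _; exact: (xW (specmap t) I). Qed.

Lemma ringof_comp (x : schhom (Spec kc) X) W (xW : lands x W)
  (yW : lands (schcomp x specmap) W) s : ringof yW s = f (ringof xW s).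
Proof.
pose top : topen (Spec kd) `<=` specmap @^-1` topen (Spec kc) := fun _ _ => I.
by apply: toG_inj; rewrite -specmap_gpull !ringofE; exact: (comp_pull_via yW xW top).
Qed.

End SpecMap.

Section Matrices.
Variables (k : fieldType) (G : GLscheme k).

Lemma gl_eq (R : comPzRingType) (x y : GL R) : glm x = glm y -> x = y.
Proof.
case: x y => [x xi xK xiK] [y yi yK yiK] /= E; subst y.
have Ei : xi = yi by rewrite -[xi]mulmx1 -yK mulmxA xiK mul1mx.
by subst yi; rewrite (Prop_irrelevance xK yK) (Prop_irrelevance xiK yiK).
Qed.

Lemma GL_eq (T : kscheme k) (s t : schhom T G) : glm (mat s) = glm (mat t) -> s = t.
Proof.
by move/gl_eq => E; have [u [_ uu]] := gluniv_univ G (mat t); rewrite -(uu s E) -(uu t).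
Qed.

Lemma GL_mor (T : kscheme k) (x : GL (Gam T)) : exists t : schhom T G, mat t = x.
Proof. by have [t [Et _]] := gluniv_univ G x; exists t. Qed.

Lemma gpull_comp (X Y Z : kscheme k) (g : schhom Y Z) (f : schhom X Y) s :
  gpull (schcomp g f) s = gpull f (gpull g s).
Proof.
pose t1 : topen Y `<=` g @^-1` topen Z := fun _ _ => I.
pose t2 : topen X `<=` f @^-1` topen Y := fun _ _ => I.
pose t3 : topen X `<=` schcomp g f @^-1` topen Z := fun _ _ => I.
exact: (comp_pull_via t3 t1 t2).
Qed.

Lemma mat_comp (S T : kscheme k) (t : schhom T G) (u : schhom S T) :
  mat (schcomp t u) = glmap (gpull u) (mat t).
Proof.
by apply: gl_eq; apply/matrixP => i j; rewrite !mxE gpull_comp.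
Qed.

End Matrices.

Definition fin_gen (k : fieldType) (B : comPzRingType) (kap : {rmorphism k -> B}) : Prop :=
  exists n (rho : {rmorphism mp n k -> B}),
    (forall c, rho (mpc n k c) = kap c) /\ forall b, exists p, rho p = b.

Section Generated.
Variables (k : fieldType) (B : comNzRingType) (kap : {rmorphism k -> B}).

Lemma fin_genP (l : seq B) :
  (forall P : set B, (forall c, P (kap c)) -> (forall b, b \in l -> P b) ->
    (forall a b, P a -> P b -> P (a + b)) -> (forall a b, P a -> P b -> P (a * b)) ->
    forall b, P b) -> fin_gen kap.
Proof.
move=> H; exists (size l), (mev kap (fun i : 'I_(size l) => l`_i)); split=> [c|].
  exact: mevC.
apply: H => [c|b bl|_ _ [p <-] [q <-]|_ _ [p <-] [q <-]].
- by exists (mpc _ k c); exact: mevC.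
- have ib : (index b l < size l)%N by rewrite index_mem.
  by exists (mpv k (Ordinal ib)); rewrite mevV /= nth_index.
- by exists (p + q); rewrite rmorphD.
- by exists (p * q); rewrite rmorphM.
Qed.

End Generated.

Lemma nilp_unit (R : comPzRingType) (u n : R) : (exists v, u * v = 1) -> n * n = 0 ->
  exists v, (u + n) * v = 1.
Proof.
move=> [v uv] n0; exists (v - v * v * n).
have -> : (u + n) * (v - v * v * n) =
  u * v + (1 - u * v) * (v * n) - v * v * (n * n) by ring.
by rewrite uv n0; ring.
Qed.

Section SmoothLift.
Variables (A B : comNzRingType) (phi : {rmorphism A -> B}).
Hypothesis sd : smooth_data phi.

(** Any lift of the generators becomes a ring map on B after composition with [th]: a product of two
    relations goes to a product of two elements of the kernel of p, which is zero. *)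
Lemma smooth_lift (C : comNzRingType) (C0 : comPzRingType) (p : {rmorphism C -> C0})
    (al : {rmorphism A -> C}) (be : {rmorphism B -> C0}) :
  (forall c0, exists c, p c = c0) -> (forall a b, p a = 0 -> p b = 0 -> a * b = 0) ->
  (forall a, p (al a) = be (phi a)) ->
  exists ga : {rmorphism B -> C}, (forall a, ga (phi a) = al a) /\ forall b, p (ga b) = be b.
Proof.
move=> ps p0 pal; have [n [r [beta [th [bC bs bk thC [thr thd]]]]]] := sd.
have /choice[c Hc] : forall i, exists c, p c = be (beta (mpv A i)) by move=> i; exact: ps.
pose e : {rmorphism mp n A -> C} := mev al c.
have pe q : p (e q) = be (beta q).
  apply: (@mp_hom_eq _ _ _ (p \o e) (be \o beta)) => [a|i] /=.
    by rewrite /e mevC pal bC.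
  by rewrite /e mevV Hc.
have ek q : span_seq r q -> p (e q) = 0 by move=> /bk E; rewrite pe E rmorph0.
have [|ga Hga] := @surj_factor _ _ _ beta (e \o th) bs.
  move=> q /bk/spanP[l [lr ->]] /=; rewrite 2!rmorph_sum big_seq big1 // => u /lr ur.
  rewrite 2!rmorphM; have /spanP[l' [l'r ->]] := thr _ ur.
  rewrite rmorph_sum big_seq big1 ?mulr0 // => v /l'r[x [y [xr yr ->]]].
  have Ex : p (e x) = 0 by apply: ek; exact: span_mem.
  have Ey : p (e y) = 0 by apply: ek; exact: span_mem.
  by rewrite !rmorphM (p0 _ _ Ex Ey) mulr0.
exists ga; split=> [a|b]; first by rewrite -bC Hga /= thC /e mevC.
have [q <-] := bs b; rewrite Hga /= pe; congr (be _).
apply/eqP; rewrite -subr_eq0 -rmorphB; apply/eqP/bk; exact: thd.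
Qed.

End SmoothLift.

Section Charts.
Variables (k : fieldType) (G : GLscheme k) (X : kscheme k) (loc : schhom X G).

Definition gmx (W : opens X) : 'M[sect W]_4 := map_mx (resT W) (glm (mat loc)).

(** Smoothness of [loc] expressed on W alone: a point lifts through any square-zero extension, with
    an arbitrarily prescribed lift of its matrix. *)
Definition has_lift (W : opens X) : Prop :=
  forall (C : comNzRingType) (C0 : comPzRingType) (p : {rmorphism C -> C0}) (kc : {rmorphism k -> C})
    (be : {rmorphism sect W -> C0}) (M : 'M[C]_4),
  (forall c0, exists c, p c = c0) -> (forall a b, p a = 0 -> p b = 0 -> a * b = 0) ->
  (forall c, be (kcst W c) = p (kc c)) -> map_mx p M = map_mx be (gmx W) ->
  exists ga : {rmorphism sect W -> C},
    [/\ forall c, ga (kcst W c) = kc c, forall b, p (ga b) = be b & map_mx ga (gmx W) = M].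

Lemma res_gmx (W W' : opens X) (WW : W' `<=` W) : map_mx (rstr WW) (gmx W) = gmx W'.
Proof. by apply/matrixP => i j; rewrite !mxE; exact: res_res. Qed.

Lemma mat_lands (D : comPzRingType) (kap : {rmorphism k -> D}) (x : schhom (Spec kap) X) W
    (xW : lands x W) : glm (mat (schcomp loc x)) = map_mx (toG D) (map_mx (ringof xW) (gmx W)).
Proof.
rewrite mat_comp /=; apply/matrixP => i j; rewrite !mxE.
exact: ringof_gpull.
Qed.

(** The matrix M is invertible because its determinant is so modulo a square-zero ideal. It defines
    a point of G, which stays in V since a square-zero thickening has no new points, and
    [smooth_lift] applies. *)
Lemma smooth_has_lift (U : opens X) (V : opens G) (UV : U `<=` loc @^-1` V) :
  affine_open U -> affine_open V -> smooth_pz (pull UV) -> has_lift U.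
Proof.
move=> aU aV [hA [hB sd]] C C0 p kc be M ps p0 bek pM.
have detM : exists v, \det M * v = 1.
  have [v Ev] : exists v, p (\det M * v) = 1.
    have E : p (\det M) = be (\det (gmx U)) by rewrite -!det_map_mx pM.
    pose gi := map_mx (resT U) (gli (mat loc)).
    have [v Ev] := ps (be (\det gi)); exists v; rewrite rmorphM E Ev -rmorphM -det_mulmx.
    by rewrite /gmx /gi -map_mxM glmK map_mx1 det1 rmorph1.
  have [w Ew] : exists w, (1 + (\det M * v - 1)) * w = 1.
    apply: nilp_unit; first by exists 1; rewrite mulr1.
    by apply: p0; rewrite rmorphB Ev rmorph1 subrr.
  by exists (v * w); rewrite mulrA -Ew; ring.
case: detM => dv detM.
have MK : map_mx (toG C) M *m map_mx (toG C) (dv *: \adj M) = 1%:M.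
  by rewrite -map_mxM -scalemxAr mul_mx_adj scale_scalar_mx mulrC detM map_scalar_mx rmorph1.
have KM : map_mx (toG C) (dv *: \adj M) *m map_mx (toG C) M = 1%:M.
  by rewrite -map_mxM -scalemxAl mul_adj_mx scale_scalar_mx mulrC detM map_scalar_mx rmorph1.
have [t Et] := GL_mor G (T := Spec kc) (MkGL MK KM).
pose k0 : {rmorphism k -> C0} := p \o kc.
pose sp : schhom (Spec k0) (Spec kc) := specmap (f := p) (kd := k0) (fun c => erefl).
pose t0' := @specmor k C0 k0 X U aU be bek.
have t0'U : lands t0' U by exact: specmor_lands.
have Et0 : schcomp t sp = schcomp loc t0'.
  apply: GL_eq; rewrite (mat_lands t0'U) mat_comp Et /=.
  have -> : map_mx (ringof t0'U) (gmx U) = map_mx p M.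
    by rewrite pM; apply/matrixP => i j; rewrite !mxE ringof_specmor.
  by apply/matrixP => i j; rewrite !mxE specmap_gpull.
have tV : lands t V.
  apply: landsP => Q.
  have [|Q0 HQ0] := @prime_image _ _ p (sval Q) ps (svalP Q).
    move=> x px; apply: (@primeX _ (sval Q) _ 2); first exact: svalP.
    by rewrite expr2 p0 // -(idpE (svalP Q)); exact: ideal0.
  have -> : Q = sp Q0 :> primes C.
    apply: prime_eq => c; rewrite -HQ0.
    exact: iff_sym (specmap_pt (f := p) (kd := k0) (kc := kc) (fun c => erefl) Q0 c).
  have E : t (sp Q0) = loc (t0' Q0).
    exact: (congr1 (fun m : schhom (Spec k0) G => m (Q0 : Spec k0)) Et0).
  by rewrite E; apply: (UV); exact: (t0'U Q0 I).
pose al : {rmorphism sect V -> C} := ringof tV.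
have pal a : p (al a) = be (pull UV a).
  have yV : lands (schcomp t sp) V by move=> s _; exact: (tV (sp s) I).
  rewrite -(ringof_comp tV yV).
  have y'V : lands (schcomp loc t0') V by move=> s _; exact/UV/(t0'U s I).
  have -> : ringof yV a = ringof y'V a by move: yV y'V; rewrite Et0 => yV y'V; rewrite (Prop_irrelevance yV y'V).
  apply: toG_inj; rewrite ringofE (comp_pull_via y'V UV t0'U) -ringofE.
  by rewrite ringof_specmor.
have [ga [gaA gap]] := @smooth_lift (nzof hA) (nzof hB) (pull UV) sd C C0 p al be ps p0 pal.
have resV (f : Gam G) : resT U (gpull loc f) = pull UV (resT V f).
  pose UT : U `<=` loc @^-1` topen G := fun _ _ => I.
  rewrite /resT (pull_restr UT).
  pose xT : topen X `<=` loc @^-1` topen G := fun _ _ => I.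
  exact: (rstr_pull xT UT).
exists ga; split=> //.
- by move=> c; rewrite -(pull_cst UV) gaA; exact: ringof_cst.
- apply/matrixP => i j; rewrite !mxE resV gaA.
  apply: toG_inj; rewrite -(ringof_gpull tV).
  have := congr1 (fun x : GL (Gam (Spec kc)) => glm x i j) Et.
  by rewrite /= !mxE.
Qed.

Lemma basic_has_lift (W : opens X) (g : sect W) : affine_open W -> has_lift W -> has_lift (dop g).
Proof.
move=> aW liftW C C0 p kc be M ps p0 bek pM.
have dW := @dop_sub k X W g; have [[gi ggi] _ _] := @aff_frac k X W aW g _ dW erefl.
have [||ga [gak gap gaM]] := liftW C C0 p kc (be \o rstr dW) M ps p0.
- by move=> c /=; rewrite res_cst bek.
- by rewrite pM -(res_gmx dW); apply/matrixP => i j; rewrite !mxE.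
pose x := @specmor k C kc X W aW ga gak.
have xW : lands x W by exact: specmor_lands.
have xd : lands x (dop g).
  apply: landsP => Q; apply/(ringof_unit xW); rewrite ringof_specmor => Qg.
  have [v Ev] := ps (be gi).
  have [w Ew] : exists w, (1 + (ga g * v - 1)) * w = 1.
    apply: nilp_unit; first by exists 1; rewrite mulr1.
    by apply: p0; rewrite rmorphB rmorphM rmorph1 Ev gap /= -rmorphM ggi rmorph1 subrr.
  apply: (@prime1 _ Q); rewrite -Ew addrC subrK -(idpE (svalP Q)).
  by rewrite -mulrA; apply: idealMr; rewrite idpE.
have E b : ringof xd (rstr dW b) = ga b by rewrite (ringof_res xW xd dW) ringof_specmor.
exists (ringof xd); split=> [c|b|].
- exact: ringof_cst.
- have [_ /(_ b)[n [a Ea]] _] := @aff_frac k X W aW g _ dW erefl.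
  have u : p (ringof xd (rstr dW g ^+ n)) * be (gi ^+ n) = 1.
    by rewrite -rmorphXn E gap /= rmorphXn /= -rmorphM -exprMn ggi expr1n rmorph1.
  have : p (ringof xd (rstr dW g ^+ n)) * p (ringof xd b) = p (ringof xd (rstr dW g ^+ n)) * be b.
    have e1 : p (ringof xd (rstr dW g ^+ n)) = be (rstr dW g ^+ n).
      by rewrite -(rmorphXn (rstr dW)) E gap.
    have e2 : p (ringof xd (rstr dW g ^+ n)) * p (ringof xd b) = p (ringof xd (rstr dW a)).
      by rewrite -Ea !rmorphM.
    by rewrite e2 E gap /= -Ea rmorphM e1.
  move=> /(congr1 (fun z => be (gi ^+ n) * z)).
  by rewrite !mulrA (mulrC (be _)) u !mul1r.
- by rewrite -gaM -(res_gmx dW); apply/matrixP => i j; rewrite !mxE E.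
Qed.

End Charts.

Definition pow_data (R : comPzRingType) (f : R) : locdata R.
Proof.
refine (@LocData R [set a | exists n, a = f ^+ n] (ideal_zero R) _ _).
  by exists 0%N; rewrite expr0.
by move=> _ _ [m ->] [n ->]; exists (m + n)%N; rewrite exprD.
Defined.

Section UniversalMatrix.
Variables (k : fieldType) (A : comPzRingType) (hA : (1 : A) != 0) (kA : {rmorphism k -> A}) (M : GL A).

Lemma det_GL (R : comPzRingType) (x : GL R) : \det x * \det (gli x) = 1.
Proof. by rewrite -det_mulmx glmK det1. Qed.

(** [GLscheme] is given only by its universal property. Here is the model R = k[x_ij][1/det] with
    the map induced by M, whose image is generated by the entries of M and the inverse of its
    determinant. *)
Lemma GL_model : exists (R : comPzRingType) (kap : {rmorphism k -> R}) (x : GL R)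
    (e : {rmorphism R -> A}),
  [/\ forall c, e (kap c) = kA c, map_mx e x = M
    & forall P : set A, (forall c, P (kA c)) -> (forall i j, P (glm M i j)) ->
      P (\det (gli M)) -> (forall a b, P a -> P b -> P (a + b)) ->
      (forall a b, P a -> P b -> P (a * b)) -> forall r, P (e r)].
Proof.
pose R1 := mp (4 * 4) k.
pose x1 : 'M[R1]_4 := vec_mx (\row_i mpv k i).
pose d := \det x1.
pose e1 : {rmorphism R1 -> A} := @mev _ _ (nzof hA) kA (fun i => mxvec (glm M) 0%R i).
have e1C c : e1 (mpc _ k c) = kA c by exact: (@mevC _ _ (nzof hA)).
have e1V i : e1 (mpv k i) = mxvec (glm M) 0%R i by exact: (@mevV _ _ (nzof hA)).
have e1x : map_mx e1 x1 = M.
  by apply/matrixP => i j; rewrite !mxE e1V mxvecE.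
have e1d : e1 d = \det M by rewrite -e1x det_map_mx.
pose L := pow_data d.
have [||e He] := @fliftP _ L _ e1.
- move=> _ [n ->]; exists (\det (gli M) ^+ n).
  by rewrite rmorphXn /= e1d -exprMn det_GL expr1n.
- by move=> a /= ->; rewrite rmorph0.
have [di Hdi] : exists v, fcst L d * v = 1 by apply: fcst_unit; exists 1%N; rewrite expr1.
have xK : map_mx (fcst L) x1 *m (di *: map_mx (fcst L) (\adj x1)) = 1%:M.
  by rewrite -scalemxAr -map_mxM mul_mx_adj map_scalar_mx scale_scalar_mx mulrC Hdi.
have Kx : (di *: map_mx (fcst L) (\adj x1)) *m map_mx (fcst L) x1 = 1%:M.
  by rewrite -scalemxAl -map_mxM mul_adj_mx map_scalar_mx scale_scalar_mx mulrC Hdi.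
exists (frac L), (fcst L \o mpc _ k), (MkGL xK Kx), e; split=> [c||P Pc PM Pd PD Pm r].
- by rewrite /= He.
- by rewrite -e1x; apply/matrixP => i j; rewrite !mxE He.
have P1 p : P (e1 p).
  move: p; apply: mp_ind => [c|i|p q Pp Pq|p q Pp Pq].
  - by rewrite e1C.
  - by rewrite e1V; case/mxvec_indexP: i => i j; rewrite mxvecE.
  - by rewrite rmorphD; exact: PD.
  - by rewrite rmorphM; exact: Pm.
have [p [s [[n ->] E]]] := frac_surj r.
have := congr1 e E; rewrite rmorphM /= !He rmorphXn /= e1d => E1.
have -> : e r = \det (gli M) ^+ n * e1 p.
  by rewrite -E1 mulrA -exprMn mulrC (mulrC (\det _)) det_GL expr1n mulr1.
apply: (Pm) => //; elim: n {E E1} => [|n IH]; last by rewrite exprS; exact: Pm.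
by rewrite expr0 -(rmorph1 kA).
Qed.

End UniversalMatrix.

Section GoodChart.
Variables (k : fieldType) (G : GLscheme k) (X : kscheme k) (loc : schhom X G).

(* Generators of the coordinate ring of an affine open of [G], up to a
   denominator; the inclusion factors through the open subset [D(det)] of the
   space of matrices, where a smaller basic open is available. *)
Lemma G_generators (V : opens G) y : affine_open V -> oset V y ->
  exists (R : comPzRingType) (e : {rmorphism R -> sect V}) (f : R),
    [/\ unit_at (e f) y, forall a, exists n b, e f ^+ n * a = e b
      & exists c, forall P : set (sect V), (forall x, P (kcst V x)) ->
        (forall i j, P (resT V (glm (gluniv G) i j))) ->
        P c -> (forall a b, P a -> P b -> P (a + b)) ->
        (forall a b, P a -> P b -> P (a * b)) -> forall r, P (e r)].
Proof.
move=> aV Vy; have hA := sect_nz Vy.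
pose M := glmap (resT V) (gluniv G).
have [R [kap [x [e [ek ex eg]]]]] := @GL_model k (sect V) hA (kcst V) M.
have [t Et] := GL_mor G (T := Spec kap) (glmap (toG R) x).
pose sp : schhom (Spec (kcst V)) (Spec kap) := specmap ek.
pose inc : schhom (Spec (kcst V)) G := specmor aV (beta := idfun) (fun c => erefl).
have incV : lands inc V by exact: specmor_lands.
have Einc : schcomp t sp = inc.
  apply: GL_eq; rewrite mat_comp Et; apply/matrixP => i j.
  rewrite !mxE specmap_gpull (ringof_gpull incV); congr (toG _ _).
  by rewrite ringof_specmor; have := congr1 (fun m : 'M_4 => m i j) ex; rewrite !mxE.
pose Q : Spec (kcst V) := ptprime Vy.
have Ey : t (sp Q) = y.
  have -> : t (sp Q) = inc Q by have := congr1 (fun m : schhom _ G => m Q) Einc.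
  apply: (aff_eq aV) => // [|f]; first exact: (incV Q I).
  rewrite specmor_unit /=; split=> [h|h]; last by move/(_ h).
  by apply: contrapT => n; apply: h.
have Vt : oset (Defs.preim (@hcont _ _ _ t) V) (sp Q) by rewrite /= Ey.
have [f' [f'Q f't]] := @aff_basic k (Spec kap) (topen _) (spec_affine kap) (sp Q) _ I Vt.
have [f Ef] := toG_surj f'.
have Qf : ~ sval (sp Q) f by move: f'Q; rewrite -Ef => /(@unit_toG k R kap (topen _) f (sp Q) I).
have uf : unit_at (e f) y.
  apply: contrapT => n; apply: Qf; apply/(specmap_pt ek); exact: n.
exists R, e, f; split=> //; last first.
  by exists (\det (gli M)) => P Pc Pg Pd PD Pm; apply: eg => // i j; rewrite mxE; exact: Pg.
move=> a.
pose L := pow_data (e f); pose fc := fcst L.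
pose kL : {rmorphism k -> frac L} := fc \o kcst V.
pose s1 : schhom (Spec kL) (Spec (kcst V)) := specmap (kd := kL) (f := fc) (fun c => erefl).
pose s2 := schcomp sp s1.
have s2D : topen (Spec kL) `<=` s2 @^-1` (dop f').
  move=> P _ /=; rewrite -Ef; apply/(@unit_toG k R kap (topen _) f _ I).
  move=> /(specmap_pt ek)/(specmap_pt (kd := kL) (fun c => erefl)) Pf.
  have [v Ev] : exists v, fc (e f) * v = 1 by apply: fcst_unit; exists 1%N; rewrite expr1.
  by apply: (@prime1 _ P); rewrite -Ev -(idpE (svalP P)); apply: idealMr; rewrite idpE.
have tD : dop f' `<=` t @^-1` V by exact: f't.
have dT := @dop_sub k (Spec kap) _ f'.
have [_ /(_ (pull tD a))[n [b' Eb]] _] := @aff_frac k (Spec kap) _ (spec_affine kap) f' _ dT erefl.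
have [b Eb'] := toG_surj b'; rewrite -{b'}Eb' in Eb.
have s2T : topen (Spec kL) `<=` s2 @^-1` topen (Spec kap) := fun _ _ => I.
have P2 r : pull s2D (rstr dT (toG R r)) = toG _ (fc (e r)).
  rewrite (pull_restr s2T) -(specmap_gpull (kd := kL) (fun c => erefl)) -(specmap_gpull ek).
  by rewrite -gpull_comp; congr (pull _ _); exact: Prop_irrelevance.
have Pf : pull s2D (rstr dT f') = toG _ (fc (e f)).
  by rewrite -(P2 f); congr (pull _ (rstr _ _)); exact: esym Ef.
have iV : lands (schcomp inc s1) V by move=> P _; exact: (incV (s1 P) I).
have iV' : lands (schcomp t s2) V by move=> P _; exact: tD (s2D P I).
have Pa : pull s2D (pull tD a) = toG _ (fc a).
  rewrite -(comp_pull_via iV' tD s2D).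
  have E : schcomp t s2 = schcomp inc s1 by rewrite /s2 schcompA Einc.
  have -> : pull iV' a = pull iV a by move: iV' iV; rewrite E => h1 h2; rewrite (Prop_irrelevance h1 h2).
  rewrite -ringofE (ringof_comp incV iV); congr (toG _ (fc _)).
  by rewrite ringof_specmor.
have := congr1 (pull s2D) Eb; rewrite (rmorphM (pull s2D)) (rmorphXn (pull s2D)) Pf P2 Pa -(rmorphXn (toG _)) -(rmorphM (toG _)) => /toG_inj.
rewrite -(rmorphXn fc) -(rmorphM fc) => /fcst_eq[_ [[m ->] /= Em]].
exists (m + n)%N, (f ^+ m * b); rewrite rmorphM rmorphXn /=.
by apply/eqP; rewrite -subr_eq0 exprD -mulrA -mulrBr Em.
Qed.

(** A smooth chart is localized at the denominator f of [G_generators]. Its ring is then generated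
    over k by the inverse of f, the entries of the matrix, the extra generator c and the variables
    of the smooth presentation. *)
Lemma good_chart x (O : opens X) : smooth loc -> oset O x ->
  exists W : opens X, [/\ oset W x, W `<=` O, affine_open W, has_lift loc W & fin_gen (kcst W)].
Proof.
move=> sm Ox; have [U [V [UV [Ux aU aV UO sd]]]] := smooth_chart sm Ox.
have liftU := smooth_has_lift aU aV sd.
have [R [e [f [ef eg [c gen]]]]] := G_generators aV (UV _ Ux).
pose W := dop (pull UV (e f)).
have WU : W `<=` U := @dop_sub k X U (pull UV (e f)).
have Wx : oset W x by apply/pull_unit.
exists W; split=> //.
- by move=> z /WU/UO.
- exact: basic_affine.
- exact: basic_has_lift.
have hB := sect_nz Wx.
have [[psi Epsi] sW _] := @aff_frac k X U aU (pull UV (e f)) W WU erefl.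
pose rho : {rmorphism sect V -> sect W} := rstr WU \o pull UV.
have [hA [hU [n [r [beta [th [bC bs _ _ _]]]]]]] := sd.
pose l : seq (sect W) := psi :: rho c :: [seq rho (resT V (glm (gluniv G) p.1 p.2)) | p <- enum {: 'I_4 * 'I_4}]
  ++ [seq rstr WU (beta (mpv (nzof hA) i)) | i <- enum 'I_n].
apply: (@fin_genP k (nzof hB) (kcst W) l) => P Pk Pl PD Pm b.
have PX a m : P a -> P (a ^+ m).
  by move=> Pa; elim: m => [|m IH]; rewrite ?expr0 -?(rmorph1 (kcst W)) // exprS; exact: Pm.
have Ppsi : P psi by apply: Pl; rewrite inE eqxx.
have Pe r' : P (rho (e r')).
  apply: (gen (fun a => P (rho a))) => [z|i j||a a' Pa Pa'|a a' Pa Pa'].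
  - by rewrite /rho /= pull_cst res_cst.
  - apply: Pl; rewrite !inE mem_cat; apply/orP; right; apply/orP; right; apply/orP; left.
    by apply/mapP; exists (i, j); rewrite ?mem_enum.
  - by apply: Pl; rewrite !inE eqxx orbT.
  - by rewrite rmorphD; exact: PD.
  - by rewrite rmorphM; exact: Pm.
have kill (m : nat) (s : sect W) : P (rho (e f) ^+ m * s) -> P s.
  move=> H; have -> : s = psi ^+ m * (rho (e f) ^+ m * s).
    by rewrite mulrA -exprMn (mulrC psi) Epsi expr1n mul1r.
  by apply: Pm => //; exact: PX.
have PA a : P (rho a).
  by have [m [b' E]] := eg a; apply: (kill m); rewrite -rmorphXn -rmorphM E.
have PU q : P (rstr WU (beta q)).
  move: q; apply: mp_ind => [a|i|p q Pp Pq|p q Pp Pq].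
  - by rewrite bC; exact: PA.
  - apply: Pl; rewrite !inE mem_cat; apply/orP; right; apply/orP; right; apply/orP; right.
    by apply/mapP; exists i; rewrite ?mem_enum.
  - by rewrite !rmorphD; exact: PD.
  - by rewrite !rmorphM; exact: Pm.
have [m [a Ea]] := sW b; apply: (kill m); rewrite Ea.
by have [q <-] := bs a.
Qed.

End GoodChart.

Lemma pz_ind (P : comPzRingType -> Prop) :
  (forall D : comPzRingType, (1 : D) = 0 -> P D) -> (forall D : comNzRingType, P D) ->
  forall D, P D.
Proof.
move=> H0 H1 D; case: (eqVneq (1 : D) 0) => [/H0//|hD].
have := H1 (nzof hD).
have -> // : (nzof hD : comPzRingType) = D by case: D hD => T [] *.
Qed.

(** * Local rings of smooth algebras are domains *)

Lemma mp_domain (n : nat) (k : fieldType) (a b : mp n k) : a * b = 0 -> a = 0 \/ b = 0.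
Proof.
by move=> /eqP; rewrite (mulf_eq0 (a : mpoly.mpoly n k)) => /orP[] /eqP; [left|right].
Qed.

Definition ksmooth (k : fieldType) (A : comPzRingType) (kap : {rmorphism k -> A}) : Prop :=
  forall (C : comNzRingType) (C0 : comPzRingType) (p : {rmorphism C -> C0})
    (kc : {rmorphism k -> C}) (be : {rmorphism A -> C0}),
  (forall c0, exists c, p c = c0) -> (forall a b, p a = 0 -> p b = 0 -> a * b = 0) ->
  (forall c, be (kap c) = p (kc c)) ->
  exists ga : {rmorphism A -> C}, (forall c, ga (kap c) = kc c) /\ forall b, p (ga b) = be b.

Section GradedOrder.
Variables (P : comNzRingType) (I : Type) (a : I -> P) (Ev : {rmorphism P -> {poly P}}).
Hypothesis Eva : forall i, Ev (a i) = (a i)%:P * 'X.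
Hypothesis Ev1 : forall p, (Ev p).[1] = p.
Hypothesis Ev_coef : forall p d, ipow (range a) d (Ev p)`_d.
Hypothesis domP : forall x y : P, x * y = 0 -> x = 0 \/ y = 0.

(** [Ev] scales the generators a_i by X, so its coefficient of degree d is the homogeneous part of
    degree d, and the order of p is the lowest degree that occurs. *)
Lemma ipow_coef p N : ipow (range a) N p <-> forall d, (d < N)%N -> (Ev p)`_d = 0.
Proof.
split=> [H|H].
  elim: H => {N p}[c|N|N x y _ Hx _ Hy|N c x _ Hx|N x y [i _ <-] _ Hx] d dN //.
  - by rewrite rmorph0 coef0.
  - by rewrite rmorphD coefD (Hx _ dN) (Hy _ dN) addr0.
  - rewrite rmorphM coefM; apply: big1 => i _.
    by rewrite (Hx _ (leq_ltn_trans (leq_subr _ _) dN)) mulr0.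
  - rewrite rmorphM Eva -mulrA coefCM coefXM; case: d dN => [|d] dN /=; first by rewrite mulr0.
    by rewrite (Hx _ dN) mulr0.
rewrite -(Ev1 p) horner_coef; apply: ipow_sum => i; rewrite expr1n mulr1.
have [iN|Ni] := ltnP i N; first by rewrite H //; exact: ip_0.
by apply: ipow_leq Ni _; exact: Ev_coef.
Qed.

Lemma ipow_low p N : ~ ipow (range a) N p -> exists d, [/\ (d < N)%N, (Ev p)`_d <> 0 & forall i, (i < d)%N -> (Ev p)`_i = 0].
Proof.
move=> H; have [|d [Hd Hm]] := @nat_min (fun d => (Ev p)`_d <> 0).
  by apply: contrapT => H'; apply/H/ipow_coef => d _; apply: contrapT => nd; apply: H'; exists d.
have lt i : (i < d)%N -> (Ev p)`_i = 0.
  by move=> id; apply: contrapT => /Hm; rewrite leqNgt id.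
exists d; split=> //; rewrite ltnNge; apply/negP => Nd; apply/H/ipow_coef => i iN.
by apply: lt; exact: leq_trans iN Nd.
Qed.

(** The lowest homogeneous parts multiply to a nonzero element, as the ring is a domain. *)
Lemma graded_mul p q M N : ~ ipow (range a) M p -> ~ ipow (range a) N q -> ~ ipow (range a) (M + N) (p * q).
Proof.
move=> /ipow_low[d [dM pd dl]] /ipow_low[e [eN qe el]] /ipow_coef /(_ (d + e)%N).
have -> : (d + e < M + N)%N by rewrite -addSn leq_add // ltnW.
move=> /(_ isT); rewrite rmorphM coefM.
have de : (d < (d + e).+1)%N by rewrite ltnS leq_addr.
rewrite (bigD1 (Ordinal de)) //= big1 ?addr0 ?addKn => [/domP[]//|i /eqP id].
have [ltd|] := ltnP i d; first by rewrite dl ?mul0r.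
rewrite leq_eqVlt => /orP[/eqP E|gt]; first by case: id; exact: val_inj.
rewrite el ?mulr0 //; have := ltn_ord i; rewrite ltnS => ide.
by rewrite ltn_subLR ?ltn_add2r.
Qed.

End GradedOrder.

Section PointOrder.
Variables (k : fieldType) (n : nat) (xi : 'I_n -> k).
Let P := mp n k.
Let a (i : 'I_n) : P := mpv k i - mpc n k (xi i).
Definition maxpow N := ipow (range a) N.
Definition mp_at : {rmorphism mp n k -> k} := mev (idfun : {rmorphism k -> k}) xi.

(** Expansion at the point xi, by the substitution of xi + (x - xi) X for x. *)
Let Ev : {rmorphism P -> {poly P}} :=
  mev (polyC \o mpc n k) (fun i => (mpc n k (xi i))%:P + (a i)%:P * 'X).

Let EvC c : Ev (mpc n k c) = (mpc n k c)%:P. Proof. exact: mevC. Qed.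
Let EvV i : Ev (mpv k i) = (mpc n k (xi i))%:P + (a i)%:P * 'X. Proof. exact: mevV. Qed.
Let Eva i : Ev (a i) = (a i)%:P * 'X.
Proof. by rewrite [in LHS]/a rmorphB EvV EvC addrC addKr. Qed.

Let Ev1 p : (Ev p).[1] = p.
Proof.
have H : (horner_eval (1 : P) \o Ev) =1 idfun.
  apply: mp_hom_eq => [c|i]; rewrite /= /horner_eval.
    by rewrite EvC hornerC.
  by rewrite EvV hornerD hornerMX !hornerC mulr1 /a addrC subrK.
by have := H p; rewrite /= /horner_eval.
Qed.

Let Ev_coef p d : maxpow d (Ev p)`_d.
Proof.
move: p d; apply: mp_ind => [c|i|p q Hp Hq|p q Hp Hq] d.
- rewrite EvC coefC; case: d => [|d]; [exact: ip_cst|exact: ip_0].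
- rewrite EvV coefD coefC coefMX coefC; case: d => [|[|d]]; rewrite /= ?add0r.
  + exact: ip_cst.
  + by apply: ipow1; exists i.
  + exact: ip_0.
- by rewrite rmorphD coefD; apply: ip_D; [exact: Hp|exact: Hq].
- rewrite rmorphM coefM; apply: ipow_sum => i.
  by have := ipow_mul (Hp i) (Hq (d - i)%N); rewrite subnKC // -ltnS.
Qed.

Lemma maxpow_mul p q M N : ~ maxpow M p -> ~ maxpow N q -> ~ maxpow (M + N) (p * q).
Proof. exact: (graded_mul Eva Ev1 Ev_coef (@mp_domain n k)). Qed.

Lemma mp_atE p : maxpow 1 (p - mpc n k (mp_at p)).
Proof.
move: p; apply: mp_ind => [c|i|p q Hp Hq|p q Hp Hq].
- by rewrite /mp_at mevC subrr; exact: ip_0.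
- by rewrite /mp_at mevV; apply: ipow1; exists i.
- by rewrite !rmorphD opprD addrACA; exact: ip_D.
- rewrite !rmorphM /=.
  have -> : p * q - mpc n k (mp_at p) * mpc n k (mp_at q) =
    q * (p - mpc n k (mp_at p)) + mpc n k (mp_at p) * (q - mpc n k (mp_at q)) by ring.
  by apply: ip_D; exact: ip_M.
Qed.

Lemma maxpow1 p : maxpow 1 p <-> mp_at p = 0.
Proof.
split=> [H|E]; last by have := mp_atE p; rewrite E rmorph0 subr0.
suff K N y : maxpow N y -> (0 < N)%N -> mp_at y = 0 by exact: K H _.
elim=> {N y}[c|N|N x y _ Hx _ Hy|N c x _ Hx|N x y [i _ <-] _ Hx] // N0.
- by rewrite rmorph0.
- by rewrite rmorphD Hx ?Hy ?addr0.
- by rewrite rmorphM /= Hx ?mulr0.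
- by rewrite rmorphM rmorphB /= /mp_at mevV mevC subrr mul0r.
Qed.

Lemma mp_atC c : mp_at (mpc n k c) = c. Proof. exact: mevC. Qed.
Lemma mp_atV i : mp_at (mpv k i) = xi i. Proof. exact: mevV. Qed.

End PointOrder.
Global Opaque mp_at.

Section LocalDomain.
Variables (k : fieldType) (A : comPzRingType) (kap : {rmorphism k -> A}).
Variables (xi : {rmorphism A -> k}).
Hypothesis xik : forall c, xi (kap c) = c.
Hypothesis fgA : fin_gen kap.

Definition near0 (a : A) : Prop := exists j, xi j != 0 /\ j * a = 0.

Lemma near0_coords : exists n (rho : {rmorphism mp n k -> A}) (z : 'I_n -> k),
  [/\ forall c, rho (mpc n k c) = kap c, forall b, exists p, rho p = b
    & forall p, xi (rho p) = mp_at z p].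
Proof.
have [n [rho [rk rs]]] := fgA; exists n, rho, (fun i => xi (rho (mpv k i))); split=> // p.
apply: (@mp_hom_eq n k k (xi \o rho) (mp_at _)) p => [c|i].
  by rewrite /= rk xik mp_atC.
by rewrite mp_atV.
Qed.

(** Krull's theorem kills an element of all powers of the maximal ideal by some 1 - i with i in that
    ideal, and 1 - i has value 1 at the point. *)
Lemma krull_near n (rho : {rmorphism mp n k -> A}) z a :
  (forall p, xi (rho p) = mp_at z p) -> (forall b, exists p, rho p = b) ->
  (forall N, exists c, maxpow z N c /\ rho c = a) -> near0 a.
Proof.
move=> rz rs H.
have [||||i [Hi E]] := @krull k n n 1 (fun i => mpv k i - mpc n k (z i)) A rho (fun=> 1) [set x | x = 0] _ _ _ a.
- by [].
- by move=> x y /= -> ->; rewrite addr0.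
- by move=> p x /= ->; rewrite mulr0.
- move=> N; have [c [cN ca]] := H N; exists (fun=> c); split=> [_|/=]; first exact: cN.
  by rewrite big_ord1 mulr1 ca subrr.
exists (1 - rho i); split=> //; rewrite rmorphB rmorph1 rz.
have -> : mp_at z i = 0; last by rewrite subr0 oner_eq0.
apply/maxpow1; have /spanP[l [lG ->]] := Hi.
rewrite big_seq; apply: (big_ind (maxpow z 1)) => [|x y|w /lG wG]; [exact: ip_0|exact: ip_D|].
by apply/ip_M/ipow1.
Qed.

(** N is chosen with a outside the N-th power of the maximal ideal. As j is a unit at the point, an
    equation j a = h^N c would put a in that power. *)
Lemma near0_order a : ~ near0 a ->
  exists N, forall j h c, xi j != 0 -> xi h = 0 -> j * a <> h ^+ N * c.
Proof.
move=> na; have [n [rho [z [rk rs rz]]]] := near0_coords.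
have [N HN] : exists N, ~ exists c, maxpow z N c /\ rho c = a.
  apply: contrapT => H; apply: na; apply: (krull_near rz rs) => N.
  by apply: contrapT => H'; apply: H; exists N.
exists N => j0 h c0 xj0 xh E0; apply: HN.
(* Normalizing j0 to value 1 at the point turns the equation into a = m a + h^N c with m in the
   maximal ideal, which is then iterated N times. *)
pose u := kap (xi j0)^-1; pose m := 1 - u * j0; pose c := u * c0.
have xm : xi m = 0 by rewrite rmorphB rmorphM rmorph1 xik mulVf ?subrr.
have E : a = m * a + h ^+ N * c by rewrite /c mulrCA -E0 /m; ring.
have it i : exists d, a = m ^+ i * a + h ^+ N * d.
  elim: i => [|i [d Ed]]; first by exists 0; rewrite expr0 mul1r mulr0 addr0.
  exists (m ^+ i * c + d); rewrite {1}Ed {1}E exprSr; ring.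
have [d Ed] := it N.
have [m' Em] := rs m; have [h' Eh] := rs h; have [a' Ea] := rs a; have [d' Ed'] := rs d.
exists (m' ^+ N * a' + h' ^+ N * d'); split; last by rewrite rmorphD !rmorphM !rmorphXn /= Em Eh Ea Ed' -Ed.
have pw x y : mp_at z x = 0 -> maxpow z N (x ^+ N * y).
  move=> /maxpow1 x1; rewrite mulrC; apply: ip_M; elim: (N) => [|i IH]; first exact: ip_cst.
  by rewrite exprS; have := ipow_mul x1 IH; rewrite add1n.
by apply: ip_D; apply: pw; rewrite -rz ?Em ?Eh.
Qed.

Hypothesis smA : ksmooth kap.

(* The lifting property gives an endomorphism of the polynomial ring over [A]
   which maps the ideal of relations into its square; its iterates embed the
   local ring into power series. *)
Lemma smooth_endo n (rho : {rmorphism mp n k -> A}) :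
  (forall c, rho (mpc n k c) = kap c) -> (forall b, exists p, rho p = b) ->
  exists th : {rmorphism mp n k -> mp n k}, (forall p, rho (th p) = rho p) /\
    forall p, rho p = 0 -> span [set z | exists x y, [/\ rho x = 0, rho y = 0 & z = x * y]] (th p).
Proof.
move=> rk rs.
pose K2 := span [set z | exists x y, [/\ rho x = 0, rho y = 0 & z = x * y]].
have K2r x : K2 x -> rho x = 0.
  move=> /spanP[l [lG ->]]; rewrite rmorph_sum big_seq big1 // => w /lG[u [v [Eu Ev ->]]].
  by rewrite !rmorphM Eu mul0r mulr0.
have [pr Hpr] := @quo_lift _ K2 _ rho K2r.
have nz : (1 : quo K2) != 0.
  apply/eqP => E; have := rmorph1 xi; rewrite -(rmorph1 rho) -Hpr (rmorph1 (toquo K2)) E (rmorph0 pr) rmorph0 => /esym/eqP.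
  by rewrite oner_eq0.
pose C := nzof nz.
have [|||sg [sgk sgp]] := smA (C := C) (C0 := A) (p := pr) (kc := toquo K2 \o mpc n k) (be := idfun).
- by move=> c0; have [p <-] := rs c0; exists (toquo K2 p).
- move=> x y; have [x' <-] := toquo_surj x; have [y' <-] := toquo_surj y.
  rewrite !Hpr => Ex Ey; rewrite -rmorphM; apply: toquo_kill; apply: span_mem.
  by exists x', y'.
- by move=> c /=; rewrite Hpr rk.
have /choice[v Hv] : forall i, exists v, toquo K2 v = sg (rho (mpv k i)) by move=> i; exact: toquo_surj.
pose th : {rmorphism mp n k -> mp n k} := mev (mpc n k) v.
have E p : toquo K2 (th p) = sg (rho p).
  apply: (@mp_hom_eq n k _ (toquo K2 \o th) (sg \o rho)) p => [c|i] /=.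
    by rewrite /th mevC rk sgk.
  by rewrite /th mevV.
exists th; split=> p; first by rewrite -Hpr E sgp.
by move=> rp; apply: toquo_mem; rewrite E rp rmorph0.
Qed.

(** If j a b = 0, the iterated endomorphism sends a lift of j a b to a high power of the maximal
    ideal of the polynomial ring, whereas the images of lifts of j, a and b are again lifts of them,
    of bounded order; and orders add at a point of affine space. *)
Lemma near0_mul a b : near0 (a * b) -> near0 a \/ near0 b.
Proof.
move=> [j [xj Ej]]; have [n [rho [z [rk rs rz]]]] := near0_coords.
have [th [thr thK]] := smooth_endo rk rs.
have it N : exists t : {rmorphism mp n k -> mp n k}, (forall p, rho (t p) = rho p) /\
    forall p, rho p = 0 -> maxpow z N (t p).
  elim: N => [|N [t [tr tK]]]; first by exists idfun; split=> // p _; exact: ip_cst.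
  exists (t \o th); split=> p /=; first by rewrite tr thr.
  move=> /thK/spanP[l [lG ->]]; rewrite rmorph_sum big_seq.
  apply: (big_ind (maxpow z N.+1)) => [|x y|w /lG[x [y [Ex Ey ->]]]]; [exact: ip_0|exact: ip_D|].
  rewrite !rmorphM; apply: ip_M; rewrite -addn1; apply: ipow_mul; first exact: tK.
  by apply/maxpow1; rewrite -rz tr Ey rmorph0.
apply: contrapT => H.
have bad x : ~ near0 x -> exists N, forall p, rho p = x -> ~ maxpow z N p.
  move=> nx; apply: contrapT => Hx; apply: nx; apply: (krull_near rz rs) => N.
  apply: contrapT => H'; apply: Hx; exists N => p px mp; apply: H'; by exists p.
have [N1 H1] : exists N, forall p, rho p = a -> ~ maxpow z N p by apply: bad => na; apply: H; left.
have [N2 H2] : exists N, forall p, rho p = b -> ~ maxpow z N p by apply: bad => nb; apply: H; right.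
have [t [tr tK]] := it (1 + (N1 + N2))%N.
have [a' Ea] := rs a; have [b' Eb] := rs b; have [j' Ejj] := rs j.
have := tK (j' * (a' * b')); rewrite !rmorphM Ejj Ea Eb Ej => /(_ erefl).
apply: maxpow_mul; last by apply: maxpow_mul; [apply: H1|apply: H2]; rewrite tr.
by move/maxpow1; rewrite -rz tr Ejj => /eqP; apply/negP.
Qed.

End LocalDomain.

(** * Jets, and germs of the strata cut out by matrix entries *)

Section Jets.
Variable D : comNzRingType.

(** D[X]/(X^N). Truncation suffices to read off a leading coefficient, and the tower of jets is made
    of square-zero extensions. *)
Definition jet N : comPzRingType := quo (span_seq [:: ('X^N : {poly D})]).
Definition jp N : {rmorphism {poly D} -> jet N} := toquo _.

Lemma span1P (R : comPzRingType) (a x : R) : span_seq [:: a] x <-> exists c, x = c * a.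
Proof.
split=> [/span_seqP[c ->]|[c ->]]; first by exists (c 0%N); rewrite big_ord1.
by apply/idealM/span_mem; rewrite /= inE.
Qed.

Lemma jp_eq0 N p : jp N p = 0 <-> forall i, (i < N)%N -> p`_i = 0.
Proof.
split=> [/toquo_mem/span1P[c ->] i iN|H]; first by rewrite coefMXn iN.
apply: toquo_kill; apply/span1P; exists (drop_poly N p).
rewrite -{1}(poly_take_drop N p) (_ : take_poly N p = 0) ?add0r //.
by apply/polyP => i; rewrite coef_take_poly coef0; case: ifP => // /H.
Qed.

Lemma jp_eq N p q : jp N p = jp N q <-> forall i, (i < N)%N -> p`_i = q`_i.
Proof.
have E : jp N p = jp N q <-> jp N (p - q) = 0.
  by rewrite rmorphB; split=> [->|/eqP]; rewrite ?subrr // subr_eq0 => /eqP.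
rewrite E jp_eq0; split=> H i iN; have := H i iN; rewrite coefB => /eqP.
  by rewrite subr_eq0 => /eqP.
by move=> /eqP ->; rewrite subrr.
Qed.

Lemma jp_surj N c : exists p, jp N p = c. Proof. exact: toquo_surj. Qed.

Lemma jet_nz N : (1 : jet N.+1) != 0.
Proof.
apply/eqP; rewrite -(rmorph1 (jp N.+1)) => /jp_eq0 /(_ 0%N isT) /eqP.
by rewrite coef1 oner_eq0.
Qed.

(** The kernel is generated by X^(N+1), whose square is divisible by X^(N+2); this is why the tower
    starts at index 1. *)
Lemma jet_proj N : exists pr : {rmorphism jet N.+2 -> jet N.+1},
  [/\ forall p, pr (jp _ p) = jp _ p, forall c, exists c', pr c' = c
    & forall a b, pr a = 0 -> pr b = 0 -> a * b = 0].
Proof.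
apply: quo_proj => [x /span1P[c ->]|x y /span1P[c ->] /span1P[d ->]]; apply/span1P.
  by exists (c * 'X); rewrite -mulrA -exprS.
by exists (c * d * 'X^N); rewrite mulrACA -exprD -[RHS]mulrA -exprD addSnnS.
Qed.

End Jets.
Global Opaque jp jet.

(** The property [has_lift] of a chart, freed from schemes. *)
Definition mlift (k : fieldType) (B : comPzRingType) (kap : {rmorphism k -> B}) (M : 'M[B]_4) : Prop :=
  forall (C : comNzRingType) (C0 : comPzRingType) (p : {rmorphism C -> C0}) (kc : {rmorphism k -> C})
    (be : {rmorphism B -> C0}) (Mc : 'M[C]_4),
  (forall c0, exists c, p c = c0) -> (forall a b, p a = 0 -> p b = 0 -> a * b = 0) ->
  (forall c, be (kap c) = p (kc c)) -> map_mx p Mc = map_mx be M ->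
  exists ga : {rmorphism B -> C},
    [/\ forall c, ga (kap c) = kc c, forall b, p (ga b) = be b & map_mx ga M = Mc].

(* The matrix [g] is multiplied on the right by a permutation matrix, so that the
   closed strata of the flag stack are given by the vanishing of entries [hc g t]
   with [t] above the diagonal. *)
Definition hc (R : Type) (M : 'M[R]_4) (t : 'I_4 * 'I_4) : R := M t.1 (ord_pred t.2).

Lemma ord_predK4 (j : 'I_4) : ordS (ord_pred j) = j.
Proof. by apply: val_inj; case: j => [[|[|[|[|]]]]]. Qed.

Lemma ordSK4 (j : 'I_4) : ord_pred (ordS j) = j.
Proof. by apply: val_inj; case: j => [[|[|[|[|]]]]]. Qed.

Lemma hc_map (R S : comPzRingType) (f : R -> S) (M : 'M[R]_4) t : hc (map_mx f M) t = f (hc M t).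
Proof. by rewrite /hc mxE. Qed.

Lemma hc_ext (R : comPzRingType) (M N : 'M[R]_4) : (forall t, hc M t = hc N t) -> M = N.
Proof.
by move=> H; apply/matrixP => i j; have := H (i, ordS j); rewrite /hc /= ordSK4.
Qed.

Definition hmx (R : comPzRingType) (F : 'I_4 * 'I_4 -> R) : 'M[R]_4 := \matrix_(i, j) F (i, ordS j).

Lemma hc_hmx (R : comPzRingType) (F : 'I_4 * 'I_4 -> R) t : hc (hmx F) t = F t.
Proof. by rewrite /hc mxE ord_predK4; case: t. Qed.

Definition IJ (B : comPzRingType) (M : 'M[B]_4) (J : seq ('I_4 * 'I_4)) : ideal B :=
  span [set x | exists t, t \in J /\ x = hc M t].

Section IJTheory.
Variables (B : comPzRingType) (M : 'M[B]_4).
Implicit Types (J : seq ('I_4 * 'I_4)).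

Lemma IJ_mem J t : t \in J -> IJ M J (hc M t).
Proof. by move=> tJ; apply: span_mem; exists t. Qed.

Lemma IJ_kill (C : comPzRingType) (f : {rmorphism B -> C}) J a :
  (forall t, t \in J -> f (hc M t) = 0) -> IJ M J a -> f a = 0.
Proof.
move=> H /spanP[l [lG ->]]; rewrite rmorph_sum big_seq big1 // => w /lG[t [tJ ->]].
by rewrite rmorphM H ?mulr0.
Qed.

Lemma IJ_sub J J' a : {subset J <= J'} -> IJ M J a -> IJ M J' a.
Proof.
move=> sub; apply: (@span_min B [set x | exists t, t \in J /\ x = hc M t]) => _ [t [tJ ->]].
by apply: IJ_mem; exact: sub.
Qed.

Lemma IJ_cons J t a : IJ M (t :: J) a -> exists c, IJ M J (a - hc M t * c).
Proof.
move=> /spanP[l [lG ->]]; rewrite big_seq; apply: (big_ind (fun a => exists c, IJ M J (a - hc M t * c))).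
- by exists 0; rewrite mulr0 subr0; exact: ideal0.
- move=> x y [c Hc] [d Hd]; exists (c + d).
  by rewrite mulrDr opprD addrACA; exact: idealD.
- move=> w /lG[s [+ ->]]; rewrite inE => /orP[/eqP->|sJ].
    by exists w.1; rewrite mulrC subrr; exact: ideal0.
  by exists 0; rewrite mulr0 subr0; apply/idealM/IJ_mem.
Qed.

End IJTheory.

Lemma IJ_map (B C : comPzRingType) (M : 'M[B]_4) (f : {rmorphism B -> C}) J a : IJ M J a -> IJ (map_mx f M) J (f a).
Proof.
move=> /spanP[l [lG ->]]; rewrite rmorph_sum big_seq; apply: ideal_sum => w /lG[t [tJ ->]].
by rewrite rmorphM -hc_map; apply/idealM/IJ_mem.
Qed.

Section JetLift.
Variables (k : fieldType) (B : comPzRingType) (kap : {rmorphism k -> B}) (M : 'M[B]_4).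
Hypothesis liftB : mlift kap M.
Variables (D : comNzRingType) (be : {rmorphism B -> D}).

Lemma jet_step (C2 : comNzRingType) (C1 : comPzRingType) (j2 : {rmorphism {poly D} -> C2})
    (j1 : {rmorphism {poly D} -> C1}) (pr : {rmorphism C2 -> C1}) (Mc : 'M[{poly D}]_4)
    (ga : {rmorphism B -> C1}) :
  (forall p, pr (j2 p) = j1 p) -> (forall c, exists c', pr c' = c) ->
  (forall a b, pr a = 0 -> pr b = 0 -> a * b = 0) -> (forall c, exists p, j2 p = c) ->
  (forall p q, j1 p = j1 q -> p`_0 = q`_0) ->
  (forall c, ga (kap c) = j1 (be (kap c))%:P) ->
  (forall b, exists q, ga b = j1 q /\ q`_0 = be b) -> map_mx ga M = map_mx j1 Mc ->
  exists ga' : {rmorphism B -> C2},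
    [/\ forall c, ga' (kap c) = j2 (be (kap c))%:P,
        forall b, exists q, ga' b = j2 q /\ q`_0 = be b & map_mx ga' M = map_mx j2 Mc].
Proof.
move=> prE prs pr0 j2s j10 gak gab gaM.
have [||ga' [gak' gap' gaM']] := liftB (p := pr) (kc := j2 \o polyC \o be \o kap) (be := ga)
  (Mc := map_mx j2 Mc) prs pr0.
- by move=> c; rewrite gak /= prE.
- by rewrite gaM; apply/matrixP => i j; rewrite !mxE prE.
exists ga'; split=> // b; have [q [E q0]] := gab b; have [q' E'] := j2s (ga' b).
exists q'; split; first exact: esym.
by rewrite -q0; apply: j10; rewrite -E -prE E' gap'.
Qed.

(** The tower of jets is climbed by square-zero steps, so every polynomial deformation of the matrix
    is realized by a deformation of the point. *)
Lemma jet_lift (Mc : 'M[{poly D}]_4) N : (forall i j, (Mc i j)`_0 = be (M i j)) ->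
  exists ga : {rmorphism B -> jet D N.+1},
    [/\ forall c, ga (kap c) = jp D _ (be (kap c))%:P, 
        forall b, exists q, ga b = jp D _ q /\ q`_0 = be b & map_mx ga M = map_mx (jp D _) Mc].
Proof.
move=> M0; elim: N => [|N [ga [gak gab gaM]]].
  exists (jp D 1 \o (polyC : {rmorphism D -> {poly D}}) \o be); split=> // [b|].
    by exists (be b)%:P; split; [|exact: coefC].
  apply/matrixP => i j; rewrite !mxE; apply/jp_eq => -[|//] _.
  by rewrite coefC M0.
have [pr [prE prs pr0]] := jet_proj D N.
have j10 p q : jp D N.+1 p = jp D N.+1 q -> p`_0 = q`_0 by move=> /jp_eq/(_ 0%N isT).
exact: (@jet_step (nzof (jet_nz D N.+1)) _ (jp D N.+2) (jp D N.+1) pr Mc ga prE prs pr0 (@jp_surj D N.+2) j10 gak gab gaM).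
Qed.

End JetLift.

Section Germs.
Variables (k : fieldType) (B : comPzRingType) (kap : {rmorphism k -> B}) (M : 'M[B]_4).
Hypothesis liftB : mlift kap M.
Hypothesis fgB : fin_gen kap.
Variable xi : {rmorphism B -> k}.
Hypothesis xik : forall c, xi (kap c) = c.
Local Notation h := (hc M).

(* [a] vanishes on the stratum [J] near the point [xi]. *)
Definition zn J (a : B) : Prop := exists j, xi j != 0 /\ IJ M J (j * a).

Lemma xi_mul_neq0 i j : xi i != 0 -> xi j != 0 -> xi (i * j) != 0.
Proof. by move=> *; rewrite rmorphM mulf_neq0. Qed.

Lemma zn_of J a : IJ M J a -> zn J a.
Proof. by move=> Ja; exists 1; rewrite rmorph1 oner_eq0 mul1r. Qed.

Lemma znD J a b : zn J a -> zn J b -> zn J (a + b).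
Proof.
move=> [i [xi_ Hi]] [j [xj Hj]]; exists (i * j); split; first exact: xi_mul_neq0.
have -> : i * j * (a + b) = j * (i * a) + i * (j * b) by ring.
by apply: idealD; exact: idealM.
Qed.

Lemma znM J a b : zn J b -> zn J (a * b).
Proof.
by move=> [j [xj Hj]]; exists j; split=> //; rewrite mulrCA; exact: idealM.
Qed.

Lemma znB J a b : zn J a -> zn J b -> zn J (a - b).
Proof. by move=> za zb; rewrite -mulN1r; apply: znD => //; exact: znM. Qed.

Lemma zn_sub J J' a : {subset J <= J'} -> zn J a -> zn J' a.
Proof. by move=> sub [j [xj Hj]]; exists j; split=> //; exact: IJ_sub Hj. Qed.

(** The lift of the matrix may be prescribed: entries of J are lifted to 0 and all others
    arbitrarily, so the lifted point stays in the stratum. *)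
Lemma quo_ksmooth J : ksmooth (toquo (IJ M J) \o kap).
Proof.
move=> C C0 p kc be ps p0 bek.
have /choice[c Hc] : forall x : 'I_4 * 'I_4, exists c, p c = be (toquo (IJ M J) (h x)) by move=> x; exact: ps.
pose Mc : 'M[C]_4 := hmx (fun t => if t \in J then 0 else c t).
have [||ga [gak gap gaM]] := liftB (p := p) (kc := kc) (be := be \o toquo (IJ M J)) (Mc := Mc) ps p0.
- by move=> x /=; exact: bek.
- apply: hc_ext => t; rewrite !hc_map hc_hmx /=; case: ifP => [tJ|_]; last exact: Hc.
  by rewrite rmorph0 (toquo_kill (IJ_mem M tJ)) rmorph0.
have [|g Hg] := @quo_lift _ (IJ M J) _ ga.
  move=> a; apply: IJ_kill => t tJ; rewrite -hc_map gaM hc_hmx tJ //.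
exists g; split=> [x|b]; first by rewrite /= Hg.
by have [a <-] := toquo_surj b; rewrite Hg gap.
Qed.

Lemma quo_fin_gen J : fin_gen (toquo (IJ M J) \o kap).
Proof.
have [n [rho [rk rs]]] := fgB; exists n, (toquo (IJ M J) \o rho); split=> [c|b].
  by rewrite /= rk.
by have [a <-] := toquo_surj b; have [p <-] := rs a; exists p.
Qed.

Section Stratum.
Variable J : seq ('I_4 * 'I_4).
Hypothesis xiJ : forall t, t \in J -> xi (h t) = 0.

Lemma xi_quo : exists xq : {rmorphism quo (IJ M J) -> k}, forall a, xq (toquo _ a) = xi a.
Proof. by apply: quo_lift => a; apply: IJ_kill. Qed.

Lemma near0_zn (xq : {rmorphism quo (IJ M J) -> k}) a : (forall a, xq (toquo _ a) = xi a) ->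
  near0 xq (toquo _ a) <-> zn J a.
Proof.
move=> Hx; split=> [[j [xj E]]|[j [xj Hj]]].
  have [j' Ej] := toquo_surj j; exists j'; rewrite -Hx Ej; split=> //.
  by apply: toquo_mem; rewrite rmorphM Ej.
by exists (toquo _ j); rewrite Hx -rmorphM; split=> //; exact: toquo_kill.
Qed.

(** The stratum is formally smooth and of finite type over k, so its germ is a domain by
    [near0_mul]. *)
Lemma zn_mul a b : zn J (a * b) -> zn J a \/ zn J b.
Proof.
have [xq Hx] := xi_quo; rewrite -(near0_zn a Hx) -(near0_zn b Hx) -(near0_zn (a * b) Hx) rmorphM.
have H c : xq ((toquo (IJ M J) \o kap) c) = c by rewrite /= Hx.
exact: (near0_mul H (quo_fin_gen J) (@quo_ksmooth J)).
Qed.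

Lemma zn_exp a n : zn J (a ^+ n) -> zn J a.
Proof.
elim: n => [|n IH]; last by rewrite exprS => /zn_mul[].
by move=> z1; rewrite -(mulr1 a) -(expr0 a); exact: znM.
Qed.

Lemma zn_order t a : xi (h t) = 0 -> ~ zn J a ->
  exists N, forall j c, xi j != 0 -> ~ IJ M J (j * a - h t ^+ N * c).
Proof.
have [xq Hx] := xi_quo; move=> ht na.
have [||N HN] := @near0_order k _ (toquo (IJ M J) \o kap) xq _ (quo_fin_gen J) (toquo _ a).
- by move=> c; rewrite /= Hx.
- by rewrite near0_zn.
exists N => j c xj Hj.
apply: (HN (toquo _ j) (toquo _ (h t)) (toquo _ c)); rewrite ?Hx //.
rewrite -rmorphM -rmorphXn -rmorphM; apply/eqP; rewrite -subr_eq0 -rmorphB; apply/eqP.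
exact: toquo_kill.
Qed.

(** A first-order deformation keeps the entries of J equal to 0 and moves the entry t to X. A
    product j h_t then goes to a multiple of X whose coefficient xi j is nonzero. *)
Lemma zn_reg t : t \notin J -> xi (h t) = 0 -> ~ zn J (h t).
Proof.
move=> tJ ht [j [xj Hj]].
pose Mc : 'M[{poly k}]_4 := hmx (fun s => (xi (h s))%:P + (if s == t then 'X else 0)).
have [|ga [_ gab gaM]] := @jet_lift k B kap M liftB k xi Mc 1.
  move=> i i'; rewrite mxE coefD coefC /= -[RHS]addr0; congr (xi _ + _).
    by rewrite /hc /= ordSK4.
  by case: ifP; rewrite ?coefX ?coef0.
have [q [Eq q0]] := gab j.
have gah s : ga (h s) = jp k 2 ((xi (h s))%:P + (if s == t then 'X else 0)).
  by rewrite -hc_map gaM hc_map hc_hmx.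
have : ga (j * h t) = 0.
  apply: IJ_kill Hj => s sJ; rewrite gah xiJ // polyC0 add0r ifN ?rmorph0 //.
  by apply: contraNneq tJ => <-.
rewrite rmorphM gah ht eqxx polyC0 add0r Eq -rmorphM => /jp_eq0/(_ 1%N isT).
by rewrite coefMX /= q0 => /eqP; apply/negP.
Qed.

Lemma zn_cancel t a n : t \notin J -> xi (h t) = 0 -> zn J (h t ^+ n * a) -> zn J a.
Proof.
by move=> tJ ht /zn_mul[/zn_exp/(zn_reg tJ ht)|].
Qed.

(** The germ being a domain, each j with j a = 0 on the stratum is killed by a function that is
    nonzero at the point. A maximal ideal among those killed by one such function contains them all,
    so that a single g is enough. *)
Lemma zn_open a : ~ zn J a -> exists g, xi g != 0 /\
  forall j, IJ M J (j * a) -> IJ M J (g * j).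
Proof.
move=> na; have [n [rho [rk rs]]] := fgB.
have nB : (1 : B) != 0 by apply/eqP => E; have /eqP := rmorph1 xi; rewrite E rmorph0 eq_sym oner_eq0.
have nN : noeth (nzof nB) by apply: (@noeth_surj (mp n k) (nzof nB) rho); [exact: rs|exact: noeth_mp].
pose PP (b : ideal (nzof nB)) := (forall j, b j -> IJ M J (j * a)) /\
  exists g, xi g != 0 /\ forall j, b j -> IJ M J (g * j).
have [|b [[bJ [g [xg bg]]] bm]] := @noeth_max (nzof nB) PP nN.
  exists (ideal_zero _); split=> [j|] /=; first by move=> ->; rewrite mul0r; exact: ideal0.
  by exists 1; rewrite rmorph1 oner_eq0; split=> // j /= ->; rewrite mulr0; exact: ideal0.
exists g; split=> // j Hj; apply: (bg).
have [zj|//] : zn J j \/ zn J a by apply/zn_mul/zn_of.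
have [i [xi_ Hi]] := zj.
have [|||b' Hb'] := @mk_ideal (nzof nB) [set x | exists y c, b y /\ x = y + c * j].
- by exists 0, 0; rewrite mul0r addr0; split=> //; exact: ideal0.
- move=> _ _ [y [c [by_ ->]]] [y' [c' [by' ->]]]; exists (y + y'), (c + c'); split; first exact: idealD.
  by rewrite mulrDl addrACA.
- move=> x _ [y [c [by_ ->]]]; exists (x * y), (x * c); split; first exact: idealM.
  by rewrite mulrDr mulrA.
apply: (bm b').
- by move=> x bx; apply/Hb'; exists x, 0; rewrite mul0r addr0.
- split=> [x /Hb'[y [c [by_ ->]]]|].
    by rewrite mulrDl; apply: idealD; [exact: (bJ)|rewrite -mulrA; exact: idealM].
  exists (g * i); split; first exact: xi_mul_neq0.
  move=> x /Hb'[y [c [by_ ->]]]; rewrite mulrDr; apply: idealD.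
    by rewrite mulrAC mulrC; by apply: idealM; exact: (bg).
  have -> : g * i * (c * j) = g * c * (i * j) by ring.
  exact: idealM.
- by apply/Hb'; exists 0, 1; rewrite mul1r add0r; split=> //; exact: ideal0.
Qed.

End Stratum.
End Germs.

(** * Closed points, leading coefficients and the good/bad dichotomy *)

Section KPoints.
Variables (k : closedFieldType) (X : kscheme k).

Definition kid : {rmorphism k -> k} := idfun.
Definition pt0 : Spec kid := exist _ _ (ker_prime kid).
Definition kpoint := schhom (Spec kid) X.
Definition kpt (y : kpoint) : X := y pt0.

Lemma k_prime (t : Spec kid) : t = pt0.
Proof.
apply: prime_eq => c /=; split=> [tc|->]; last by rewrite -(idpE (svalP t)); exact: ideal0.
apply/eqP; apply: contrapT => /negP c0; apply: (@prime1 _ t).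
by rewrite -(mulVf c0) -(idpE (svalP t)); apply: idealM; rewrite idpE.
Qed.

Lemma kpt_lands (y : kpoint) (W : opens X) : oset W (kpt y) -> lands y W.
Proof. by move=> yW; apply: landsP => t; rewrite (k_prime t). Qed.

Lemma lands_kpt (y : kpoint) (W : opens X) : lands y W -> oset W (kpt y).
Proof. by move=> yW; exact: (yW pt0 I). Qed.

Lemma kpt_unit (y : kpoint) W (yW : lands y W) s : unit_at s (kpt y) <-> ringof yW s != 0.
Proof. by rewrite (ringof_unit yW); split=> /eqP. Qed.

Lemma kpt_nunit (y : kpoint) W (yW : lands y W) s : ~ unit_at s (kpt y) <-> ringof yW s = 0.
Proof.
rewrite (kpt_unit yW); split=> [H|->]; last by rewrite eqxx.
by apply/eqP; apply: contrapT => /negP.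
Qed.

Lemma spec_in (W O : opens X) (aW : affine_open W) (x y : X) : oset W x -> oset W y -> oset O y ->
  (forall s : sect W, unit_at s y -> unit_at s x) -> oset O x.
Proof.
move=> Wx Wy Oy H; have [f [fy fO]] := aff_basic aW Wy Oy.
exact/fO/H.
Qed.

(** By the Nullstellensatz, x has a specialization y in W which is a k-point and where v remains a
    unit. *)
Lemma kspec (W : opens X) (x : X) (v : sect W) : affine_open W -> fin_gen (kcst W) -> unit_at v x ->
  exists y : kpoint, [/\ oset W (kpt y), unit_at v (kpt y)
    & forall s : sect W, unit_at s (kpt y) -> unit_at s x].
Proof.
move=> aW [n [rho [rk rs]]] vx; have Wx := unit_in vx.
pose q : primes (mp n k) := exist _ _ (prime_preim rho (nonunit_prime Wx)).
have [v' Ev] := rs v.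
have [|xi [xik xiq xiv]] := @nullst_mp k n q v'; first by rewrite /= Ev.
have [|eta He] := @surj_factor _ _ _ rho xi rs.
  by move=> p rp; apply: xiq; rewrite /= rp; exact: nonunit0.
have ek c : eta (kcst W c) = kid c by rewrite -rk He xik.
pose y : kpoint := specmor aW ek.
have yW : lands y W by exact: specmor_lands.
exists y; split; first exact: lands_kpt.
  by apply/(kpt_unit yW); rewrite ringof_specmor -Ev He.
move=> s /(kpt_unit yW); rewrite ringof_specmor; have [p <-] := rs s.
by rewrite He => np; apply: contrapT => nu; move/negP: np; apply; rewrite (xiq p nu).
Qed.

End KPoints.

Section Leading.
Variables (k : closedFieldType) (G : GLscheme k) (X : kscheme k) (loc : schhom X G).
Hypothesis smloc : smooth loc.
Variable f : Gam X.
Local Notation g := (gmx loc).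
Implicit Types (cs : seq (('I_4 * 'I_4) * nat)) (J : seq ('I_4 * 'I_4)) (y : kpoint X).

Definition chart (W : opens X) : Prop :=
  [/\ affine_open W, mlift (kcst W) (g W) & fin_gen (kcst W)].

Lemma chart_exists x (O : opens X) : oset O x ->
  exists W, [/\ oset W x, W `<=` O & chart W].
Proof. by move=> /(good_chart smloc)[W [Wx WO aW lW fW]]; exists W. Qed.

Lemma hc_res (W W' : opens X) (WW : W' `<=` W) t : rstr WW (hc (g W) t) = hc (g W') t.
Proof.
transitivity (hc (map_mx (rstr WW) (g W)) t); last by rewrite res_gmx.
by symmetry; exact: mxE.
Qed.

Definition onJ J (x : X) : Prop := forall t, t \in J -> ~ unit_at (hc (g (topen X)) t) x.

Lemma onJE (W : opens X) (x : X) t : oset W x ->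
  unit_at (hc (g (topen X)) t) x <-> unit_at (hc (g W) t) x.
Proof. by move=> Wx; rewrite -(hc_res (@sub_topen X W)) unit_res. Qed.

Lemma onJ_ring J y W (yW : lands y W) : onJ J (kpt y) <-> forall t, t \in J -> ringof yW (hc (g W) t) = 0.
Proof.
by split=> H t /H; rewrite (onJE _ (lands_kpt yW)) (kpt_nunit yW).
Qed.

Lemma onJ_sub J J' (x : X) : {subset J <= J'} -> onJ J' x -> onJ J x.
Proof. by move=> sub H t /sub/H. Qed.

Lemma onJ_spec J (W : opens X) (x y : X) : oset W x -> oset W y ->
  (forall s : sect W, unit_at s y -> unit_at s x) -> onJ J x -> onJ J y.
Proof. by move=> Wx Wy H Jx t /Jx; rewrite (onJE _ Wx) (onJE _ Wy) => n /H. Qed.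

(** The pair at the end of the list is treated first. At each step the previous leading coefficient
    is divided by h_t^n, modulo the entries already set to zero. *)
Fixpoint lead cs (V : opens X) (phi : sect V) : Prop :=
  if cs is (t, n) :: cs' then
    exists psi, lead cs' psi /\ IJ (g V) (unzip1 cs') (psi - hc (g V) t ^+ n * phi)
  else phi = resT V f.

Lemma IJ_res J (V W : opens X) (WV : W `<=` V) a : IJ (g V) J a -> IJ (g W) J (rstr WV a).
Proof. by move=> H; rewrite -(res_gmx loc WV); exact: IJ_map. Qed.

Lemma lead_res cs (V W : opens X) (WV : W `<=` V) (phi : sect V) :
  lead cs phi -> lead cs (rstr WV phi).
Proof.
elim: cs phi => [|[t n] cs IH] phi /=; first by move=> ->; exact: res_res.
move=> [psi [/IH Hp /(IJ_res WV)]]; rewrite rmorphB rmorphM rmorphXn hc_res => HI.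
by exists (rstr WV psi).
Qed.

Definition znk y W (yW : lands y W) J a := zn (g W) (ringof yW) J a.

(** For the converse, a basic open D(u) of W around y inside W' is used: the multiplier j and the
    combination of entries have denominators that are powers of u, nonzero at y. *)
Lemma znk_res y (W W' : opens X) (yW : lands y W) (yW' : lands y W') (WW : W' `<=` W) J a :
  affine_open W -> znk yW J a <-> znk yW' J (rstr WW a).
Proof.
move=> aW; split=> [[j [yj Hj]]|[j [yj Hj]]].
  exists (rstr WW j); rewrite (ringof_res yW yW' WW) -rmorphM; split=> //.
  exact: IJ_res.
have [u [uy uW]] := aff_basic aW (lands_kpt yW) (lands_kpt yW').
pose dW := @dop_sub k X W u.
have dW' : dop u `<=` W' := uW.
have [_ fr kl] := @aff_frac k X W aW u _ dW erefl.
have [n [b Eb]] := fr (rstr dW' j).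
have yu : ringof yW u != 0 by apply/kpt_unit.
have key b' : IJ (g (dop u)) J (rstr dW b') -> exists m, IJ (g W) J (u ^+ m * b').
  move=> /spanP[l [lG El]].
  have [m [c [cJ Ec]]] : exists m c, IJ (g W) J c /\ rstr dW u ^+ m * rstr dW b' = rstr dW c.
    rewrite El; elim: l lG {El} => [|w l IH] lG.
      by exists 0%N, 0; rewrite big_nil mulr0 rmorph0; split=> //; exact: ideal0.
    have [|m [c [cJ Ec]]] := IH; first by move=> p pl; apply: lG; rewrite inE pl orbT.
    have [m' [c' Ec']] := fr w.1.
    have [t [tJ Et]] := lG w (mem_head _ _).
    exists (m + m')%N, (u ^+ m * (c' * hc (g W) t) + u ^+ m' * c); split.
      by apply: idealD; apply: idealM => //; apply/idealM/IJ_mem.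
    rewrite big_cons mulrDr rmorphD !rmorphM !rmorphXn /= -Ec -Ec' hc_res -Et exprD.
    ring.
  have /kl[m' Em] : rstr dW (u ^+ m * b' - c) = 0.
    by rewrite rmorphB rmorphM rmorphXn /= Ec subrr.
  exists (m' + m)%N; rewrite exprD -mulrA; apply: (idealBDr (b := u ^+ m' * c)); last exact: idealM.
  by rewrite -mulrBr Em; exact: ideal0.
have [|m Hm] := key (b * a).
  rewrite rmorphM -Eb -mulrA; apply: idealM; rewrite -(res_res WW dW') -rmorphM.
  exact: IJ_res.
exists (u ^+ m * b); split; last by rewrite -mulrA.
have yd : lands y (dop u) by apply: kpt_lands.
rewrite rmorphM rmorphXn mulf_neq0 ?expf_neq0 //.
rewrite -(ringof_res yW yd dW) -Eb rmorphM rmorphXn mulf_neq0 //.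
  by rewrite expf_neq0 // (ringof_res yW yd dW).
by rewrite (ringof_res yW' yd dW').
Qed.

Section AtPoint.
Variables (y : kpoint X) (W : opens X) (yW : lands y W).
Hypothesis cW : chart W.
Local Notation h := (hc (g W)).
Local Notation xi := (ringof yW).

Let liftW : mlift (kcst W) (g W). Proof. by case: cW. Qed.
Let fgW : fin_gen (kcst W). Proof. by case: cW. Qed.
Let xik c : xi (kcst W c) = c. Proof. exact: ringof_cst. Qed.

Lemma znk_mul J a b : onJ J (kpt y) -> znk yW J (a * b) -> znk yW J a \/ znk yW J b.
Proof. by move=> /onJ_ring-/(_ W yW) H; exact: (zn_mul liftW fgW xik H). Qed.

Lemma znk_cancel J t n a : t \notin J -> onJ (t :: J) (kpt y) ->
  znk yW J (h t ^+ n * a) -> znk yW J a.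
Proof.
move=> tJ /onJ_ring-/(_ W yW) H; apply: (zn_cancel liftW fgW xik) => //.
  by move=> s sJ; apply: H; rewrite inE sJ orbT.
by apply: H; exact: mem_head.
Qed.

Lemma lead_uniq cs (phi phi' : sect W) : uniq (unzip1 cs) -> onJ (unzip1 cs) (kpt y) ->
  lead cs phi -> lead cs phi' -> znk yW (unzip1 cs) (phi - phi').
Proof.
elim: cs phi phi' => [|[t n] cs IH] phi phi' /=.
  by move=> _ _ -> ->; rewrite subrr; apply/zn_of/ideal0.
move=> /andP[tcs ucs] ty [psi [Hpsi I1]] [psi' [Hpsi' I2]].
have sub : {subset unzip1 cs <= t :: unzip1 cs} by move=> s; rewrite inE orbC => ->.
apply: (zn_sub sub); apply: (@znk_cancel _ t n) => //.
have := IH _ _ ucs (onJ_sub sub ty) Hpsi Hpsi'.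
have -> : h t ^+ n * (phi - phi') =
  (psi - psi') - ((psi - h t ^+ n * phi) - (psi' - h t ^+ n * phi')) by ring.
by move=> z; apply: znB => //; apply: znB; exact: zn_of.
Qed.

(** If n < m, then phi equals h_t^(m-n) phi' on the germ of the previous stratum, so it vanishes on
    the locus h_t = 0. *)
Lemma lead_max cs t m n (phi phi' : sect W) : uniq (t :: unzip1 cs) -> onJ (t :: unzip1 cs) (kpt y) ->
  lead ((t, m) :: cs) phi' -> lead ((t, n) :: cs) phi -> ~ znk yW (t :: unzip1 cs) phi ->
  (m <= n)%N.
Proof.
move=> /andP[tcs ucs] ty [psi' [Hpsi' I2]] [psi [Hpsi I1]] nz.
have sub : {subset unzip1 cs <= t :: unzip1 cs} by move=> s; rewrite inE orbC => ->.
rewrite leqNgt; apply/negP => nm; apply: nz.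
have z := lead_uniq ucs (onJ_sub sub ty) Hpsi Hpsi'.
have z' : znk yW (unzip1 cs) (phi - h t ^+ (m - n) * phi').
  apply: (@znk_cancel _ t n) => //.
  have -> : h t ^+ n * (phi - h t ^+ (m - n) * phi') =
    (psi - psi') - ((psi - h t ^+ n * phi) - (psi' - h t ^+ m * phi')).
    have -> : h t ^+ m = h t ^+ n * h t ^+ (m - n) by rewrite -exprD subnKC // ltnW.
    ring.
  by apply: znB => //; apply: znB; exact: zn_of.
rewrite -(subrK (h t ^+ (m - n) * phi') phi).
apply: znD; first exact: zn_sub z'.
rewrite -(prednK (n := (m - n)%N)) ?subn_gt0 // exprS -mulrA.
by apply/zn_of/idealMr/IJ_mem/mem_head.
Qed.

(** On a smaller chart phi lies in the ideal of the stratum, and the coefficient 0 works for any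
    exponent. *)
Lemma lead_zero cs t n (phi : sect W) : lead cs phi -> znk yW (unzip1 cs) phi ->
  exists W' : opens X, [/\ oset W' (kpt y), chart W' & exists phi' : sect W', lead ((t, n) :: cs) phi'].
Proof.
move=> Lphi [j [yj Hj]].
have jy : oset (dop j) (kpt y) by apply/(kpt_unit yW).
have [W' [yW' W'j cW']] := chart_exists jy.
have dW := @dop_sub k X W j; exists W'; split=> //.
have aW : affine_open W by case: cW.
have [[i Ei] _ _] := @aff_frac k X W aW j _ dW erefl.
have WW : W' `<=` W by move=> z /W'j/dW.
exists 0, (rstr WW phi); split; first exact: lead_res.
rewrite mulr0 subr0; have -> : rstr WW phi = rstr W'j i * rstr WW (j * phi).
  rewrite rmorphM mulrA -(res_res dW W'j WW j) -rmorphM mulrC mulrC mulrC.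
  by rewrite [i * _]mulrC Ei rmorph1 mulr1.
by apply: idealM; exact: IJ_res.
Qed.

(** The exponent is the largest n such that h_t^n divides phi on the stratum up to a factor that is
    nonzero at y; [zn_order] bounds it. *)
Lemma lead_ext cs t (phi : sect W) : uniq (t :: unzip1 cs) -> onJ (t :: unzip1 cs) (kpt y) ->
  lead cs phi -> ~ znk yW (unzip1 cs) phi ->
  exists n (W' : opens X) (yW' : lands y W') (phi' : sect W'),
    [/\ W' `<=` W, chart W', lead ((t, n) :: cs) phi' & ~ znk yW' (t :: unzip1 cs) phi'].
Proof.
move=> /andP[tcs ucs] ty Lphi nz; set J := unzip1 cs in tcs ucs ty nz *.
have [aW _ _] := cW.
have sub : {subset J <= t :: J} by move=> s; rewrite inE orbC => ->.
have xit : xi (h t) = 0 by apply: ((proj1 (onJ_ring _ yW)) ty); exact: mem_head.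
have [N HN] := @zn_order _ _ _ _ fgW _ xik J (proj1 (onJ_ring _ yW) (onJ_sub sub ty)) t phi xit nz.
pose P n := exists j c, xi j != 0 /\ IJ (g W) J (j * phi - h t ^+ n * c).
have [|m [nPm Hm]] := @nat_min (fun n => ~ P n); first by exists N => -[j [c [yj Hj]]]; exact: HN Hj.
(* Exponent 0 is always possible, so the least impossible one is a successor. *)
case: m nPm Hm => [[]|n nPn Hn].
  by exists 1, phi; rewrite rmorph1 oner_eq0 expr0 subrr; split=> //; exact: ideal0.
have [j [c [yj Hj]]] : P n by apply: contrapT => /Hn; rewrite ltnn.
have jy : oset (dop j) (kpt y) by apply/(kpt_unit yW).
have [W' [yW' W'j cW']] := chart_exists jy.
have dW := @dop_sub k X W j.
have [[i Ei] _ _] := @aff_frac k X W aW j _ dW erefl.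
have WW : W' `<=` W by move=> z /W'j/dW.
have iE : rstr WW j * rstr W'j i = 1 by rewrite -(res_res dW W'j WW j) -rmorphM Ei rmorph1.
exists n, W', (kpt_lands yW'), (rstr WW c * rstr W'j i); split=> //.
  exists (rstr WW phi); split; first exact: lead_res.
  have -> : rstr WW phi - hc (g W') t ^+ n * (rstr WW c * rstr W'j i) =
    rstr W'j i * rstr WW (j * phi - h t ^+ n * c).
    rewrite rmorphB !rmorphM rmorphXn /= hc_res -{1}[rstr WW phi]mul1r -iE; ring.
  by apply: idealM; exact: IJ_res.
move=> /(znM (rstr WW j)).
rewrite mulrCA iE mulr1 => /(znk_res yW _ WW _ _ aW)[j' [yj' /IJ_cons[d Hd]]].
apply: nPn; exists (j' * j), d; split; first by rewrite rmorphM mulf_neq0.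
have -> : j' * j * phi - h t ^+ n.+1 * d =
  j' * (j * phi - h t ^+ n * c) + h t ^+ n * (j' * c - h t * d) by rewrite exprSr; ring.
by apply: idealD; exact: idealM.
Qed.

End AtPoint.

Definition good cs (x : X) : Prop := exists (V : opens X) (phi : sect V), oset V x /\ lead cs phi.

(** Failure on a whole neighbourhood in the stratum, which makes this condition open like [good]. *)
Definition bad cs (x : X) : Prop := exists O : opens X, oset O x /\
  forall x', oset O x' -> onJ (unzip1 cs) x' -> ~ good cs x'.

Lemma good_nbhd cs x : good cs x -> exists V : opens X, oset V x /\ V `<=` good cs.
Proof. by move=> [V [phi [Vx L]]]; exists V; split=> // z Vz; exists V, phi. Qed.

Lemma good_tail cs t n x : good ((t, n) :: cs) x -> good cs x.
Proof. by move=> [V [phi [Vx [psi [L _]]]]]; exists V, psi. Qed.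

Lemma good_chart_at cs x (O : opens X) : good cs x -> oset O x ->
  exists (W : opens X) (phi : sect W), [/\ oset W x, W `<=` O, chart W & lead cs phi].
Proof.
move=> [V [phi [Vx L]]] Ox.
have [W [Wx WO cW]] := @chart_exists x (interO O V) (conj Ox Vx).
have WV : W `<=` V by move=> z /WO[].
exists W, (rstr WV phi); split=> //; last exact: lead_res.
by move=> z /WO[].
Qed.

Lemma nz_nbhd cs y W (yW : lands y W) (phi : sect W) : chart W -> onJ (unzip1 cs) (kpt y) ->
  ~ znk yW (unzip1 cs) phi -> exists O : opens X, [/\ oset O (kpt y), O `<=` W
    & forall y' (yW' : lands y' W), oset O (kpt y') -> onJ (unzip1 cs) (kpt y') -> ~ znk yW' (unzip1 cs) phi].
Proof.
move=> cW Jy nz; have [aW lW fW] := cW.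
have [u [yu Hu]] := @zn_open _ _ _ _ lW fW _ (ringof_cst yW) _ (proj1 (onJ_ring _ yW) Jy) phi nz.
exists (dop u); split; [exact/(kpt_unit yW)|exact: dop_sub|].
move=> y' yW' /(kpt_unit yW') uy' Jy' [j [yj Hj]].
have := IJ_kill (proj1 (onJ_ring _ yW') Jy') (Hu _ Hj).
by rewrite rmorphM => /eqP; rewrite mulf_eq0 (negPf uy') (negPf yj).
Qed.

(** If the previous coefficient vanishes near y, any exponent works. Otherwise let n' be its order
    along h_t: for n <= n' the factor h_t^(n'-n) is put back, and for n' < n the coefficient for n'
    stays nonzero near y, where [lead_max] excludes n. *)
Lemma good_bad_k cs y : uniq (unzip1 cs) -> onJ (unzip1 cs) (kpt y) ->
  good cs (kpt y) \/ bad cs (kpt y).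
Proof.
elim: cs => [|[t n] cs IH] /=; first by left; exists (topen X), (resT _ f).
move=> /andP[tcs ucs] ty; set J := unzip1 cs in tcs ucs ty *.
have sub : {subset J <= t :: J} by move=> s; rewrite inE orbC => ->.
have uJ : uniq (t :: J) by rewrite /= tcs.
case: (IH ucs (onJ_sub sub ty)) => [gd|[O [Oy HO]]]; last first.
  right; exists O; split=> // x' Ox' /(onJ_sub sub) Jx' /good_tail; exact: HO.
have [W [phi [Wy _ cW L]]] := @good_chart_at cs (kpt y) (topen X) gd I.
pose yW := kpt_lands Wy.
have [z|nz] := pselect (znk yW J phi).
  by left; have [W' [yW' _ [phi' L']]] := lead_zero cW t n L z; exists W', phi'.
have [n' [W' [yW' [phi' [WW cW' [psi [L' I']] nz']]]]] := lead_ext cW uJ ty L nz.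
have [nn|nn] := leqP n n'.
  left; exists W', (hc (g W') t ^+ (n' - n) * phi'); split; first exact: lands_kpt.
  by exists psi; split=> //; rewrite mulrA -exprD subnKC.
right; have [O [Oy OW HO]] := @nz_nbhd ((t, n') :: cs) y W' yW' phi' cW' ty nz'.
exists O; split=> // x' Ox' Jx' gx'.
have [W1 [phi1 [W1x W1O cW1 L1]]] := good_chart_at gx' Ox'.
have [aW1 _ fW1] := cW1.
have [y1 [W1y _ Hy]] := @kspec k X W1 x' 1 aW1 fW1 (unit_at1 W1x).
have Jy1 : onJ (t :: J) (kpt y1) := onJ_spec W1x W1y Hy Jx'.
have W1W : W1 `<=` W' by move=> z /W1O/OW.
have nz1 := HO y1 (kpt_lands (W1W _ W1y)) (W1O _ W1y) Jy1.
have [aW' _ _] := cW'.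
move/(znk_res (kpt_lands (W1W _ W1y)) (kpt_lands W1y) W1W _ _ aW'): nz1 => nz1.
have L2 : lead ((t, n') :: cs) (rstr W1W phi') by apply: lead_res; exists psi.
by have := lead_max cW1 uJ Jy1 L1 L2 nz1; rewrite leqNgt nn.
Qed.

(** The point x specializes to a closed point of a chart, and an open condition valid there is valid
    at x. *)
Lemma good_bad cs x : uniq (unzip1 cs) -> onJ (unzip1 cs) x -> good cs x \/ bad cs x.
Proof.
move=> ucs Jx; have [W [Wx _ [aW _ fW]]] := @chart_exists x (topen X) I.
have [y [Wy _ Hy]] := @kspec k X W x 1 aW fW (unit_at1 Wx).
have in_open O : oset O (kpt y) -> oset O x by move=> Oy; exact: (spec_in aW Wx Wy Oy Hy).
case: (good_bad_k ucs (onJ_spec Wx Wy Hy Jx)) => [[V [phi [Vy L]]]|[O [Oy HO]]].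
  by left; exists V, phi; split=> //; exact: in_open.
by right; exists O; split=> //; exact: in_open.
Qed.

End Leading.

(** * Characters and the action of E' on matrix entries *)

Section IntPower.
Variables (R : comPzRingType) (x y : R).
Hypothesis xy : x * y = 1.

Definition zpw (n : int) : R :=
  match n with Posz m => x ^+ m | Negz m => y ^+ m.+1 end.

Lemma zpwS n : zpw (n + 1) = x * zpw n.
Proof.
case: n => [m|[|m]].
- have -> : Posz m + 1 = Posz m.+1 by lia.
  by rewrite /= exprS.
- have -> : Negz 0 + 1 = 0 by lia.
  by rewrite /= expr1 expr0 xy.
- have -> : Negz m.+1 + 1 = Negz m by lia.
  by rewrite /= [y ^+ m.+2]exprS mulrA xy mul1r.
Qed.

Lemma zpwD m n : zpw (m + n) = zpw m * zpw n.
Proof.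
have pr i : zpw (i - 1) = y * zpw i.
  by rewrite -{2}(subrK 1 i) zpwS mulrA (mulrC y) xy mul1r.
elim/int_ind: m => [|m IH|m IH].
- by rewrite add0r /= expr0 mul1r.
- have -> : m.+1%:Z + n = m%:Z + n + 1 by lia.
  have -> : m.+1%:Z = m%:Z + 1 by lia.
  by rewrite !zpwS IH mulrA.
- have -> : - m.+1%:Z + n = - m%:Z + n - 1 by lia.
  have -> : - m.+1%:Z = - m%:Z - 1 by lia.
  by rewrite !pr IH mulrA.
Qed.

End IntPower.

Section Triangular.
Variables (R : comPzRingType) (n : nat) (x y : 'M[R]_n).
Hypothesis xy : x *m y = 1%:M.
Hypothesis tx : is_trig_mx x.

Lemma trig_inv : is_trig_mx y /\ forall i, x i i * y i i = 1.
Proof.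
have/is_trig_mxP tx' := tx.
have key m : forall i : 'I_n, (i < m)%N -> x i i * y i i = 1 /\ forall j : 'I_n, (i < j)%N -> y i j = 0.
  elim: m => // m IH i im.
  have lo (a j : 'I_n) : (a < i)%N -> (a < j)%N -> y a j = 0.
    by move=> ai aj; have [|_ ->] := IH a; first exact: leq_trans ai _.
  have E (j : 'I_n) : (i <= j)%N -> x i i * y i j = (i == j)%:R.
    move=> ij; have := congr1 (fun M : 'M_n => M i j) xy; rewrite !mxE (bigD1 i) //= big1 ?addr0 //.
    move=> a ai; have [ia|] := ltnP i a; first by rewrite tx' ?mul0r.
    by rewrite leq_eqVlt val_eqE (negPf ai) /= => ia; rewrite lo ?mulr0 //; exact: leq_trans ia ij.
  have xi1 : x i i * y i i = 1 by rewrite E ?eqxx.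
  split=> // j ij; have := E j (ltnW ij); rewrite -val_eqE ltn_eqF //= => E0.
  by rewrite -[y i j]mul1r -xi1 mulrAC E0 mul0r.
split=> [|i]; last by case: (key i.+1 i (ltnSn i)).
by apply/is_trig_mxP => i j ij; case: (key i.+1 i (ltnSn i)) => _; apply.
Qed.

End Triangular.

Section Characters.
Variables (R : comPzRingType).
Implicit Types (b : GL R) (lam : 'rV[int]_4).

Lemma in_B_diag b i : in_B b -> b i i * gli b i i = 1.
Proof. by move=> Bb; have [_ ->] := trig_inv (glmK b) Bb. Qed.

Lemma gl_charE lam b : gl_char lam b = \prod_i zpw (b i i) (gli b i i) (lam 0%R i).
Proof. by []. Qed.

Lemma gl_charD lam lam' b : in_B b -> gl_char (lam + lam') b = gl_char lam b * gl_char lam' b.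
Proof.
move=> Bb; rewrite !gl_charE -big_split /=; apply: eq_bigr => i _.
by rewrite mxE zpwD // in_B_diag.
Qed.

Lemma gl_char0 b : gl_char 0 b = 1.
Proof. by rewrite gl_charE big1 // => i _; rewrite mxE. Qed.

Lemma gl_charMn lam n b : in_B b -> gl_char (lam *+ n) b = gl_char lam b ^+ n.
Proof.
move=> Bb; elim: n => [|n IH]; first by rewrite mulr0n gl_char0.
by rewrite mulrS exprS gl_charD // IH.
Qed.

Lemma gl_charN lam b : in_B b -> gl_char lam b * gl_char (- lam) b = 1.
Proof. by move=> Bb; rewrite -gl_charD // subrr gl_char0. Qed.

Lemma gl_char_delta i b : gl_char (delta_mx 0 i) b = b i i.
Proof.
rewrite gl_charE (bigD1 i) //= big1 ?mulr1.
  by rewrite mxE !eqxx /= expr1.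
by move=> j ji; rewrite mxE (negPf ji) andbF.
Qed.

Lemma gl_char_map (S : comPzRingType) (f : {rmorphism R -> S}) lam b :
  gl_char lam (glmap f b) = f (gl_char lam b).
Proof.
rewrite /gl_char rmorph_prod; apply: eq_bigr => i _.
by case: (lam 0%R i) => m; rewrite rmorphXn !mxE.
Qed.

End Characters.

Section ZipGroup.
Variable q : nat.
Hypothesis q_gt0 : (0 < q)%N.

(* The weight of the entry [t] for the action of E'. *)
Definition wt (t : 'I_4 * 'I_4) : 'rV[int]_4 :=
  delta_mx 0 t.1 - (delta_mx 0 (ord_pred t.2)) *+ q.

Definition hmat (R : comPzRingType) (M : 'M[R]_4) : 'M[R]_4 := \matrix_(i, j) hc M (i, j).

Definition zipY (R : comPzRingType) (e : GL2 R) : 'M[R]_4 :=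
  \matrix_(i, j) gli e.2 (ord_pred i) (ord_pred j).

Lemma ord_pred_inj4 : injective (@ord_pred 4).
Proof. exact: (can_inj (@ord_predK4)). Qed.

Section OverRing.
Variables (R : comPzRingType).
Implicit Types (e : GL2 R).

Lemma hmat_act e (M : GL R) : hmat (zip_act e M) = (e.1 *m hmat M) *m zipY e.
Proof.
apply/matrixP => i j; rewrite mxE /hc /= mxE [RHS]mxE.
rewrite (reindex_inj ord_pred_inj4) /=; apply: eq_bigr => m _.
rewrite [zipY e m j]mxE; congr (_ * _); rewrite !mxE.
by apply: eq_bigr => a _; rewrite !mxE.
Qed.

(** Conjugation by the cyclic permutation makes e.2 lower triangular: its Levi part is the Frobenius
    of a lower triangular matrix, and the unipotent part of Q, in the last column, moves to the
    first one. *)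
Lemma zipY_spec e : zipE' q e -> is_trig_mx (zipY e) /\
  forall j, e.1 (ord_pred j) (ord_pred j) ^+ q * zipY e j j = 1.
Proof.
move=> [[_ plus lev] Bb].
pose x : 'M[R]_4 := \matrix_(i, j) e.2 (ord_pred i) (ord_pred j).
have levE i j : mu i = mu j -> e.2 i j = e.1 i j ^+ q.
  by move=> E; have := congr1 (fun M : 'M_4 => M i j) lev; rewrite !mxE E eqxx.
have xE j : x j j = e.1 (ord_pred j) (ord_pred j) ^+ q by rewrite mxE levE.
have [||tY xy] := @trig_inv R 4 x (zipY e).
- apply/matrixP => i j.
  transitivity ((glm e.2 *m gli e.2) (ord_pred i) (ord_pred j)); last first.
    by rewrite glmK !mxE (inj_eq ord_pred_inj4).
  rewrite [RHS]mxE (reindex_inj ord_pred_inj4) [LHS]mxE.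
  by apply: eq_bigr => m _; rewrite /x /zipY !mxE.
- apply/is_trig_mxP => i j ij; rewrite mxE.
  have jE : ord_pred j = j.-1 :> nat.
    by move: ij; case: j => [[|[|[|[|]]]]].
  have [i0|i0] := posnP i.
    by apply: plus; rewrite /mu jE /= i0 /=; move: (ltn_ord j); case: (nat_of_ord j) => [|[|[|[|]]]].
  have iE : ord_pred i = i.-1 :> nat.
    by move: i0; case: (i) => [[|[|[|[|]]]]].
  rewrite levE; first by rewrite (is_trig_mxP Bb) ?expr0n ?gtn_eqF // jE iE; lia.
  by rewrite /mu jE iE; have := ltn_ord j; have := ltn_ord i; lia.
by split=> // j; rewrite -xE.
Qed.

Lemma gl_char_wt e (t : 'I_4 * 'I_4) : zipE' q e -> gl_char (wt t) e.1 = e.1 t.1 t.1 * zipY e t.2 t.2.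
Proof.
move=> Ee; have [_ H] := zipY_spec Ee; have [_ Bb] := Ee.
have E := @gl_charD _ (wt t) (delta_mx 0 (ord_pred t.2) *+ q) e.1 Bb.
rewrite /wt subrK gl_charMn // !gl_char_delta in E.
by rewrite E -mulrA H mulr1.
Qed.

(** Both factors are lower triangular, so only entries weakly above and to the right of t contribute
    at t, and among these only t is nonzero. *)
Lemma hc_act e (M : GL R) (t : 'I_4 * 'I_4) : zipE' q e ->
  (forall a m : 'I_4, (a <= t.1)%N -> (t.2 <= m)%N -> (a, m) != t -> hc M (a, m) = 0) ->
  hc (zip_act e M) t = gl_char (wt t) e.1 * hc M t.
Proof.
case: t => i j /= Ee H; have [tY _] := zipY_spec Ee; have [_ tb] := Ee.
have -> : hc (zip_act e M) (i, j) = hmat (zip_act e M) i j by rewrite mxE.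
rewrite gl_char_wt // hmat_act mxE (bigD1 j) //= [X in _ + X]big1 ?addr0.
  rewrite mxE (bigD1 i) //= [X in _ + X]big1 ?addr0 => [|a ai].
    by rewrite mxE mulrAC.
  have [ia|ia] := ltnP i a; first by rewrite (is_trig_mxP tb) ?mul0r.
  by rewrite [hmat _ _ _]mxE H ?mulr0 // xpair_eqE (negPf ai).
move=> m mj; have [mj'|mj'] := ltnP m j; first by rewrite (is_trig_mxP tY _ _ mj') mulr0.
rewrite mxE big1 ?mul0r // => a _.
have [ia|ia] := ltnP i a; first by rewrite (is_trig_mxP tb) ?mul0r.
by rewrite [hmat _ _ _]mxE H ?mulr0 // xpair_eqE (negPf mj) andbF.
Qed.

End OverRing.

Lemma zipE_map (R S : comPzRingType) (f : {rmorphism R -> S}) (e : GL2 R) :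
  zipE q e -> zipE q (GL2_map f e).
Proof.
move=> [m p l]; split=> [i j ij|i j ij|].
- by rewrite mxE m ?rmorph0.
- by rewrite mxE p ?rmorph0.
apply/matrixP => i j; have := congr1 (fun M : 'M_4 => f (M i j)) l; rewrite !mxE.
by case: ifP => _; rewrite ?rmorph0 ?expr0n ?rmorphXn // gtn_eqF // rmorph0.
Qed.

Lemma in_B_map (R S : comPzRingType) (f : {rmorphism R -> S}) (b : GL R) :
  in_B b -> in_B (glmap f b).
Proof.
by move=> /is_trig_mxP tb; apply/is_trig_mxP => i j ij; rewrite mxE tb ?rmorph0.
Qed.

Lemma zipE'_map (R S : comPzRingType) (f : {rmorphism R -> S}) (e : GL2 R) :
  zipE' q e -> zipE' q (GL2_map f e).
Proof. by move=> [z B]; split; [exact: zipE_map|exact: in_B_map]. Qed.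

End ZipGroup.

Lemma jet_ev (D : comNzRingType) N : exists ev : {rmorphism jet D N.+1 -> D},
  forall p, ev (jp D N.+1 p) = p`_0.
Proof.
have [|ev Hev] := @surj_factor _ _ D (jp D N.+1) (horner_eval (0 : D)) (@jp_surj D N.+1).
  by move=> p /jp_eq0/(_ 0%N isT) p0; rewrite /= /horner_eval horner_coef0.
by exists ev => p; rewrite Hev /= /horner_eval horner_coef0.
Qed.

Lemma jet_cancel (D : comNzRingType) n (p p' : {poly D}) c s l :
  jp D n.+1 ('X^n * (c%:P ^+ n * p') * s%:P) = jp D n.+1 (l%:P * ('X^n * p)) ->
  c ^+ n * p'`_0 * s = l * p`_0.
Proof.
move=> /jp_eq/(_ n (ltnSn n)); rewrite coefMC coefCM !coefXnM ltnn subnn.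
by rewrite -polyC_exp coefCM.
Qed.

Lemma local_eq (D : comPzRingType) (a b : D) :
  (forall P : primes D, exists u, ~ sval P u /\ fcst (pow_data u) a = fcst (pow_data u) b) -> a = b.
Proof.
move=> H; apply/eqP; rewrite -subr_eq0; apply/eqP.
have [|||J HJ] := @mk_ideal D [set u | u * (a - b) = 0].
- by rewrite /= mul0r.
- by move=> x y /= Ex Ey; rewrite mulrDl Ex Ey addr0.
- by move=> x y /= Ey; rewrite -mulrA Ey mulr0.
have [|n] := @nilp_prime D J 1; last by rewrite expr1n => /HJ; rewrite /= mul1r.
move=> P pP JP; exfalso; have [u [Pu /fcst_eq[_ [[m ->] /= E]]]] := H (exist _ _ pP).
have : P (u ^+ m) by apply/JP/HJ.
by move/(primeX pP).
Qed.

Lemma rmorph_XnM (R S : comPzRingType) (h : {rmorphism R -> S}) x c n p :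
  h (x ^+ n * (c ^+ n * p)) = (h c * h x) ^+ n * h p.
Proof. by rewrite !rmorphM !rmorphXn exprMn /= mulrCA mulrA. Qed.

(** * Equivariance of leading coefficients *)

Section Equivariance.
Variables (k : closedFieldType) (q : nat) (q_gt0 : (0 < q)%N).
Variables (G : GLscheme k) (S : kscheme k) (zeta : zip_mor q G S).
Local Notation X := (ztot zeta).
Local Notation loc := (zloc zeta).
Local Notation act := (@zact _ _ _ _ zeta).
Local Notation g := (gmx loc).
Hypothesis smloc : smooth loc.
Variables (lam : 'rV[int]_4) (f : Gam X).
Hypothesis f_eq : forall T e (x : schhom T X), zipE' q e ->
  gpull (act e x) f = gl_char lam e.1 * gpull x f.

Fixpoint wtsum (cs : seq (('I_4 * 'I_4) * nat)) : 'rV[int]_4 :=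
  if cs is (t, n) :: cs' then wtsum cs' + wt q t *+ n else 0.

(* The entries of weight [t] may only mix with those already known to vanish. *)
Fixpoint closed_list (J : seq ('I_4 * 'I_4)) : Prop :=
  if J is t :: J' then closed_list J' /\
    forall a m : 'I_4, (a <= t.1)%N -> (t.2 <= m)%N -> (a, m) != t -> (a, m) \in J'
  else True.

(** The scheme-theoretic counterpart of [onJ]: the entries vanish as functions on T, not merely at
    its points. *)
Definition inX (J : seq ('I_4 * 'I_4)) T (x : schhom T X) : Prop :=
  forall t, t \in J -> hc (glm (mat (schcomp loc x))) t = 0.

Lemma inX_cons J t T (x : schhom T X) : inX (t :: J) x ->
  inX J x /\ hc (glm (mat (schcomp loc x))) t = 0.
Proof.
by move=> H; split=> [s sJ|]; apply: H; rewrite inE ?sJ ?orbT // eqxx.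
Qed.

Lemma inX_comp J T T' (x : schhom T X) (u : schhom T' T) : inX J x -> inX J (schcomp x u).
Proof.
move=> H t /H E; rewrite schcompA mat_comp.
have -> : hc (glm (glmap (gpull u) (mat (schcomp loc x)))) t = gpull u (hc (glm (mat (schcomp loc x))) t).
  exact: mxE.
by rewrite E rmorph0.
Qed.

Section DPoint.
Variables (D : comPzRingType) (kap : {rmorphism k -> D}).
Implicit Types (x : schhom (Spec kap) X).

Lemma hc_lands x W (xW : lands x W) t :
  hc (glm (mat (schcomp loc x))) t = toG D (ringof xW (hc (g W) t)).
Proof. by rewrite (mat_lands loc xW) /hc !mxE. Qed.

Lemma inX_IJ J x W (xW : lands x W) a : inX J x -> IJ (g W) J a -> ringof xW a = 0.
Proof.
move=> H; apply: IJ_kill => t tJ; apply: toG_inj.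
by rewrite -hc_lands H // rmorph0.
Qed.

Lemma act_hc e x t J : zipE' q e -> closed_list (t :: J) -> inX J x ->
  hc (glm (mat (schcomp loc (act e x)))) t =
  gl_char (wt q t) e.1 * hc (glm (mat (schcomp loc x))) t.
Proof.
move=> Ee [_ cl] xJ; rewrite zequiv; last by case: Ee.
by apply: hc_act => // a m ai mj am; apply/xJ/cl.
Qed.

Lemma act_inX e x J : zipE' q e -> closed_list J -> inX J x -> inX J (act e x).
Proof.
move=> Ee; elim: J => [|t J IH] // cl; have [cl' _] := cl.
move=> /inX_cons[xJ xt] s; rewrite inE => /orP[/eqP->|]; last exact: IH.
by rewrite (act_hc Ee cl xJ) xt mulr0.
Qed.

End DPoint.

Lemma act_comp T T' (u : schhom T' T) e (x : schhom T X) : zipE q e ->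
  act (GL2_map (gpull u) e) (schcomp x u) = schcomp (act e x) u.
Proof. by case: (ztorsor zeta) => -[_ _ H] _ _ _; exact: H. Qed.

Definition eqv cs (D : comPzRingType) (kap : {rmorphism k -> D}) (x : schhom (Spec kap) X) : Prop :=
  forall e (V V' : opens X) (xV : lands x V) (xV' : lands (act e x) V')
    (phi : sect V) (phi' : sect V'), zipE' q e -> inX (unzip1 cs) x ->
  lead loc f cs phi -> lead loc f cs phi' ->
  toG D (ringof xV' phi') * gl_char (wtsum cs) e.1 = gl_char lam e.1 * toG D (ringof xV phi).

Lemma eqv_local cs : (forall (D : comPzRingType) (kap : {rmorphism k -> D})
    (x : schhom (Spec kap) X) W, chart loc W -> lands x W -> eqv cs x) ->
  forall (D : comPzRingType) (kap : {rmorphism k -> D}) (x : schhom (Spec kap) X), eqv cs x.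
Proof.
move=> H D kap x e V V' xV xV' phi phi' Ee Jx L L'.
set lhs := LHS; set rhs := RHS.
rewrite -(fromGK lhs) -(fromGK rhs); congr (toG D _); apply: local_eq => P.
have [W [Wx _ cW]] := @chart_exists _ _ _ loc smloc (x P) (topen X) I.
have [u' [uP uW]] := @aff_basic k (Spec kap) (topen _) (spec_affine kap) P
  (Defs.preim (@hcont _ _ _ x) W) I Wx.
have [u Eu] := toG_surj u'.
exists u; split.
  by apply/(@unit_toG k D kap (topen _) u P I); move: uP; rewrite -Eu.
pose fc := fcst (pow_data u); pose kL : {rmorphism k -> frac (pow_data u)} := fc \o kap.
pose s : schhom (Spec kL) (Spec kap) := specmap (kd := kL) (f := fc) (fun c => erefl).
have xsW : lands (schcomp x s) W.
  apply: landsP => Q; apply: (uW (s Q)); rewrite -Eu.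
  apply/(@unit_toG k D kap (topen _) u (s Q) I) => /(specmap_pt (kd := kL) (fun c => erefl)) Qu.
  have [v Ev] : exists v, fc u * v = 1 by apply: fcst_unit; exists 1%N; rewrite expr1.
  by apply: (@prime1 _ Q); rewrite -Ev -(idpE (svalP Q)); apply: idealMr; rewrite idpE.
have Ee' := zipE'_map q_gt0 (gpull s) Ee.
have Ea : act (GL2_map (gpull s) e) (schcomp x s) = schcomp (act e x) s by apply: act_comp; case: Ee.
have aV' : lands (act (GL2_map (gpull s) e) (schcomp x s)) V' by rewrite Ea => z _; exact: (xV' (s z) I).
have xsV : lands (schcomp x s) V by move=> z _; exact: (xV (s z) I).
have E := H _ _ _ W cW xsW _ _ _ xsV aV' phi phi' Ee' (inX_comp s Jx) L L'.
have gs a : gpull s (toG D a) = toG _ (fc a) by exact: (specmap_gpull (kd := kL)).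
have r1 : ringof xsV phi = fc (ringof xV phi) by exact: ringof_comp.
have r2 : ringof aV' phi' = fc (ringof xV' phi').
  have sV' : lands (schcomp (act e x) s) V' by move=> z _; exact: (xV' (s z) I).
  transitivity (ringof sV' phi'); last exact: ringof_comp.
  move: aV' sV' {E}; rewrite Ea => h1 h2.
  by rewrite (Prop_irrelevance h1 h2).
move: E; rewrite r1 r2 !gl_char_map -!gs -!rmorphM -/lhs -/rhs => E.
by apply: (@toG_inj); rewrite -!gs !fromGK.
Qed.

(** The point x is deformed over D[X]/(X^(n+1)) so that h_t becomes X and the earlier entries stay
    0. The previous coefficient becomes X^n phi, its equivariance is known, and h_t is multiplied by
    the character [wt q t]; comparing coefficients of X^n gives the claim for phi. *)
Lemma equivariance cs : closed_list (unzip1 cs) -> uniq (unzip1 cs) ->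
  forall (D : comPzRingType) (kap : {rmorphism k -> D}) (x : schhom (Spec kap) X), eqv cs x.
Proof.
elim: cs => [|[t n] cs IH] cl.
  move=> _ D kap x e V V' xV xV' _ _ Ee _ -> ->.
  by rewrite /= gl_char0 mulr1 -(ringof_gpull xV') -(ringof_gpull xV) (f_eq x Ee).
move=> /andP[tcs ucs]; have [cl' clt] := cl; have {}IH := IH cl' ucs.
apply: eqv_local; elim/pz_ind => [D D0|D] kap x W cW xW e V V' xV xV' phi phi' Ee Jx.
  by move=> _ _; rewrite -[LHS]mul1r -[RHS]mul1r -(rmorph1 (toG D)) D0 rmorph0 !mul0r.
move=> [psi [L I1]] [psi' [L' I1']].
have [xJ xt] := inX_cons Jx.
pose be := ringof xW.
pose Mc : 'M[{poly D}]_4 := hmx (fun s => (be (hc (g W) s))%:P + (if s == t then 'X else 0)).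
have [_ liftW _] := cW.
have [|ga [gak gab gaM]] := @jet_lift k _ (kcst W) (g W) liftW D be Mc n.
  move=> i j; rewrite mxE coefD coefC /= -[RHS]addr0; congr (be _ + _).
    by rewrite /hc /= ordSK4.
  by case: ifP; rewrite ?coefX ?coef0.
have [ev Hev] := jet_ev D n.
pose io : {rmorphism D -> jet D n.+1} := jp D n.+1 \o polyC.
pose kJ : {rmorphism k -> jet D n.+1} := io \o kap.
have [aW _ _] := cW.
have gak' c : ga (kcst W c) = kJ c by rewrite gak /be ringof_cst.
pose x1 : schhom (Spec kJ) X := specmor aW gak'.
have x1W : lands x1 W by exact: specmor_lands.
have evk c : ev (kJ c) = kap c by rewrite Hev coefC.
pose r : schhom (Spec kap) (Spec kJ) := specmap evk.
pose j : schhom (Spec kJ) (Spec kap) := specmap (kd := kJ) (f := io) (fun c => erefl).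
have x1r : schcomp x1 r = x.
  have rW : lands (schcomp x1 r) W by move=> z _; exact: (x1W (r z) I).
  apply: (lands_uniq aW (xW := rW) (yW := xW)) => b.
  rewrite (ringof_comp x1W rW) ringof_specmor.
  by have [p [-> p0]] := gab b; rewrite Hev p0.
(* The group element is kept constant along the jet. *)
pose e1 := GL2_map (gpull j) e.
have e1r : GL2_map (gpull r) e1 = e.
  have H a : gpull r (gpull j a) = a.
    by rewrite -(fromGK a) specmap_gpull specmap_gpull Hev coefC.
  rewrite /GL2_map /=; case: (e) => a b /=.
  by congr (_, _); apply: gl_eq; apply/matrixP => i i'; rewrite !mxE H.
have [ze _] := Ee.
have e1z : zipE' q e1 by exact: zipE'_map.
have ar : schcomp (act e1 x1) r = act e x.
  by rewrite -act_comp ?e1r ?x1r //; case: e1z.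
(* The kernel of [ev] is nilpotent, so the jets have the same points as D. *)
have lift_lands (y : schhom (Spec kJ) X) O : lands (schcomp y r) O -> lands y O.
  move=> yO; apply: landsP => Q.
  have [b|p pQ|Q0 HQ0] := @prime_image _ _ ev (sval Q) _ (svalP Q).
  - by exists (io b); rewrite Hev coefC.
  - have [p' Ep] := jp_surj p; rewrite -Ep in pQ *.
    apply: (primeX (svalP Q) (n := n.+1)); rewrite -(idpE (svalP Q)).
    have -> : jp D n.+1 p' ^+ n.+1 = 0; last exact: ideal0.
    rewrite -rmorphXn; apply/jp_eq0 => i i_n.
    have -> : p' = drop_poly 1 p' * 'X.
      apply/polyP => m; rewrite coefMX coef_drop_poly; case: m => [|m] /=; last by rewrite addn1.
      by rewrite -(Hev p').
    by rewrite exprMn coefMXn i_n.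
  have -> : Q = r Q0 :> Spec kJ.
    by apply: prime_eq => c; rewrite -HQ0; exact: iff_sym (specmap_pt evk Q0 c).
  exact: (yO Q0 I).
have x1V : lands x1 V by apply: lift_lands; rewrite x1r.
have a1V : lands (act e1 x1) V' by apply: lift_lands; rewrite ar.
have beJ s : s \in t :: unzip1 cs -> be (hc (g W) s) = 0.
  by move=> sJ; apply: toG_inj; rewrite /be -hc_lands Jx // rmorph0.
have gaE s : ga (hc (g W) s) = jp D n.+1 ((be (hc (g W) s))%:P + (if s == t then 'X else 0)).
  transitivity (hc (map_mx ga (g W)) s); first by symmetry; exact: mxE.
  rewrite gaM; transitivity (jp D n.+1 (hc Mc s)); first exact: mxE.
  by rewrite hc_hmx.
have x1J : inX (unzip1 cs) x1.
  move=> s sJ; rewrite (hc_lands x1W) ringof_specmor gaE beJ ?inE ?sJ ?orbT //.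
  rewrite polyC0 add0r ifN ?rmorph0 ?rmorph0 //; apply: contraNneq tcs => <-; exact: sJ.
have x1t : hc (glm (mat (schcomp loc x1))) t = toG _ (jp D n.+1 'X).
  by rewrite (hc_lands x1W) ringof_specmor gaE beJ ?inE ?eqxx // polyC0 add0r.
have E := IH _ kJ x1 e1 V V' x1V a1V psi psi' e1z x1J L L'.
pose c0 := fromG (gl_char (wt q t) e.1); pose s0 := fromG (gl_char (wtsum cs) e.1).
pose l0 := fromG (gl_char lam e.1).
have chE w : gl_char w e1.1 = toG _ (jp D n.+1 (fromG (gl_char w e.1))%:P).
  by rewrite gl_char_map -{1}(fromGK (gl_char w e.1)) specmap_gpull.
have [p Ep] := jp_surj (ringof x1V phi); have [p' Ep'] := jp_surj (ringof a1V phi').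
have Epsi : ringof x1V psi = jp D n.+1 ('X^n * p).
  have -> : ringof x1V psi = ringof x1V (hc (g V) t) ^+ n * ringof x1V phi.
    apply/eqP; rewrite -subr_eq0 -rmorphXn -rmorphM -rmorphB; apply/eqP.
    exact: inX_IJ I1.
  have E1 : ringof x1V (hc (g V) t) = jp D n.+1 'X by apply: toG_inj; rewrite -hc_lands x1t.
  have E2 := rmorph_XnM (jp D n.+1) 'X 1 n p.
  rewrite expr1n mul1r rmorph1 mul1r in E2.
  exact: etrans (congr2 (fun a b => a ^+ n * b) E1 (esym Ep)) (esym E2).
have Epsi' : ringof a1V psi' = jp D n.+1 ('X^n * (c0%:P ^+ n * p')).
  have -> : ringof a1V psi' = ringof a1V (hc (g V') t) ^+ n * ringof a1V phi'.
    apply/eqP; rewrite -subr_eq0 -rmorphXn -rmorphM -rmorphB; apply/eqP.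
    exact: inX_IJ (act_inX e1z cl' x1J) I1'.
  have E1 : ringof a1V (hc (g V') t) = jp D n.+1 c0%:P * jp D n.+1 'X.
    apply: toG_inj; rewrite -hc_lands (act_hc e1z cl x1J) x1t chE.
    exact: esym (rmorphM _ _ _).
  have E2 := rmorph_XnM (jp D n.+1) 'X c0%:P n p'.
  exact: etrans (congr2 (fun a b => a ^+ n * b) E1 (esym Ep')) (esym E2).
have P0 : ringof xV phi = p`_0.
  rewrite -Hev Ep; have rV : lands (schcomp x1 r) V by rewrite x1r.
  rewrite -(ringof_comp x1V rV); move: rV xV {E}; rewrite x1r => h1 h2.
  by rewrite (Prop_irrelevance h1 h2).
have P0' : ringof xV' phi' = p'`_0.
  rewrite -Hev Ep'; have rV : lands (schcomp (act e1 x1) r) V' by rewrite ar.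
  rewrite -(ringof_comp a1V rV); move: rV xV' {E}; rewrite ar => h1 h2.
  by rewrite (Prop_irrelevance h1 h2).
move: E; rewrite !chE Epsi Epsi' -!rmorphM => /toG_inj.
move=> /jet_cancel E0.
have E1 : p'`_0 * ((s0 : D) * (c0 : D) ^+ n) = (l0 : D) * p`_0.
  by rewrite -[RHS]E0 mulrA mulrC mulrA.
have [_ Bb] := Ee.
rewrite P0 P0' /= gl_charD // gl_charMn // -[gl_char (wtsum cs) _]fromGK -[gl_char (wt q t) _]fromGK.
rewrite -[gl_char lam _]fromGK -/s0 -/c0 -/l0 -!rmorphXn -!rmorphM; congr (toG D _).
by rewrite rmorphM rmorphXn; exact: E1.
Qed.

End Equivariance.

Lemma GL_det (R : comPzRingType) (M : 'M[R]_4) v : \det M * v = 1 -> exists x : GL R, glm x = M.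
Proof.
move=> detM.
have MK : M *m (v *: \adj M) = 1%:M.
  by rewrite -scalemxAr mul_mx_adj scale_scalar_mx mulrC detM.
have KM : (v *: \adj M) *m M = 1%:M.
  by rewrite -scalemxAl mul_adj_mx scale_scalar_mx mulrC detM.
by exists (MkGL MK KM).
Qed.

Lemma spec_mor_eq (k : fieldType) (C D : comPzRingType) (kc : {rmorphism k -> C})
    (kd : {rmorphism k -> D}) (u v : schhom (Spec kd) (Spec kc)) :
  (forall c, gpull u (toG C c) = gpull v (toG C c)) -> u = v.
Proof.
move=> E.
pose uT : topen (Spec kd) `<=` u @^-1` topen (Spec kc) := fun _ _ => I.
pose vT : topen (Spec kd) `<=` v @^-1` topen (Spec kc) := fun _ _ => I.
have H c : pull uT c = pull vT c; last exact: (@mor_uniq k (Spec kd) (Spec kc) (topen _) (spec_affine kc) u v uT vT H).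
by rewrite -(fromGK (c : Gam (Spec kc))); exact: E.
Qed.

(** * Connectedness of the zip groups *)

Section Path.
Variables (q : nat) (q_gt0 : (0 < q)%N) (K : fieldType).
Variable e : GL2 K.
Hypothesis Ee : zipE q e.

(** The segment from 1 to e.1. In [path2] the Levi part is the Frobenius of that segment, as the zip
    group requires, and the unipotent part is multiplied by X. *)
Definition path1 : 'M[{poly K}]_4 := 1%:M + 'X *: map_mx polyC (glm e.1 - 1%:M).
Definition path2 : 'M[{poly K}]_4 :=
  \matrix_(i, j) if mu i == mu j then path1 i j ^+ q else 'X * (e.2 i j)%:P.

Lemma path1E i j : path1 i j = (i == j)%:R + 'X * (e.1 i j - (i == j)%:R)%:P.
Proof. by rewrite !mxE. Qed.

Lemma path1_at c : map_mx (horner_eval c) path1 = 1%:M + c *: (glm e.1 - 1%:M).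
Proof.
apply/matrixP => i j; rewrite mxE path1E !mxE /horner_eval hornerD hornerM hornerX hornerC.
by rewrite -[in LHS]polyC_natr hornerC.
Qed.

Lemma path2_at c : map_mx (horner_eval c) path2 =
  \matrix_(i, j) if mu i == mu j then (1%:M + c *: (glm e.1 - 1%:M)) i j ^+ q else c * e.2 i j.
Proof.
apply/matrixP => i j; rewrite !mxE; case: ifP => _.
  rewrite rmorphXn; congr (_ ^+ _).
  by have := congr1 (fun M : 'M_4 => M i j) (path1_at c); rewrite !mxE.
by rewrite /horner_eval hornerM hornerX hornerC.
Qed.

(* A path in the zip group from 1 to [e], defined over the localization of the
   affine line where the determinants are invertible. *)
Lemma zip_path : exists (R : comPzRingType) (io : {rmorphism K -> R}) (eu : GL2 R)
    (ev0 ev1 : {rmorphism R -> K}),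
  [/\ zipE q eu, in_B e.1 -> in_B eu.1, prime_ideal [set r : R | r = 0],
      (forall c, ev0 (io c) = c) /\ (forall c, ev1 (io c) = c)
    & GL2_map ev0 eu = GL2_1 K /\ GL2_map ev1 eu = e].
Proof.
have [minus plus lev] := Ee.
pose d : {poly K} := \det path1 * \det path2.
pose L := pow_data d.
have e2E i j : mu i == mu j -> e.2 i j = e.1 i j ^+ q.
  by move=> E; have := congr1 (fun M : 'M_4 => M i j) lev; rewrite !mxE E.
have at0 : map_mx (horner_eval 0) path1 = 1%:M /\ map_mx (horner_eval 0) path2 = 1%:M.
  split; first by rewrite path1_at scale0r addr0.
  rewrite path2_at; apply/matrixP => i j; rewrite scale0r addr0 !mxE.
  case: ifP => [_|/eqP ij]; first by case: (i == j); rewrite ?expr1n // expr0n gtn_eqF.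
  by rewrite mul0r; case: eqP => // E; case: ij; rewrite E.
have at1 : map_mx (horner_eval 1) path1 = glm e.1 /\ map_mx (horner_eval 1) path2 = glm e.2.
  have E1 : 1%:M + 1 *: (glm e.1 - 1%:M) = glm e.1 by rewrite scale1r addrC subrK.
  split; first by rewrite path1_at.
  rewrite path2_at E1; apply/matrixP => i j; rewrite !mxE.
  by case: ifP => [/e2E->//|_]; rewrite mul1r.
have d0 : horner_eval 0 d = 1.
  by rewrite rmorphM -!det_map_mx; case: at0 => -> ->; rewrite !det1 mulr1.
have d1 : horner_eval 1 d != 0.
  rewrite rmorphM -!det_map_mx; case: at1 => -> ->.
  apply: contra_neqN (oner_neq0 K) => /eqP E.
  have := congr2 *%R (det_GL e.1) (det_GL e.2); rewrite mulr1 mulrACA.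
  by rewrite E mul0r => <-.
have dn0 : d != 0 by apply: contraNneq d1 => ->; rewrite rmorph0.
have lift c : horner_eval c d != 0 ->
    exists ev : {rmorphism frac L -> K}, forall p, ev (fcst L p) = p.[c].
  move=> dc; have [||ev Hev] := @fliftP _ L _ (horner_eval c); last by exists ev.
    move=> _ [n ->]; exists ((horner_eval c d) ^- n).
    by rewrite rmorphXn /= divff // expf_neq0.
  by move=> a /= ->; rewrite rmorph0.
have [|ev0 H0] := lift 0; first by rewrite d0 oner_eq0.
have [ev1 H1] := lift 1 d1.
have f0 p : fcst L p = 0 -> p = 0.
  move=> /fcst_eq0[_ [[n ->] /= /eqP]].
  by rewrite mulf_eq0 (negPf (expf_neq0 n dn0)) => /eqP.
have [w dw] : exists v, fcst L d * v = 1 by apply: fcst_unit; exists 1%N; rewrite expr1.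
have [|x1 E1] := @GL_det _ (map_mx (fcst L) path1) (fcst L (\det path2) * w).
  by rewrite det_map_mx mulrA -rmorphM.
have [|x2 E2] := @GL_det _ (map_mx (fcst L) path2) (fcst L (\det path1) * w).
  by rewrite det_map_mx mulrA -rmorphM [\det path2 * _]mulrC.
exists (frac L), (fcst L \o polyC), (x1, x2), ev0, ev1.
have ij0 i j : (mu i < mu j)%N || (mu j < mu i)%N -> (i == j) = false /\ (mu i == mu j) = false.
  by move=> H; split; apply/eqP => E; move: H; rewrite E ltnn.
split.
- split=> [i j ij|i j ij|] /=.
  + rewrite E1 mxE path1E; have [-> _] := @ij0 i j (introT orP (or_intror ij)).
    by rewrite (minus i j ij) add0r subr0 polyC0 mulr0 rmorph0.
  + rewrite E2 !mxE; have [_ ->] := @ij0 i j (introT orP (or_introl ij)).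
    by rewrite (plus i j ij) polyC0 mulr0 rmorph0.
  + apply/matrixP => i j; rewrite E1 E2 !mxE; case: ifP => _; last by rewrite expr0n gtn_eqF.
    by rewrite -rmorphXn.
- move=> /is_trig_mxP tb; apply/is_trig_mxP => i j ij /=.
  have nij : (i == j) = false by apply/eqP => E; rewrite E ltnn in ij.
  by rewrite E1 mxE path1E tb // nij /= add0r subr0 polyC0 mulr0 rmorph0.
- split=> [|a b|a b||a b] /=.
  + by [].
  + by move=> -> ->; rewrite addr0.
  + by move=> ->; rewrite mulr0.
  + by rewrite -(rmorph1 (fcst L)) => /f0/eqP; rewrite oner_eq0.
  + have [x [s [[n Es] Ea]]] := frac_surj a; have [y [t [[m Et] Eb]]] := frac_surj b.
    move=> ab; have : fcst L (x * y) = 0.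
      have -> : fcst L (x * y) = fcst L s * a * (fcst L t * b) by rewrite Ea Eb rmorphM.
      by rewrite mulrACA ab mulr0.
    move/f0/eqP; rewrite mulf_eq0 => /orP[] /eqP z; [left|right].
      have := Ea; rewrite z rmorph0 => sa; have [v Ev] := fcst_unit (ex_intro _ n Es : L s).
      by rewrite -[a]mul1r -Ev mulrAC sa mul0r.
    have := Eb; rewrite z rmorph0 => sa; have [v Ev] := fcst_unit (ex_intro _ m Et : L t).
    by rewrite -[b]mul1r -Ev mulrAC sa mul0r.
- by split=> c; rewrite /= ?H0 ?H1 hornerC.
- have mp c (ev : {rmorphism frac L -> K}) (M : 'M[{poly K}]_4) : (forall p, ev (fcst L p) = p.[c]) ->
    map_mx ev (map_mx (fcst L) M) = map_mx (horner_eval c) M.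
    by move=> H; apply/matrixP => i j; rewrite !mxE H.
  split.
    rewrite /GL2_map /GL2_1 /=; congr (_, _); apply: gl_eq; rewrite /= ?E1 ?E2 (mp 0) //.
      by case: at0.
    by case: at0.
  rewrite /GL2_map /=; case: (e) at1 => a b /= at1; congr (_, _); apply: gl_eq; rewrite /= ?E1 ?E2 (mp 1) //.
    by case: at1.
  by case: at1.
Qed.

End Path.

Section Invariance.
Variables (k : fieldType) (q : nat) (q_gt0 : (0 < q)%N) (X : kscheme k) (act : action_on X).
Variable H : forall R : comPzRingType, GL2 R -> Prop.
Hypothesis H_path : (forall R e, H e <-> @zipE q R e) \/ forall R e, H e <-> @zipE' q R e.
Hypothesis isact : Defs.is_action H act.
Variables (Z U1 U2 : set X).
Hypothesis Z_stable : forall (D : comPzRingType) (kap : {rmorphism k -> D})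
  (x : schhom (Spec kap) X) e tau, H e -> Z (x tau) -> Z (act e x tau).
Hypotheses (U1o : open U1) (U2o : open U2) (ZU : Z `<=` U1 `|` U2).
Hypothesis U12 : forall x, Z x -> U1 x -> ~ U2 x.

Lemma H_map (R R' : comPzRingType) (h : {rmorphism R -> R'}) (e : GL2 R) : H e -> H (GL2_map h e).
Proof.
by case: H_path => HE; rewrite !HE; [exact: zipE_map|exact: zipE'_map].
Qed.

(** Over the residue field of tau, the path of [zip_path] has a generic point [eta], whose image
    lies in every open set containing the image of an end. The initial end puts it in U1; were the
    final end in U2, it would be in U2 as well, although it lies in Z. *)
Lemma path_invariant (D : comPzRingType) (kap : {rmorphism k -> D})
    (x : schhom (Spec kap) X) e tau :
  H e -> Z (x tau) -> U1 (x tau) -> U1 (act e x tau).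
Proof.
move=> He Zx Ux; have [a1 aM aC] := isact.
pose K := resf tau; pose t : {rmorphism D -> K} := tores tau.
pose kK : {rmorphism k -> K} := t \o kap.
pose s : schhom (Spec kK) (Spec kap) := specmap (kd := kK) (f := t) (fun c => erefl).
have pK : prime_ideal [set c : K | c = 0].
  split=> [|a b|a b||a b] /=.
  - by [].
  - by move=> -> ->; rewrite addr0.
  - by move=> ->; rewrite mulr0.
  - by move/eqP; rewrite oner_eq0.
  - by move/eqP; rewrite mulf_eq0 => /orP[]/eqP; [left|right].
pose z : Spec kK := exist _ _ pK.
have sz : s z = tau.
  apply: prime_eq => c; apply: iff_trans (specmap_pt (kd := kK) (fun c => erefl) z c) _.
  exact: tores_eq0.
pose eK : GL2 K := GL2_map (@fromG K) (GL2_map (gpull s) e).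
have HeK : H eK by do 2!apply: H_map.
have zeK : zipE q eK by case: H_path => HE; have := HeK; rewrite HE // => -[].
have [R [io [eu [ev0 [ev1 [zeu Beu pR [io0 io1] [E0 E1]]]]]]] := zip_path q_gt0 zeK.
have Heu : H eu.
  case: H_path => HE; rewrite HE //; split=> //; apply: Beu.
  by have := HeK; rewrite HE => -[].
pose kR : {rmorphism k -> R} := io \o kK.
pose r : schhom (Spec kR) (Spec kK) := specmap (kd := kR) (f := io) (fun c => erefl).
pose xK := schcomp x s; pose xR := schcomp xK r.
pose eR : GL2 (Gam (Spec kR)) := GL2_map (toG R) eu.
have HeR : H eR by exact: H_map.
pose y := act eR xR.
pose eta : Spec kR := exist _ _ pR.
have at_ev (ev : {rmorphism R -> K}) (e' : GL2 (Gam (Spec kK))) (io' : forall c, ev (io c) = c) :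
    GL2_map ev eu = GL2_map (@fromG K) e' -> exists Q : Spec kR, y Q = act e' xK z /\
    forall O : set X, open O -> O (y Q) -> O (y eta).
  move=> Eev; have evk c : ev (kR c) = kK c by exact: io'.
  pose v : schhom (Spec kK) (Spec kR) := specmap evk.
  exists (v z); split; last first.
    move=> O oO; have oyO : open (y @^-1` O) by move/continuousP: (@hcont _ _ _ y); apply.
    move: oyO; rewrite zopenE => zo yv; have [h [hv hO]] := zo _ yv.
    apply: hO => /= h0; apply: hv; rewrite h0 -(idpE (svalP (v z))); exact: ideal0.
  have ev_e : GL2_map (gpull v) eR = e'.
    case: e' Eev => a b Eev.
    have Ea := congr1 (fun z => glm z.1) Eev; have Eb := congr1 (fun z => glm z.2) Eev.
    apply: (f_equal2 (@pair (GL (Gam (Spec kK))) (GL (Gam (Spec kK))))); apply: gl_eq; apply/matrixP => i j.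
      have := congr1 (fun M : 'M_4 => toG K (M i j)) Ea; rewrite !mxE fromGK => <-.
      exact: specmap_gpull.
    have := congr1 (fun M : 'M_4 => toG K (M i j)) Eb; rewrite !mxE fromGK => <-.
    exact: specmap_gpull.
  have xv : schcomp xR v = xK.
    rewrite /xR /xK -!schcompA; congr (schcomp x _); apply: spec_mor_eq => c.
    rewrite !gpull_comp (specmap_gpull (kd := kK)) (specmap_gpull (kd := kR)) specmap_gpull.
    by rewrite io'.
  have -> : y (v z) = schcomp y v z by [].
  by rewrite /y -aC // ev_e xv.
have [|Q0 [yQ0 sp0]] := at_ev ev0 (GL2_1 _) io0.
  rewrite E0 /GL2_map /GL2_1 /=; congr (_, _); apply: gl_eq; apply/matrixP => i j;
  by rewrite !mxE; case: (i == j); rewrite ?rmorph1 ?rmorph0.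
have [Q1 [yQ1 sp1]] := at_ev ev1 (GL2_map (gpull s) e) io1 E1.
have xKz : xK z = x tau := congr1 x sz.
have U1eta : U1 (y eta) by apply: sp0 => //; rewrite yQ0 a1 xKz.
have act_tau : y Q1 = act e x tau.
  by rewrite yQ1 aC // -[LHS]/(act e x (s z)) sz.
have reta : r eta = z.
  apply: prime_eq => c; apply: iff_trans (specmap_pt (kd := kR) (fun c => erefl) eta c) _.
  split=> /= [E|->]; last exact: rmorph0.
  by rewrite -(io0 c) E rmorph0.
have Zeta : Z (y eta).
  apply: Z_stable => //; rewrite -[xR eta]/(xK (r eta)) reta xKz.
  exact: Zx.
have Zt : Z (act e x tau) by exact: Z_stable.
case: (ZU Zt) => // U2t; exfalso; apply: (U12 Zeta U1eta).
by apply: sp1 => //; rewrite act_tau.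
Qed.

End Invariance.

Lemma res_point (k : fieldType) (D : comPzRingType) (kap : {rmorphism k -> D}) (tau : Spec kap) :
  exists (K : comPzRingType) (kK : {rmorphism k -> K}) (s : schhom (Spec kK) (Spec kap)) (z : Spec kK),
    [/\ s z = tau, forall c : K, sval z c <-> c = 0 & forall c : K, c = 0 \/ exists v : K, c * v = 1].
Proof.
pose K := resf tau; pose kK : {rmorphism k -> K} := tores tau \o kap.
pose s : schhom (Spec kK) (Spec kap) := specmap (kd := kK) (f := tores tau) (fun c => erefl).
have pK : prime_ideal [set c : K | c = 0].
  split=> [|a b|a b||a b] /=.
  - by [].
  - by move=> -> ->; rewrite addr0.
  - by move=> ->; rewrite mulr0.
  - by move/eqP; rewrite oner_eq0.
  - by move/eqP; rewrite mulf_eq0 => /orP[]/eqP; [left|right].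
exists K, kK, s, (exist _ _ pK); split=> // [|c].
  apply: prime_eq => c; apply: iff_trans (specmap_pt (kd := kK) (fun c => erefl) _ c) _.
  exact: tores_eq0.
case: (eqVneq c 0) => [->|c0]; [by left|right].
by exists (c : resf tau)^-1; exact: divff.
Qed.

Lemma component_clopen (T : topologicalType) (A B : set T) x : open A -> open B ->
  A `|` B = setT -> A `&` B = set0 -> A x -> connected_component setT x `<=` A.
Proof.
move=> oA oB AB AB0 Ax; set C := connected_component setT x.
have Cx : C x by exact: connected_component_refl.
have cC : connected C by exact: component_connected.
have E : C `&` A = C.
  apply: cC; [by exists x|by exists A|exists (~` B)].
    by rewrite closedC.
  apply/seteqP; split=> y [Cy Hy]; split=> //.
    by move=> By; have : (A `&` B) y by []; rewrite AB0.
  by have : (A `|` B) y by [rewrite AB]; case.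
by rewrite -E => y [].
Qed.

(** * Invariance of the dichotomy, and a base point on the smallest stratum *)

Section Components.
Variables (k : closedFieldType) (q : nat) (q_gt0 : (0 < q)%N).
Variables (G : GLscheme k) (S : kscheme k) (zeta : zip_mor q G S).
Local Notation X := (ztot zeta).
Local Notation loc := (zloc zeta).
Local Notation act := (@zact _ _ _ _ zeta).
Local Notation g := (gmx loc).
Hypothesis smloc : smooth loc.
Variable f : Gam X.

Lemma act_isaction : Defs.is_action (zipE q) act /\ Defs.is_action (zipE' q) act.
Proof.
have [[a1 aM aC] _ _ _] := ztorsor zeta; split=> //; split=> //.
  by move=> T e e' x [Ee _] [Ee' _]; exact: aM.
by move=> T T' u e x [Ee _]; exact: aC.
Qed.

Lemma inX_onJ J (D : comPzRingType) (kap : {rmorphism k -> D}) (x : schhom (Spec kap) X) tau :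
  inX (zeta := zeta) J x -> onJ loc J (x tau).
Proof.
move=> H t /H; have xT : lands x (topen X) by [].
rewrite (hc_lands xT) => E; rewrite (ringof_unit xT); apply.
have -> : ringof xT (hc (g (topen X)) t) = 0 by apply: toG_inj; rewrite E rmorph0.
by rewrite -(idpE (svalP tau)); exact: ideal0.
Qed.

Lemma onJ_act J (D : comPzRingType) (kap : {rmorphism k -> D}) (x : schhom (Spec kap) X) e tau :
  closed_list J -> zipE' q e -> onJ loc J (x tau) -> onJ loc J (act e x tau).
Proof.
move=> cl Ee Jx; have [K [kK [s [z [sz z0 _]]]]] := res_point tau.
have Ea : act (GL2_map (gpull s) e) (schcomp x s) = schcomp (act e x) s by apply: act_comp; case: Ee.
have -> : act e x tau = act (GL2_map (gpull s) e) (schcomp x s) z.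
  by rewrite Ea; exact: (congr1 (act e x) (esym sz)).
apply: inX_onJ; apply: act_inX => //; first exact: zipE'_map.
have xT : lands (schcomp x s) (topen X) by [].
move=> t tJ; rewrite (hc_lands xT) (_ : ringof xT _ = 0) ?rmorph0 //.
apply/z0; apply: contrapT => n; apply: (Jx t tJ).
by rewrite -sz; exact: (proj2 (ringof_unit xT _ z) n).
Qed.

(** [good] and [bad] are open, disjoint on the stratum and cover it, so [path_invariant] applies in
    both directions. *)
Lemma good_invariant cs (D : comPzRingType) (kap : {rmorphism k -> D}) (x : schhom (Spec kap) X) e tau :
  closed_list (unzip1 cs) -> uniq (unzip1 cs) -> zipE' q e -> onJ loc (unzip1 cs) (x tau) ->
  good loc f cs (x tau) <-> good loc f cs (act e x tau).
Proof.
move=> cl ucs Ee Jx; have [_ isa] := act_isaction.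
have og : open (good loc f cs) by apply: open_nb => z /good_nbhd[V [Vz VG]]; exists V.
have ob : open (bad loc f cs).
  by apply: open_nb => z [O [Oz HO]]; exists O; split=> // z' Oz'; exists O.
have st (D' : comPzRingType) (kap' : {rmorphism k -> D'}) (x' : schhom (Spec kap') X) e' tau' :
    zipE' q e' -> onJ loc (unzip1 cs) (x' tau') -> onJ loc (unzip1 cs) (act e' x' tau').
  exact: onJ_act.
have ex z : onJ loc (unzip1 cs) z -> good loc f cs z -> ~ bad loc f cs z.
  by move=> Jz gz [O [Oz /(_ z Oz Jz)]].
have inv := path_invariant q_gt0 (or_intror (fun R e => iff_refl (zipE' q e))) isa st.
have gb : onJ loc (unzip1 cs) `<=` good loc f cs `|` bad loc f cs by move=> z; exact: (good_bad smloc f ucs).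
have bg : onJ loc (unzip1 cs) `<=` bad loc f cs `|` good loc f cs by rewrite setUC.
have ex' z : onJ loc (unzip1 cs) z -> bad loc f cs z -> ~ good loc f cs z.
  by move=> Jz bz gz; exact: (ex z Jz gz bz).
split=> gx; first exact: (inv _ _ og ob gb ex _ _ _ _ _ Ee Jx gx).
case: (good_bad smloc f ucs Jx) => // bx; exfalso.
apply: (ex _ (onJ_act cl Ee Jx) gx).
exact: (inv _ _ ob og bg ex' _ _ _ _ _ Ee Jx bx).
Qed.

Definition vanish (x : X) : Prop := exists V : opens X, oset V x /\ resT V f = 0.
Definition nonvan (x : X) : Prop := exists O : opens X, oset O x /\ forall x', oset O x' -> ~ vanish x'.

Lemma IJ_nil W a : IJ (g W) [::] a -> a = 0.
Proof. by move=> /spanP[l [lG ->]]; rewrite big_seq big1 // => w /lG[t []]. Qed.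

Lemma vanish_k (y : kpoint X) W (yW : lands y W) : chart loc W ->
  vanish (kpt y) <-> znk loc yW [::] (resT W f).
Proof.
move=> cW; have [aW _ _] := cW; split=> [[V [Vy Vf]]|[j [yj /IJ_nil Hj]]].
  have [W' [yW' W'WV cW']] := @chart_exists _ _ _ loc smloc (kpt y) (interO W V) (conj (lands_kpt yW) Vy).
  have WW : W' `<=` W by move=> z /W'WV[].
  have WV : W' `<=` V by move=> z /W'WV[].
  apply: (proj2 (@znk_res _ _ _ loc _ _ _ yW (kpt_lands yW') WW _ _ aW)).
  have -> : rstr WW (resT W f) = rstr WV (resT V f).
    exact: etrans (res_res _ _ (@sub_topen X W') f) (esym (res_res _ _ (@sub_topen X W') f)).
  rewrite Vf rmorph0.
  exact/zn_of/ideal0.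
exists (dop j); split; first exact/(kpt_unit yW).
have dW := @dop_sub k X W j.
have [[i Ei] _ _] := @aff_frac k X W aW j _ dW erefl.
have -> : resT (dop j) f = rstr dW (resT W f) by exact: esym (res_res _ _ (@sub_topen X _) f).
by rewrite -[LHS]mul1r -Ei mulrAC -rmorphM Hj rmorph0 mul0r.
Qed.

(** At a closed specialization of x, a nonzero germ of f stays nonzero at the nearby closed points
    by [nz_nbhd] for the empty list; either alternative is open and so holds at x. *)
Lemma vanish_dich x : vanish x \/ nonvan x.
Proof.
have [W [Wx _ cW]] := @chart_exists _ _ _ loc smloc x (topen X) I.
have [aW _ fW] := cW.
have [y [Wy _ Hy]] := @kspec k X W x 1 aW fW (unit_at1 Wx).
have in_open O : oset O (kpt y) -> oset O x by move=> Oy; exact: (spec_in aW Wx Wy Oy Hy).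
have Ny : onJ loc [::] (kpt y) by [].
have [z|nz] := pselect (znk loc (kpt_lands Wy) [::] (resT W f)).
  left; have [V [Vy Vf]] := (proj2 (vanish_k (kpt_lands Wy) cW)) z.
  by exists V; split=> //; exact: in_open.
right; have [O [Oy OW HO]] := @nz_nbhd _ _ _ loc [::] y W (kpt_lands Wy) (resT W f) cW Ny nz.
exists O; split; first exact: in_open.
move=> x' Ox' [V [Vx' Vf]].
have [W1 [W1x W1O [aW1 _ fW1]]] := @chart_exists _ _ _ loc smloc x' (interO O V) (conj Ox' Vx').
have [y1 [W1y _ _]] := @kspec k X W1 x' 1 aW1 fW1 (unit_at1 W1x).
have [Oy1 Vy1] := W1O _ W1y.
apply: (HO y1 (kpt_lands (OW _ Oy1)) Oy1) => //.
by apply/(vanish_k _ cW); exists V.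
Qed.

Lemma nonvan_exists : f <> 0 -> exists x, nonvan x.
Proof.
move=> f0; apply: contrapT => H; apply: f0.
apply: (@sect_eq0 k X (topen X)) => x _.
case: (vanish_dich x) => [[V [Vx Vf]]|nx]; last by case: H; exists x.
by exists V, (@sub_topen X V).
Qed.

Hypothesis cond_b : zeta_surj_on_components zeta.

(** The locus where f is not locally zero is open and closed, and stable under the connected group
    E, so its image in S is open and closed and contains a whole component. Condition (b) gives a
    point of this locus above F, which then specializes to a closed point. *)
Lemma base_point (F : 'M[k]_4) v : \det F * v = 1 -> f <> 0 ->
  exists y : kpoint X, nonvan (kpt y) /\ forall t, hc F t = 0 -> onJ loc [:: t] (kpt y).
Proof.
move=> detF /nonvan_exists[x0 nx0].
have [isa _] := act_isaction.
have on : open nonvan by apply: open_nb => z [O [Oz HO]]; exists O; split=> // z' Oz'; exists O.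
have ov : open vanish by apply: open_nb => z [O [Oz HO]]; exists O; split=> // z' Oz'; exists O.
have ex z : nonvan z -> ~ vanish z by move=> [O [Oz /(_ z Oz)]].
have inv := path_invariant q_gt0 (or_introl (fun R e => iff_refl (zipE q e))) isa
  (Z := setT) (fun _ _ _ _ _ _ _ => I).
have nv : setT `<=` nonvan `|` vanish by move=> z _; case: (vanish_dich z); [right|left].
have vn : setT `<=` vanish `|` nonvan by rewrite setUC.
have ex1 z : setT z -> nonvan z -> ~ vanish z by move=> _; exact: ex.
have ex2 z : setT z -> vanish z -> ~ nonvan z by move=> _ vz nz; exact: (ex z nz vz).
have i1 (D : comPzRingType) (kap : {rmorphism k -> D}) (x : schhom (Spec kap) X) e tau : zipE q e ->
    nonvan (x tau) -> nonvan (act e x tau).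
  by move=> Ee; exact: (inv _ _ on ov nv ex1 _ _ _ _ _ Ee I).
have i2 (D : comPzRingType) (kap : {rmorphism k -> D}) (x : schhom (Spec kap) X) e tau : zipE q e ->
    vanish (x tau) -> vanish (act e x tau).
  by move=> Ee; exact: (inv _ _ ov on vn ex2 _ _ _ _ _ Ee I).
have inv1 : invariant (zipE q) act (Opens on).
  move=> D kap x e tau Ee; split=> [|na]; first exact: i1.
  case: (vanish_dich (x tau)) => // vx; exfalso; exact: (ex _ na (i2 _ _ _ _ _ Ee vx)).
have inv2 : invariant (zipE q) act (Opens ov).
  move=> D kap x e tau Ee; split=> [|na]; first exact: i2.
  case: (vanish_dich (x tau)) => // nx; exfalso; exact: (ex _ (i1 _ _ _ _ _ Ee nx) na).
have [o1 p1] := torsor_open (ztorsor zeta) inv1.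
have [o2 p2] := torsor_open (ztorsor zeta) inv2.
have [t Et] : exists t : schhom (Spec (@kid k)) G, glm (mat t) = map_mx (toG k) F.
  have [x Ex] : exists x : GL (Gam (Spec (@kid k))), glm x = map_mx (toG k) F.
    by apply: (@GL_det _ _ (toG k v)); rewrite det_map_mx -rmorphM detF rmorph1.
  by have [t Et] := GL_mor G x; exists t; rewrite Et.
have [x [Cx lx]] := cond_b (zproj zeta x0) (t (@pt0 k)).
have nx : nonvan x.
  apply: p1; apply: (component_clopen o1 o2) Cx; last by exists x0.
    apply/seteqP; split=> // s _; have [z <-] := torsor_surj (ztorsor zeta) s.
    by case: (vanish_dich z) => vz; [right|left]; exists z.
  apply/seteqP; split=> // s [[z nz <-] /p2 vz]; exact: (ex _ nz vz).
have [W [Wx _ [aW _ fW]]] := @chart_exists _ _ _ loc smloc x (topen X) I.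
have [y [Wy _ Hy]] := @kspec k X W x 1 aW fW (unit_at1 Wx).
exists y; split.
  case: (vanish_dich (kpt y)) => // -[V [Vy Vf]]; exfalso; apply: (ex _ nx).
  by exists V; split=> //; exact: (spec_in aW Wx Wy Vy Hy).
move=> s Fs; apply: (onJ_spec Wx Wy Hy) => s'; rewrite inE => /eqP -> {s'}.
pose xT : topen X `<=` loc @^-1` topen G := fun _ _ => I.
have -> : hc (g (topen X)) s = pull xT (hc (glm (gluniv G)) s).
  by rewrite /hc !mxE; exact: res_id.
rewrite pull_unit // lx.
pose tT : topen (Spec (@kid k)) `<=` t @^-1` topen G := fun _ _ => I.
rewrite -(pull_unit tT) //.
have -> : pull tT (hc (glm (gluniv G)) s) = 0.
  have := congr1 (fun M : 'M_4 => hc M s) Et; rewrite /hc !mxE.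
  by move: Fs; rewrite /hc => ->; rewrite rmorph0.
exact: nonunit0.
Qed.

End Components.

Lemma span_seq_map (R S : comPzRingType) (h : {rmorphism R -> S}) (l : seq R) x :
  span_seq l x -> span_seq (map h l) (h x).
Proof.
move=> /spanP[m [ml ->]]; rewrite rmorph_sum big_seq; apply: ideal_sum => w /ml wl.
by rewrite rmorphM; apply/idealM/span_mem; exact: map_f.
Qed.

Lemma toquo_sub (R : comPzRingType) (J : ideal R) a b : toquo J a = toquo J b -> J (a - b).
Proof. by move=> E; apply: toquo_mem; rewrite rmorphB E subrr. Qed.

Section NonUnits.
Variables (k : fieldType) (X : kscheme k).

Lemma nonunitD (W : opens X) (a b : sect W) (x : X) : oset W x ->
  ~ unit_at a x -> ~ unit_at b x -> ~ unit_at (a + b) x.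
Proof.
move=> Wx na nb; have pW := nonunit_prime Wx.
by have := @idealD _ (idp pW) a b; rewrite !idpE; exact.
Qed.

Lemma nonunitM (W : opens X) (a b : sect W) (x : X) : ~ unit_at b x -> ~ unit_at (a * b) x.
Proof. by move=> nb /unit_atM[_]. Qed.

End NonUnits.

(** * Descent to the flag space and pseudo-completeness *)

Section PseudoComplete.
Variables (k : closedFieldType) (q : nat) (q_gt0 : (0 < q)%N).
Variables (G : GLscheme k) (S : kscheme k) (zeta : zip_mor q G S) (FlagS : flag_space zeta).
Local Notation X := (ztot zeta).
Local Notation loc := (zloc zeta).
Local Notation act := (@zact _ _ _ _ zeta).
Local Notation g := (gmx loc).
Local Notation F := (fsch FlagS).
Local Notation pi := (fproj FlagS).
Variable J : seq ('I_4 * 'I_4).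
Hypothesis clJ : closed_list J.

Lemma act_inX_conv (D : comPzRingType) (kap : {rmorphism k -> D}) (x : schhom (Spec kap) X) e J' :
  zipE' q e -> closed_list J' -> inX (zeta := zeta) J' (act e x) -> inX (zeta := zeta) J' x.
Proof.
move=> Ee; elim: J' => [|t J' IH] // cl /inX_cons[aJ at0]; have [cl' _] := cl.
have xJ := IH cl' aJ; move=> s; rewrite inE => /orP[/eqP->|]; last exact: xJ.
have [_ Bb] := Ee; have := act_hc q_gt0 Ee cl xJ; rewrite at0 => /esym E.
by rewrite -[LHS]mul1r -(gl_charN (wt q t) Bb) mulrAC E mul0r.
Qed.

Lemma inX_field (K : comPzRingType) (kK : {rmorphism k -> K}) (y : schhom (Spec kK) X) (z : Spec kK) J' :
  (forall c, sval z c <-> c = 0) -> onJ loc J' (y z) -> inX (zeta := zeta) J' y.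
Proof.
move=> z0 Jy t tJ; have yT : lands y (topen X) by [].
rewrite (hc_lands yT) (_ : ringof yT _ = 0) ?rmorph0 //.
by apply/z0; apply: contrapT => n; apply: (Jy t tJ); exact: (proj2 (ringof_unit yT _ z) n).
Qed.

Lemma ringof_field (K : comPzRingType) (kK : {rmorphism k -> K}) (Y : kscheme k) (y : schhom (Spec kK) Y)
    (z : Spec kK) W (yW : lands y W) a :
  (forall c, sval z c <-> c = 0) -> ~ unit_at a (y z) <-> ringof yW a = 0.
Proof.
move=> z0; rewrite -z0 (ringof_unit yW); split; last by move=> ? h.
exact: contrapT.
Qed.

Lemma onJ_actE (D : comPzRingType) (kap : {rmorphism k -> D}) (x : schhom (Spec kap) X) e tau :
  zipE' q e -> onJ loc J (x tau) <-> onJ loc J (act e x tau).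
Proof.
move=> Ee; split; first exact: onJ_act.
move=> Ja; have [K [kK [s [z [sz z0 _]]]]] := res_point tau.
have Ea : act (GL2_map (gpull s) e) (schcomp x s) = schcomp (act e x) s by apply: act_comp; case: Ee.
have -> : x tau = schcomp x s z by exact: (congr1 x (esym sz)).
apply: inX_onJ; apply: act_inX_conv (zipE'_map q_gt0 (gpull s) Ee) clJ _.
rewrite Ea; apply: (inX_field z0).
by have -> : schcomp (act e x) s z = act e x tau by exact: (congr1 (act e x) sz).
Qed.

Lemma onJ_closed : open (~` onJ loc J).
Proof.
apply: open_nb => x nx; apply: contrapT => H; apply: nx => t tJ ux; apply: H.
by exists (dop (hc (g (topen X)) t)); split=> // y uy Jy; exact: Jy uy.
Qed.

(** The complement of the stratum is open and invariant, so it is saturated for [pi] by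
    [torsor_open]. *)
Lemma onJ_fibre x x' : pi x = pi x' -> onJ loc J x -> onJ loc J x'.
Proof.
move=> E Jx; apply: contrapT => nx'.
have inv : invariant (zipE' q) act (Opens onJ_closed).
  move=> D kap y e tau Ee; split=> n Jy; apply: (n).
    exact: (proj2 (onJ_actE y tau Ee) Jy).
  exact: (proj1 (onJ_actE y tau Ee) Jy).
have [_ H] := torsor_open (ftorsor FlagS) inv.
by apply: (H x) => //; rewrite E; exists x'.
Qed.

Variable Phi : forall V : opens X, sect V -> Prop.
Hypothesis Phi_cover : forall x, onJ loc J x -> exists (V : opens X) (phi : sect V), oset V x /\ Phi phi.
Hypothesis Phi_inv : forall (D : comPzRingType) (kap : {rmorphism k -> D}) (x : schhom (Spec kap) X) e
  (V V' : opens X) (xV : lands x V) (xV' : lands (act e x) V') (phi : sect V) (phi' : sect V'),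
  zipE' q e -> inX (zeta := zeta) J x -> Phi phi -> Phi phi' -> ringof xV phi = ringof xV' phi'.

(* The invariant functions descend to the flag space, by flat descent along an
   etale local section of the torsor. *)
Lemma descent x0 : onJ loc J x0 -> exists (V0 : opens F) (sg : sect V0), oset V0 (pi x0) /\
  forall x (V O : opens X) (OV : O `<=` V) (Op : O `<=` pi @^-1` V0) (phi : sect V),
    oset O x -> onJ loc J x -> Phi phi -> ~ unit_at (rstr OV phi - pull Op sg) x.
Proof.
move=> Jx0; have [_ _ tr [U [u [s [eu us su]]]]] := ftorsor FlagS.
have [u0 Eu0] := us (pi x0).
have Es0 y : pi (s y) = u y by rewrite -su.
have Js0 : onJ loc J (s u0) by apply: onJ_fibre Jx0; rewrite Es0 Eu0.
have [V [phi [Vs Pphi]]] := Phi_cover Js0.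
have Vs' : oset (Defs.preim (@hcont _ _ _ s) V) u0 by [].
have [U1 [Vf [UV [U1u aU1 aVf U1V [hA [hB [n [r [beta [th [bC bs bk thC [thr _]]]]]]]]]]]] :=
  smooth_chart eu Vs'.
pose A := nzof hA; pose B := nzof hB.
have sV : U1 `<=` s @^-1` V by move=> y /U1V.
pose a : sect U1 := pull sV phi.
(* The ideal of the stratum on the étale chart U1; L below is the coordinate ring of the stratum
   there. *)
pose I5 := span [set b : sect U1 | exists t, t \in J /\ b = pull sV (hc (g V) t)].
have I5u b : I5 b -> ~ unit_at b u0.
  move=> /spanP[l [lG ->]]; rewrite big_seq.
  have pW := nonunit_prime U1u.
  have : idp pW (\sum_(i <- l | i \in l) i.1 * i.2); last by rewrite idpE.
  apply: ideal_sum => w /lG[t [tJ ->]]; apply: idealM; rewrite idpE /= pull_unit //.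
  by rewrite -onJE //; exact: Js0.
have hL : (1 : quo I5) != 0.
  apply/eqP; rewrite -(rmorph1 (toquo I5)) => /toquo_mem/I5u; apply; exact: unit_at1.
pose L := nzof hL.
pose iota : {rmorphism A -> L} := toquo I5 \o pull UV.
have [at_ Eat] := bs a.
(* The fibre product, over the flag space, of the stratum in U1 with U1; b1 and b2 correspond to its
   two projections. *)
pose C := quo (span_seq (map (mpmap n iota) r)).
pose tC : {rmorphism mp n L -> C} := toquo _.
pose b1 : {rmorphism sect U1 -> C} := tC \o mpc n L \o toquo I5.
have [b2 Hb2] : exists b2 : {rmorphism B -> C}, forall p, b2 (beta p) = (tC \o mpmap n iota) p.
  apply: (@surj_factor _ _ _ beta (tC \o mpmap n iota) bs) => p /bk pr.
  exact: toquo_kill (span_seq_map (mpmap n iota) pr).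
have b12 c : b1 (pull UV c) = b2 (pull UV c).
  by rewrite -[in RHS]bC Hb2 /= mpmapC.
pose kC : {rmorphism k -> C} := b1 \o kcst U1.
have b2k c : b2 (kcst U1 c) = kC c by rewrite /= -(pull_cst UV) -b12.
pose t1 : schhom (Spec kC) U := @specmor k C kC U U1 aU1 b1 (fun c => erefl).
pose t2 : schhom (Spec kC) U := @specmor k C kC U U1 aU1 b2 b2k.
have t1U : lands t1 U1 by exact: specmor_lands.
have t2U : lands t2 U1 by exact: specmor_lands.
have Eut : schcomp u t1 = schcomp u t2.
  have T1 : lands (schcomp u t1) Vf by move=> z _; exact/UV/(t1U z I).
  have T2 : lands (schcomp u t2) Vf by move=> z _; exact/UV/(t2U z I).
  apply: (lands_uniq aVf (xW := T1) (yW := T2)) => c; apply: toG_inj.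
  rewrite !ringofE (comp_pull_via T1 UV t1U) (comp_pull_via T2 UV t2U) -!ringofE.
  by rewrite !ringof_specmor b12.
have Epi : schcomp pi (schcomp s t1) = schcomp pi (schcomp s t2) by rewrite !schcompA su.
have [e [[Ee Ea] _]] := tr _ _ _ Epi.
have s1V : lands (schcomp s t1) V by move=> z _; exact/sV/(t1U z I).
have s2V : lands (schcomp s t2) V by move=> z _; exact/sV/(t2U z I).
have r1 b : ringof s1V b = b1 (pull sV b).
  by apply: toG_inj; rewrite ringofE (comp_pull_via s1V sV t1U) -ringofE ringof_specmor.
have r2 b : ringof s2V b = b2 (pull sV b).
  by apply: toG_inj; rewrite ringofE (comp_pull_via s2V sV t2U) -ringofE ringof_specmor.
have s1J : inX (zeta := zeta) J (schcomp s t1).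
  move=> t tJ; rewrite (hc_lands s1V) r1 /b1 /=.
  rewrite (toquo_kill (J := I5)) ?rmorph0 //; apply: span_mem; by exists t.
(* Both projections have the same image in the flag space, hence differ by a group element, and the
   invariance of phi gives the descent datum. *)
have Eb : b1 a = b2 a.
  have s2V' : lands (act e (schcomp s t1)) V by rewrite Ea.
  rewrite /a -r1 -r2 (Phi_inv s1V s2V' Ee s1J Pphi Pphi).
  by move: s2V s2V' {r2}; rewrite Ea => h1 h2; rewrite (Prop_irrelevance h1 h2).
(* N is the image in L of the functions on the flag space. [flat] puts a times any coefficient of p
   into N, and one of these coefficients is a unit at the point, so that a descends. *)
pose N : set L := [set y | exists c, y = iota c].
have [|||||p [p1 Np]] := @flat k A (kcst Vf) n r th thC thr L iota N _ _ _ (toquo I5 a) (mpmap n iota at_).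
- by exists 0; rewrite rmorph0.
- by move=> _ _ [c ->] [d ->]; exists (c + d); rewrite rmorphD.
- by move=> c _ [d ->]; exists (c * d); rewrite rmorphM.
- by move=> m; exists (mpcf m at_); exact: mpmap_cf.
- apply: toquo_sub; apply: (etrans Eb); rewrite -Eat; exact: Hb2.
have [m um] : exists m, unit_at (mpcf m p : sect Vf) (pi x0).
  apply: contrapT => H.
  pose yB : primes B := ptprime U1u.
  pose yA : primes (mp n A) := exist _ _ (prime_preim beta (svalP yB)).
  have rY p' : p' \in r -> sval yA p'.
    move=> pr; rewrite /= (proj2 (bk p')); last exact: span_mem.
    by move=> H'; exact: nonunit0 H'.
  apply: (@prime_split1 _ yA p); last exact: (span_prime rY).
  apply: coef_prime => m; rewrite /= bC => um; apply: H; exists m.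
  by move: um; rewrite pull_unit // Eu0.
have [c Ec] := Np m.
pose al : sect Vf := mpcf m p.
have oU1 : open (u @` U1) by exact: smooth_map_open eu U1.
pose V0 := interO (dop al) (Opens oU1).
have V0f : V0 `<=` Vf by move=> z [/unit_in].
have V0x : oset V0 (pi x0) by split=> //; exists u0.
have [ai Eai] : exists ai, rstr V0f al * ai = 1.
  have dV := @dop_sub k F Vf al.
  have V0d : V0 `<=` dop al by move=> z [].
  have [[i Ei] _ _] := @aff_frac k F Vf aVf al _ dV erefl.
  by exists (rstr V0d i); rewrite -(res_res dV V0d V0f al) -rmorphM Ei rmorph1.
exists V0, (rstr V0f c * ai); split=> // x V' O OV Op phi' Ox Jx Pphi'.
have [_ [u1 U1u1 Eu1]] := Op _ Ox.
have [D [kap [w1 [w2 [tau [Ew w1x w1O w2U]]]]]] :=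
  @smooth_co k U F u True eu X pi x u1 O U1 (esym Eu1) Ox U1u1.
have Epw : schcomp pi w1 = schcomp pi (schcomp s w2) by rewrite schcompA su.
have [K [kK [sp [z [sz z0 _]]]]] := res_point tau.
pose v1 := schcomp w1 sp; pose v2 := schcomp w2 sp.
have Epv : schcomp pi v1 = schcomp pi (schcomp s v2).
  by rewrite /v1 /v2 (schcompA pi w1 sp) Epw -(schcompA pi (schcomp s w2) sp) -(schcompA s w2 sp).
have [e' [[Ee' Ea'] _]] := tr _ _ _ Epv.
have v1x : v1 z = x by rewrite -w1x; exact: (congr1 w1 sz).
have v1J : inX (zeta := zeta) J v1 by apply: (inX_field z0); rewrite v1x.
have v1O : lands v1 O by move=> y _; exact: w1O.
have v2U : lands v2 U1 by move=> y _; exact: w2U.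
have v1V : lands v1 V' by move=> y _; exact/OV/(v1O y I).
have sv2V : lands (schcomp s v2) V by move=> y _; exact/sV/(v2U y I).
have rs b : ringof sv2V b = ringof v2U (pull sV b).
  by apply: toG_inj; rewrite !ringofE; exact: (comp_pull_via sv2V sV v2U).
have Ephi : ringof v1V phi' = ringof v2U a.
  have av : lands (act e' v1) V by rewrite Ea'.
  rewrite /a -rs (Phi_inv v1V av Ee' v1J Pphi' Pphi).
  by move: av sv2V {rs}; rewrite Ea' => h1 h2; rewrite (Prop_irrelevance h1 h2).
have sv2J : inX (zeta := zeta) J (schcomp s v2) by rewrite -Ea'; apply: act_inX.
have I5v b : I5 b -> ringof v2U b = 0.
  move=> /spanP[l [lG ->]]; rewrite rmorph_sum big_seq big1 // => y /lG[t [tJ ->]].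
  rewrite rmorphM -rs (_ : ringof sv2V _ = 0) ?mulr0 //.
  by apply: toG_inj; rewrite -hc_lands sv2J // rmorph0.
have Eac : ringof v2U (pull UV al) * ringof v2U a = ringof v2U (pull UV c).
  apply/eqP; rewrite -subr_eq0 -rmorphM -rmorphB; apply/eqP/I5v.
  by apply: toquo_sub; rewrite rmorphM; exact: Ec.
have pv1 : lands (schcomp pi v1) Vf by move=> y _; exact/V0f/Op/(v1O y I).
have pv2 : lands (schcomp pi (schcomp s v2)) Vf by rewrite -Epv.
have rpi b : ringof v1O (pull Op (rstr V0f b)) = ringof v2U (pull UV b).
  have uv : lands (schcomp u v2) Vf by move=> y _; exact/UV/(v2U y I).
  have OVf : O `<=` pi @^-1` Vf by move=> y /Op/V0f.
  apply: toG_inj; rewrite !ringofE (pull_restr OVf) -(comp_pull_via pv1 OVf v1O) -(comp_pull_via uv UV v2U).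
  have E : schcomp pi v1 = schcomp u v2 by rewrite Epv schcompA su.
  by move: pv1 uv; rewrite E => h1 h2; rewrite (Prop_irrelevance h1 h2).
rewrite -v1x; apply/(ringof_field v1O _ z0).
rewrite rmorphB (ringof_res v1V v1O OV) Ephi !rmorphM rpi.
have Eal : ringof v2U (pull UV al) * ringof v1O (pull Op ai) = 1.
  by rewrite -rpi -rmorphM -rmorphM Eai !rmorph1.
by rewrite -Eac mulrAC Eal mul1r subrr.
Qed.

(** The local descents agree with the same functions of [Phi], hence with one another at the points
    of Z, and [pseudo_complete] applies to them; the constant is then pulled back to X. *)
Lemma locally_constant (Z : set F) x0 (V : opens X) (phi : sect V) :
  pseudo_complete Z -> (forall z, Z z -> exists x, onJ loc J x /\ pi x = z) ->
  onJ loc J x0 -> Z (pi x0) -> oset V x0 -> Phi phi ->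
  exists (V' : opens X) (VV : V' `<=` V) (c : k), oset V' x0 /\
    forall x, oset V' x -> onJ loc J x -> Z (pi x) -> ~ unit_at (rstr VV phi - kcst V' c) x.
Proof.
move=> pc ZJ Jx0 Zx0 Vx0 Pphi.
pose I := {z : F | Z z}.
have /choice[U HU] : forall i : I, exists V0 : opens F, exists sg : sect V0, oset V0 (sval i) /\
    forall x (V O : opens X) (OV : O `<=` V) (Op : O `<=` pi @^-1` V0) (phi : sect V),
    oset O x -> onJ loc J x -> Phi phi -> ~ unit_at (rstr OV phi - pull Op sg) x.
  by move=> i; have [x [Jx Ex]] := ZJ _ (svalP i); have := descent Jx; rewrite Ex.
pose sg i := sval (cid (HU i)).
have Usg i : oset (U i) (sval i) by have [] := svalP (cid (HU i)).
have Hsg i := proj2 (svalP (cid (HU i))).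
have [||i [W [WU [c [Wz Hc]]]]] := pc I U sg _ _ (pi x0) Zx0.
- by move=> z Zz; exists (exist _ z Zz) => //; exact: (Usg (exist _ z Zz)).
- move=> i j W Wi Wj y Zy Wy; have [x [Jx Ex]] := ZJ _ Zy.
  have [V1 [phi1 [V1x P1]]] := Phi_cover Jx.
  pose O := interO V1 (Defs.preim (@hcont _ _ _ pi) W).
  have Ox : oset O x by split=> //; rewrite /= Ex.
  have OV : O `<=` V1 by move=> v [].
  have OW : O `<=` pi @^-1` W by move=> v [].
  have Oi : O `<=` pi @^-1` U i by move=> v /OW/Wi.
  have Oj : O `<=` pi @^-1` U j by move=> v /OW/Wj.
  have n1 := Hsg i x V1 O OV Oi phi1 Ox Jx P1; have n2 := Hsg j x V1 O OV Oj phi1 Ox Jx P1.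
  rewrite -Ex -(pull_unit OW) // rmorphB (pull_restr Oi) (pull_restr Oj).
  rewrite (_ : _ - _ = (rstr OV phi1 - pull Oj (sg j)) + (- 1) * (rstr OV phi1 - pull Oi (sg i))).
    by apply: nonunitD => //; exact: nonunitM.
  by ring.
pose O := interO V (Defs.preim (@hcont _ _ _ pi) W).
have OV : O `<=` V by move=> v [].
have OW : O `<=` pi @^-1` W by move=> v [].
have Oi : O `<=` pi @^-1` U i by move=> v /OW/WU.
exists O, OV, c; split=> // x Ox Jx Zx.
have n1 := Hsg i x V O OV Oi phi Ox Jx Pphi.
have n2 : ~ unit_at (pull OW (rstr WU (sg i) - kcst W c)) x.
  by rewrite pull_unit //; apply: Hc => //; exact: (OW x Ox).
move: n2; rewrite rmorphB pull_cst (pull_restr Oi) => n2.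
rewrite (_ : _ - _ = (rstr OV phi - pull Oi (sg i)) + (pull Oi (sg i) - kcst O c)); last by ring.
exact: nonunitD.
Qed.

End PseudoComplete.

(** * Bruhat strata of length one and semi-invariants on them *)

Lemma zW_ordS (j : 'I_4) : zW j = ordS j.
Proof.
rewrite /zW permM permE /w0I; apply: val_inj.
case: tpermP => [->|->|/eqP n0 /eqP n2] /=; rewrite ?inordK //.
move: n0 n2; rewrite -!val_eqE /= !inordK //.
by case: j => [[|[|[|[|]]]]].
Qed.

Section Bruhat.
Variables (R : comPzRingType).

(** [zW] is the cyclic permutation built into [hc], which therefore undoes the factor z^-1 of the
    Bruhat cell. *)
Lemma hmat_perm (x : GL R) : hmat (glM x (glV (gl_perm R zW))) = glm x.
Proof.
apply/matrixP => i j; rewrite mxE /hc /= -col_permE mxE zW_ordS.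
by rewrite (ord_predK4 j).
Qed.

Lemma hmatE (M : 'M[R]_4) t : hmat M t.1 t.2 = hc M t.
Proof. by rewrite mxE; case: t. Qed.

Variables (a b : 'I_4) (ab : b = a.+1 :> nat).

Lemma sum2 (F : 'I_4 -> R) : (forall c, c != a -> c != b -> F c = 0) -> \sum_c F c = F a + F b.
Proof.
have nab : b != a by rewrite -val_eqE /= ab gtn_eqF.
move=> H; rewrite (bigD1 a) //= (bigD1 b) //= big1 ?addr0 // => c /andP[ca cb].
exact: H.
Qed.

Lemma tperm_gt (c : 'I_4) : (c < tperm a b c)%N -> c = a.
Proof. by case: tpermP => // [->|_ _]; rewrite ?ltnn // ab ltnNge leqnSn. Qed.

(** A nonzero term through the index c needs c <= i and j <= tperm a b c. The transposition then
    raises c, so c = a, and this leaves only the position (a, b). *)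
Lemma bruhat_vanish (x y : GL R) (i j : 'I_4) : in_B x -> in_B y -> (i < j)%N -> (i, j) != (a, b) ->
  (glm x *m perm_mx (tperm a b) *m glm y) i j = 0.
Proof.
move=> /is_trig_mxP tx /is_trig_mxP ty ij nij.
rewrite -mulmxA mxE big1 // => c _.
have -> : (perm_mx (tperm a b) *m glm y) c j = glm y (tperm a b c) j.
  by rewrite -row_permE mxE.
have [ic|ci] := ltnP i c; first by rewrite tx ?mul0r.
have [cj|jc] := ltnP (tperm a b c) j; first by rewrite ty ?mulr0.
have ca : c = a by apply: tperm_gt; exact: leq_trans (leq_ltn_trans ci ij) jc.
case/negP: nij; move: ci jc; rewrite ca tpermL => ai jb.
have E1 : i = a by apply: val_inj => /=; lia.
have E2 : j = b by apply: val_inj => /=; lia.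
by rewrite E1 E2.
Qed.

(** Subtracting h_aa / h_ab times column b from column a clears the entry (a, a); exchanging the two
    columns then leaves a lower triangular matrix. *)
Lemma bruhat_factor (x : GL R) v :
  (forall i j : 'I_4, (i < j)%N -> (i, j) != (a, b) -> hc x (i, j) = 0) -> hc x (a, b) * v = 1 ->
  exists b1 b2 : GL R, [/\ in_B b1, in_B b2 &
    x = glM (glM (glM b1 (gl_perm R (tperm a b))) b2) (glV (gl_perm R zW))].
Proof.
move=> H uv; pose c := v * hc x (a, a); pose E : 'M[R]_4 := delta_mx b a.
have nab : (a == b) = false by apply/eqP => h; move: ab; rewrite -h => /n_Sn.
have EE : E *m E = 0 by rewrite mul_delta_mx_cond nab.
have K1 : (1%:M + c *: E) *m (1%:M - c *: E) = 1%:M.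
  rewrite mulmxDl !mulmxBr !mul1mx mulmx1 -scalemxAl -scalemxAr EE !scaler0 subr0.
  by rewrite addrNK.
have K2 : (1%:M - c *: E) *m (1%:M + c *: E) = 1%:M.
  rewrite mulmxBl !mulmxDr !mul1mx mulmx1 -scalemxAl -scalemxAr EE !scaler0 addr0.
  by rewrite addrK.
pose b2 := MkGL K1 K2; pose h := glM x (gl_perm R zW).
have hE i j : glm h i j = hc x (i, j).
  have -> : glm h = glm x *m perm_mx (zW^-1)^-1 by rewrite invgK.
  rewrite -col_permE mxE /hc; congr (glm x i _).
  by apply: (canLR (permK _)); rewrite zW_ordS ord_predK4.
pose b1 := glM (glM h (glV b2)) (gl_perm R (tperm a b)).
exists b1, b2; split.
- apply/is_trig_mxP => i j ij /=.
  have h2 m : (glm h *m (1%:M - c *: E)) i m = hc x (i, m) - c * (hc x (i, b) * (m == a)%:R).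
    have -> : (glm h *m (1%:M - c *: E)) i m = glm h i m - c * (glm h *m E) i m.
      by rewrite mulmxBr mulmx1 -scalemxAr !mxE.
    rewrite hE; congr (_ - _ * _); rewrite mxE (bigD1 b) //= big1 ?addr0 => [|l /negPf lb]; last by rewrite [E l m]mxE lb mulr0.
    by rewrite [E b m]mxE eqxx /= hE.
  have -> : perm_mx (tperm a b) = perm_mx (tperm a b)^-1^-1 :> 'M[R]_4 by rewrite invgK.
  rewrite -col_permE mxE tpermV h2.
  have ia_ne : i != a -> (tperm a b j == a) = false -> hc x (i, tperm a b j) - c * (hc x (i, b) * 0) = 0.
    move=> ia ja; rewrite !mulr0 subr0; apply: H; last by rewrite xpair_eqE (negPf ia).
    case: tpermP ja ij => [-> _|-> /eqP//|_ _ _ //]; by rewrite ?eqxx //; move: ab; lia.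
  case: (tpermP a b j) => [Ej|Ej|/eqP ja /eqP jb].
  + subst j; rewrite eq_sym nab mulr0 mulr0 subr0.
    by apply: H; [lia|rewrite xpair_eqE; apply/nandP; left; rewrite -val_eqE /= ltn_eqF].
  + subst j; rewrite eqxx mulr1.
    have [ia|ia] := eqVneq i a.
      by rewrite ia /c -mulrA [hc x (a, a) * _]mulrC mulrA [v * _]mulrC uv mul1r subrr.
    have ia' : (i < a)%N by move: ia ij ab; rewrite -val_eqE /=; lia.
    have e1 : hc x (i, a) = 0 by apply: H => //; rewrite xpair_eqE (negPf ia).
    have e2 : hc x (i, b) = 0 by apply: H; [rewrite ab; lia|rewrite xpair_eqE (negPf ia)].
    by rewrite e1 e2 mulr0 subr0.
  + rewrite (negPf ja) mulr0 mulr0 subr0; apply: H => //.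
    by rewrite xpair_eqE (negPf jb) andbF.
- apply/is_trig_mxP => i j ij; rewrite /= !mxE.
  have -> : (i == j) = false by apply/eqP => h'; move: ij; rewrite h' ltnn.
  have -> : (i == b) && (j == a) = false.
    by apply/andP => -[/eqP ib /eqP ja]; move: ij; rewrite ib ja ab ltnNge leqnSn.
  by rewrite mulr0 addr0.
- apply: gl_eq; rewrite /b1 /h /=.
  have P1 : perm_mx (tperm a b) *m perm_mx (tperm a b) = 1%:M :> 'M[R]_4.
    by rewrite -perm_mxM tperm2 perm_mx1.
  rewrite -!mulmxA (mulmxA (perm_mx (tperm a b)) (perm_mx (tperm a b))) P1 mul1mx.
  by rewrite (mulmxA (1%:M - _)) K2 mul1mx gl_permK mulmx1.
Qed.

End Bruhat.

Section Units.
Variables (q : nat) (q_gt0 : (0 < q)%N) (R : comPzRingType).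
Variables (a b : 'I_4) (ab : b = a.+1 :> nat).

(** The 2 x 2 diagonal minor at a, b. On the curve the entries (a, a) and (b, b) are no longer
    semi-invariant, but this minor is. *)
Definition hblk (h : 'M[R]_4) : R := hc h (a, a) * hc h (b, b) - hc h (a, b) * hc h (b, a).

Definition on_curve (h : 'M[R]_4) : Prop :=
  forall i j : 'I_4, (i < j)%N -> (i, j) != (a, b) -> hc h (i, j) = 0.

Lemma hdiag_act e (M : GL R) (s : 'I_4) : zipE' q e -> on_curve M -> s != a -> s != b ->
  hc (zip_act e M) (s, s) = gl_char (wt q (s, s)) e.1 * hc M (s, s).
Proof.
move=> Ee H sa sb; apply: hc_act => //= i j ij sj nij; apply: H.
  move: nij; rewrite xpair_eqE -!val_eqE /=; lia.
rewrite xpair_eqE -!val_eqE /=; move: sa sb; rewrite -!val_eqE /= ab; lia.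
Qed.

Lemma hblk_act e (M : GL R) : zipE' q e -> on_curve M ->
  hblk (zip_act e M) = gl_char (wt q (a, a) + wt q (b, b)) e.1 * hblk M.
Proof.
move=> Ee H; have [_ Bb] := Ee; have [/is_trig_mxP tY _] := zipY_spec q_gt0 Ee.
have /is_trig_mxP tb := Bb.
have ab' : (a < b)%N by rewrite ab.
have blk (i j : 'I_4) : (a <= i <= b)%N -> (a <= j <= b)%N -> hc (zip_act e M) (i, j) =
    (e.1 i a * hc M (a, a) + e.1 i b * hc M (b, a)) * zipY e a j +
    (e.1 i a * hc M (a, b) + e.1 i b * hc M (b, b)) * zipY e b j.
  move=> ai aj; have -> : hc (zip_act e M) (i, j) = hmat (zip_act e M) i j by rewrite mxE.
  have z (c m : 'I_4) : (c <= b)%N -> (a <= m)%N -> (c, m) \notin [:: (a, a); (a, b); (b, a); (b, b)] -> hc M (c, m) = 0.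
    rewrite !inE !xpair_eqE -!val_eqE /= => cb am n; apply: H; first by move: n ab'; rewrite ab; lia.
    by rewrite xpair_eqE -!val_eqE /=; move: n; rewrite ab; lia.
  have colE (m : 'I_4) : (a <= m)%N ->
      (glm e.1 *m hmat M) i m = e.1 i a * hc M (a, m) + e.1 i b * hc M (b, m).
    move=> am; rewrite mxE (sum2 ab) => [|c ca cb]; first by rewrite -!(hmatE M (_, _)).
    have [ci|ci] := ltnP i c; first by rewrite tb ?mul0r.
    rewrite (_ : hmat M c m = 0) ?mulr0 // mxE z //; first exact: leq_trans ci (andP ai).2.
    by rewrite !inE !xpair_eqE (negPf ca) (negPf cb).
  rewrite hmat_act mxE (sum2 ab) => [|m ma mb]; first by rewrite !colE // ltnW.
  have [mj|mj] := ltnP m j; first by rewrite tY ?mulr0.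
  rewrite mxE big1 ?mul0r // => c _.
  have [ci|ci] := ltnP i c; first by rewrite tb ?mul0r.
  rewrite [hmat _ _ _]mxE z ?mulr0 //.
  - exact: leq_trans ci (andP ai).2.
  - exact: leq_trans (andP aj).1 mj.
  - by rewrite !inE !xpair_eqE (negPf ma) (negPf mb) !andbF.
rewrite /hblk !blk ?leqnn ?(ltnW ab') //.
rewrite (tb a b ab') (tY a b ab') gl_charD // !gl_char_wt //=; ring.
Qed.

Definition hdet (h : 'M[R]_4) : R := \det (hmat h).
Definition hdeti (M : GL R) : R := \det (\matrix_(i, j) gli M (ord_pred i) j).

Lemma hdetK (M : GL R) : hdet M * hdeti M = 1.
Proof.
rewrite -det_mulmx (_ : _ *m _ = 1%:M) ?det1 //.
rewrite -(glmK M); apply/matrixP => i j; rewrite [RHS]mxE (reindex_inj ord_pred_inj4) [LHS]mxE.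
by apply: eq_bigr => m _; rewrite !mxE.
Qed.

Lemma hdet_act e (M : GL R) : zipE' q e ->
  hdet (zip_act e M) = gl_char (\sum_s wt q (s, s)) e.1 * hdet M.
Proof.
move=> Ee; have [_ Bb] := Ee; have [tY _] := zipY_spec q_gt0 Ee.
rewrite /hdet hmat_act !det_mulmx (det_trig Bb) (det_trig tY) mulrAC; congr (_ * _).
rewrite -big_split /=.
rewrite (big_morph (fun w => gl_char w e.1) (fun x y => gl_charD x y Bb) (gl_char0 e.1)).
by apply: eq_bigr => s _; rewrite gl_char_wt.
Qed.

Lemma hdeti_act e (M : GL R) : zipE' q e ->
  hdeti (zip_act e M) = gl_char (- \sum_s wt q (s, s)) e.1 * hdeti M.
Proof.
move=> Ee; have [_ Bb] := Ee; set w := \sum_s _.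
have E1 := hdetK (zip_act e M); rewrite hdet_act // -/w in E1.
have E2 := gl_charN w Bb; have E3 := hdetK M.
rewrite -[LHS]mul1r -[X in X * _ = _]mulr1 -{1}E2 -E3.
rewrite [LHS](_ : _ = gl_char (- w) e.1 * hdeti M * (gl_char w e.1 * hdet M * hdeti (zip_act e M))); last by ring.
by rewrite E1 mulr1.
Qed.

End Units.

Lemma weight_sum (V : zmodType) (l w t : V) (Q n m : nat) (E : int) : m%:Z = Q%:Z * n%:Z - E ->
  l *+ Q + (- w) *+ Q + (- t) *+ (n * Q) + t *+ m = (l - w) *+ Q - t *~ E.
Proof.
move=> mE; rewrite mulrnBl !mulNrn -addrA; congr (_ + _).
have -> : t *~ E = t *+ (n * Q) - t *+ m.
  by rewrite !pmulrn -mulrzBr; congr (_ *~ _); rewrite PoszM mE; ring.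
by rewrite opprB addrC.
Qed.

(** * The bound on the order along one simple entry *)

Section Curve.
Variables (k : closedFieldType) (q : nat) (q_gt0 : (0 < q)%N).
Variables (G : GLscheme k) (S : kscheme k) (zeta : zip_mor q G S) (FlagS : flag_space zeta).
Local Notation X := (ztot zeta).
Local Notation loc := (zloc zeta).
Local Notation act := (@zact _ _ _ _ zeta).
Local Notation g := (gmx loc).
Local Notation F := (fsch FlagS).
Local Notation pi := (fproj FlagS).
Hypothesis smloc : smooth loc.
Variables (lam : 'rV[int]_4) (f : Gam X).
Hypothesis f_eq : forall T e (x : schhom T X), zipE' q e ->
  gpull (act e x) f = gl_char lam e.1 * gpull x f.
Variables (a b : 'I_4) (ab : b = a.+1 :> nat).
Variable cs : seq (('I_4 * 'I_4) * nat).
Local Notation J := (unzip1 cs).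
Local Notation t := (a, b).
Hypothesis clJ : closed_list (t :: J).
Hypothesis ucs : uniq (t :: J).
Hypothesis J_upper : forall i j : 'I_4, ((i, j) \in J) = ((i < j)%N && ((i, j) != t)).
Hypothesis pc : pseudo_complete (closure (flag_stratum FlagS (tperm a b))).
Local Notation Z := (closure (flag_stratum FlagS (tperm a b))).
Let clJ' : closed_list J. Proof. by case: clJ. Qed.
Let ucs' : uniq J. Proof. by case/andP: ucs. Qed.
Let tJ : t \notin J. Proof. by case/andP: ucs. Qed.
Let subJ : {subset J <= t :: J}. Proof. by move=> s; rewrite inE orbC => ->. Qed.

Lemma inX_curve T (x : schhom T X) : inX (zeta := zeta) J x <-> on_curve a b (mat (schcomp loc x)).
Proof.
split=> [H i j ij nij|H [i j]]; first by apply: H; rewrite J_upper ij.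
by rewrite J_upper => /andP[ij nij]; exact: H.
Qed.

Lemma stratum_onJ z : flag_stratum FlagS (tperm a b) z -> exists x, onJ loc J x /\ pi x = z.
Proof.
move=> [x [T [u [tau [b1 [b2 [ux B1 B2 Eu]]]]]] <-]; exists x; split=> // -[i j].
rewrite J_upper => /andP[ij nij].
pose xT : topen X `<=` loc @^-1` topen G := fun _ _ => I.
pose uT : topen T `<=` u @^-1` topen G := fun _ _ => I.
have -> : hc (g (topen X)) (i, j) = pull xT (hc (glm (gluniv G)) (i, j)).
  by rewrite /hc !mxE; exact: res_id.
rewrite pull_unit // -ux -(pull_unit uT) //.
have -> : pull uT (hc (glm (gluniv G)) (i, j)) = 0; last exact: nonunit0.
have <- : hmat (mat u) i j = pull uT (hc (glm (gluniv G)) (i, j)) by rewrite mxE /hc !mxE.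
by rewrite Eu hmat_perm; exact: bruhat_vanish.
Qed.

(** The complement of the stratum is open and E'-stable, so its image is an open set disjoint from
    the flag stratum, hence from its closure. *)
Lemma closure_onJ z : Z z -> exists x, onJ loc J x /\ pi x = z.
Proof.
move=> Zz; have [x Ex] := torsor_surj (ftorsor FlagS) z.
exists x; split=> //; apply: contrapT => nx.
have inv : invariant (zipE' q) act (Opens (@onJ_closed _ _ _ _ zeta J)).
  move=> D kap y e tau Ee; split=> n Jy; apply: (n).
    exact: (proj2 (onJ_actE q_gt0 clJ' y tau Ee) Jy).
  exact: (proj1 (onJ_actE q_gt0 clJ' y tau Ee) Jy).
have [o H] := torsor_open (ftorsor FlagS) inv.
have [|z' [Sz' [x' nx' Ex']]] := Zz (pi @` (~` onJ loc J)).
  by apply: open_nbhs_nbhs; split=> //; exists x.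
have [x1 [Jx1 Ex1]] := stratum_onJ Sz'.
by apply: (H x1) => //; exists x' => //; rewrite Ex1.
Qed.

Lemma open_curve_stratum x : onJ loc J x -> unit_at (hc (g (topen X)) t) x ->
  flag_stratum FlagS (tperm a b) (pi x).
Proof.
move=> Jx ux; exists x => //; have [W [Wx _ [aW _ _]]] := chart_exists smloc (x := x) (O := topen X) I.
pose x1 : schhom (Spec (kcst W)) X := specmor aW (beta := idfun) (fun c => erefl).
pose P : Spec (kcst W) := ptprime Wx.
have x1P : x1 P = x.
  apply: (aff_eq aW) => // [|f0]; first exact: specmor_in.
  rewrite specmor_unit /=; split=> [h|h]; last by move/(_ h).
  by apply: contrapT => n; apply: h.
have [K [kK [s [z [sz z0 zV]]]]] := res_point P.
pose y := schcomp x1 s; have yz : y z = x by rewrite -x1P; exact: (congr1 x1 sz).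
have yJ : inX (zeta := zeta) J y by apply: (inX_field z0); rewrite yz.
have yT : lands y (topen X) by [].
have [v Ev] : exists v, hc (glm (mat (schcomp loc y))) t * v = 1.
  rewrite (hc_lands yT); case: (zV (ringof yT (hc (g (topen X)) t))) => [E0|[v Ev]].
    by exfalso; move: ux; rewrite -yz; apply/(ringof_field yT _ z0).
  by exists (toG K v); rewrite -rmorphM Ev rmorph1.
have [b1 [b2 [B1 B2 E]]] := bruhat_factor ab (proj1 (inX_curve y) yJ) Ev.
exists (Spec kK), (schcomp loc y), z, b1, b2; split=> //.
by rewrite -yz.
Qed.

(** Such a c lies in every prime containing the ideal of the stratum, so it is nilpotent modulo this
    ideal, and the germ is a domain. *)
Lemma znk_points (y : kpoint X) W (yW : lands y W) (c : sect W) : chart loc W -> onJ loc J (kpt y) ->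
  (forall x, oset W x -> onJ loc J x -> ~ unit_at c x) -> znk loc yW J c.
Proof.
move=> cW Jy H; have [aW _ _] := cW.
have [n Hn] : exists n, IJ (g W) J (c ^+ n).
  apply: nilp_prime => P pP JP.
  have [x [Wx Hx]] := prime_pt aW (exist _ _ pP : primes (sect W)).
  apply/Hx; apply: (H) => // s sJ; rewrite (onJE loc s Wx).
  by apply/Hx => /=; apply: JP; exact: IJ_mem.
have zc : znk loc yW J (c ^+ n) by exact: zn_of.
elim: n {Hn} zc => [|n IH]; last by rewrite exprS => /(znk_mul cW Jy)[].
by move=> z1; rewrite -(mulr1 c) -(expr0 c); exact: znM.
Qed.

(** By [zn_reg], h_t does not vanish on the germ at y of the stratum of J, so every neighbourhood of
    y meets its nonzero locus, which lies over the flag stratum. *)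
Lemma closed_point_Z (y : kpoint X) : onJ loc (t :: J) (kpt y) -> Z (pi (kpt y)).
Proof.
move=> Jty B; rewrite nbhsE => -[O [oO Oy] OB].
have [W [Wy WO cW]] := chart_exists smloc (x := kpt y) (O := Defs.preim (@hcont _ _ _ pi) (Opens oO)) Oy.
have [aW lW fW] := cW; pose yW := kpt_lands Wy.
have Jy := onJ_sub subJ Jty.
have [x [Wx [Jx ux]]] : exists x, oset W x /\ onJ loc J x /\ unit_at (hc (g W) t) x.
  apply: contrapT => H.
  have z : znk loc yW J (hc (g W) t).
    by apply: znk_points => // x Wx Jx ux; apply: H; exists x.
  have Jr := proj1 (onJ_ring loc _ yW) Jty.
  have xJ s : s \in J -> ringof yW (hc (g W) s) = 0 by move=> sJ; apply: Jr; exact: subJ.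
  have xt : ringof yW (hc (g W) t) = 0 by apply: Jr; exact: mem_head.
  exact: (zn_reg lW xJ tJ xt z).
exists (pi x); split; last by apply: OB; exact: WO.
by apply: open_curve_stratum => //; rewrite (onJE loc t Wx).
Qed.

Variables (n Q : nat) (E : int) (A : 'I_4 -> int).
Hypothesis Aab : A a = A b.
Hypothesis weq : (lam - wtsum q cs) *+ Q - wt q t *~ E + \sum_s wt q (s, s) *~ A s = 0.
Hypothesis minimal : forall y : kpoint X, onJ loc (t :: J) (kpt y) ->
  good loc f cs (kpt y) -> good loc f ((t, n) :: cs) (kpt y).

Section Exponents.
Variables (M m : nat) (ex : 'I_4 -> nat).
Hypothesis exE : forall s, (ex s)%:Z = A s + M%:Z.
Hypothesis mE : m%:Z = Q%:Z * n%:Z - E.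
Hypothesis m_gt0 : (0 < m)%N.

(** The product of the h_ss^(A s), made regular: all exponents are raised by M and compensated by
    the M-th power of the inverse determinant [di]. The factors at a and b, whose exponents agree,
    are merged into the minor [hblk]. *)
Definition ufun (R : comPzRingType) (h : 'M[R]_4) (di : R) : R :=
  \prod_(s | (s != a) && (s != b)) hc h (s, s) ^+ ex s * hblk a b h ^+ ex a * di ^+ M.

Lemma ufun_map (R R' : comPzRingType) (r : {rmorphism R -> R'}) h di :
  r (ufun h di) = ufun (map_mx r h) (r di).
Proof.
rewrite /ufun !rmorphM rmorph_prod !rmorphXn /=; congr (_ * _ ^+ _ * _).
  by apply: eq_bigr => s _; rewrite rmorphXn hc_map.
by rewrite /hblk rmorphB !rmorphM /= !hc_map.
Qed.

Definition uweight : 'rV[int]_4 := \sum_s wt q (s, s) *~ A s.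

Lemma ufun_act (R : comPzRingType) e (x : GL R) : zipE' q e -> on_curve a b x ->
  ufun (zip_act e x) (hdeti (zip_act e x)) = gl_char uweight e.1 * ufun x (hdeti x).
Proof.
move=> Ee Hx; have [_ Bb] := Ee; rewrite /ufun (hblk_act q_gt0 ab Ee Hx) (hdeti_act q_gt0 _ Ee) !exprMn -!gl_charMn //.
have -> : \prod_(s | (s != a) && (s != b)) hc (zip_act e x) (s, s) ^+ ex s =
    gl_char (\sum_(s | (s != a) && (s != b)) wt q (s, s) *+ ex s) e.1 *
    \prod_(s | (s != a) && (s != b)) hc x (s, s) ^+ ex s.
  rewrite (big_morph (fun w => gl_char w e.1) (fun x y => gl_charD x y Bb) (gl_char0 e.1)) -big_split /=.
  by apply: eq_bigr => s /andP[sa sb]; rewrite (hdiag_act q_gt0 ab Ee Hx) // exprMn gl_charMn.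
set P := \prod_(s | _) _; set w1 := \sum_(s | _) _; set w2 := (_ + _) *+ _; set w3 := (- _) *+ M.
have -> : uweight = w1 + w2 + w3.
  rewrite /uweight /w1 /w2 /w3 mulNrn -sumrMnl.
  have -> : \sum_s wt q (s, s) *~ A s = \sum_s wt q (s, s) *+ ex s - \sum_s wt q (s, s) *+ M.
    rewrite -sumrB; apply: eq_bigr => s _.
    by rewrite !pmulrn -mulrzBr exE addrK.
  congr (_ - _).
  have nab : b != a by rewrite -val_eqE /= ab gtn_eqF.
  rewrite (bigD1 a) //= (bigD1 b) //= addrA [RHS]addrC; congr (_ + _).
  have -> : ex b = ex a by apply/eqP; rewrite -eqz_nat !exE Aab.
  by rewrite -mulrnDl.
rewrite !gl_charD //; ring.
Qed.

(** By [weq], the function inside the power has weight zero, m being Q n - E. The power n+1 makes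
    h_t occur at least n times, because equivariance controls c6 only after multiplication by h_t^n;
    see [pow_cancel]. *)
Definition psif (V : opens X) (c6 : sect V) : sect V :=
  (c6 ^+ Q * hc (g V) t ^+ m * ufun (g V) (resT V (hdeti (mat loc)))) ^+ n.+1.

(** Near points where cs has no leading coefficient the function 0 is used, so that [Phi] covers the
    whole stratum. *)
Definition Phi (V : opens X) (psi : sect V) : Prop :=
  (exists c6, lead loc f ((t, n) :: cs) c6 /\ psi = psif c6) \/
  (psi = 0 /\ forall x, oset V x -> onJ loc J x -> ~ good loc f cs x).

(** Where h_t is invertible, the coefficient of cs can be divided by h_t^n. Where it vanishes, a bad
    neighbourhood is excluded by applying [minimal] at a closed specialization. *)
Lemma Phi_cover x : onJ loc J x -> exists (V : opens X) (psi : sect V), oset V x /\ Phi psi.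
Proof.
move=> Jx; case: (good_bad smloc f ucs' Jx) => [gx|[O [Ox HO]]]; last first.
  by exists O, 0; split=> //; right.
have [ut|nt] := pselect (unit_at (hc (g (topen X)) t) x).
  have [W [phi [Wx WO cW L]]] := good_chart_at smloc (O := dop (hc (g (topen X)) t)) gx ut.
  have dT := @dop_sub k X _ (hc (g (topen X)) t).
  have [v Ev] : exists v, hc (g W) t * v = 1.
    have [aW _ _] := cW; apply: (aff_inv aW) => z Wz.
    by rewrite -(onJE loc t Wz); exact: (WO z Wz).
  exists W, (psif (phi * v ^+ n)); split=> //; left; exists (phi * v ^+ n); split=> //.
  exists phi; split=> //; rewrite mulrCA -exprMn Ev expr1n mulr1 subrr; exact: ideal0.
have Jtx : onJ loc (t :: J) x by move=> s; rewrite inE => /orP[/eqP->|/Jx].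
have [gt|[O [Ox HO]]] := good_bad smloc f (cs := (t, n) :: cs) ucs Jtx.
  have [V [c6 [Vx L]]] := gt.
  by exists V, (psif c6); split=> //; left; exists c6.
exfalso; have [W [phi [Wx WO cW L]]] := good_chart_at smloc gx Ox.
have [aW _ fW] := cW; have [y [Wy _ Hy]] := @kspec k X W x 1 aW fW (unit_at1 Wx).
have Jty := onJ_spec Wx Wy Hy Jtx.
apply: (HO _ (WO _ Wy) Jty); apply: minimal => //.
by exists W, phi.
Qed.

Lemma pow_cancel (R : comPzRingType) (T x y u : R) : T ^+ n * x = T ^+ n * y ->
  (x ^+ Q * T ^+ m * u) ^+ n.+1 = (y ^+ Q * T ^+ m * u) ^+ n.+1.
Proof.
move=> E0; have E1 r : T ^+ n * x ^+ r = T ^+ n * y ^+ r.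
  elim: r => [|r IH]; first by rewrite !expr0.
  rewrite !exprS mulrA E0 -mulrA mulrCA IH mulrCA; ring.
rewrite !exprMn -!exprM; congr (_ * _).
have -> : (m * n.+1 = n + (m * n.+1 - n))%N by rewrite subnKC // (leq_trans (leqnSn n)) // leq_pmull.
by rewrite exprD !mulrA -![_ * T ^+ n]mulrC !E1.
Qed.

Lemma ufun_value (D : comPzRingType) (kap : {rmorphism k -> D}) (x : schhom (Spec kap) X) V (xV : lands x V) :
  toG D (ringof xV (ufun (g V) (resT V (hdeti (mat loc))))) =
  ufun (mat (schcomp loc x)) (hdeti (mat (schcomp loc x))).
Proof.
rewrite (mat_lands loc xV).
have -> : hdeti (mat (schcomp loc x)) = toG D (ringof xV (resT V (hdeti (mat loc)))).
  rewrite -(ringof_gpull xV) mat_comp /hdeti -det_map_mx; congr (\det _).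
  by apply/matrixP => i j; rewrite !mxE.
by rewrite -!ufun_map.
Qed.

Lemma psif_value (D : comPzRingType) (kap : {rmorphism k -> D}) (x : schhom (Spec kap) X) V (xV : lands x V) c6 :
  toG D (ringof xV (psif c6)) = (toG D (ringof xV c6) ^+ Q * hc (glm (mat (schcomp loc x))) t ^+ m *
    ufun (mat (schcomp loc x)) (hdeti (mat (schcomp loc x)))) ^+ n.+1.
Proof.
rewrite /psif (hc_lands xV).
by rewrite -(ufun_value xV) !rmorphXn !rmorphM !rmorphXn.
Qed.

(** [equivariance] gives the character by which h_t^n c6 is multiplied, and [weq] makes the
    characters cancel. If the two functions come from different alternatives, [good_invariant] shows
    that D has no prime, so it is trivial. *)
Lemma Phi_inv (D : comPzRingType) (kap : {rmorphism k -> D}) (x : schhom (Spec kap) X) e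
  (V V' : opens X) (xV : lands x V) (xV' : lands (act e x) V') (phi : sect V) (phi' : sect V') :
  zipE' q e -> inX (zeta := zeta) J x -> Phi phi -> Phi phi' -> ringof xV phi = ringof xV' phi'.
Proof.
move=> Ee Jx P1 P2; have [_ Bb] := Ee.
have trivD (V1 : opens X) (x1 : schhom (Spec kap) X) : (forall tau : Spec kap, False) -> forall d d' : D, d = d'.
  move=> H d d'; have [|r E0] := @nilp_prime D (ideal_zero D) 1.
    by move=> P pP _; case: (H (exist _ _ pP)).
  by rewrite -[d]mul1r -[d']mul1r -(expr1n _ r) E0 !mul0r.
case: P1 P2 => [[c6 [L1 ->]]|[-> N1]] [[c6' [L2 ->]]|[-> N2]]; last by rewrite !rmorph0.
- apply: toG_inj; rewrite !psif_value.
  have [phi5 [Lp I1]] := L1; have [phi5' [Lp' I2]] := L2.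
  set T := hc (glm (mat (schcomp loc x))) t; set P := toG D (ringof xV c6).
  set P' := toG D (ringof xV' c6').
  have ET : hc (glm (mat (schcomp loc (act e x)))) t = gl_char (wt q t) e.1 * T by exact: (act_hc q_gt0 Ee clJ Jx).
  have val (x' : schhom (Spec kap) X) (V1 : opens X) (xV1 : lands x' V1) (a5 a6 : sect V1) :
      inX (zeta := zeta) J x' -> IJ (g V1) J (a5 - hc (g V1) t ^+ n * a6) ->
      toG D (ringof xV1 a5) = hc (glm (mat (schcomp loc x'))) t ^+ n * toG D (ringof xV1 a6).
    move=> Jx' Ia; have := inX_IJ xV1 Jx' Ia; rewrite (hc_lands xV1) -rmorphXn -rmorphM => E0.
    congr (toG D _); apply/eqP; rewrite -subr_eq0; apply/eqP.
    by rewrite -E0 rmorphB rmorphM rmorphXn.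
  have Eq := equivariance q_gt0 smloc f_eq clJ' ucs' xV xV' Ee Jx Lp Lp'.
  rewrite (val _ _ _ _ _ Jx I1) (val _ _ _ _ _ (act_inX q_gt0 Ee clJ' Jx) I2) ET in Eq.
  rewrite ET zequiv; last by case: Ee.
  rewrite ufun_act //; last exact/inX_curve.
  set chi := gl_char (wt q t) e.1 in Eq *; set Ws := gl_char (wtsum q cs) e.1 in Eq.
  set La := gl_char lam e.1 in Eq; set u := ufun _ _; set Uc := gl_char uweight e.1.
  rewrite -/T -/P -/P' in Eq *.
  have El := gl_charN lam Bb; have Ew := gl_charN (wtsum q cs) Bb; have Ec := gl_charN (wt q t) Bb.
  set Lai := gl_char (- lam) e.1 in El; set Wsi := gl_char (- wtsum q cs) e.1 in Ew.
  set chii := gl_char (- wt q t) e.1 in Ec; rewrite -/La -/Ws -/chi in El Ew Ec.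
  pose Y := P' * chi ^+ n * Ws * Lai.
  have EY : T ^+ n * P = T ^+ n * Y.
    transitivity (Lai * (La * (T ^+ n * P))); first by rewrite mulrA [Lai * La]mulrC El mul1r.
    rewrite -Eq /Y exprMn; ring.
  rewrite (pow_cancel u EY); congr (_ ^+ _).
  have EP : P' = Y * La * Wsi * chii ^+ n.
    rewrite /Y -[LHS]mulr1 -(expr1n _ n) -{1}Ec exprMn.
    rewrite -[X in X = _]mulr1 -Ew -[X in X = _]mulr1 -El; ring.
  have one : La ^+ Q * Wsi ^+ Q * chii ^+ (n * Q) * chi ^+ m * Uc = 1.
    rewrite /La /Wsi /chii /chi /Uc -!gl_charMn // -!gl_charD // -(gl_char0 e.1); congr (gl_char _ _).
    rewrite -weq /uweight; congr (_ + _).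
    exact: weight_sum.
  have EQ : P' ^+ Q = Y ^+ Q * La ^+ Q * Wsi ^+ Q * chii ^+ (n * Q) by rewrite {1}EP 3!exprMn -exprM.
  rewrite EQ [(chi * T) ^+ m]exprMn.
  rewrite [RHS](_ : _ = Y ^+ Q * T ^+ m * u * (La ^+ Q * Wsi ^+ Q * chii ^+ (n * Q) * chi ^+ m * Uc)); last first.
    by move: (Y ^+ Q) (La ^+ Q) (Wsi ^+ Q) (chii ^+ _) (chi ^+ m) (T ^+ m) => *; ring.
  by rewrite one mulr1.
- apply: (trivD V x) => tau; have Jt : onJ loc J (x tau) by exact: inX_onJ.
  have Jat : onJ loc J (act e x tau) by exact: onJ_act.
  apply: (N2 _ (xV' tau I) Jat).
  apply: (proj1 (good_invariant q_gt0 smloc f clJ' ucs' Ee Jt)).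
  by have [phi5 [Lp _]] := L1; exists V, phi5; split=> //; exact: (xV tau I).
- apply: (trivD V x) => tau; have Jt : onJ loc J (x tau) by exact: inX_onJ.
  apply: (N1 _ (xV tau I) Jt).
  apply: (proj2 (good_invariant q_gt0 smloc f clJ' ucs' Ee Jt)).
  by have [phi5 [Lp _]] := L2; exists V', phi5; split=> //; exact: (xV' tau I).
Qed.

Lemma ufun_unit (R : comPzRingType) (x : GL R) : (forall i j : 'I_4, (i < j)%N -> hc x (i, j) = 0) ->
  exists v, ufun x (hdeti x) * v = 1.
Proof.
move=> H.
have um (y z : R) : (exists v, y * v = 1) -> (exists v, z * v = 1) -> exists v, y * z * v = 1.
  by move=> [v Ev] [w Ew]; exists (v * w); rewrite mulrACA Ev Ew mulr1.
have ux (y : R) i : (exists v, y * v = 1) -> exists v, y ^+ i * v = 1.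
  by move=> [v Ev]; exists (v ^+ i); rewrite -exprMn Ev expr1n.
have tH : is_trig_mx (hmat x) by apply/is_trig_mxP => i j ij; rewrite mxE H.
have diag s : exists v, hc x (s, s) * v = 1.
  have inv : hmat x *m (\matrix_(i, j) gli x (ord_pred i) j) = 1%:M.
    rewrite -(glmK x); apply/matrixP => i j; rewrite [RHS]mxE (reindex_inj ord_pred_inj4) [LHS]mxE.
    by apply: eq_bigr => m' _; rewrite !mxE.
  have [_ /(_ s) Hs] := trig_inv inv tH; exists (gli x (ord_pred s) s).
  by move: Hs; rewrite !mxE.
rewrite /ufun; apply: (um); last by apply: ux; exists (hdet x); rewrite mulrC hdetK.
apply: (um); last first.
  apply: ux; rewrite /hblk (H a b) ?mul0r ?subr0 ?ab //; exact: um.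
apply: (big_ind (fun y => exists v, y * v = 1)) => [|y z|s _]; [by exists 1; rewrite mulr1|exact: um|].
exact: ux.
Qed.

(** The function [psif c6] is locally constant along the curve, and it is zero at y since m > 0.
    Hence it vanishes on the open stratum near y; as h_t and [ufun] are nonzero in the germ, which
    is a domain, c6 vanishes. *)
Lemma curve_contra (y : kpoint X) W (yW : lands y W) (c6 : sect W) : chart loc W ->
  onJ loc (t :: J) (kpt y) -> lead loc f ((t, n) :: cs) c6 -> znk loc yW (t :: J) c6.
Proof.
move=> cW Jty L; have Jy := onJ_sub subJ Jty.
have PP : Phi (psif c6) by left; exists c6.
have [V' [VV [c [Vy Hc]]]] := locally_constant q_gt0 clJ' Phi_cover Phi_inv pc closure_onJ Jy
  (closed_point_Z Jty) (lands_kpt yW) PP.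
have xt : ringof yW (hc (g W) t) = 0 by apply: (proj1 (onJ_ring loc _ yW) Jty); exact: mem_head.
have c0 : c = 0.
  have yV : lands y V' := kpt_lands Vy.
  have := Hc _ Vy Jy (closed_point_Z Jty); rewrite (kpt_nunit yV) rmorphB ringof_cst (ringof_res yW yV VV).
  have [z ->] : exists z, psif c6 = hc (g W) t * z.
    exists (c6 ^+ Q * hc (g W) t ^+ m.-1 * ufun (g W) (resT W (hdeti (mat loc))) *
      (c6 ^+ Q * hc (g W) t ^+ m * ufun (g W) (resT W (hdeti (mat loc)))) ^+ n).
    rewrite /psif exprS -{1}(prednK m_gt0) exprS; ring.
  by rewrite rmorphM xt mul0r sub0r => /eqP; rewrite oppr_eq0 => /eqP.
have [W2 [W2y W2V cW2]] := chart_exists smloc Vy.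
have W2W : W2 `<=` W by move=> z /W2V/VV.
pose y2 := kpt_lands W2y; have [aW _ _] := cW; have [aW2 lW2 fW2] := cW2.
have xJ s : s \in J -> ringof y2 (hc (g W2) s) = 0 by move=> sJ; exact: (proj1 (onJ_ring loc _ y2) Jy).
have xt2 : ringof y2 (hc (g W2) t) = 0 by apply: (proj1 (onJ_ring loc _ y2) Jty); exact: mem_head.
have z : znk loc y2 J (rstr W2W (psif c6) * hc (g W2) t).
  apply: znk_points => // x W2x Jx /unit_atM[u1 u2].
  have Zx : Z (pi x).
    by apply: subset_closure; apply: open_curve_stratum => //; rewrite (onJE loc t W2x).
  have := Hc x (W2V _ W2x) Jx Zx; rewrite c0 rmorph0 subr0 => nu; apply: (nu).
  by rewrite (unit_res VV _ (W2V _ W2x)) -(unit_res W2W _ W2x).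
have zr := zn_reg lW2 xJ tJ xt2.
have zp : znk loc y2 J (rstr W2W (psif c6)) by case: (znk_mul cW2 Jy z).
have zex i (d : sect W2) : znk loc y2 J (d ^+ i) -> znk loc y2 J d.
  elim: i => [|i IH]; last by rewrite exprS => /(znk_mul cW2 Jy)[].
  by move=> z1; rewrite -(mulr1 d) -(expr0 d); exact: znM.
have [u Eu] : exists u, u = ufun (g W) (resT W (hdeti (mat loc))) by eexists.
move: zp; rewrite /psif -Eu rmorphXn => /zex; rewrite !rmorphM => /(znk_mul cW2 Jy)[/(znk_mul cW2 Jy)[]|].
- rewrite rmorphXn => /zex zc; apply: (proj2 (@znk_res _ _ _ loc _ _ _ yW y2 W2W _ _ aW)).
  exact: zn_sub zc.
- by rewrite rmorphXn /= hc_res => /zex.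
- move=> [j [yj /(IJ_kill xJ)]]; rewrite rmorphM (ringof_res yW y2 W2W) => /eqP.
  rewrite mulf_eq0 (negPf yj) orFb Eu => /eqP u0; exfalso.
  have [|v Ev] := @ufun_unit _ (mat (schcomp loc y)).
    move=> i1 i2 ij; rewrite (hc_lands yW) (_ : ringof yW _ = 0) ?rmorph0 //.
    apply: (proj1 (onJ_ring loc _ yW) Jty).
    by rewrite inE J_upper ij; case: eqVneq.
  move: Ev; rewrite -(ufun_value yW) u0 rmorph0 mul0r -(rmorph1 (toG k)) -(rmorph0 (toG k)).
  by move/toG_inj/eqP; rewrite eq_sym oner_eq0.
Qed.

End Exponents.

(** If Q n > E, the invariant c6^Q h_t^(Qn-E) times a unit is regular and vanishes with h_t, so
    [curve_contra] forces c6 to vanish. *)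
Lemma curve_bound (y : kpoint X) W (yW : lands y W) (c6 : sect W) : chart loc W ->
  onJ loc (t :: J) (kpt y) -> lead loc f ((t, n) :: cs) c6 -> ~ znk loc yW (t :: J) c6 ->
  (Q%:Z * n%:Z <= E)%R.
Proof.
move=> cW Jty L nz; apply: contrapT => /negP lt; apply: nz.
(* Any M that makes all the exponents A s + M nonnegative would serve. *)
pose M := (\sum_s `|A s|)%N; pose m := absz (Q%:Z * n%:Z - E)%R.
have AM s : (`|A s| <= M)%N by rewrite /M (bigD1 s) //= leq_addr.
apply: (@curve_contra M m (fun s => absz (A s + M%:Z)%R)) L => //.
- by move=> s; have := AM s; lia.
- by rewrite /m; lia.
- by rewrite /m; lia.
Qed.

End Curve.

(** * Minimal orders at closed points of the smallest stratum *)

Section Seeds.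
Variables (k : closedFieldType) (G : GLscheme k) (X : kscheme k) (loc : schhom X G).
Hypothesis smloc : smooth loc.
Variable f : Gam X.
Local Notation g := (gmx loc).
Variable UP : seq ('I_4 * 'I_4).

(* Closed points of the smallest stratum with nonzero leading coefficient. *)
Definition seed cs (y : kpoint X) : Prop := onJ loc UP (kpt y) /\
  exists W (yW : lands y W) (c : sect W), [/\ chart loc W, lead loc f cs c & ~ znk loc yW (unzip1 cs) c].

(** n is the least order along h_t over all closed points carrying a nonzero coefficient for cs. At
    any other good point the order is larger, or the coefficient vanishes locally, and in both cases
    the exponent n is allowed. *)
Lemma seed_next cs t : t \in UP -> {subset unzip1 cs <= UP} -> uniq (t :: unzip1 cs) ->
  (exists y, seed cs y) -> exists n, (exists y, seed ((t, n) :: cs) y) /\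
    forall y, onJ loc UP (kpt y) -> good loc f cs (kpt y) -> good loc f ((t, n) :: cs) (kpt y).
Proof.
move=> tU JU ut [y0 s0].
have tyE (y : kpoint X) : onJ loc UP (kpt y) -> onJ loc (t :: unzip1 cs) (kpt y).
  by apply: onJ_sub => s; rewrite inE => /orP[/eqP->|/JU].
have ext (y : kpoint X) : seed cs y -> exists n, seed ((t, n) :: cs) y.
  move=> [Uy [W [yW [c [cW L nz]]]]].
  have [n [W' [yW' [c' [_ cW' L' nz']]]]] := lead_ext smloc cW ut (tyE y Uy) L nz.
  by exists n; split=> //; exists W', yW', c'.
have [n0 Hn0] := ext _ s0.
have [|n [Hn Hmin]] := @nat_min (fun n => exists y, seed ((t, n) :: cs) y); first by exists n0, y0.
exists n; split=> // y Uy gy.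
have [W [c [Wy _ cW L]]] := good_chart_at smloc (O := topen X) gy I.
pose yW := kpt_lands Wy.
have [z|nz] := pselect (znk loc yW (unzip1 cs) c).
  by have [W' [yW' _ [c' L']]] := lead_zero smloc cW t n L z; exists W', c'.
have [n' sn'] : exists n, seed ((t, n) :: cs) y by apply: ext; split=> //; exists W, yW, c.
have nn' : (n <= n')%N by apply: Hmin; exists y.
have [_ [W' [yW' [c' [cW' [psi [L' I1]] _]]]]] := sn'.
exists W', (hc (g W') t ^+ (n' - n) * c'); split; first exact: lands_kpt.
by exists psi; split=> //; rewrite mulrA -exprD subnKC.
Qed.

(* The order along [t'] does not drop after restriction to the divisor [t]. *)
Lemma seed_order cs t t' n m n' y : t \in UP -> t' \in UP -> {subset unzip1 cs <= UP} ->
  uniq (t' :: t :: unzip1 cs) ->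
  (forall y, onJ loc UP (kpt y) -> good loc f cs (kpt y) -> good loc f ((t', n') :: cs) (kpt y)) ->
  seed ((t', m) :: (t, n) :: cs) y -> (n' <= m)%N.
Proof.
set J := unzip1 cs => tU tU' JU ut H [Uy [W0 [yW0 [c0 [cW0 L0 nz0]]]]].
have onS L : {subset L <= UP} -> onJ loc L (kpt y) by move=> sub; exact: onJ_sub Uy.
have gd : good loc f cs (kpt y) by move: L0 => [psi [[phi [L _]] _]]; exists W0, phi; split=> //; exact: lands_kpt.
have [W [d [Wy WW0 cW [phi2 [L2 I2]]]]] := good_chart_at smloc (H y Uy gd) (lands_kpt yW0).
pose yW := kpt_lands Wy; have [aW _ _] := cW; have [aW0 _ _] := cW0.
pose c := rstr WW0 c0; have L : lead loc f ((t', m) :: (t, n) :: cs) c := lead_res WW0 L0.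
have nz : ~ znk loc yW (t' :: t :: J) c.
  by move=> z; apply: nz0; apply: (proj2 (@znk_res _ _ _ loc _ _ _ yW0 yW WW0 _ _ aW0)).
have [psi [[phi [L1 I1]] I3]] := L.
have /and3P[t't tcs ucs] := ut.
have t'J : t' \notin J by move: t't; rewrite inE negb_or => /andP[].
have tt' : t != t' by move: t't; rewrite inE negb_or eq_sym => /andP[].
have onJ1 : onJ loc J (kpt y) := onS _ JU.
have ont : onJ loc (t :: J) (kpt y) by apply: onS => s; rewrite inE => /orP[/eqP->|/JU].
have ont' : onJ loc (t' :: J) (kpt y) by apply: onS => s; rewrite inE => /orP[/eqP->|/JU].
have ontt' : onJ loc (t :: t' :: J) (kpt y) by apply: onS => s; rewrite !inE => /or3P[/eqP->|/eqP->|/JU].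
have ont't : onJ loc (t' :: t :: J) (kpt y) by apply: onS => s; rewrite !inE => /or3P[/eqP->|/eqP->|/JU].
pose h := hc (g W) t; pose h' := hc (g W) t'; pose xi := ringof yW.
have z1 : znk loc yW J (h ^+ n * psi - h' ^+ n' * d).
  have zu := lead_uniq yW cW ucs onJ1 L1 L2.
  rewrite (_ : _ - _ = (phi - phi2) - ((phi - h ^+ n * psi) - (phi2 - h' ^+ n' * d))); last by ring.
  by apply: znB => //; apply: znB; exact: zn_of.
(* Up to a factor nonzero at the point, psi itself is divisible by h'^n' on the stratum of J: since
   h remains a nonzero divisor where h' = 0, the factors h' are extracted one at a time. *)
have [j [e [xj Ij]]] : exists j e, xi j != 0 /\ IJ (g W) J (j * psi - h' ^+ n' * e).
  have sub : {subset J <= t' :: J} by move=> s; rewrite inE orbC => ->.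
  have : forall r d, znk loc yW J (h ^+ n * psi - h' ^+ r * d) ->
      exists j e, xi j != 0 /\ IJ (g W) J (j * psi - h' ^+ r * e); last by move/(_ n' d z1).
  elim=> [|r IH] d1 z.
    by exists 1, psi; rewrite rmorph1 oner_eq0 expr0 !mul1r subrr; split=> //; exact: ideal0.
  have [|j [e [xj Ij]]] := IH (h' * d1); first by rewrite mulrA -exprSr.
  have z2 : znk loc yW J (h ^+ n * e - j * h' * d1).
    apply: (@znk_cancel _ _ _ loc y W yW cW J t' r) => //.
    rewrite (_ : _ * _ = j * (h ^+ n * psi - h' ^+ r.+1 * d1) - h ^+ n * (j * psi - h' ^+ r * e)); last first.
      by rewrite exprSr -/h'; ring.
    by apply: znB; [exact: znM|exact/znM/zn_of].
  have [j2 [xj2 /IJ_cons[e2 Ie2]]] : znk loc yW (t' :: J) e.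
    apply: (@znk_cancel _ _ _ loc y W yW cW _ t n) => //.
      by rewrite inE negb_or tt'.
    rewrite (_ : _ * e = (h ^+ n * e - j * h' * d1) + h' * (j * d1)); last by rewrite -/h; ring.
    by apply: znD; [exact: zn_sub sub z2|apply/zn_of/idealMr/IJ_mem/mem_head].
  exists (j2 * j), e2; split; first by rewrite rmorphM mulf_neq0.
  rewrite (_ : _ - _ = j2 * (j * psi - h' ^+ r * e) + h' ^+ r * (j2 * e - h' * e2)); last by rewrite exprSr; ring.
  by apply: idealD; exact: idealM.
have subt : {subset J <= t :: J} by move=> s; rewrite inE orbC => ->.
rewrite leqNgt; apply/negP => mn; apply: nz.
have z3 : znk loc yW (t :: J) (j * c - h' ^+ (n' - m) * e).
  apply: (@znk_cancel _ _ _ loc y W yW cW _ t' m) => //.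
  have -> : hc (g W) t' ^+ m * (j * c - h' ^+ (n' - m) * e) =
    (j * psi - h' ^+ n' * e) - j * (psi - h' ^+ m * c).
    have -> : h' ^+ n' = h' ^+ m * h' ^+ (n' - m) by rewrite -exprD subnKC // ltnW.
    by rewrite -/h'; ring.
  by apply: znB; apply: zn_of; [exact: IJ_sub Ij|exact: idealM].
have [i [xi_ Ii]] : znk loc yW (t' :: t :: J) (j * c).
  rewrite -(subrK (h' ^+ (n' - m) * e) (j * c)); apply: znD.
    by apply: zn_sub z3 => s sJ; rewrite inE sJ orbT.
  rewrite -(prednK (n := (n' - m)%N)) ?subn_gt0 // exprS -mulrA.
  by apply/zn_of/idealMr/IJ_mem/mem_head.
by exists (i * j); rewrite -mulrA; split=> //; rewrite rmorphM mulf_neq0.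
Qed.

End Seeds.

(** * The third inequality of the cone *)

Section Arithmetic.
Variables (q : int) (q_gt0 : (0 < q)%R).
Variables U0 U1 U2 V01 V02 V10 V12 : int.
Hypotheses (c1 : ((1 + q + q ^+ 2) * V01 <= q ^+ 2 * U0 + V02)%R)
  (c2 : ((1 + q + q ^+ 2) * V02 <= q * U0 + q ^+ 2 * V01)%R)
  (c3 : ((1 + q + q ^+ 2) * V10 <= U1 + q * V12)%R)
  (c4 : ((1 + q + q ^+ 2) * V12 <= q * V10 + q ^+ 2 * U1)%R)
  (l1 : (U1 <= V01)%R) (l2 : (U2 <= V02)%R) (l0 : (U0 <= V10)%R).

(** Eliminating V02 from [c1], [c2] gives (1+q) V01 <= q U0, and eliminating V12 from [c3], [c4]
    gives (1+q) V10 <= U1. With U0 <= V10 and U1 <= V01 the loop closes as (1+q)^2 U0 <= q U0, so U0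
    <= 0, and the other bounds follow. *)
Lemma orders_le0 : (U0 <= 0 /\ U1 <= 0 /\ U2 <= 0)%R.
Proof.
have pos (x y : int) : (0 < x -> x * y <= 0 -> y <= 0)%R.
  by move=> x0; rewrite (Num.Theory.pmulr_rle0 y x0).
have s0 : (0 < 1 + q + q ^+ 2)%R by rewrite expr2; nia.
have k1 : (0 < (1 + q) * (1 + q ^+ 2))%R by rewrite expr2; nia.
have e1 : ((1 + q) * V01 - q * U0 <= 0)%R.
  by apply: (pos _ _ k1); have := Num.Theory.ler_wpM2l (ltac:(lia) : (0 <= 1 + q + q ^+ 2)%R) c1; lia.
have e2 : ((1 + q) * V02 - q * U0 <= 0)%R.
  apply: (pos _ _ s0).
  have := Num.Theory.ler_wpM2l (ltac:(lia) : (0 <= 1 + q)%R) c2.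
  by have := Num.Theory.ler_wpM2l (ltac:(nia) : (0 <= q ^+ 2)%R) e1; lia.
have e3 : ((1 + q) * V10 - U1 <= 0)%R.
  apply: (pos _ _ k1).
  have := Num.Theory.ler_wpM2l (ltac:(lia) : (0 <= 1 + q + q ^+ 2)%R) c3.
  by have := Num.Theory.ler_wpM2l (ltac:(lia) : (0 <= q)%R) c4; lia.
have e4 : ((1 + q + q ^+ 2) * U0 <= 0)%R.
  have := Num.Theory.ler_wpM2l (ltac:(lia) : (0 <= 1 + q)%R) l1.
  have := Num.Theory.ler_wpM2l (ltac:(lia) : (0 <= (1 + q) * (1 + q))%R) l0.
  by have := Num.Theory.ler_wpM2l (ltac:(lia) : (0 <= 1 + q)%R) e3; lia.
have u0 : (U0 <= 0)%R := pos _ _ s0 e4.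
have qu0 : (q * U0 <= 0)%R by have := Num.Theory.ler_wpM2l (ltac:(lia) : (0 <= q)%R) u0; rewrite mulr0.
have q1 : (0 < 1 + q)%R by lia.
have v1 : (V01 <= 0)%R by apply: (pos _ _ q1); lia.
have v2 : (V02 <= 0)%R by apply: (pos _ _ q1); lia.
by split=> //; split; lia.
Qed.

End Arithmetic.

Lemma length1_tperm (i : 'I_3) : has_length (simple_refl i) 1.
Proof.
split; first by exists [:: i]; rewrite /word big_seq1.
case=> [|//]; rewrite /word big_nil => E.
have := congr1 (fun s : 'S_4 => s (widen_ord (leqnSn 3) i)) E; rewrite perm1 tpermL.
by move/(congr1 val); rewrite /= /bump /=; lia.
Qed.

Section WeightCheck.
Variable q : nat.

Lemma rVD (A B : 'rV[int]_4) j : (A + B) 0%R j = A 0%R j + B 0%R j.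
Proof. by rewrite mxE. Qed.

Lemma rVN (A : 'rV[int]_4) j : (- A) 0%R j = - A 0%R j.
Proof. by rewrite mxE. Qed.

Lemma rV_mulz (A : 'rV[int]_4) z j : (A *~ z) 0%R j = A 0%R j * z.
Proof.
case: z => n; rewrite ?NegzE ?mulrNz ?mxE -?pmulrn mulmxnE -mulr_natr natz //.
by rewrite mulrN.
Qed.

Lemma weight_check (nu : 'rV[int]_4) (Q : nat) (E : int) (A : 'I_4 -> int) t :
  (forall j, nu 0%R j * Q%:Z - wt q t 0%R j * E + \sum_s wt q (s, s) 0%R j * A s = 0) ->
  nu *+ Q - wt q t *~ E + \sum_s wt q (s, s) *~ A s = 0.
Proof.
move=> H; apply/rowP => j.
have E1 : (nu *+ Q) 0%R j = nu 0%R j * Q%:Z by rewrite mulmxnE -mulr_natr natz.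
have E3 : (\sum_s wt q (s, s) *~ A s) 0%R j = \sum_s wt q (s, s) 0%R j * A s.
  by rewrite summxE; apply: eq_bigr => s _; exact: rV_mulz.
by rewrite rVD rVD rVN E1 rV_mulz E3 H mxE.
Qed.

Lemma wtE t j : wt q t 0%R j = (j == t.1)%:Z - (j == ord_pred t.2)%:Z * q%:Z.
Proof. by rewrite !mxE mulmxnE mxE !eqxx /= !natz -mulr_natr natz. Qed.

End WeightCheck.

Notation o0 := (@Ordinal 4 0 isT).
Notation o1 := (@Ordinal 4 1 isT).
Notation o2 := (@Ordinal 4 2 isT).
Notation o3 := (@Ordinal 4 3 isT).

Definition upper : seq ('I_4 * 'I_4) :=
  [:: (o0, o3); (o0, o2); (o1, o3); (o0, o1); (o1, o2); (o2, o3)].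

Lemma upperP (i j : 'I_4) : ((i, j) \in upper) = (i < j)%N.
Proof. by case: i j => [[|[|[|[|//]]]] ?] [[|[|[|[|//]]]] ?]. Qed.

Section Hasse.
Variables (k : closedFieldType) (q : nat) (q_gt0 : (0 < q)%N).
Variables (G : GLscheme k) (S : kscheme k) (zeta : zip_mor q G S) (FlagS : flag_space zeta).
Local Notation X := (ztot zeta).
Local Notation loc := (zloc zeta).
Local Notation act := (@zact _ _ _ _ zeta).
Hypothesis smloc : smooth loc.
Hypothesis cond_b : zeta_surj_on_components zeta.
Hypothesis cond_c : forall w : 'S_4, has_length w 1 -> pseudo_complete (closure (flag_stratum FlagS w)).
Variables (lam : 'rV[int]_4) (f : Gam X).
Hypothesis f_eq : forall T e (x : schhom T X), zipE' q e ->
  gpull (act e x) f = gl_char lam e.1 * gpull x f.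
Local Notation seed := (seed loc f upper).

Lemma pc_curve (a b : 'I_4) : b = a.+1 :> nat -> pseudo_complete (closure (flag_stratum FlagS (tperm a b))).
Proof.
move=> ab; have a3 : (a < 3)%N by have := ltn_ord b; rewrite ab.
have -> : tperm a b = simple_refl (Ordinal a3); last by apply/cond_c/length1_tperm.
by rewrite /simple_refl; congr tperm; apply: val_inj.
Qed.

(** The base point is taken above the permutation matrix of z^-1, for which the matrix h is the
    identity. *)
Lemma seed_base : f <> 0 -> exists y, seed [::] y.
Proof.
move=> f0; pose x0 : GL k := glM (gl1 k) (glV (gl_perm k zW)).
have [y [ny Hy]] := base_point q_gt0 smloc cond_b (det_GL x0) f0.
have Uy : onJ loc upper (kpt y).
  move=> t tU; apply: (Hy t) => //; last exact: mem_head.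
  rewrite -hmatE hmat_perm mxE; move: tU; case: t => i j; rewrite upperP => ij /=.
  by case: eqP => // E; move: ij; rewrite E ltnn.
exists y; split=> //; have [W [Wy _ cW]] := chart_exists smloc (x := kpt y) (O := topen X) I.
exists W, (kpt_lands Wy), (resT W f); split=> // z.
have [O [Oy HO]] := ny; apply: (HO _ Oy).
exact: (proj2 (vanish_k smloc f (kpt_lands Wy) cW) z).
Qed.

Lemma seed_curve (a b : 'I_4) cs n (E : int) (A : 'I_4 -> int) (Q : nat) : b = a.+1 :> nat ->
  closed_list ((a, b) :: unzip1 cs) -> uniq ((a, b) :: unzip1 cs) ->
  (forall i j : 'I_4, ((i, j) \in unzip1 cs) = ((i < j)%N && ((i, j) != (a, b)))) ->
  (lam - wtsum q cs) *+ Q - wt q (a, b) *~ E + \sum_s wt q (s, s) *~ A s = 0 -> A a = A b ->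
  (exists y, seed ((a, b, n) :: cs) y) ->
  (forall y, onJ loc upper (kpt y) -> good loc f cs (kpt y) -> good loc f ((a, b, n) :: cs) (kpt y)) ->
  (Q%:Z * n%:Z <= E)%R.
Proof.
move=> ab cl u JE weq Aab [y [Uy [W [yW [c [cW L nz]]]]]] mini.
have eqU : (a, b) :: unzip1 cs =i upper.
  move=> [i j]; rewrite upperP inE JE; case: eqVneq => [[-> ->]|_] /=; first by rewrite ab leqnn.
  by rewrite andbT.
have onE y' : onJ loc ((a, b) :: unzip1 cs) y' <-> onJ loc upper y'.
  by split=> H t tU; apply: H; rewrite ?eqU // -eqU.
apply: (@curve_bound k q q_gt0 G S zeta FlagS smloc lam f f_eq a b ab cs cl u JE (pc_curve ab)
  n Q E A Aab weq _ y W yW c cW) => //; last exact/onE.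
by move=> y' /onE Uy'; exact: mini.
Qed.

Local Notation t03 := (o0, o3).
Local Notation t02 := (o0, o2).
Local Notation t13 := (o1, o3).
Local Notation t01 := (o0, o1).
Local Notation t12 := (o1, o2).
Local Notation t23 := (o2, o3).

Local Ltac clist :=
  repeat (split; [|by move=> [[|[|[|[|//]]]] ?] [[|[|[|[|//]]]] ?]]); exact I.

(** Once the entries 03, 02 and 13 are divided out, the simple entries 01, 12, 23 remain. A curve
    bounds the order x along the last of them after the other two are divided out; by [seed_order],
    the order v after only one division is at most x, and the order u after none is at most v.
    Chains starting with 01 and with 12 are enough to close the system. *)
Lemma hasse : f <> 0 -> exists n1, (exists y, seed [:: (t03, n1)] y) /\
  (q%:Z ^+ 2 * (lam 0%R o0 - n1%:Z) + q%:Z * lam 0%R o1 + (lam 0%R o2 + q%:Z * n1%:Z)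
    <= (1 + q%:Z + q%:Z ^+ 2) * lam 0%R o3)%R.
Proof.
move=> /seed_base s0.
have next cs t : t \in upper -> {subset unzip1 cs <= upper} -> uniq (t :: unzip1 cs) ->
  (exists y, seed cs y) -> exists n, (exists y, seed ((t, n) :: cs) y) /\
    forall y, onJ loc upper (kpt y) -> good loc f cs (kpt y) -> good loc f ((t, n) :: cs) (kpt y).
  exact: (seed_next smloc).
have order cs t t' n m n' : t \in upper -> t' \in upper -> {subset unzip1 cs <= upper} ->
  uniq (t' :: t :: unzip1 cs) -> (exists y, seed ((t', m) :: (t, n) :: cs) y) ->
  (forall y, onJ loc upper (kpt y) -> good loc f cs (kpt y) -> good loc f ((t', n') :: cs) (kpt y)) ->
  (n' <= m)%N.
  by move=> a1 a2 a3 a4 [y sy] H; exact: (seed_order smloc a1 a2 a3 a4 H sy).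
have subU (l : seq ('I_4 * 'I_4)) : all (mem upper) l -> {subset l <= upper} by move=> /allP.
have [n1 [s1 _]] := next [::] t03 isT (subU [::] isT) isT s0.
have [n2 [s2 _]] := next [:: (t03, n1)] t02 isT (subU [:: t03] isT) isT s1.
have [n3 [s3 _]] := next [:: (t02, n2); (t03, n1)] t13 isT (subU [:: t02; t03] isT) isT s2.
pose cs3 := [:: (t13, n3); (t02, n2); (t03, n1)].
have sub3 := subU [:: t13; t02; t03] isT.
have [u0 [su0 mu0]] := next cs3 t01 isT sub3 isT s3.
have [u1 [su1 mu1]] := next cs3 t12 isT sub3 isT s3.
have [u2 [su2 mu2]] := next cs3 t23 isT sub3 isT s3.
have sub0 := subU [:: t01; t13; t02; t03] isT.
have sub1 := subU [:: t12; t13; t02; t03] isT.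
have [v01 [sv01 mv01]] := next ((t01, u0) :: cs3) t12 isT sub0 isT su0.
have [v02 [sv02 mv02]] := next ((t01, u0) :: cs3) t23 isT sub0 isT su0.
have [v10 [sv10 mv10]] := next ((t12, u1) :: cs3) t01 isT sub1 isT su1.
have [v12 [sv12 mv12]] := next ((t12, u1) :: cs3) t23 isT sub1 isT su1.
have [x2 [sx2 mx2]] := next ((t12, v01) :: (t01, u0) :: cs3) t23 isT (subU [:: t12; t01; t13; t02; t03] isT) isT sv01.
have [x1 [sx1 mx1]] := next ((t23, v02) :: (t01, u0) :: cs3) t12 isT (subU [:: t23; t01; t13; t02; t03] isT) isT sv02.
have [x2' [sx2' mx2']] := next ((t01, v10) :: (t12, u1) :: cs3) t23 isT (subU [:: t01; t12; t13; t02; t03] isT) isT sv10.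
have [x0 [sx0 mx0]] := next ((t23, v12) :: (t12, u1) :: cs3) t01 isT (subU [:: t23; t12; t13; t02; t03] isT) isT sv12.
have ol1 : (u1 <= v01)%N := order cs3 t01 t12 u0 v01 u1 isT isT sub3 isT sv01 mu1.
have ol2 : (u2 <= v02)%N := order cs3 t01 t23 u0 v02 u2 isT isT sub3 isT sv02 mu2.
have ol0 : (u0 <= v10)%N := order cs3 t12 t01 u1 v10 u0 isT isT sub3 isT sv10 mu0.
have ox2 : (v02 <= x2)%N := order ((t01, u0) :: cs3) t12 t23 v01 x2 v02 isT isT sub0 isT sx2 mv02.
have ox1 : (v01 <= x1)%N := order ((t01, u0) :: cs3) t23 t12 v02 x1 v01 isT isT sub0 isT sx1 mv01.
have ox2' : (v12 <= x2')%N := order ((t12, u1) :: cs3) t01 t23 v10 x2' v12 isT isT sub1 isT sx2' mv12.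
have ox0 : (v10 <= x0)%N := order ((t12, u1) :: cs3) t23 t01 v12 x0 v10 isT isT sub1 isT sx0 mv10.
exists n1; split=> //.
(* The torus weights on a curve are e_i - q e_w(i) for a permutation w with a 3-cycle and a fixed
   point, so q^3 - 1 clears the denominators of the weight relation. *)
pose Q := (q ^ 3 - 1)%N; set qz := q%:Z.
have QE : Q%:Z = qz ^+ 3 - 1.
  by rewrite /Q -subzn ?expn_gt0 ?q_gt0 // -[(q ^ 3)%N]/(q * (q * q))%N !PoszM exprS expr2.
(* The exponents solve weight - E * wt t + sum_s A_s * wt (s, s) = 0, with equal
   values of [A] at the two indices of [t]. *)
have E8 (cs : seq (('I_4 * 'I_4) * nat)) (nu := lam - wtsum q cs) (a0 := nu 0%R o0) (a1 := nu 0%R o1)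
    (a2 := nu 0%R o2) (a3 := nu 0%R o3) :
  (nu *+ Q - wt q t01 *~ (- (1 + qz + qz ^+ 2) * a0 + a1 + qz * a2 + qz ^+ 2 * a3) +
    \sum_s wt q (s, s) *~ nth 0 [:: a1 + qz * a2 + qz ^+ 2 * a3; a1 + qz * a2 + qz ^+ 2 * a3;
      a2 + qz * a3 + qz ^+ 2 * a1; a3 + qz * a1 + qz ^+ 2 * a2] s = 0) /\
  (nu *+ Q - wt q t12 *~ (qz ^+ 2 * a0 - (1 + qz + qz ^+ 2) * a1 + a2 + qz * a3) +
    \sum_s wt q (s, s) *~ nth 0 [:: a0 + qz * a2 + qz ^+ 2 * a3; a2 + qz * a3 + qz ^+ 2 * a0;
      a2 + qz * a3 + qz ^+ 2 * a0; a3 + qz * a0 + qz ^+ 2 * a2] s = 0) /\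
  (nu *+ Q - wt q t23 *~ (qz * a0 + qz ^+ 2 * a1 - (1 + qz + qz ^+ 2) * a2 + a3) +
    \sum_s wt q (s, s) *~ nth 0 [:: a0 + qz * a1 + qz ^+ 2 * a3; a1 + qz * a3 + qz ^+ 2 * a0;
      a3 + qz * a0 + qz ^+ 2 * a1; a3 + qz * a0 + qz ^+ 2 * a1] s = 0).
  have nuE (P : 'I_4 -> Prop) : P o0 -> P o1 -> P o2 -> P o3 -> forall j, P j.
    move=> P0 P1 P2 P3 [[|[|[|[|//]]]] p]; [move: P0|move: P1|move: P2|move: P3];
    by congr P; apply: val_inj.
  split; [|split]; apply: weight_check; apply: nuE; rewrite QE !big_ord_recl big_ord0 !wtE /=;
    rewrite -/a0 -/a1 -/a2 -/a3 -/qz; ring.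
have nuC t n cs j : (lam - wtsum q ((t, n) :: cs)) 0%R j = (lam - wtsum q cs) 0%R j - wt q t 0%R j * n%:Z.
  have -> : lam - wtsum q ((t, n) :: cs) = (lam - wtsum q cs) + - (wt q t *+ n) by rewrite /= opprD addrA.
  rewrite rVD; congr (_ + _); rewrite rVN; congr (- _).
  by rewrite mulmxnE -mulr_natr natz.
have [m mE] : exists m : 'I_4 -> int, forall j, (lam - wtsum q cs3) 0%R j = m j by exists (fun j => (lam - wtsum q cs3) 0%R j).
have nuC2 t n t' n' j : (lam - wtsum q ((t, n) :: (t', n') :: cs3)) 0%R j =
    m j - wt q t' 0%R j * n'%:Z - wt q t 0%R j * n%:Z by rewrite 2!nuC mE.
have muE j : m j = lam 0%R j - wt q t03 0%R j * n1%:Z - wt q t02 0%R j * n2%:Z - wt q t13 0%R j * n3%:Z.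
  by rewrite -mE /cs3 !nuC -[wtsum q [::]]/(0 : 'rV[int]_4) subr0.
have w1 := (E8 ((t23, v02) :: (t01, u0) :: cs3)).2.1.
have w2 := (E8 ((t12, v01) :: (t01, u0) :: cs3)).2.2.
have w0 := (E8 ((t23, v12) :: (t12, u1) :: cs3)).1.
have w2' := (E8 ((t01, v10) :: (t12, u1) :: cs3)).2.2.
have cl1 : closed_list [:: t12; t23; t01; t13; t02; t03].
  by clist.
have cl2 : closed_list [:: t23; t12; t01; t13; t02; t03].
  by clist.
have cl0 : closed_list [:: t01; t23; t12; t13; t02; t03].
  by clist.
have cl2' : closed_list [:: t23; t01; t12; t13; t02; t03].
  by clist.
have J1 (i j : 'I_4) : ((i, j) \in [:: t23; t01; t13; t02; t03]) = ((i < j)%N && ((i, j) != t12)).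
  by case: i j => [[|[|[|[|//]]]] ?] [[|[|[|[|//]]]] ?].
have J2 (i j : 'I_4) : ((i, j) \in [:: t12; t01; t13; t02; t03]) = ((i < j)%N && ((i, j) != t23)).
  by case: i j => [[|[|[|[|//]]]] ?] [[|[|[|[|//]]]] ?].
have J0 (i j : 'I_4) : ((i, j) \in [:: t23; t12; t13; t02; t03]) = ((i < j)%N && ((i, j) != t01)).
  by case: i j => [[|[|[|[|//]]]] ?] [[|[|[|[|//]]]] ?].
have J2' (i j : 'I_4) : ((i, j) \in [:: t01; t12; t13; t02; t03]) = ((i < j)%N && ((i, j) != t23)).
  by case: i j => [[|[|[|[|//]]]] ?] [[|[|[|[|//]]]] ?].
have b1 := @seed_curve o1 o2 ((t23, v02) :: (t01, u0) :: cs3) x1 _ _ Q erefl cl1 isT J1 w1 erefl sx1 mx1.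
have b2 := @seed_curve o2 o3 ((t12, v01) :: (t01, u0) :: cs3) x2 _ _ Q erefl cl2 isT J2 w2 erefl sx2 mx2.
have b0 := @seed_curve o0 o1 ((t23, v12) :: (t12, u1) :: cs3) x0 _ _ Q erefl cl0 isT J0 w0 erefl sx0 mx0.
have b2' := @seed_curve o2 o3 ((t01, v10) :: (t12, u1) :: cs3) x2' _ _ Q erefl cl2' isT J2' w2' erefl sx2' mx2'.
rewrite QE !nuC2 in b0 b1 b2 b2'; clear nuC nuC2 mE E8 order next.
have e0 := muE o0; have e1 := muE o1; have e2 := muE o2; have e3 := muE o3; clear muE.
rewrite !wtE /= -/qz in b0 b1 b2 b2' e0 e1 e2 e3.
move: (m o0) (m o1) (m o2) (m o3) b0 b1 b2 b2' e0 e1 e2 e3 => m0 m1 m2 m3 b0 b1 b2 b2' e0 e1 e2 e3.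
have qz1 : (0 <= qz - 1)%R by rewrite /qz; lia.
have sq : (0 <= (1 + qz + qz ^+ 2) * (qz - 1))%R.
  by rewrite Num.Theory.mulr_ge0 // expr2; nia.
have lift (i j : nat) : (i <= j)%N -> ((1 + qz + qz ^+ 2) * (qz - 1) * i%:Z <= (1 + qz + qz ^+ 2) * (qz - 1) * j%:Z)%R.
  by move=> ij; apply: Num.Theory.ler_wpM2l => //; lia.
have lift1 (i j : nat) : (i <= j)%N -> ((qz - 1) * i%:Z <= (qz - 1) * j%:Z)%R.
  by move=> ij; apply: Num.Theory.ler_wpM2l => //; lia.
have := lift _ _ ox0; have := lift _ _ ox1; have := lift _ _ ox2; have := lift _ _ ox2'.
have := lift1 _ _ ol0; have := lift1 _ _ ol1; have := lift1 _ _ ol2.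
have := lift1 _ _ (leq0n u0); have := lift1 _ _ (leq0n u1); have := lift1 _ _ (leq0n u2).
move=> g2 g1 g0 k2 k1 k0 h2' h2 h1 h0.
(* The weight of the entry (i, i+1) is (1 - q) e_i, so (q - 1) u + m_i is the i-th coordinate of the
   weight after division by the u-th power of this entry. All coordinates are compared with m_3,
   which these divisions do not change. *)
have [|||||||//|i0 [i1 i2]] := @orders_le0 qz _ ((qz - 1) * u0%:Z + m0 - m3) ((qz - 1) * u1%:Z + m1 - m3)
  ((qz - 1) * u2%:Z + m2 - m3) ((qz - 1) * v01%:Z + m1 - m3) ((qz - 1) * v02%:Z + m2 - m3)
  ((qz - 1) * v10%:Z + m0 - m3) ((qz - 1) * v12%:Z + m2 - m3); try lia.
have drop (u : nat) (x y : int) : ((qz - 1) * u%:Z + x - y <= 0 -> x - y <= 0)%R.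
  have := Num.Theory.mulr_ge0 qz1 (isT : (0 <= u%:Z)%R); clear; lia.
have f0 := drop _ _ _ i0; have f1 := drop _ _ _ i1; have f2 := drop _ _ _ i2.
move: e0 e1 e2 e3 f0 f1 f2; clear => e0 e1 e2 e3 f0 f1 f2.
(* With the coefficients q^2, q and 1, the orders n2 and n3 along the entries 02 and 13 cancel. *)
have := Num.Theory.ler_wpM2l (ltac:(rewrite expr2; nia) : (0 <= qz ^+ 2)%R) f0.
have := Num.Theory.ler_wpM2l (ltac:(lia) : (0 <= qz)%R) f1.
lia.
Qed.

End Hasse.

(** * Sections over S as equivariant functions on the torsor *)

Lemma schid_exists (k : fieldType) (X : kscheme k) : exists i : schhom X X,
  [/\ forall T (x : schhom T X), schcomp i x = x, forall Y (y : schhom X Y), schcomp y i = y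
    & forall s, gpull i s = s].
Proof.
have ic : continuous (id : X -> X) by move=> x; exact: cvg_id.
have H1 (V V' U U' : opens X) (UV : U `<=` id @^-1` V) (U'V' : U' `<=` id @^-1` V')
    (VV : V' `<=` V) (UU : U' `<=` U) (s : sect V) : rstr UU (rstr UV s) = rstr U'V' (rstr VV s).
  have U'V : U' `<=` V by move=> x /U'V'/VV.
  by rewrite (res_res _ _ U'V) (res_res _ _ U'V).
have H2 (V U : opens X) (UV : U `<=` id @^-1` V) (c : k) : rstr UV (kcst V c) = kcst U c.
  exact: res_cst.
have H3 (V U : opens X) (UV : U `<=` id @^-1` V) (s : sect V) x : unit_at (rstr UV s) x -> unit_at s x.
  by move=> u; have Ux := unit_in u; move: u; rewrite unit_res.
exists (@Defs.Hom k X X id ic (fun V U UV => rstr UV) H1 H2 H3); split=> [T x|Y y|s]; last exact: res_id.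
- apply: schhom_ext => // V U UV UV' s.
  have E := @pull_res k T X x V (Defs.preim ic V) U U UV' UV (fun _ h => h) (fun _ h => h) s.
  exact: etrans (esym E) (res_id _ _).
- apply: schhom_ext => // V U UV UV' s; rewrite /= /comp_pull /=.
  have E := @pull_res k X Y y V V (Defs.preim (@hcont _ _ _ y) V) U (fun _ h => h) UV' (fun _ h => h) UV s.
  by rewrite E res_id.
Qed.

Lemma in_PminusE (R : comPzRingType) (x : GL R) : in_Pminus x <-> forall i : 'I_4, (i < 3)%N -> x i o3 = 0.
Proof.
split=> H i; first by move=> i3; apply: H; rewrite /mu i3.
move=> j; rewrite /mu; case: (ltnP j 3) => [|j3]; case: (ltnP i 3) => // i3 _.
by rewrite -(H i i3); congr (glm x i _); apply: val_inj => /=; have := ltn_ord j; lia.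
Qed.

Lemma in_PminusV (R : comPzRingType) (x : GL R) : in_Pminus x -> in_Pminus (glV x).
Proof.
move=> /in_PminusE Px; apply/in_PminusE.
have E (i : 'I_4) : (gli x *m glm x) i o3 = gli x i o3 * x o3 o3.
  by rewrite mxE (bigD1 o3) //= big1 ?addr0 // => m m3; rewrite Px ?mulr0 //; have := ltn_ord m; move: m3; rewrite -val_eqE /=; lia.
rewrite gliK in E; have u : 1 = gli x o3 o3 * x o3 o3 by rewrite -E mxE.
move=> i i3; have := E i; rewrite mxE -val_eqE /= (ltn_eqF i3) => E0.
by rewrite -[LHS]mulr1 u mulrCA -E0 mulr0.
Qed.

Lemma in_PminusM (R : comPzRingType) (x y : GL R) : in_Pminus x -> in_Pminus y -> in_Pminus (glM x y).
Proof.
move=> Px Py i j ij; rewrite mxE big1 // => m _.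
have [mi|] := ltnP (mu m) (mu i); first by rewrite Px ?mul0r.
by move=> im; rewrite Py ?mulr0 //; exact: leq_trans ij im.
Qed.

Lemma levi_mul (R : comPzRingType) (x y : GL R) : in_Pminus x -> in_Pminus y ->
  levi (x *m y) = levi x *m levi y.
Proof.
move=> Px Py; apply/matrixP => i j; rewrite !mxE.
case: ifPn => [/eqP ij|ij]; last first.
  rewrite big1 // => m _; rewrite !mxE; case: eqP => [<-|]; rewrite ?mul0r //.
  by rewrite (negPf ij) mulr0.
apply: eq_bigr => m _; rewrite !mxE -ij [mu m == _]eq_sym.
case: eqVneq => // im; have [mi|] := ltnP (mu m) (mu i); first by rewrite Px ?mul0r.
by rewrite leq_eqVlt (negPf im) /= => im'; rewrite [y m j]Py ?mulr0 ?mul0r // -ij.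
Qed.

Lemma levi1 (R : comPzRingType) : levi (1%:M : 'M[R]_4) = 1%:M.
Proof. by apply/matrixP => i j; rewrite !mxE; case: (eqVneq i j) => [->|_]; rewrite ?eqxx //; case: ifP. Qed.

Section Parabolic.
Variables (p n : nat) (k : fieldType).
Hypothesis pchar_k : p \in [pchar k].
Local Notation q := (p ^ n)%N.

Lemma frobD (D : comPzRingType) (kap : {rmorphism k -> D}) (x y : D) : (x + y) ^+ q = x ^+ q + y ^+ q.
Proof.
move: kap x y; elim/pz_ind: D => [D D0|D] kap x y.
  by rewrite -[LHS]mul1r -[RHS]mul1r D0 !mul0r.
apply: exprDn_pchar; have pD := rmorph_pchar kap pchar_k.
by rewrite pnatX (eq_pnat _ (pcharf_eq pD)) pnat_id ?orbT // (pcharf_prime pD).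
Qed.

Lemma frobM (m : nat) (D : comPzRingType) (kap : {rmorphism k -> D}) (x y : 'M[D]_m) :
  map_mx (fun a : D => a ^+ q) (x *m y) = map_mx (fun a : D => a ^+ q) x *m map_mx (fun a : D => a ^+ q) y.
Proof.
have p_gt0 : (0 < p)%N by apply: prime_gt0; exact: pcharf_prime pchar_k.
apply/matrixP => i j; rewrite !mxE.
rewrite (big_morph (fun a : D => a ^+ q) (frobD kap) (_ : 0 ^+ q = 0)); last first.
  by rewrite expr0n expn_eq0 eqn0Ngt p_gt0.
by apply: eq_bigr => l _; rewrite !mxE exprMn.
Qed.

(** The Frobenius of the Levi component is multiplicative on P, which gives a section of the
    projection from the zip group to P. *)
Lemma zip_section (D : comPzRingType) (kap : {rmorphism k -> D}) (r : GL D) : in_Pminus r ->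
  exists e, [/\ zipE q e, e.1 = r & glm e.2 = map_mx (fun a : D => a ^+ q) (levi r)].
Proof.
move=> Pr; have Pr' := @in_PminusV _ _ Pr.
have p_gt0 : (0 < p)%N by apply: prime_gt0; exact: pcharf_prime pchar_k.
have one : map_mx (fun a : D => a ^+ q) (1%:M : 'M[D]_4) = 1%:M.
  apply/matrixP => i j; rewrite !mxE; case: eqVneq => _; first exact: expr1n.
  by rewrite expr0n expn_eq0 eqn0Ngt p_gt0.
have K1 : map_mx (fun a : D => a ^+ q) (levi r) *m map_mx (fun a : D => a ^+ q) (levi (gli r)) = 1%:M.
  by rewrite -(frobM kap) -(levi_mul Pr Pr') glmK levi1.
have K2 : map_mx (fun a : D => a ^+ q) (levi (gli r)) *m map_mx (fun a : D => a ^+ q) (levi r) = 1%:M.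
  by rewrite -(frobM kap) -(levi_mul Pr' Pr) gliK levi1.
exists (r, MkGL K1 K2); split=> //; split=> //= [i j ij|].
  by rewrite !mxE ltn_eqF // expr0n expn_eq0 eqn0Ngt p_gt0.
apply/matrixP => i j; rewrite !mxE; case: eqVneq => // _.
by rewrite expr0n expn_eq0 eqn0Ngt p_gt0.
Qed.

End Parabolic.

Lemma in_B_Pminus (R : comPzRingType) (b : GL R) : in_B b -> in_Pminus b.
Proof. by move=> /is_trig_mxP tb; apply/in_PminusE => i i3; exact: (tb i o3 i3). Qed.

Lemma in_BV (R : comPzRingType) (b : GL R) : in_B b -> in_B (glV b).
Proof. by move=> Bb; have [] := trig_inv (glmK b) Bb. Qed.

Lemma zpwN (R : comPzRingType) (x y : R) m : zpw y x (- m) = zpw x y m.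
Proof. by case: m => [[|m]|m]. Qed.

Lemma gl_charV (R : comPzRingType) lam (b : GL R) : gl_char (- lam) (glV b) = gl_char lam b.
Proof. by rewrite !gl_charE; apply: eq_bigr => i _; rewrite mxE zpwN. Qed.

Section Sections.
Variables (k : closedFieldType) (p n : nat).
Hypothesis pchar_k : p \in [pchar k].
Local Notation q := (p ^ n)%N.
Variables (G : GLscheme k) (S : kscheme k) (zeta : zip_mor q G S) (lam : 'rV[int]_4).
Local Notation X := (ztot zeta).
Local Notation act := (@zact _ _ _ _ zeta).

(** A section over S as one family on pairs of a point of X and a point of P over the same base:
    naturality lets the point of X be pulled back to the scheme on which r is defined. *)
Record equi_section := EquiSection {
  esf :> forall T, schhom T X -> GL (Gam T) -> Gam T;
  es_nat : forall T T' (u : schhom T' T) x r, in_Pminus r ->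
    esf (schcomp x u) (glmap (gpull u) r) = gpull u (esf x r);
  es_B : forall T (x : schhom T X) r b, in_Pminus r -> in_B b ->
    esf x (glM r b) = gl_char (- lam) b * esf x r;
  es_act : forall T e (x : schhom T X) r, zipE q e -> in_Pminus r ->
    esf (act e x) r = esf x (glM (glV e.1) r);
  es_nz : exists T (x : schhom T X) r, in_Pminus r /\ esf x r <> 0
}.

Lemma C_S_section : C_S zeta lam -> exists F : equi_section, True.
Proof.
move=> [s [sVI snat sact [T [x [T1 [v [r [Pr nz]]]]]]]].
have [i [i1 _ _]] := schid_exists X.
have E T' (y : schhom T' X) T2 (w : schhom T2 T') r' : in_Pminus r' -> s T' y T2 w r' = s X i T2 (schcomp y w) r'.
  by move=> Pr'; rewrite -(snat _ _ y) // i1.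
have H1 T0 T' (u : schhom T' T0) (y : schhom T0 X) r' : in_Pminus r' ->
  s X i T' (schcomp y u) (glmap (gpull u) r') = gpull u (s X i T0 y r') by exact: (sVI X i).1.
have H2 T0 (y : schhom T0 X) r' b : in_Pminus r' -> in_B b ->
  s X i T0 y (glM r' b) = gl_char (- lam) b * s X i T0 y r' by exact: (sVI X i).2.
have H3 T0 e (y : schhom T0 X) r' : zipE q e -> in_Pminus r' ->
  s X i T0 (act e y) r' = s X i T0 y (glM (glV e.1) r').
  move=> Ee Pr'; have [j [_ j2 j3]] := schid_exists T0.
  have P2 : in_Pminus (glM (glV e.1) r') by case: Ee => Pe _ _; exact: (@in_PminusM _ _ _ (@in_PminusV _ _ Pe) Pr').
  have := sact T0 e y T0 j r' Ee Pr'; rewrite /VI_act.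
  have -> : glmap (gpull j) e.1 = e.1 by apply: gl_eq; apply/matrixP => a b; rewrite mxE j3.
  by rewrite (E _ (act e y) _ j) // (E _ y _ j) // !j2.
have nz' : s X i T1 (schcomp x v) r <> 0 by rewrite -E.
exists (@EquiSection (s X i) H1 H2 H3 (ex_intro _ T1 (ex_intro _ (schcomp x v) (ex_intro _ r (conj Pr nz'))))) => //.
Qed.

Variable F : equi_section.

(** f is the value of the section at the identity of P. Equivariance identifies the value at any r
    with a value of f at a translate under E, so f is nonzero; for r in B it gives the character
    lam. *)
Lemma section_function : exists f : Gam X, [/\ f <> 0,
  forall T e (x : schhom T X), zipE q e -> gpull (act e x) f = esf F x (glV e.1)
  & forall T e (x : schhom T X), zipE' q e -> gpull (act e x) f = gl_char lam e.1 * gpull x f].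
Proof.
have [i [i1 _ _]] := schid_exists X.
have P1 R : in_Pminus (gl1 R) by apply: in_B_Pminus; exact: scalar_mx_is_trig.
have E T (x : schhom T X) : gpull x (esf F i (gl1 _)) = esf F x (gl1 _).
  rewrite -es_nat // i1; congr (esf F _ _); apply: gl_eq; exact: map_mx1.
have M1 R (x : GL R) : glM x (gl1 R) = x by apply: gl_eq; exact: mulmx1.
have M2 R (x : GL R) : glM (gl1 R) x = x by apply: gl_eq; exact: mul1mx.
have EV T e (x : schhom T X) : zipE q e -> gpull (act e x) (esf F i (gl1 _)) = esf F x (glV e.1).
  by move=> Ee; rewrite E es_act // M1.
exists (esf F i (gl1 _)); split=> // [f0|T e x [Ee Bb]]; last first.
  by rewrite EV // -(M2 _ (glV e.1)) es_B ?gl_charV ?E //; exact: in_BV.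
have [T [x [r [Pr []]]]] := es_nz F.
have [e [Ee e1 _]] := zip_section n pchar_k (kcst (topen T)) (@in_PminusV _ _ Pr).
have -> : r = glV e.1 by rewrite e1; case: (r).
by rewrite -EV // f0 rmorph0.
Qed.

End Sections.

(** * The first two inequalities of the cone *)

Section Laurent.
Variable k : fieldType.
Local Notation L := {fraction {poly k}}.
Local Notation iota := (@tofrac {poly k}).
Variable h : {rmorphism {poly k} -> L}.
Hypotheses (hX : h 'X = (iota 'X)^-1) (hC : forall c, h c%:P = iota c%:P).

(** The right-hand side X^m Q(1/X) has exponents at most m, while the left-hand side has a nonzero
    term of exponent at least n. *)
Lemma laurent_bound (P Q : {poly k}) (n : nat) (m : int) : P != 0 ->
  iota (P * 'X^n) = zpw (iota 'X) (iota 'X)^-1 m * h Q -> (n%:Z <= m)%R.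
Proof.
set u := iota 'X => P0 E.
have u0 : u != 0 by rewrite tofrac_eq0 polyX_eq0.
have uv : u * u^-1 = 1 by rewrite divff.
case: (Num.Theory.lerP n%:Z m) => // mn.
have [d Ed] : exists d : nat, n%:Z = m + d.+1%:Z.
  by exists (absz (n%:Z - m - 1)%R); lia.
have E1 : iota (P * 'X^(d.+1)) = h Q.
  have z : zpw u u^-1 m * zpw u u^-1 (- m) = 1 by rewrite -zpwD // subrr.
  have Eu : u ^+ n = zpw u u^-1 m * u ^+ d.+1 by rewrite -[u ^+ n]/(zpw u u^-1 n%:Z) Ed zpwD.
  move: E; rewrite !rmorphM !rmorphXn -/u Eu => E.
  by rewrite -[RHS]mul1r -z mulrAC -E -[LHS]mul1r -z; ring.
pose e := size Q.
have E2 : u ^+ e * h Q = iota (\sum_(i < e) (Q`_i)%:P * 'X^(e - i)).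
  rewrite -{1}[Q]coefK poly_def rmorph_sum rmorph_sum mulr_sumr; apply: eq_bigr => i _.
  rewrite -mul_polyC !rmorphM hC !rmorphXn hX mulrCA; congr (_ * _).
  have -> : u ^+ e = u ^+ (e - i) * u ^+ i by rewrite -exprD subnK // ltnW.
  by rewrite -mulrA -exprMn uv expr1n mulr1.
have E3 : P * 'X^(d.+1) * 'X^e = \sum_(i < e) (Q`_i)%:P * 'X^(e - i).
  by apply/eqP; rewrite -tofrac_eq; apply/eqP; rewrite -E2 -E1 rmorphM rmorphXn mulrC.
have := congr1 (fun A : {poly k} => size A) E3; rewrite !size_mulXn ?mulf_neq0 ?expf_neq0 ?polyX_eq0 //.
have : (size (\sum_(i < e) (Q`_i)%:P * 'X^(e - i))%R <= e.+1)%N.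
  apply: leq_trans (size_sum _ _ _) _; apply/bigmax_leqP => i _.
  rewrite mul_polyC; apply: leq_trans (size_scale_leq _ _) _.
  by rewrite size_polyXn ltnS leq_subr.
by move: P0; rewrite -size_poly_gt0; lia.
Qed.

End Laurent.

Section Blocks.
Variables (a b : 'I_4) (nab : a != b).

Section OverRing.
Variable R : comPzRingType.
Implicit Types (w x y z : R).

Definition blk w x y z : 'M[R]_4 := \matrix_(i, j)
  if i == a then (if j == a then w else if j == b then x else 0)
  else if i == b then (if j == a then y else if j == b then z else 0) else (i == j)%:R.

Lemma blk_mul w x y z w' x' y' z' : blk w x y z *m blk w' x' y' z' =
  blk (w * w' + x * y') (w * x' + x * z') (y * w' + z * y') (y * x' + z * z').
Proof.
have nba : (b == a) = false by rewrite eq_sym (negPf nab).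
apply/matrixP => i j; rewrite mxE (bigD1 a) //= (bigD1 b) /=; last by rewrite eq_sym.
have [ia|ia] := eqVneq i a.
  rewrite big1 => [|m /andP[/negPf ma /negPf mb]]; last by rewrite !mxE ia eqxx ma mb mul0r.
  rewrite !mxE ia !eqxx nba addr0; case: eqVneq => // _; case: eqVneq => // _.
  by rewrite !mulr0 addr0.
have [ib|ib] := eqVneq i b.
  rewrite big1 => [|m /andP[/negPf ma /negPf mb]]; last by rewrite !mxE ib nba eqxx ma mb mul0r.
  rewrite !mxE ib !eqxx nba addr0; case: eqVneq => // _; case: eqVneq => // _.
  by rewrite !mulr0 addr0.
rewrite (bigD1 i) ?ia //= big1 => [|m /andP[_ /negPf mi]].
  by rewrite !mxE (negPf ia) (negPf ib) !eqxx !mul0r !add0r addr0 mul1r.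
by rewrite !mxE (negPf ia) (negPf ib) eq_sym mi mul0r.
Qed.

Lemma blk1 : blk 1 0 0 1 = 1%:M.
Proof.
apply/matrixP => i j; rewrite !mxE; have nba : (b == a) = false by rewrite eq_sym (negPf nab).
case: (eqVneq i a) => [->|_]; first by case: (eqVneq j a) => _; [|case: ifP].
case: (eqVneq i b) => [->|_] //; case: (eqVneq j a) => [->|_]; first by rewrite nba.
by rewrite [b == j]eq_sym; case: (j == b).
Qed.

Lemma blkK w x y z : w * z - x * y = 1 -> blk w x y z *m blk z (- x) (- y) w = 1%:M.
Proof.
by move=> H; rewrite blk_mul -blk1; congr blk; rewrite -?H; ring.
Qed.

Lemma blkVK w x y z : w * z - x * y = 1 -> blk z (- x) (- y) w *m blk w x y z = 1%:M.
Proof.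
by move=> H; rewrite blk_mul -blk1; congr blk; rewrite -?H; ring.
Qed.

Definition gblk w x y z (H : w * z - x * y = 1) : GL R := MkGL (blkK H) (blkVK H).

Lemma blk_mu w x y z i j : (a < 3)%N -> (b < 3)%N -> mu i != mu j -> blk w x y z i j = 0.
Proof.
move=> a3 b3; rewrite mxE /mu; case: (eqVneq i a) => [->|_].
  case: (eqVneq j a) => [->|_]; first by rewrite eqxx.
  by case: (eqVneq j b) => [->|//]; rewrite a3 b3.
case: (eqVneq i b) => [->|_]; last by case: (eqVneq i j) => [->|//]; rewrite eqxx.
case: (eqVneq j a) => [->|_]; first by rewrite a3 b3.
by case: (eqVneq j b) => [->|//]; rewrite eqxx.
Qed.

Lemma trv_det x : 1 * 1 - x * 0 = 1 :> R. Proof. by rewrite mulr0 subr0 mul1r. Qed.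

Definition trv x : GL R := gblk (trv_det x).

Lemma trv_zipE (q : nat) x : (0 < q)%N -> (a < 3)%N -> (b < 3)%N -> zipE q (trv x, trv (x ^+ q)).
Proof.
move=> q0 a3 b3; split=> [i j ij|i j ij|]; try by apply: blk_mu => //=; move: ij; lia.
apply/matrixP => i j; rewrite mxE [levi _ i j]mxE [RHS]mxE; case: ifP => _; last by rewrite expr0n gtn_eqF.
rewrite !mxE; do ?case: ifP => _; rewrite ?expr1n ?expr0n ?gtn_eqF //.
by case: (i == j); rewrite ?expr1n ?expr0n ?gtn_eqF.
Qed.

(** The inverse of a unipotent matrix is split into a factor depending only on v = 1/u and, for a <
    b, an element of B with diagonal entries v and u, which produces the character. *)
Lemma blk_trv (u v : R) : u * v = 1 -> blk 1 (- u) (- 0) 1 = blk 0 (- 1) 1 v *m blk v 0 (- 1) u.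
Proof. by move=> uv; rewrite blk_mul; f_equal; try ring; rewrite -uv; ring. Qed.

End OverRing.

Lemma trv_map (R R' : comPzRingType) (f : {rmorphism R -> R'}) x : glmap f (trv x) = trv (f x).
Proof.
apply: gl_eq; apply/matrixP => i j; rewrite !mxE.
by do ?case: ifP => _; rewrite ?rmorph0 ?rmorph1 ?rmorph_nat.
Qed.

End Blocks.

Lemma trv_hc01 (R : comPzRingType) q (x : R) (g : GL R) (nab : o0 != o1) :
  hc (zip_act (trv nab x, trv nab (x ^+ q)) g) (o0, o3) = hc g (o0, o3) + x ^+ 1 * hc g (o1, o3).
Proof.
have E : ord_pred o3 = o2 by apply: val_inj.
rewrite /hc /= E !mxE !big_ord_recl big_ord0 !mxE !big_ord_recl !big_ord0 !mxE /=.
rewrite (_ : lift ord0 ord0 = o1 :> 'I_4); last exact: val_inj.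
rewrite (_ : lift ord0 (lift ord0 ord0) = o2 :> 'I_4); last exact: val_inj.
rewrite (_ : ord0 = o0 :> 'I_4); last exact: val_inj.
by ring.
Qed.

Lemma trv_hc12 (R : comPzRingType) q (x : R) (g : GL R) (nab : o1 != o2) :
  hc (zip_act (trv nab x, trv nab (x ^+ q)) g) (o0, o3) = hc g (o0, o3) + x ^+ q * - hc g (o0, o2).
Proof.
have E : ord_pred o3 = o2 by apply: val_inj.
have E' : ord_pred o2 = o1 by apply: val_inj.
rewrite /hc /= E E' !mxE !big_ord_recl big_ord0 !mxE !big_ord_recl !big_ord0 !mxE /=.
rewrite (_ : lift ord0 ord0 = o1 :> 'I_4); last exact: val_inj.
rewrite (_ : lift ord0 (lift ord0 ord0) = o2 :> 'I_4); last exact: val_inj.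
rewrite (_ : ord0 = o0 :> 'I_4); last exact: val_inj.
by ring.
Qed.

Section Dominance.
Variables (k : closedFieldType) (p n : nat).
Hypothesis pchar_k : p \in [pchar k].
Local Notation q := (p ^ n)%N.
Variables (G : GLscheme k) (S : kscheme k) (zeta : zip_mor q G S) (lam : 'rV[int]_4).
Local Notation X := (ztot zeta).
Local Notation loc := (zloc zeta).
Local Notation act := (@zact _ _ _ _ zeta).
Local Notation g := (gmx loc).
Variable F : equi_section zeta lam.
Variable f : Gam X.
Hypothesis fF : forall T e (x : schhom T X), zipE q e -> gpull (act e x) f = esf F x (glV e.1).
Variables (a b : 'I_4) (nab : a != b) (a3 : (a < 3)%N) (b3 : (b < 3)%N).
Local Notation E x := (trv nab x, trv nab (x ^+ q)).

Let q_gt0 : (0 < q)%N.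
Proof. by rewrite expn_gt0 prime_gt0 // (pcharf_prime pchar_k). Qed.

Local Notation kA := (polyC : {rmorphism k -> {poly k}}).
Variable y : kpoint X.
Let r0 : schhom (Spec kA) (Spec (kid k)) := @specmap _ _ _ (kid k) kA polyC (fun c => erefl).
Let xA := schcomp y r0.
Local Notation eX := (E (toG {poly k} 'X) : GL2 (Gam (Spec kA))).
Let P := fromG (gpull (act eX xA) f).

Lemma gblk_P (R : comPzRingType) (w x y0 z : R) (H : w * z - x * y0 = 1) : in_Pminus (gblk nab H).
Proof. by move=> i j ij; apply: blk_mu => //; rewrite gtn_eqF. Qed.

(** P is the section at the inverse of the unipotent matrix with parameter X. By [blk_trv] it equals
    X^(lam_a - lam_b) times a value of the section depending polynomially on 1/X, so its degree is
    at most lam_a - lam_b. *)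
Lemma dominance_degree (P' : {poly k}) (m : nat) : P' != 0 -> P = P' * 'X^m -> (a < b)%N ->
  (m%:Z <= lam 0%R a - lam 0%R b)%R.
Proof.
move=> P'0 PE ab.
pose iota : {rmorphism {poly k} -> {fraction {poly k}}} := @tofrac {poly k}.
pose u := iota 'X; pose kL : {rmorphism k -> {fraction {poly k}}} := iota \o polyC.
have u0 : u != 0 by rewrite tofrac_eq0 polyX_eq0.
(* Substitution of 1/X for X. *)
pose h : {rmorphism {poly k} -> {fraction {poly k}}} := horner_eval u^-1 \o map_poly kL.
have hX : h 'X = u^-1 by rewrite /h /= /horner_eval map_polyX hornerX.
have hC c : h c%:P = kL c by rewrite /h /= /horner_eval map_polyC hornerC.
pose j1 : schhom (Spec kL) (Spec kA) := @specmap _ _ _ kA kL iota (fun c => erefl).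
pose j2 : schhom (Spec kL) (Spec kA) := @specmap _ _ _ kA kL h hC.
have j12 : schcomp xA j1 = schcomp xA j2.
  rewrite -!schcompA; congr schcomp; apply: spec_mor_eq => c.
  by rewrite !gpull_comp !specmap_gpull hC.
pose U : Gam (Spec kL) := toG _ u; pose V : Gam (Spec kL) := toG _ u^-1.
have UV : U * V = 1 by rewrite -rmorphM divff // rmorph1.
have d2 (R : comPzRingType) (v : R) : 0 * v - (- 1) * 1 = 1 by rewrite mul0r sub0r mulr1 opprK.
have dB : V * U - 0 * (- 1) = 1 by rewrite mul0r subr0 mulrC.
pose Bm := gblk nab dB; pose R2 (R : comPzRingType) (v : R) := gblk nab (d2 R v).
pose Q := fromG (esf F xA (R2 _ (toG {poly k} 'X : Gam (Spec kA)))).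
have BB : in_B Bm.
  apply/is_trig_mxP => i j ij; rewrite mxE.
  case: (eqVneq i a) => [ia|_]; first by case: (eqVneq j a) => [ja|_]; [move: ij; rewrite ia ja ltnn|case: ifP].
  case: (eqVneq i b) => [ib|_]; last by rewrite -val_eqE ltn_eqF.
  case: (eqVneq j a) => [ja|_]; first by move: ij; rewrite ib ja; lia.
  by case: (eqVneq j b) => [jb|//]; move: ij; rewrite ib jb ltnn.
have gX : gpull j1 (toG {poly k} 'X) = U by exact: specmap_gpull.
have gX2 : gpull j2 (toG {poly k} 'X) = V by rewrite specmap_gpull hX.
have chB : gl_char (- lam) Bm = zpw U V (lam 0%R a - lam 0%R b).
  rewrite zpwD // gl_charE (bigD1 a) //= (bigD1 b) /=; last by rewrite eq_sym.
  rewrite big1 => [|i /andP[/negPf ia /negPf ib]]; last first.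
    by rewrite !mxE ia ib eqxx /zpw; case: (- lam 0%R i) => l; rewrite expr1n.
  rewrite !mxE !eqxx [b == a]eq_sym (negPf nab) mulr1; congr (_ * _).
  exact: zpwN.
have zpwM (D D' : comPzRingType) (t : {rmorphism D -> D'}) x0 x1 l : t (zpw x0 x1 l) = zpw (t x0) (t x1) l.
  by case: l => l; exact: rmorphXn.
apply: (@laurent_bound k h _ _ P' Q m) => //.
apply: (@toG_inj _); rewrite -PE rmorphM zpwM -/U -/V.
transitivity (gpull j1 (toG _ P)); first by rewrite specmap_gpull.
rewrite fromGK fF; last exact: trv_zipE.
rewrite -es_nat; last exact: in_PminusV (gblk_P _).
have -> : glmap (gpull j1) (glV eX.1) = glM (R2 _ V) Bm.
  apply: gl_eq; transitivity (gli (glmap (gpull j1) (trv nab (toG {poly k} 'X)))); first by [].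
  by rewrite trv_map gX; exact: blk_trv.
rewrite es_B //; last exact: gblk_P.
rewrite chB; congr (_ * _); rewrite -(@specmap_gpull k _ _ kA kL h hC) fromGK -es_nat; last exact: gblk_P.
have -> : glmap (gpull j2) (R2 _ (toG {poly k} 'X : Gam (Spec kA))) = R2 _ V; last by rewrite j12.
apply: gl_eq; apply/matrixP => i j; rewrite !mxE.
by do ?case: ifP => _; rewrite ?rmorph0 ?rmorphN1 ?rmorph1 ?rmorph_nat ?gX2.
Qed.

Variables (t' : 'I_4 * 'I_4) (d : nat) (sg : bool).
Hypothesis trv_hc : forall (R : comPzRingType) (x : R) (h : GL R),
  hc (zip_act (E x) h) (o0, o3) = hc h (o0, o3) + x ^+ d * ((-1) ^+ sg * hc h t').
Variables (W : opens X) (yW : lands y W) (m : nat) (c : sect W).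
Hypotheses (fc : resT W f = hc (g W) (o0, o3) ^+ m * c).
Hypotheses (y0 : ringof yW (hc (g W) (o0, o3)) = 0) (yt : ringof yW (hc (g W) t') != 0)
  (yc : ringof yW c != 0).

(** At y the entry h_03 is 0 while h_t' and c are nonzero. Along the unipotent subgroup h_03 becomes
    X^d h_t' up to sign, so f = h_03^m c has order d m at X = 0. This is computed in jets because a
    jet at y stays in the chart W. *)
Lemma dominance_order : exists P' : {poly k}, P' != 0 /\ P = P' * 'X^(d * m).
Proof.
pose N := (d * m)%N; pose jN := jp k N.+1; pose kJ : {rmorphism k -> jet k N.+1} := jN \o polyC.
pose jA : schhom (Spec kJ) (Spec kA) := @specmap _ _ _ kA kJ jN (fun c => erefl).
have [ev Hev] := jet_ev k N.
have evk c0 : ev (kJ c0) = kid k c0 by rewrite Hev coefC.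
pose r : schhom (Spec (kid k)) (Spec kJ) := specmap evk.
pose yJ := schcomp (act eX xA) jA.
have [is1 isM isN] := (act_isaction zeta).1.
have Ez (R : comPzRingType) (x : R) : zipE q (E x) by exact: trv_zipE.
have yJr : schcomp yJ r = y.
  rewrite /yJ -schcompA -isN //.
  have -> : GL2_map (gpull (schcomp jA r)) eX = GL2_1 _.
    have gX : gpull (schcomp jA r) (toG {poly k} 'X) = 0.
      by rewrite gpull_comp !specmap_gpull Hev coefX rmorph0.
    have t0 (R : comPzRingType) : trv nab (0 : R) = gl1 R by apply: gl_eq; exact: blk1.
    by rewrite /GL2_map /= !trv_map rmorphXn gX expr0n gtn_eqF // t0.
  rewrite is1 -schcompA.
  have [i [_ i2 i3]] := schid_exists (Spec (kid k)).
  rewrite -{2}(i2 _ y); congr schcomp; apply: spec_mor_eq => c0.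
  by rewrite !gpull_comp !specmap_gpull i3 Hev coefC.
have yJW : lands yJ W.
  apply: landsP => Q.
  have [c0|p0 pQ|Q0 HQ0] := @prime_image _ _ ev (sval Q) _ (svalP Q).
  - by exists (kJ c0); rewrite evk.
  - have [p' Ep] := jp_surj p0; rewrite -Ep in pQ *.
    apply: (primeX (svalP Q) (n := N.+1)); rewrite -(idpE (svalP Q)).
    have -> : jp k N.+1 p' ^+ N.+1 = 0; last exact: ideal0.
    rewrite -rmorphXn; apply/jp_eq0 => i i_n.
    have -> : p' = drop_poly 1 p' * 'X.
      apply/polyP => l; rewrite coefMX coef_drop_poly; case: l => [|l] /=; last by rewrite addn1.
      by rewrite -(Hev p').
    by rewrite exprMn coefMXn i_n.
  have -> : Q = r Q0 :> Spec kJ.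
    by apply: prime_eq => c0; rewrite -HQ0; exact: iff_sym (specmap_pt evk Q0 c0).
  have yrW : lands (schcomp yJ r) W by rewrite yJr.
  exact: (yrW Q0 I).
have [c' Ec'] := jp_surj (ringof yJW c).
have c'0 : c'`_0 = ringof yW c.
  rewrite -Hev Ec'; have rW : lands (schcomp yJ r) W by rewrite yJr.
  rewrite -(ringof_comp yJW rW); move: rW (yW); rewrite yJr => h1 h2.
  by rewrite (Prop_irrelevance h1 h2).
pose w : k := (-1) ^+ sg * ringof yW (hc (g W) t').
have w0 : w != 0 by rewrite mulf_neq0 // signr_eq0.
have hE : ringof yJW (hc (g W) (o0, o3)) = jN ('X^d * w%:P).
  apply: toG_inj; rewrite -hc_lands.
  have -> : schcomp loc yJ = schcomp (schcomp loc (act eX xA)) jA by rewrite /yJ schcompA.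
  rewrite mat_comp.
  transitivity (gpull jA (hc (glm (mat (schcomp loc (act eX xA)))) (o0, o3))); first exact: mxE.
  rewrite zequiv // trv_hc.
  have xAW : lands xA W by exact: lands_comp.
  rewrite !(hc_lands xAW) !(ringof_comp yW xAW) y0 !rmorph0 add0r.
  rewrite -(rmorphXn (toG {poly k})) -(rmorph_sign (toG {poly k})) -!(rmorphM (toG {poly k})) specmap_gpull.
  by rewrite /w polyCM polyC_exp polyCN.
have jE : jN P = jN (('X^d * w%:P) ^+ m * c').
  apply: toG_inj; rewrite rmorphM rmorphXn Ec' -hE -rmorphXn -rmorphM -fc.
  rewrite -ringof_gpull gpull_comp -(@specmap_gpull k _ _ kA kJ jN (fun c => erefl)); congr (gpull jA _).
  exact: fromGK.
have coef i : (i < N.+1)%N -> P`_i = if (i < N)%N then 0 else w ^+ m * c'`_(i - N).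
  move=> iN; have /jp_eq/(_ i iN) -> := jE.
  by rewrite exprMn -exprM -mulrA coefXnM -/N -polyC_exp coefCM.
exists (drop_poly N P); split.
  apply/eqP => /(congr1 (fun A : {poly k} => A`_0)); rewrite coef_drop_poly add0n coef0 coef // ltnn subnn c'0.
  by apply/eqP; rewrite mulf_neq0 // expf_neq0.
rewrite -{1}(poly_take_drop N P) (_ : take_poly N P = 0) ?add0r //.
by apply/polyP => i; rewrite coef_take_poly coef0; case: ifP => // iN; rewrite coef ?iN // ltnW.
Qed.

Lemma dominance_bound : (a < b)%N -> ((d * m)%:Z <= lam 0%R a - lam 0%R b)%R.
Proof. by move=> ab; have [P' [P'0 PE]] := dominance_order; exact: dominance_degree P'0 PE ab. Qed.

End Dominance.

Section GenericPoint.
Variables (k : closedFieldType) (G : GLscheme k) (X : kscheme k) (loc : schhom X G).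
Local Notation g := (gmx loc).
Variables (y0 : kpoint X) (W : opens X) (y0W : lands y0 W) (c : sect W) (t t' : 'I_4 * 'I_4).
Hypotheses (cW : chart loc W) (tt' : t' != t) (on : onJ loc [:: t'; t] (kpt y0)).

(** The germ of h_t' c on the divisor h_t = 0 is nonzero, so some prime containing the ideal of the
    divisor avoids it, and [kspec] specializes this prime to a closed point. *)
Lemma generic_point : ~ znk loc y0W [:: t] c -> exists (y : kpoint X) (yW : lands y W),
  [/\ ringof yW (hc (g W) t) = 0, ringof yW (hc (g W) t') != 0 & ringof yW c != 0].
Proof.
move=> nz; have [aW lW fW] := cW; pose v := hc (g W) t' * c.
have nv : ~ znk loc y0W [:: t] v.
  move=> z; apply: nz; apply: (@znk_cancel _ _ _ loc y0 W y0W cW _ t' 1) => //.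
  by rewrite inE.
have [P [pP [sub vP]]] : exists P, prime_ideal P /\ (iset (IJ (g W) [:: t]) `<=` P /\ ~ P v).
  apply: contrapT => no; have [|m Im] := @nilp_prime _ (IJ (g W) [:: t]) v.
    by move=> P pP sub; apply: contrapT => Pv; apply: no; exists P.
  have /onJ_ring-/(_ W y0W) xJ : onJ loc [:: t] (kpt y0).
    by apply: onJ_sub on => s; rewrite !inE => ->; rewrite orbT.
  by apply: nv; apply: (zn_exp lW fW (ringof_cst y0W) xJ (n := m)); exact: zn_of.
have [x [[Wx xP] _]] := aff_point aW pP.
have ux : unit_at v x by apply: contrapT => /xP.
have [y [Wy vy spec]] := kspec aW fW ux.
exists y, (kpt_lands Wy).
move: vy; rewrite (kpt_unit (kpt_lands Wy)) rmorphM mulf_eq0 negb_or => /andP[nt nc].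
split=> //; apply/kpt_nunit => /spec; apply/xP/sub; exact/IJ_mem/mem_head.
Qed.

End GenericPoint.

Section Cone.
Variables (k : closedFieldType) (p n : nat).
Hypothesis pchar_k : p \in [pchar k].
Local Notation q := (p ^ n)%N.
Variables (G : GLscheme k) (S : kscheme k) (zeta : zip_mor q G S) (FlagS : flag_space zeta).
Hypothesis cond_a : zeta_smooth zeta.
Hypothesis cond_b : zeta_surj_on_components zeta.
Hypothesis cond_c : forall w : 'S_4, has_length w 1 -> pseudo_complete (closure (flag_stratum FlagS w)).

Lemma C_S_cone lam : C_S zeta lam -> exists m : nat, [/\ (m%:Z <= lam 0%R o0 - lam 0%R o1)%R,
  (q%:Z * m%:Z <= lam 0%R o1 - lam 0%R o2)%R &
  (q%:Z ^+ 2 * (lam 0%R o0 - m%:Z) + q%:Z * lam 0%R o1 + (lam 0%R o2 + q%:Z * m%:Z)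
    <= (1 + q%:Z + q%:Z ^+ 2) * lam 0%R o3)%R].
Proof.
move=> /C_S_section[F _]; have [f [f0 fF fE]] := section_function pchar_k F.
have q_gt0 : (0 < q)%N by rewrite expn_gt0 prime_gt0 // (pcharf_prime pchar_k).
have [m [[y [Uy [W [yW [c [cW L nz]]]]]] H]] := hasse q_gt0 cond_a cond_b cond_c fE f0.
have fc : resT W f = hc (gmx (zloc zeta) W) (o0, o3) ^+ m * c.
  by have [psi [-> /IJ_nil/eqP]] := L; rewrite subr_eq0 => /eqP.
have pt t' : t' \in upper -> t' != (o0, o3) -> exists (y : kpoint (ztot zeta)) (yW : lands y W),
    [/\ ringof yW (hc (gmx (zloc zeta) W) (o0, o3)) = 0, ringof yW (hc (gmx (zloc zeta) W) t') != 0 & ringof yW c != 0].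
  move=> tU t3; apply: (generic_point cW t3 (y0W := yW)) => //.
  by apply: onJ_sub Uy => s; rewrite inE => /orP[/eqP->//|]; rewrite inE => /eqP->.
exists m; split=> //.
  have [y1 [y1W [z0 zt zc]]] := pt (o1, o3) isT isT.
  have H1 (R : comPzRingType) (x : R) (h : GL R) : hc (zip_act (trv (isT : o0 != o1) x, trv (isT : o0 != o1) (x ^+ q)) h) (o0, o3) =
      hc h (o0, o3) + x ^+ 1 * ((-1) ^+ false * hc h (o1, o3)) by rewrite mul1r; exact: trv_hc01.
  have D := dominance_bound pchar_k fF (isT : (o0 < 3)%N) (isT : (o1 < 3)%N) H1 fc z0 zt zc isT.
  by rewrite mul1n in D.
(* Here the unipotent subgroup acts on h_03 through its second factor, by a column operation with
   parameter x^q, whence the factor q in the bound. *)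
have [y1 [y1W [z0 zt zc]]] := pt (o0, o2) isT isT.
have H1 (R : comPzRingType) (x : R) (h : GL R) : hc (zip_act (trv (isT : o1 != o2) x, trv (isT : o1 != o2) (x ^+ q)) h) (o0, o3) =
    hc h (o0, o3) + x ^+ q * ((-1) ^+ true * hc h (o0, o2)) by rewrite expr1 mulN1r; exact: trv_hc12.
have D := dominance_bound pchar_k fF (isT : (o1 < 3)%N) (isT : (o2 < 3)%N) H1 fc z0 zt zc isT.
by rewrite PoszM in D.
Qed.

End Cone.

(** * Sections on the stack from semi-invariants of E' *)

Section ZipGroupInverse.
Variables (p n : nat) (k : fieldType).
Hypothesis pchar_k : p \in [pchar k].
Local Notation q := (p ^ n)%N.
Variables (R : comPzRingType) (kap : {rmorphism k -> R}).
Implicit Types (x y : GL R) (e : GL2 R).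

Lemma trK (M N : 'M[R]_4) : M *m N = 1%:M -> N^T *m M^T = 1%:M.
Proof. by move=> MN; rewrite -trmx_mul MN trmx1. Qed.

(** Transposition exchanges P_+ and P_-, which transfers the statements on [in_Pminus]. *)
Definition trgl x : GL R := MkGL (trK (gliK x)) (trK (glmK x)).

Lemma in_Pplus_tr x : in_Pplus x <-> in_Pminus (trgl x).
Proof. by split=> H i j ij; have := H j i ij; rewrite ?mxE. Qed.

Lemma in_PplusV x : in_Pplus x -> in_Pplus (glV x).
Proof. by move=> /in_Pplus_tr Px; apply/in_Pplus_tr; exact: (@in_PminusV _ (trgl x) Px). Qed.

Lemma in_PplusM x y : in_Pplus x -> in_Pplus y -> in_Pplus (glM x y).
Proof.
move=> Px Py i j ij; rewrite mxE big1 // => m _.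
have [im|mi] := ltnP (mu i) (mu m); first by rewrite Px ?mul0r.
by rewrite [y m j]Py ?mulr0 //; exact: leq_ltn_trans ij.
Qed.

Lemma levi_tr (M : 'M[R]_4) : levi M^T = (levi M)^T.
Proof. by apply/matrixP => i j; rewrite !mxE eq_sym. Qed.

Lemma levi_mul_plus x y : in_Pplus x -> in_Pplus y -> levi (x *m y) = levi x *m levi y.
Proof.
move=> /in_Pplus_tr Px /in_Pplus_tr Py.
have := levi_mul Py Px; rewrite /= -trmx_mul !levi_tr -trmx_mul => /(congr1 trmx).
by rewrite !trmxK.
Qed.

Definition GL2_V e : GL2 R := (glV e.1, glV e.2).

Lemma zipE_M e e' : zipE q e -> zipE q e' -> zipE q (GL2_M e e').
Proof.
move=> [m p' l] [m' p'' l']; split; [exact: in_PminusM|exact: in_PplusM|].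
by rewrite levi_mul // (frobM n pchar_k kap) l l' levi_mul_plus.
Qed.

Lemma zipE_V e : zipE q e -> zipE q (GL2_V e).
Proof.
move=> [m p' l]; split; [exact: in_PminusV|exact: in_PplusV|].
have [e' [[_ _ l'] e1 _]] := zip_section n pchar_k kap (@in_PminusV _ _ m).
rewrite e1 in l'; have K1 : map_mx (fun a : R => a ^+ q) (levi (gli e.1)) *m levi e.2 = 1%:M.
  rewrite -l -(frobM n pchar_k kap) -(levi_mul (@in_PminusV _ _ m) m) gliK levi1.
  apply/matrixP => i j; rewrite !mxE; case: eqVneq => _; first exact: expr1n.
  by rewrite expr0n expn_eq0 eqn0Ngt prime_gt0 // (pcharf_prime pchar_k).
have K2 : levi e.2 *m levi (gli e.2) = 1%:M by rewrite -(levi_mul_plus p' (@in_PplusV _ p')) glmK levi1.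
by rewrite -[LHS]mulmx1 -K2 mulmxA K1 mul1mx.
Qed.

End ZipGroupInverse.

Section Weights.
Variables (p n : nat) (k : closedFieldType).
Hypothesis pchar_k : p \in [pchar k].
Local Notation q := (p ^ n)%N.

Let q_gt0 : (0 < q)%N.
Proof. by rewrite expn_gt0 prime_gt0 // (pcharf_prime pchar_k). Qed.

(** Natural functions on GL_4 that are semi-invariant under E'. Equivariance is asked over
    k-algebras, where the Frobenius is a ring map. *)
Definition has_weight (Phi : forall R : comPzRingType, GL R -> R) (lam : 'rV[int]_4) : Prop :=
  (forall (R R' : comPzRingType) (f : {rmorphism R -> R'}) x, Phi R' (glmap f x) = f (Phi R x)) /\
  forall (R : comPzRingType) (kap : {rmorphism k -> R}) e x, zipE' q e ->
    Phi R (zip_act e x) = gl_char lam e.1 * Phi R x.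

Lemma weightM Phi Psi l l' : has_weight Phi l -> has_weight Psi l' ->
  has_weight (fun R x => Phi R x * Psi R x) (l + l').
Proof.
move=> [N1 E1] [N2 E2]; split=> [R R' f x|R kap e x Ee]; first by rewrite N1 N2 rmorphM.
by rewrite E1 // E2 // gl_charD; [rewrite mulrACA|case: Ee].
Qed.

Lemma weightX Phi l m : has_weight Phi l -> has_weight (fun R x => Phi R x ^+ m) (l *+ m).
Proof.
move=> [N1 E1]; split=> [R R' f x|R kap e x Ee]; first by rewrite N1 rmorphXn.
by rewrite E1 // gl_charMn; [rewrite exprMn|case: Ee].
Qed.

Lemma zip_actM (R : comPzRingType) (e e' : GL2 R) x : zip_act (GL2_M e e') x = zip_act e (zip_act e' x).
Proof. by apply: gl_eq; rewrite /= !mulmxA. Qed.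

Lemma zip_act_map (R R' : comPzRingType) (f : {rmorphism R -> R'}) e x :
  glmap f (zip_act e x) = zip_act (GL2_map f e) (glmap f x).
Proof. by apply: gl_eq; rewrite /= !map_mxM. Qed.

Section ZipSection.
Variables (Phi : forall R : comPzRingType, GL R -> R) (lam : 'rV[int]_4).
Hypothesis wPhi : has_weight Phi lam.

(** The quotient of e by e' lies in E', with first component b. *)
Lemma weight_zip (R : comPzRingType) (kap : {rmorphism k -> R}) (e e' : GL2 R) b x : zipE q e -> zipE q e' ->
  in_B b -> e.1 = glM b e'.1 -> Phi (zip_act e x) = gl_char lam b * Phi (zip_act e' x).
Proof.
move=> Ee Ee' Bb E1; pose d := GL2_M e (GL2_V e').
have V1 (y z : GL R) : glM (glM y (glV z)) z = y by apply: gl_eq; rewrite /= -mulmxA gliK mulmx1.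
have V2 (y z : GL R) : glM (glM y z) (glV z) = y by apply: gl_eq; rewrite /= -mulmxA glmK mulmx1.
have d1 : d.1 = b by rewrite /d /= E1 V2.
have -> : e = GL2_M d e' by rewrite /GL2_M /d /= !V1; case: (e).
rewrite zip_actM -d1; apply: (wPhi.2 _ kap); split; last by rewrite d1.
by apply: (zipE_M pchar_k kap) => //; exact: (zipE_V pchar_k kap).
Qed.

Lemma weight_zip1 (R : comPzRingType) (kap : {rmorphism k -> R}) (e e' : GL2 R) x : zipE q e -> zipE q e' ->
  e.1 = e'.1 -> Phi (zip_act e x) = Phi (zip_act e' x).
Proof.
move=> Ee Ee' E1; rewrite (weight_zip kap (e' := e') (b := gl1 R)) //.
- rewrite gl_charE big1 ?mul1r // => i _; rewrite !mxE eqxx.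
  by rewrite /zpw; case: (lam 0%R i) => l; rewrite expr1n.
- exact: scalar_mx_is_trig.
- by rewrite E1; apply: gl_eq; rewrite /= mul1mx.
Qed.

(** A choice of an element of E above r^-1; by [weight_zip1], the values of Phi do not depend on
    it. *)
Definition zip_over (R : comPzRingType) (r : GL R) : GL2 R :=
  if pselect (exists e, zipE q e /\ e.1 = glV r) is left H then sval (cid H) else GL2_1 R.

Lemma zip_overP (R : comPzRingType) (kap : {rmorphism k -> R}) (r : GL R) : in_Pminus r ->
  zipE q (zip_over r) /\ (zip_over r).1 = glV r.
Proof.
move=> Pr; rewrite /zip_over; case: pselect => [H|[]]; first exact: (svalP (cid H)).
by have [e [Ee e1 _]] := zip_section n pchar_k kap (@in_PminusV _ _ Pr); exists e.
Qed.

(** Induction from E' to E: the section sends g to the function r |-> Phi(e g), where e is an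
    element of E with first component r^-1. *)
Lemma weight_C_zip (x0 : GL k) : Phi x0 <> 0 -> C_zip k q lam.
Proof.
move=> nz; pose s (T : kscheme k) (g : GL (Gam T)) (T1 : kscheme k) (v : schhom T1 T) (r : GL (Gam T1)) :=
  Phi (zip_act (zip_over r) (glmap (gpull v) g)).
have kT (T : kscheme k) : {rmorphism k -> Gam T} := kcst (topen T).
have VM (R : comPzRingType) (y z : GL R) : glV (glM y z) = glM (glV z) (glV y) by exact: gl_eq.
have VV (R : comPzRingType) (y : GL R) : glV (glV y) = y by case: y.
exists s; split.
- move=> T g; split=> [T1 T2 v u r Pr|T1 v r b Pr Bb].
    have [Ee e1] := zip_overP (kT T1) Pr.
    have Pr' : in_Pminus (glmap (gpull u) r) by move=> i j ij; rewrite mxE Pr ?rmorph0.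
    have [Ee' e1'] := zip_overP (kT T2) Pr'.
    rewrite /s -(wPhi.1 _ _ (gpull u)) zip_act_map.
    have -> : glmap (gpull (schcomp v u)) g = glmap (gpull u) (glmap (gpull v) g).
      by apply: gl_eq; apply/matrixP => i j; rewrite !mxE gpull_comp.
    apply: (weight_zip1 (kT T2)) => //; first exact: zipE_map.
    rewrite e1'; transitivity (glmap (gpull u) (glV r)); first exact: gl_eq.
    by rewrite /GL2_map /= e1.
  have [Ee e1] := zip_overP (kT T1) Pr.
  have [Ee' e1'] := zip_overP (kT T1) (@in_PminusM _ _ _ Pr (in_B_Pminus Bb)).
  have -> : gl_char (- lam) b = gl_char lam (glV b) by rewrite -{1}(VV _ b) gl_charV.
  by apply: (weight_zip (kT T1)) => //; [exact: in_BV|rewrite e1' VM e1].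
- move=> T T' u g T1 v r Pr; rewrite /s; congr (Phi (zip_act _ _)).
  by apply: gl_eq; apply/matrixP => i j; rewrite !mxE gpull_comp.
- move=> T e g T1 v r Ee Pr; rewrite /s /VI_act zip_act_map -zip_actM.
  have [Eo o1] := zip_overP (kT T1) Pr.
  have Ev : zipE q (GL2_map (gpull v) e) by exact: zipE_map.
  have Pe : in_Pminus (glM (glV (glmap (gpull v) e.1)) r).
    by apply: (@in_PminusM _ _ _ _ Pr); apply: (@in_PminusV _ _); case: Ev.
  have [Eo' o1'] := zip_overP (kT T1) Pe.
  apply: (weight_zip1 (kT T1)) => //; first exact: (zipE_M pchar_k (kT T1)).
  by rewrite o1' VM VV /= o1.
- have [i [_ _ i3]] := schid_exists (Spec (kid k)).
  pose T := Spec (kid k); pose x : GL (Gam T) := glmap (toG k) x0.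
  have P1 : in_Pminus (gl1 (Gam T)) by apply: in_B_Pminus; exact: scalar_mx_is_trig.
  exists T, x, T, i, (gl1 _); split=> //; rewrite /s => Z; apply: nz.
  have [Ee e1] := zip_overP (kT T) P1; apply: (@toG_inj k); rewrite rmorph0 -Z -wPhi.1.
  have E1 : zipE q (GL2_1 (Gam T)).
    split=> [|j j' jj|]; [exact: P1|by rewrite mxE -val_eqE; case: eqP => // E; move: jj; rewrite (val_inj E) ltnn|].
    rewrite /= levi1; apply/matrixP => j j'; rewrite !mxE; case: eqVneq => _; first exact: expr1n.
    by rewrite expr0n gtn_eqF.
  rewrite (weight_zip1 (kT T) (e' := GL2_1 (Gam T))) //.
  congr Phi; apply: gl_eq; rewrite /= mul1mx mulmx1.
  by apply/matrixP => j j'; rewrite !mxE i3.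
Qed.

End ZipSection.

End Weights.

(** * The partial Hasse invariants *)

Section PartialHasse.
Variables (p n : nat) (k : closedFieldType).
Hypothesis pchar_k : p \in [pchar k].
Local Notation q := (p ^ n)%N.
Local Notation w := (widen_ord (leqnSn 3)).
Local Notation a0 := (@Ordinal 3 0 isT).
Local Notation a1 := (@Ordinal 3 1 isT).
Local Notation a2 := (@Ordinal 3 2 isT).

Let q_gt0 : (0 < q)%N.
Proof. by rewrite expn_gt0 prime_gt0 // (pcharf_prime pchar_k). Qed.

Definition tl (R : Type) (M : 'M[R]_4) : 'M[R]_3 := \matrix_(i, j) M (w i) (w j).
Definition phi (R : comPzRingType) m (M : 'M[R]_m) : 'M[R]_m := map_mx (fun a : R => a ^+ q) M.

(* With [A] the upper left block of the matrix and [e] the last (resp. first) basis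
   vector: [theta] is det (e, A e, A phi(A) e), and [theta'] is a minor of the rows
   e phi(A) and e A phi(A). *)
Definition theta (R : comPzRingType) (A : 'M[R]_3) : R :=
  A a0 a2 * (A *m phi A) a1 a2 - A a1 a2 * (A *m phi A) a0 a2.
Definition theta' (R : comPzRingType) (A : 'M[R]_3) : R :=
  phi A a0 a1 * (A *m phi A) a0 a2 - phi A a0 a2 * (A *m phi A) a0 a1.

Lemma wmax : (ord_max : 'I_4) = o3. Proof. exact: val_inj. Qed.

Lemma w3 : [/\ w a0 = o0, w a1 = o1 & w a2 = o2].
Proof. by split; exact: val_inj. Qed.

Lemma tl_diag (R : comPzRingType) (M : 'M[R]_4) i : tl M i i = M (w i) (w i). Proof. exact: mxE. Qed.

Lemma tl_mull (R : comPzRingType) (x y : 'M[R]_4) : (forall i : 'I_3, x (w i) o3 = 0) ->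
  tl (x *m y) = tl x *m tl y.
Proof.
move=> x0; apply/matrixP => i j; rewrite !mxE big_ord_recr /= wmax x0 mul0r addr0.
by apply: eq_bigr => m _; rewrite !mxE.
Qed.

Lemma tl_mulr (R : comPzRingType) (x y : 'M[R]_4) : (forall j : 'I_3, y o3 (w j) = 0) ->
  tl (x *m y) = tl x *m tl y.
Proof.
move=> y0; apply/matrixP => i j; rewrite !mxE big_ord_recr /= wmax y0 mulr0 addr0.
by apply: eq_bigr => m _; rewrite !mxE.
Qed.

Lemma tl1 (R : comPzRingType) : tl (1%:M : 'M[R]_4) = 1%:M.
Proof. by apply/matrixP => i j; rewrite !mxE -!val_eqE. Qed.

Section OverRing.
Variable R : comPzRingType.

Lemma tri_entries (T A U : 'M[R]_3) : is_trig_mx T -> is_trig_mx U ->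
  [/\ (T *m A *m U) a0 a2 = T a0 a0 * A a0 a2 * U a2 a2,
      (T *m A *m U) a1 a2 = (T a1 a0 * A a0 a2 + T a1 a1 * A a1 a2) * U a2 a2 &
      (T *m A *m U) a0 a1 = T a0 a0 * (A a0 a1 * U a1 a1 + A a0 a2 * U a2 a1)].
Proof.
have e0 : ord0 = a0 by exact: val_inj.
have e1 : lift ord0 ord0 = a1 by exact: val_inj.
have e2 : lift ord0 (lift ord0 ord0) = a2 by exact: val_inj.
move=> /is_trig_mxP tT /is_trig_mxP tU.
have T01 := tT a0 a1 isT; have T02 := tT a0 a2 isT; have T12 := tT a1 a2 isT.
have U01 := tU a0 a1 isT; have U02 := tU a0 a2 isT; have U12 := tU a1 a2 isT.
have E i j : (T *m A *m U) i j = (T i a0 * A a0 a0 + T i a1 * A a1 a0 + T i a2 * A a2 a0) * U a0 j +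
    (T i a0 * A a0 a1 + T i a1 * A a1 a1 + T i a2 * A a2 a1) * U a1 j +
    (T i a0 * A a0 a2 + T i a1 * A a1 a2 + T i a2 * A a2 a2) * U a2 j.
  by rewrite mxE !big_ord_recl big_ord0 !mxE !big_ord_recl !big_ord0 !e2 !e1 !e0; ring.
by rewrite !E T01 T02 T12 U01 U02 U12; split; ring.
Qed.

Lemma tl_zip (e : GL2 R) (x : GL R) : zipE' q e -> let b := tl e.1 in let z := tl (gli e.2) in
  [/\ tl (zip_act e x) = b *m tl x *m z, z *m phi b = 1%:M, is_trig_mx b, is_trig_mx z
    & forall j, z j j = gli e.1 (w j) (w j) ^+ q].
Proof.
move=> Ee /=; have [/is_trig_mxP tY dY] := zipY_spec q_gt0 Ee; have [[_ plus lev] Bb] := Ee.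
have /is_trig_mxP tb := Bb.
have yE i j : gli e.2 i j = zipY e (ordS i) (ordS j) by rewrite mxE !ordSK4.
have z0 (j : 'I_3) : gli e.2 o3 (w j) = 0.
  by rewrite yE tY //=; case: j => [[|[|[|]]]].
have e0 (j : 'I_3) : glm e.2 o3 (w j) = 0 by apply: plus; rewrite /mu /= ltn_ord.
have b0 (i : 'I_3) : glm e.1 (w i) o3 = 0 by apply: tb => /=.
split.
- by rewrite /= tl_mulr // tl_mull.
- have -> : phi (tl e.1) = tl e.2.
    apply/matrixP => i j; have := congr1 (fun M : 'M_4 => M (w i) (w j)) lev.
    by rewrite !mxE /mu /= !ltn_ord eqxx.
  by rewrite -tl_mulr // gliK tl1.
- by apply/is_trig_mxP => i j ij; rewrite mxE; apply: tb.
- apply/is_trig_mxP => i j ij; rewrite mxE yE tY //=.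
  by move: ij; case: i j => [[|[|[|//]]] ?] [[|[|[|//]]] ?].
move=> j; rewrite mxE yE; have := dY (ordS (w j)); rewrite ordSK4 => E1.
have E2 := in_B_diag (w j) Bb; rewrite -[LHS]mul1r -(expr1n _ q) -E2 exprMn mulrAC E1 mul1r //.
Qed.

Lemma phi_zip (kap : {rmorphism k -> R}) (b A z : 'M[R]_3) : z *m phi b = 1%:M ->
  phi (b *m A *m z) = phi b *m phi A *m phi z /\
  (b *m A *m z) *m phi (b *m A *m z) = b *m (A *m phi A) *m phi z.
Proof.
move=> zb; have E : phi (b *m A *m z) = phi b *m phi A *m phi z by rewrite /phi !(frobM n pchar_k kap).
split=> //; rewrite E !mulmxA; congr (_ *m _ *m _).
by rewrite -(mulmxA _ z) zb mulmx1.
Qed.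

Lemma phi_trig (b : 'M[R]_3) : is_trig_mx b -> is_trig_mx (phi b).
Proof. by move=> /is_trig_mxP tb; apply/is_trig_mxP => i j ij; rewrite mxE tb // expr0n gtn_eqF. Qed.

Lemma gl_char_neg (i : 'I_4) m (b : GL R) : in_B b -> gl_char (- (delta_mx 0 i *+ m)) b = gli b i i ^+ m.
Proof.
move=> Bb; have -> : b = glV (glV b) by case: (b).
rewrite gl_charV gl_charMn; last exact: in_BV.
by rewrite gl_char_delta.
Qed.

End OverRing.

Local Notation D i := (delta_mx 0 i : 'rV[int]_4).

Lemma theta_weight : has_weight p n k (fun R x => theta (tl x)) (D o0 + D o1 - D o2 *+ q - D o2 *+ (q * q)).
Proof.
split=> [R R' f x|R kap e x Ee].
  rewrite /theta !mxE rmorphB !rmorphM !rmorph_sum.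
  by congr (_ * _ - _ * _); apply: eq_bigr => m _; rewrite !mxE rmorphM rmorphXn.
have [E zb tb tz dz] := tl_zip x Ee; have [_ Bb] := Ee.
have [_ E2] := phi_zip kap (tl x) zb.
rewrite /theta E E2; have [-> -> _] := tri_entries (tl x) tb tz.
have [-> -> _] := tri_entries (tl x *m phi (tl x)) tb (phi_trig tz).
rewrite !gl_charD // !gl_char_neg // !gl_char_delta // [phi _ a2 a2]mxE dz -exprM.
rewrite !tl_diag; have [-> -> ->] := w3.
by move: (gli e.1 o2 o2 ^+ q) (gli e.1 o2 o2 ^+ (q * q)) => u v; ring.
Qed.

Lemma theta'_weight : has_weight p n k (fun R x => theta' (tl x))
  (D o0 *+ q + D o0 - D o1 *+ (q * q) - D o2 *+ (q * q)).
Proof.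
split=> [R R' f x|R kap e x Ee].
  rewrite /theta' !mxE rmorphB !rmorphM !rmorph_sum !rmorphXn.
  by congr (_ * _ - _ * _); apply: eq_bigr => m _; rewrite !mxE rmorphM rmorphXn.
have [E zb tb tz dz] := tl_zip x Ee; have [_ Bb] := Ee.
have [E1 E2] := phi_zip kap (tl x) zb.
rewrite /theta' E E2 E1; have [-> _ ->] := tri_entries (phi (tl x)) (phi_trig tb) (phi_trig tz).
have [-> _ ->] := tri_entries (tl x *m phi (tl x)) tb (phi_trig tz).
rewrite !gl_charD // !gl_char_neg // gl_charMn // !gl_char_delta //.
rewrite [phi (tl (gli e.2)) a1 a1]mxE [phi (tl (gli e.2)) a2 a2]mxE !dz -!exprM [phi (tl e.1) a0 a0]mxE !tl_diag.
have [-> -> ->] := w3.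
by move: (glm e.1 o0 o0 ^+ q) (gli e.1 o1 o1 ^+ (q * q)) (gli e.1 o2 o2 ^+ (q * q)) => u v v'; ring.
Qed.

Lemma detA_weight : has_weight p n k (fun R x => \det (tl x))
  (D o0 + D o1 + D o2 - D o0 *+ q - D o1 *+ q - D o2 *+ q).
Proof.
split=> [R R' f x|R kap e x Ee].
  by rewrite -det_map_mx; congr (\det _); apply/matrixP => i j; rewrite !mxE.
have [E _ tb tz dz] := tl_zip x Ee; have [_ Bb] := Ee.
rewrite E !det_mulmx (det_trig tb) (det_trig tz) !gl_charD // !gl_char_neg // !gl_char_delta //.
have sum3 (F : 'I_3 -> R) : \prod_i F i = F a0 * F a1 * F a2.
  rewrite !big_ord_recl big_ord0 mulr1 mulrA; congr (F _ * F _ * F _); exact: val_inj.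
rewrite !sum3 !dz !tl_diag; have [-> -> ->] := w3.
by move: (gli e.1 o0 o0 ^+ q) (gli e.1 o1 o1 ^+ q) (gli e.1 o2 o2 ^+ q) => u v v'; ring.
Qed.

(** Cyclic on the first three indices, with value 2 at 0: at its matrix the entry h_03 and the
    invariants [theta], [theta'] and det A are all nonzero. *)
Definition cyc : 'S_4 := (tperm o0 o2 * tperm o0 o1)%g.

Lemma cycE : [/\ cyc o0 = o2, cyc o1 = o0, cyc o2 = o1 & cyc o3 = o3].
Proof. by split; rewrite permM; do 2?case: tpermP => //. Qed.

Lemma theta_cyc : [/\ theta (tl (perm_mx cyc : 'M[k]_4)) != 0, theta' (tl (perm_mx cyc : 'M[k]_4)) != 0
  & \det (tl (perm_mx cyc : 'M[k]_4)) != 0].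
Proof.
have [c0 c1 c2 c3] := cycE; set A := tl _.
have AE i j : A i j = (j == ord_pred i)%:R.
  have cE : cyc (w i) = w (ord_pred i).
    have [E0 E1 E2] := w3; case: i => [[|[|[|//]]] pi].
    - by rewrite (_ : Ordinal pi = a0) ?E0 ?c0 -?E2; [congr w; exact: val_inj|exact: val_inj].
    - by rewrite (_ : Ordinal pi = a1) ?E1 ?c1 -?E0; [congr w; exact: val_inj|exact: val_inj].
    - by rewrite (_ : Ordinal pi = a2) ?E2 ?c2 -?E1; [congr w; exact: val_inj|exact: val_inj].
  by rewrite !mxE cE -!val_eqE eq_sym.
have PE i j : phi A i j = A i j.
  by rewrite mxE AE; case: (j == _); rewrite ?expr1n // expr0n gtn_eqF.
have A2 i j : (A *m phi A) i j = A (ord_pred i) j.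
  rewrite mxE (bigD1 (ord_pred i)) //= big1 => [|m /negPf mi]; rewrite AE ?mi ?mul0r //.
  by rewrite eqxx mul1r addr0 PE.
split.
- by rewrite /theta !A2 !AE /= mul0r subr0 mul1r oner_eq0.
- by rewrite /theta' !A2 !PE !AE /= mul0r sub0r mul1r oppr_eq0 oner_eq0.
have z (j : 'I_3) : (perm_mx cyc^-1 : 'M[k]_4) o3 (w j) = 0.
  have -> : (perm_mx cyc^-1 : 'M[k]_4) o3 (w j) = (cyc^-1%g o3 == w j)%:R by rewrite !mxE.
  have -> : (cyc^-1)%g o3 = o3 by apply: (perm_inj (s := cyc)); rewrite permKV c3.
  by rewrite -val_eqE /= gtn_eqF.
apply/eqP => d0; have := congr1 (fun M : 'M[k]_4 => \det (tl M)) (gl_permK k cyc).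
by rewrite tl_mulr // det_mulmx d0 mul0r tl1 det1 => /eqP; rewrite eq_sym oner_eq0.
Qed.

End PartialHasse.

(** * From sections on the stack to sections over S, and the converse inclusion *)

(** By [flat] with the zero submodule, s is killed by all coefficients of a polynomial congruent to
    1 modulo the relations, and one of them is a unit at z. *)
Lemma smooth_faithful (k : fieldType) (U F : kscheme k) (f : schhom U F) (s : Gam F) : smooth f ->
  (forall z, exists x, f x = z) -> gpull f s = 0 -> s = 0.
Proof.
move=> sf fs s0; apply: (@sect_eq0 k F (topen F)) => z _; have [x xz] := fs z.
have [U1 [V [UV [U1x aU1 aV _ [hA [hB [n [r [beta [th [bC bs bk thC [thr _]]]]]]]]]]]] :=
  @smooth_chart k U F f False sf x (topen U) I.
pose A := nzof hA; pose a : A := resT V s.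
have a0 : pull UV a = 0.
  pose fT : topen U `<=` f @^-1` topen F := fun _ _ => I.
  have := pull_res fT UV (@sub_topen F V) (@sub_topen U U1) s.
  by rewrite -[pull fT s]/(gpull f s) s0 rmorph0 => E; exact: esym E.
have [|||||p [p1 pa]] := @flat k A (kcst V) n r th thC thr A idfun [set c | c = 0] _ _ _ a 0.
- by [].
- by move=> c d /= -> ->; rewrite addr0.
- by move=> c d /= ->; rewrite mulr0.
- by move=> m; rewrite mpcf0.
- rewrite subr0 -(mpmapC n (idfun : {rmorphism A -> A})); apply: span_seq_map.
  by apply/bk; rewrite bC.
have [m um] : exists m, unit_at (mpcf m p : sect V) z.
  apply: contrapT => nu; pose yB : primes (nzof hB) := ptprime U1x.
  pose y : primes (mp n A) := exist _ _ (prime_preim beta (svalP yB)).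
  have : sval y p.
    apply: coef_prime => m; apply/(ptprimeE U1x); rewrite bC => /(pull_unit UV) -/(_ U1x).
    by rewrite xz => um; apply: nu; exists m.
  have bp : beta p = 1 by move/bk: p1; rewrite rmorphB rmorph1 => /eqP; rewrite subr_eq0 => /eqP.
  by rewrite /= bp => /(prime1 (P := yB)).
have [O [OV [Oz [v uv]]]] := um.
exists O, (@sub_topen F O); split=> //.
have -> : rstr (@sub_topen F O) s = rstr OV a by apply: esym; exact: res_res.
have E : rstr OV (mpcf m p : sect V) * rstr OV a = 0 by rewrite -rmorphM (pa m) rmorph0.
by rewrite -[LHS]mul1r -uv mulrAC E mul0r.
Qed.

Section ZipToS.
Variables (k : closedFieldType) (p n : nat).
Hypothesis pchar_k : p \in [pchar k].
Local Notation q := (p ^ n)%N.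
Variables (G : GLscheme k) (S : kscheme k) (zeta : zip_mor q G S).
Hypothesis S_nonempty : exists s : S, True.
Hypothesis cond_a : zeta_smooth zeta.
Hypothesis cond_b : zeta_surj_on_components zeta.

(** The value h of the section at the identity of P is a function on G that determines the section
    by E-equivariance, so h is nonzero. Its pullback to the torsor is nonzero because X -> G is
    smooth and surjective. *)
Lemma C_zip_C_S lam : C_zip k q lam -> C_S zeta lam.
Proof.
move=> [s [sVI snat sact [T [x [T1 [v [r [Pr nz]]]]]]]].
have [i [i1 _ _]] := schid_exists G; pose h : Gam G := s G (gluniv G) G i (gl1 _).
have P1 (R : comPzRingType) : in_Pminus (gl1 R) by apply: in_B_Pminus; exact: scalar_mx_is_trig.
have F1 T0 (t : schhom T0 G) T2 (v0 : schhom T2 T0) r0 : in_Pminus r0 ->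
  s T0 (mat t) T2 v0 r0 = s G (gluniv G) T2 (schcomp t v0) r0 by move=> Pr0; exact: snat.
have F2 T0 (t : schhom T0 G) : s G (gluniv G) T0 t (gl1 _) = gpull t h.
  have [E _] := sVI G (gluniv G); rewrite /h -E // i1; congr (s _ _ _ _ _).
  by apply: gl_eq; rewrite /= map_mx1.
have h0 : h <> 0.
  move=> h0; apply: nz; have [t Et] := GL_mor G x; rewrite -Et F1 //.
  set t0 := schcomp t v.
  have [e [Ee e1 _]] := zip_section n pchar_k (kcst (topen T1)) (@in_PminusV _ _ Pr).
  have [t' Et'] := GL_mor G (zip_act e (mat t0)).
  have [j [_ j2 j3]] := schid_exists T1.
  have := sact T1 e (mat t0) T1 j (gl1 _) Ee (P1 _).
  have -> : VI_act e.1 (s T1 (mat t0)) j (gl1 (Gam T1)) = s T1 (mat t0) T1 j r.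
    rewrite /VI_act; congr (s _ _ _ _ _); apply: gl_eq; rewrite /= mulmx1 e1 /=.
    by apply/matrixP => a b; rewrite mxE j3.
  by rewrite -Et' !F1 // !j2 F2 h0 rmorph0 => <-.
have loc0 : gpull (zloc zeta) h <> 0.
  have [s0 _] := S_nonempty; move=> /(smooth_faithful cond_a) E; apply: h0; apply: E => z.
  by have [y [_ yz]] := cond_b s0 z; exists y.
exists (fun T0 y => s T0 (mat (schcomp (zloc zeta) y))); split.
- by move=> T0 y; exact: sVI.
- by move=> T0 T' u y T2 w r0 Pr0; rewrite schcompA mat_comp; exact: snat.
- by move=> T0 e y T2 w r0 Ee Pr0; rewrite zequiv //; exact: sact.
have [j [_ j2 _]] := schid_exists (ztot zeta).
exists (ztot zeta), j, (ztot zeta), j, (gl1 _); split; first exact: P1.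
by rewrite F1 // F2 !j2.
Qed.

End ZipToS.

Section Converse.
Variables (k : closedFieldType) (p n : nat).
Hypothesis pchar_k : p \in [pchar k].
Hypothesis n_gt0 : (0 < n)%N.
Local Notation q := (p ^ n)%N.

Lemma hdet_weight : has_weight p n k (fun R x => hdet x) (\sum_s wt q (s, s)) /\
  has_weight p n k (fun R x => hdeti x) (- \sum_s wt q (s, s)).
Proof.
have q_gt0 : (0 < q)%N by rewrite expn_gt0 prime_gt0 // (pcharf_prime pchar_k).
split; split=> [R R' f x|R kap e x Ee]; try exact: hdet_act; try exact: hdeti_act.
  by rewrite /hdet -det_map_mx; congr (\det _); apply/matrixP => i j; rewrite !mxE /hc mxE.
by rewrite /hdeti -det_map_mx; congr (\det _); apply/matrixP => i j; rewrite !mxE.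
Qed.

Lemma hc03_weight : has_weight p n k (fun R x => hc x (o0, o3)) (wt q (o0, o3)).
Proof.
have q_gt0 : (0 < q)%N by rewrite expn_gt0 prime_gt0 // (pcharf_prime pchar_k).
split=> [R R' f x|R kap e x Ee]; first exact: mxE.
apply: hc_act => // a m a0 m3 am; case/negP: am; rewrite xpair_eqE -!val_eqE /=.
by move: a0 m3 (ltn_ord m) => /=; lia.
Qed.

Lemma cone_C_zip (lam : 'rV[int]_4) (m : nat) : (m%:Z <= lam 0%R o0 - lam 0%R o1)%R ->
  (q%:Z * m%:Z <= lam 0%R o1 - lam 0%R o2)%R ->
  (q%:Z ^+ 2 * (lam 0%R o0 - m%:Z) + q%:Z * lam 0%R o1 + (lam 0%R o2 + q%:Z * m%:Z)
    <= (1 + q%:Z + q%:Z ^+ 2) * lam 0%R o3)%R ->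
  exists N : nat, (0 < N)%N /\ C_zip k q (lam *+ N).
Proof.
(* (q - 1) (1 + q + q^2) lam is a nonnegative combination of the weights of hc03,
   theta, theta' and det A, up to a multiple of the weight of det. *)
set l0 := lam 0%R o0; set l1 := lam 0%R o1; set l2 := lam 0%R o2; set l3 := lam 0%R o3.
set Q := q%:Z => H1 H2 H3.
have q_gt1 : (1 < q)%N by rewrite -(exp1n n) ltn_exp2r // prime_gt1 // (pcharf_prime pchar_k).
have nat_of (z : int) : (0 <= z)%R -> exists c : nat, c%:Z = z by case: z => // c _; exists c.
(* The slacks a, b and z of the three inequalities become, up to the factor q - 1 for the first two,
   the exponents of [theta'], [theta] and det A. *)
have [a Ea] : exists a : nat, a%:Z = l0 - m%:Z - l1 by apply: nat_of; lia.
have [b Eb] : exists b : nat, b%:Z = l1 - l2 - Q * m%:Z by apply: nat_of; lia.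
have [z Ez] : exists z : nat, z%:Z = (1 + Q + Q ^+ 2) * l3 - (Q ^+ 2 * (l0 - m%:Z) + Q * l1 + (l2 + Q * m%:Z)).
  by apply: nat_of; lia.
(* The exponent of det, fixed by the last coordinate of lam, may have either sign: it is split as c
   - d between [hdet] and [hdeti]. *)
have [c [d Ecd]] : exists c d : nat, c%:Z - d%:Z = - ((1 + Q + Q ^+ 2) * l3).
  case: (- _) => w; [by exists w, 0%N; rewrite subr0|by exists 0%N, w.+1; rewrite NegzE sub0r].
have Eq : (q - 1)%N%:Z = Q - 1 by rewrite -subzn // ltnW.
have [N [EN N0]] : exists N : nat, N%:Z = (Q - 1) * (1 + Q + Q ^+ 2) /\ (0 < N)%N.
  exists ((q - 1) * (1 + q + q ^ 2))%N; split; last by rewrite muln_gt0 subn_gt0 q_gt1.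
  by rewrite PoszM Eq !PoszD -[(q ^ 2)%N]/(q * q)%N PoszM expr2.
exists N; split=> //.
have [wd wd'] := hdet_weight.
have wP := weightM (weightM (weightM (weightM (weightM (weightX (N * m) hc03_weight)
  (weightX ((q - 1) * b) (theta_weight n pchar_k)))
  (weightX ((q - 1) * a) (theta'_weight n pchar_k))) (weightX z (detA_weight n pchar_k)))
  (weightX c wd)) (weightX d wd').
apply: (weight_C_zip pchar_k (Phi := fun R x => hc x (o0, o3) ^+ (N * m) * theta p n (tl x) ^+ ((q - 1) * b) *
  theta' p n (tl x) ^+ ((q - 1) * a) * \det (tl x) ^+ z * hdet x ^+ c * hdeti x ^+ d) _ (x0 := gl_perm k cyc)).
  move: wP; congr has_weight; apply/rowP => j.
  have MN (A : 'rV[int]_4) l : (A *+ l) 0%R j = A 0%R j * l%:Z by rewrite mulmxnE -mulr_natr natz.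
  have DE i : (delta_mx 0 i : 'rV[int]_4) 0%R j = (j == i)%:Z by rewrite mxE eqxx natz.
  have SE : (\sum_s wt q (s, s) : 'rV[int]_4) 0%R j = 1 - Q.
    rewrite summxE (eq_bigr (fun s : 'I_4 => (j == s)%:Z - (j == ord_pred s)%:Z * Q)); last by move=> s _; rewrite wtE.
    by rewrite !big_ord_recl big_ord0 /Q; case: j {MN DE} => [[|[|[|[|//]]]] ?]; rewrite -!val_eqE /=; ring.
  rewrite !rVD !MN !rVN !SE !rVD !rVN !MN !DE ?wtE -/Q !PoszM Eq EN Ea Eb Ez -/Q.
  have nuE (P : 'I_4 -> Prop) : P o0 -> P o1 -> P o2 -> P o3 -> forall j, P j.
    move=> P0 P1 P2 P3 [[|[|[|[|//]]]] pj]; [move: P0|move: P1|move: P2|move: P3];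
    by congr P; apply: val_inj.
  have {Ecd} Ec : c%:Z = d%:Z - (1 + Q + Q ^+ 2) * l3 by rewrite -[LHS](subrK d%:Z) Ecd addrC.
  rewrite Ec; move: j {MN DE SE}; apply: nuE; rewrite /= -?/l0 -?/l1 -?/l2 -?/l3; ring.
have [t1 t2 t3] := theta_cyc n pchar_k; have [c0 _ _ _] := cycE.
apply/eqP; rewrite !mulf_neq0 // expf_neq0 //.
- have E32 : ord_pred o3 = o2 by exact: val_inj.
  by rewrite /hc /= E32 !mxE c0 eqxx oner_eq0.
- by apply/eqP => E0; have := hdetK (gl_perm k cyc); rewrite E0 mul0r => /eqP; rewrite eq_sym oner_eq0.
- by apply/eqP => E0; have := hdetK (gl_perm k cyc); rewrite E0 mulr0 => /eqP; rewrite eq_sym oner_eq0.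
Qed.

End Converse.
Theorem theorem4p2p7 (p n : nat) (k : closedFieldType)
    (p_prime : prime p) (n_gt0 : (0 < n)%N) (pchar_k : p \in [pchar k])
    (k_alg : forall a : k, exists m : nat, (0 < m)%N /\ a ^+ ((p ^ n) ^ m)%N = a)
    (G : GLscheme k) (S : kscheme k) (S_nonempty : exists s : S, True)
    (zeta : zip_mor (p ^ n)%N G S) (FlagS : flag_space zeta)
    (cond_a : zeta_smooth zeta)
    (cond_b : zeta_surj_on_components zeta)
    (cond_c : forall w : 'S_4, has_length w 1 ->
       pseudo_complete (closure (flag_stratum FlagS w))) :
  saturation (C_S zeta) = saturation (C_zip k (p ^ n)%N).
Proof.
apply/seteqP; split=> lam [N [N0 /= CN]]; last by exists N; split=> //; exact: C_zip_C_S.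
have [m [H1 H2 H3]] := C_S_cone pchar_k cond_a cond_b cond_c CN.
have [N' [N'0 C']] := cone_C_zip pchar_k n_gt0 H1 H2 H3.
by exists (N * N')%N; rewrite muln_gt0 N0 N'0 mulrnA.
Qed.
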